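(* Assume $\theta=0$. Let $\underline b>0$ and suppose that $\mathbb{E}[g_m^2(X)]\ge\underline b$ and $\mathbb{E}[|h_m(X,X')|^{2+\ell}]\le B_n^\ell$ for $\ell=1,2$ and all $m=1,\dots,d$. Let $\gamma\in(0,e^{-1})$ and assume $\log(1/\gamma)\le K\log(dn)$ and $\log d\le\bar b n$ for some constants $K,\bar b>0$. Set $$\varpi_{1,n}=\left(\frac{B_n^2\log^7(nd)}{n}\right)^{1/6},\qquad \varpi^B_{2,n}(\gamma)=\left(\frac{B_n^2\log^3(nd)}{\gamma^{2/q}n^{1-2/q}}\right)^{1/3}.$$ (i) If $\|h_m(X,X')\|_{\psi_1}\le B_n$ for all $m=1,\dots,d$, then there exists a constant $C>0$ depending only on $\underline b,\bar b,K$ such that $\rho^B(T_n,T_n^\diamond)\le C\varpi_{1,n}$ holds with probability at least $1-\gamma$. (ii) If $\mathbb{E}[\max_{1\le m\le d}(|h_m(X,X')|/B_n)^q]\le1$ for some $q\ge4$, then there exists a constant $C>0$ depending only on $\underline b,\bar b,q,K$ such that $\rho^B(T_n,T_n^\diamond)\le C\{\varpi_{1,n}+\varpi^B_{2,n}(\gamma)\}$ holds with probability at least $1-\gamma$.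
   Context: Throughout $n\ge 4$, $d\ge 3$. $X_1,\dots,X_n$ are iid random vectors in $\mathbb{R}^p$ with distribution $F$, $X_1^n=(X_1,\dots,X_n)$, and $X,X'$ are independent with distribution $F$, independent of $X_1^n$. $h:\mathbb{R}^p\times\mathbb{R}^p\to\mathbb{R}^d$ is measurable with $h(x_1,x_2)=h(x_2,x_1)$ and $\mathbb{E}|h_k(X_1,X_2)|<\infty$ for all $k$. Put $\theta=\mathbb{E}[h(X_1,X_2)]$, $U_n=\frac1{n(n-1)}\sum_{1\le i\ne j\le n}h(X_i,X_j)$, $T_n=\sqrt n(U_n-\theta)/2$, $g(x)=\mathbb{E}[h(x,X')]-\theta$. $p,d,F$ may depend on $n$; $B_n\ge1$ is a sequence of reals possibly tending to infinity. Randomly reweighted bootstrap: $w_1,\dots,w_n$ are iid $N(1,1)$ random variables independent of $X_1^n$, $U_n^\diamond=\frac1{n(n-1)}\sum_{1\le i\ne j\le n}w_iw_jh(X_i,X_j)$ and $T_n^\diamond=\sqrt n(U_n^\diamond-U_n)/2$. $\mathcal{A}^{re}$ is the class of all hyperrectangles $\{x\in\mathbb{R}^d:a_j\le x_j\le b_j,\ j=1,\dots,d\}$ with $-\infty\le a_j\le b_j\le\infty$, and $\rho^B(T_n,T_n^\diamond)=\sup_{A\in\mathcal{A}^{re}}|\mathbb{P}(T_n\in A)-\mathbb{P}(T_n^\diamond\in A\mid X_1^n)|$. For a real random variable $\xi$, $\|\xi\|_{\psi_1}=\inf\{C>0:\mathbb{E}[\exp(|\xi|/C)-1]\le1\}$.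 *)

(* Defs.v *)
From HB Require Import structures.
From mathcomp Require Import all_boot all_order all_algebra.
From mathcomp Require Import all_classical all_reals all_analysis.

Set Implicit Arguments.
Unset Strict Implicit.
Unset Printing Implicit Defensive.

Import Order.TTheory GRing.Theory Num.Theory.
Import numFieldNormedType.Exports.

Local Open Scope classical_set_scope.
Local Open Scope ring_scope.

(* R^p is [p.-tuple R], whose measurable structure is the product of the Borel
   sigma-algebras. *)

Section independence.
Context {dO : measure_display} {Omega : measurableType dO} {R : realType}.
Variable P : probability Omega R.

Definition has_law {dS} {S : measurableType dS} (Y : {RV P >-> S})
    (F : set S -> \bar R) : Prop :=
  forall A, measurable A -> P (Y @^-1` A) = F A.

(* Taking [A i = setT] gives the product rule for subfamilies. *)
Definition mutually_independent {dS} {S : measurableType dS} {n : nat}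
    (Y : 'I_n -> {RV P >-> S}) : Prop :=
  forall A : 'I_n -> set S, (forall i, measurable (A i)) ->
    P (\bigcap_(i in [set: 'I_n]) (Y i @^-1` A i)) =
    (\prod_(i < n) P (Y i @^-1` A i))%E.

Definition iid {dS} {S : measurableType dS} {n : nat}
    (Y : 'I_n -> {RV P >-> S}) (F : set S -> \bar R) : Prop :=
  mutually_independent Y /\ forall i, has_law (Y i) F.

Definition independent {dS dS'} {S : measurableType dS}
    {S' : measurableType dS'} (Y : Omega -> S) (Z : Omega -> S') : Prop :=
  forall A B, measurable A -> measurable B ->
    P (Y @^-1` A `&` Z @^-1` B) = (P (Y @^-1` A) * P (Z @^-1` B))%E.

(* [k] is a regular conditional distribution of [Z] given [Y]:
   [k (Y w) B] is a version of P(Z \in B | Y)(w), for every measurable [B]. *)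
Definition regular_conditional_law {dS dS'} {S : measurableType dS}
    {S' : measurableType dS'} (Y : Omega -> S) (Z : Omega -> S')
    (k : R.-pker S ~> S') : Prop :=
  forall A B, measurable A -> measurable B ->
    P (Y @^-1` A `&` Z @^-1` B) = (\int[P]_(w in Y @^-1` A) k (Y w) B)%E.

Definition psi1_norm (xi : Omega -> R) : \bar R :=
  ereal_inf [set C%:E | C in
    [set C : R | 0 < C /\
       ('E_P[(fun w => expR (`|xi w| / C) - 1)%R] <= 1)%E]].

End independence.

Definition joint {T S : Type} {n : nat} (Y : 'I_n -> T -> S) (w : T) :
    n.-tuple S := [tuple Y i w | i < n].

Section ustatistics.
Context {R : realType} {p d : nat}.
Variable h : p.-tuple R -> p.-tuple R -> d.-tuple R.

Definition U_stat {n : nat} (x : n.-tuple (p.-tuple R)) (k : 'I_d) : R :=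
  (n%:R * (n%:R - 1))^-1 *
  \sum_(i < n) \sum_(j < n | i != j) tnth (h (tnth x i) (tnth x j)) k.

Definition U_boot {n : nat} (x : n.-tuple (p.-tuple R)) (w : n.-tuple R)
    (k : 'I_d) : R :=
  (n%:R * (n%:R - 1))^-1 *
  \sum_(i < n) \sum_(j < n | i != j)
    tnth w i * tnth w j * tnth (h (tnth x i) (tnth x j)) k.

Definition T_stat {n : nat} (theta : 'I_d -> R) (x : n.-tuple (p.-tuple R)) :
    d.-tuple R :=
  [tuple Num.sqrt n%:R * (U_stat x k - theta k) / 2 | k < d].

Definition T_boot {n : nat} (x : n.-tuple (p.-tuple R)) (w : n.-tuple R) :
    d.-tuple R :=
  [tuple Num.sqrt n%:R * (U_boot x w k - U_stat x k) / 2 | k < d].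

(* Under [(F \x F)%E] the two coordinates are independent with law F: they play
   the role of (X_1, X_2) and of (X, X'). *)
Variable F : probability (p.-tuple R) R.

Definition theta (k : 'I_d) : R :=
  fine 'E_(F \x F)%E[(fun z => tnth (h z.1 z.2) k)]%E.

Definition g (x : p.-tuple R) (k : 'I_d) : R :=
  fine 'E_F[(fun y => tnth (h x y) k)]%E - theta k.

Definition kernel_condition : Prop :=
  [/\ measurable_fun [set: p.-tuple R * p.-tuple R] (fun z => h z.1 z.2),
      forall x1 x2, h x1 x2 = h x2 x1 &
      forall k, ('E_(F \x F)%E[(fun z => `|tnth (h z.1 z.2) k|)%R] < +oo)%E].

Definition moment_condition (b B : R) : Prop :=
  forall m : 'I_d,
    (b%:E <= 'E_F[(fun x => g x m ^+ 2)%R])%E /\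
    forall l : nat, (1 <= l <= 2)%N ->
      ('E_(F \x F)%E[(fun z => `|tnth (h z.1 z.2) m| ^+ (2 + l))%R]
         <= (B ^+ l)%:E)%E.

Definition psi1_condition (B : R) : Prop :=
  forall m : 'I_d,
    (psi1_norm (F \x F)%E (fun z => tnth (h z.1 z.2) m) <= B%:E)%E.

Definition envelope_condition (q B : R) : Prop :=
  ('E_(F \x F)%E[(fun z =>
      \big[Num.max/0]_(m < d) ((`|tnth (h z.1 z.2) m| / B) `^ q))%R] <= 1)%E.

End ustatistics.

Definition hyperrectangle {R : realType} {d : nat} (A : set (d.-tuple R)) :
    Prop :=
  exists a b : 'I_d -> \bar R, (forall j, (a j <= b j)%E) /\
    A = [set x | forall j, (a j <= (tnth x j)%:E <= b j)%E].

(* [rhoB P T Q] compares the law of [T] under [P] with [Q]; it is used with [Q]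
   a conditional law evaluated at the observed sample. *)
Definition rhoB {dO} {Omega : measurableType dO} {R : realType} {d : nat}
    (P : probability Omega R) (T : Omega -> d.-tuple R)
    (Q : set (d.-tuple R) -> \bar R) : \bar R :=
  ereal_sup [set `|P (T @^-1` A) - Q A|%E | A in hyperrectangle].

(* The sample X_1^n has independent entries with law F, the weights w_1^n are
   iid N(1,1) ([normal_prob] takes mean and standard deviation) and independent
   of X_1^n, and [k] is a regular conditional law of
   T_boot given X_1^n. *)
Definition bootstrap_model {dO} {Omega : measurableType dO} {R : realType}
    {n p d : nat} (P : probability Omega R)
    (h : p.-tuple R -> p.-tuple R -> d.-tuple R)
    (F : probability (p.-tuple R) R)
    (X : 'I_n -> {RV P >-> p.-tuple R}) (w : 'I_n -> {RV P >-> R})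
    (k : R.-pker (n.-tuple (p.-tuple R)) ~> (d.-tuple R)) : Prop :=
  [/\ iid X F, iid w (normal_prob 1 1),
      independent P (joint X) (joint w) &
      regular_conditional_law P (joint X)
        (fun o => T_boot h (joint X o) (joint w o)) k].

Section rates.
Context {R : realType}.

Definition varpi1 (n d : nat) (B : R) : R :=
  (B ^+ 2 * ln (n * d)%:R ^+ 7 / n%:R) `^ 6^-1.

Definition varpi2B (n d : nat) (B q gamma : R) : R :=
  (B ^+ 2 * ln (n * d)%:R ^+ 3 /
     (gamma `^ (2 / q) * n%:R `^ (1 - 2 / q))) `^ 3^-1.

End rates.

(* Main.v *)
(* By doubling the coordinates, boxes in R^d become lower orthants in R^D, D = 2d.
   Hoeffding's decomposition writes T_n as a sum of iid vectors n^(-1/2) g(X_i)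
   plus a degenerate remainder, and for a fixed sample T_n^<> is a Gaussian vector
   plus a degenerate chaos; both remainders are controlled in sup norm by a
   smoothed square of the sup norm along which centred increments add up. The
   covariance of the Gaussian vector is a U-statistic of order 3, concentrated
   around the covariance of g(X) by a Bernstein inequality after truncation, and
   the truncation error is handled by Markov's inequality: this fixes the good
   event of probability 1 - gamma. On it, the linear parts are compared by
   Lindeberg's method, swapping each summand against a Gaussian vector having the
   empirical covariance, with smoothed indicators of orthants whose derivatives
   are supported in a window near the boundary; the probability of the window is
   bounded through the quantity being estimated and Nazarov's anticoncentration
   inequality, so that no factor is lost. *)
Require Import Defs.
From HB Require Import structures.
From mathcomp Require Import all_boot all_order all_algebra.
From mathcomp Require Import all_classical all_reals all_analysis.
From mathcomp Require Import measurable_realfun.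
From mathcomp Require Import perm.
From mathcomp Require Import ring lra zify.

Set Implicit Arguments.
Unset Strict Implicit.
Unset Printing Implicit Defensive.

Import Order.TTheory GRing.Theory Num.Theory.
Import numFieldNormedType.Exports.

Local Open Scope classical_set_scope.
Local Open Scope ring_scope.

(** * Expectations and product measures *)

Section pushforward_probability.
Context {d d'} {T : measurableType d} {T' : measurableType d'} {R : realType}.

(** The rate is read off one inequality. With $r^2=\log(nd)$, orthants are smoothed at bandwidth
    $v/r$; the $\sqrt{\log}$ of the anticoncentration inequality cancels the $r$ and leaves an error
    of order $v$. The $n$ swaps have total weight of order $r^7B/(\sqrt n\,v^3)$, and asking that
    this be a small constant makes $v$ a multiple of $\varpi_{1,n}$: hence the seventh power of the
    logarithm and the exponent $1/6$. The second rate is what Markov's inequality at level $\gamma$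
    demands of a kernel with only $q$ moments. If the resulting $v$ exceeds 1 the bound is trivial,
    so $v\le1$ is assumed in the analysis. No covariance matrix, square root or multivariate density
    appears: a Gaussian law is built from a point mass by adding independent scalar Gaussians along
    fixed directions, and rotation invariance of two such scalars is the main tool. Two gaps
    separate the model from this analysis: the conditional law is known only up to null sets
    depending on the event, which forces rational boxes, and sections of the kernel are integrable
    only almost everywhere, which forces a modified kernel. *)

Definition pushP (P : probability T R) (f : T -> T')
    (mf : measurable_fun setT f) : probability T' R :=
  distribution P (HB.pack_for {mfun T >-> T'} f
    (isMeasurableFun.Build _ _ _ _ f mf)).

Lemma pushPE (P : probability T R) (f : T -> T')
    (mf : measurable_fun setT f) A : @pushP P f mf A = P (f @^-1` A).
Proof. by []. Qed.

Lemma ge0_integral_pushP (P : probability T R) (f : T -> T')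
    (mf : measurable_fun setT f) (g : T' -> \bar R) :
  measurable_fun [set: T'] g -> (forall y, (0 <= g y)%E) ->
  (\int[@pushP P f mf]_y g y = \int[P]_x g (f x))%E.
Proof. by move=> mg g0; rewrite ge0_integral_distribution. Qed.

End pushforward_probability.

Section expectation.
Context {d} {T : measurableType d} {R : realType}.
Implicit Types (P Q : {measure set T -> \bar R}) (f g : T -> R).

Definition intg P f := P.-integrable setT (EFin \o f).
(** Real-valued, so that [lra] and [ring] apply. A non-finite integral yields the default value 0,
    hence statements about [Ex] usually travel with [intg]. *)
Definition Ex P f : R := fine (\int[P]_x (f x)%:E).

(** Equality on measurable sets only: the values on other sets carry no meaning and need not
    agree. *)
Definition meq P Q := forall A, measurable A -> P A = Q A.

Lemma meq_integral P Q (f : T -> \bar R) :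
  meq P Q -> (\int[P]_x f x = \int[Q]_x f x)%E.
Proof. by move=> PQ; apply: eq_measure_integral => A mA _; exact: PQ. Qed.

Lemma meq_Ex P Q f : meq P Q -> Ex P f = Ex Q f.
Proof. by move=> PQ; rewrite /Ex (meq_integral _ PQ). Qed.

Lemma meq_intg P Q f : meq P Q -> intg P f -> intg Q f.
Proof.
move=> PQ /integrableP[mf fi]; apply/integrableP; split => //.
by rewrite -(meq_integral _ PQ).
Qed.

Lemma meqP P Q : (forall f : T -> \bar R, measurable_fun setT f ->
    (forall x, (0 <= f x)%E) -> (\int[P]_x f x = \int[Q]_x f x)%E) -> meq P Q.
Proof.
move=> PQ A mA.
have := PQ (fun x => (\1_A x)%:E); rewrite !integral_indic// !setIT; apply.
  by apply/measurable_EFinP; exact: measurable_indic.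
by move=> x; rewrite lee_fin.
Qed.

Lemma meq_refl P : meq P P. Proof. by []. Qed.

Lemma meq_sym P Q : meq P Q -> meq Q P.
Proof. by move=> PQ A mA; rewrite PQ. Qed.

Lemma meq_trans P Q (S : {measure set T -> \bar R}) :
  meq P Q -> meq Q S -> meq P S.
Proof. by move=> PQ QS A mA; rewrite PQ// QS. Qed.

End expectation.

Section expectation_theory.
Context {d} {T : measurableType d} {R : realType} (P : probability T R).
Implicit Types f g : T -> R.

Lemma intg_measurable f : intg P f -> measurable_fun setT f.
Proof. by move=> /integrableP[mf _]; exact/measurable_EFinP. Qed.

Lemma intgD f g : intg P f -> intg P g -> intg P (fun x => f x + g x).
Proof. by move=> fi gi; have := integrableD measurableT fi gi. Qed.

Lemma intgZ c f : intg P f -> intg P (fun x => c * f x).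
Proof. by move=> fi; have := integrableZl measurableT c fi. Qed.

Lemma intgN f : intg P f -> intg P (fun x => - f x).
Proof. by move=> fi; have := integrableN fi. Qed.

Lemma intgB f g : intg P f -> intg P g -> intg P (fun x => f x - g x).
Proof. by move=> fi gi; apply: intgD => //; exact: intgN. Qed.

Lemma intg_cst c : intg P (fun=> c).
Proof. exact: finite_measure_integrable_cst. Qed.

Lemma intg_sum (I : Type) (s : seq I) (p : pred I) (f : I -> T -> R) :
  (forall i, p i -> intg P (f i)) -> intg P (fun x => \sum_(i <- s | p i) f i x).
Proof.
move=> fi; have := integrable_sum measurableT s fi.
by apply: eq_integrable => // x _ /=; rewrite sumEFin.
Qed.

Lemma intg_le f g : measurable_fun setT f -> (forall x, `|f x| <= g x) ->
  intg P g -> intg P f.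
Proof.
move=> mf fg; apply: le_integrable => //; first exact/measurable_EFinP.
by move=> x _ /=; rewrite lee_fin (le_trans (fg x))// ler_norm.
Qed.

Lemma intg_abs f : intg P f -> intg P (fun x => `|f x|).
Proof. by move=> fi; have := integrable_norm fi. Qed.

Lemma intg_bounded f c : measurable_fun setT f -> (forall x, `|f x| <= c) ->
  intg P f.
Proof. by move=> mf fc; exact: (intg_le mf fc (intg_cst c)). Qed.

Lemma intg_ge0P f : measurable_fun setT f -> (forall x, 0 <= f x) ->
  (\int[P]_x (f x)%:E < +oo)%E -> intg P f.
Proof.
move=> mf f0 fi; apply/integrableP; split; first exact/measurable_EFinP.
by under eq_integral do rewrite /= ger0_norm//.
Qed.

Lemma ExE f : intg P f -> (\int[P]_x (f x)%:E)%E = (Ex P f)%:E.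
Proof. by move=> fi; rewrite fineK//; exact: integrable_fin_num. Qed.

Lemma ExD f g : intg P f -> intg P g ->
  Ex P (fun x => f x + g x) = Ex P f + Ex P g.
Proof. by move=> fi gi; have := RintegralD measurableT fi gi. Qed.

Lemma ExZ c f : intg P f -> Ex P (fun x => c * f x) = c * Ex P f.
Proof. by move=> fi; exact: (RintegralZl _ measurableT). Qed.

Lemma ExB f g : intg P f -> intg P g ->
  Ex P (fun x => f x - g x) = Ex P f - Ex P g.
Proof. by move=> fi gi; have := RintegralB measurableT fi gi. Qed.

Lemma ExN f : intg P f -> Ex P (fun x => - f x) = - Ex P f.
Proof.
move=> fi; rewrite -mulN1r -ExZ//; congr (fine _).
by apply: eq_integral => x _; rewrite mulN1r.
Qed.

Lemma Ex_cst c : Ex P (fun=> c) = c.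
Proof. by rewrite /Ex integral_cst//= probability_setT mule1. Qed.

Lemma Ex_sum (I : Type) (s : seq I) (p : pred I) (f : I -> T -> R) :
  (forall i, intg P (f i)) ->
  Ex P (fun x => \sum_(i <- s | p i) f i x) = \sum_(i <- s | p i) Ex P (f i).
Proof.
move=> fi; elim: s => [|i s IH].
  by under eq_fun do rewrite big_nil; rewrite Ex_cst big_nil.
rewrite big_cons -IH; under eq_fun do rewrite big_cons.
by case: ifPn => // _; rewrite ExD//; apply: intg_sum.
Qed.

Lemma Ex_le f g : intg P f -> intg P g -> (forall x, f x <= g x) ->
  Ex P f <= Ex P g.
Proof. by move=> fi gi fg; apply: (le_Rintegral measurableT fi gi). Qed.

Lemma Ex_ge0 f : (forall x, 0 <= f x) -> 0 <= Ex P f.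
Proof. by move=> f0; apply/fine_ge0/integral_ge0 => x _; rewrite lee_fin. Qed.

Lemma Ex_abs f : intg P f -> `|Ex P f| <= Ex P (fun x => `|f x|).
Proof. by move=> fi; have := le_normr_Rintegral measurableT fi. Qed.

Lemma Ex_ext f g : f =1 g -> Ex P f = Ex P g.
Proof. by move=> fg; congr fine; apply: eq_integral => x _; rewrite fg. Qed.

Lemma intg_ext f g : f =1 g -> intg P f -> intg P g.
Proof. by move=> /funext ->. Qed.

Definition pr (A : set T) : R := fine (P A).

Lemma prE A : measurable A -> P A = (pr A)%:E.
Proof. by move=> mA; rewrite fineK// fin_num_measure. Qed.

Lemma pr_ge0 A : 0 <= pr A. Proof. exact: fine_ge0. Qed.

Lemma pr_le1 A : measurable A -> pr A <= 1.
Proof. by move=> mA; rewrite -lee_fin -prE// probability_le1. Qed.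

Lemma intg_indic A : measurable A -> intg P (\1_A).
Proof. by move=> mA; exact: integrable_indic. Qed.

Lemma Ex_indic A : measurable A -> Ex P (\1_A) = pr A.
Proof. by move=> mA; rewrite /Ex integral_indic// setIT. Qed.

Lemma pr_le A B : measurable A -> measurable B -> A `<=` B -> pr A <= pr B.
Proof.
by move=> mA mB AB; rewrite -lee_fin -!prE// le_measure// inE.
Qed.

Lemma pr_setC A : measurable A -> pr (~` A) = 1 - pr A.
Proof.
move=> mA; apply: EFin_inj; rewrite -prE//; last exact: measurableC.
by rewrite probability_setC// prE.
Qed.

Lemma pr_setU A B : measurable A -> measurable B ->
  pr (A `|` B) <= pr A + pr B.
Proof.
move=> mA mB; rewrite -lee_fin EFinD -!prE//; last exact: measurableU.
exact: measureU2.
Qed.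

Lemma markov_pr f t : intg P f -> (forall x, 0 <= f x) -> 0 < t ->
  pr [set x | t < f x] <= Ex P f / t.
Proof.
move=> fi f0 t0.
have mf := intg_measurable fi.
have mA : measurable [set x | t < f x].
  rewrite -[X in measurable X]setTI.
  rewrite (_ : [set x | _] = f @^-1` `]t, +oo[%classic).
    exact: mf.
  by apply/seteqP; split => x /=; rewrite in_itv/= andbT.
rewrite ler_pdivlMr// mulrC -Ex_indic// -ExZ//; last exact: intg_indic.
apply: Ex_le => //; first by apply: intgZ; exact: intg_indic.
move=> x; rewrite indicE; case: (boolP (x \in _)) => [|_]; last by rewrite mulr0.
by rewrite inE/= mulr1 => /ltW.
Qed.

End expectation_theory.

Section product_expectation.
Context {d1 d2} {T1 : measurableType d1} {T2 : measurableType d2} {R : realType}.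
Variables (P1 : probability T1 R) (P2 : probability T2 R).

Lemma Ex_prod (f : T1 * T2 -> R) : intg (P1 \x P2)%E f ->
  (forall x, intg P2 (fun y => f (x, y))) ->
  Ex (P1 \x P2)%E f = Ex P1 (fun x => Ex P2 (fun y => f (x, y))).
Proof.
move=> fi fx; rewrite {1}/Ex -integral12_prod_meas1//; congr fine.
by apply: eq_integral => x _; rewrite -ExE.
Qed.

Lemma intg_prod1 (f : T1 * T2 -> R) : intg (P1 \x P2)%E f ->
  (forall x, intg P2 (fun y => f (x, y))) ->
  intg P1 (fun x => Ex P2 (fun y => f (x, y))).
Proof.
move=> fi fx; have := integrable_fubini_F fi.
by apply: eq_integrable => // x _; rewrite /= -ExE.
Qed.

End product_expectation.

Section tuple_measure.
Context {d} {T : measurableType d} {R : realType}.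

Lemma measurable_tcons n : measurable_fun [set: T * n.-tuple T]
  (fun z : T * n.-tuple T => [tuple of z.1 :: z.2]).
Proof. exact: measurable_cons. Qed.

(** Built head by head, so that integrals unfold one variable at a time; the empty product is the
    point mass at the empty tuple. *)
Fixpoint prodn (P : probability T R) n : probability (n.-tuple T) R :=
  if n is m.+1 then pushP (P \x prodn P m)%E (@measurable_tcons m)
  else (\d_[tuple])%R.

Definition trect n (A : 'I_n -> set T) : set (n.-tuple T) :=
  [set t | forall i, A i (tnth t i)].

Lemma measurable_trect n (A : 'I_n -> set T) :
  (forall i, measurable (A i)) -> measurable (trect A).
Proof.
move=> mA; rewrite (_ : trect A = \bigcap_(i in [set: 'I_n])
   ((fun t => tnth t i) @^-1` A i)); last first.
  by apply/seteqP; split => [t At i _|t At i]; exact: At.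
apply: fin_bigcap_measurable => // i _.
by rewrite -[X in measurable X]setTI; exact: measurable_tnth.
Qed.

Lemma prodn_trect (P : probability T R) n (A : 'I_n -> set T) :
  (forall i, measurable (A i)) -> prodn P n (trect A) = (\prod_(i < n) P (A i))%E.
Proof.
elim: n A => [|n IH] A mA.
  by rewrite big_ord0 /= diracE (_ : _ \in _)//; apply/mem_set => -[].
rewrite big_ord_recl -IH//= [LHS](pushPE _ (@measurable_tcons n)).
transitivity ((P \x prodn P n)%E (A ord0 `*` trect (fun i => A (lift ord0 i))));
  last by rewrite product_measure1E//; exact: measurable_trect.
congr (_ _); apply/seteqP; split => [[x t] /= At|[x t] [/= Ax At] i].
  by split => [|i] /=; [exact: (At ord0)|have := At (lift ord0 i); rewrite tnthS].
by case: (unliftP ord0 i) => [j|] ->; rewrite ?tnthS//; exact: At.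
Qed.

(** Measurable rectangles form a pi-system containing the generators of the product sigma-algebra,
    each of which constrains a single coordinate. *)
Lemma trect_unique n (m1 m2 : {measure set (n.-tuple T) -> \bar R}) :
  m1 setT = 1%E ->
  (forall A : 'I_n -> set T, (forall i, measurable (A i)) ->
     m1 (trect A) = m2 (trect A)) -> meq m1 m2.
Proof.
move=> m1T m12 X mX.
pose G := [set Y | exists2 A : 'I_n -> set T, (forall i, measurable (A i))
   & Y = trect A].
have trT : trect (fun=> setT) = [set: n.-tuple T] by apply/seteqP; split.
apply: (@g_sigma_algebra_measure_unique _ _ _ G _ (fun=> setT)) => //.
- by move=> Y [A mA ->]; exact: measurable_trect.
- by move=> _; exists (fun=> setT); rewrite ?trT.
- by rewrite bigcup_const.
- move=> Y Z [A mA ->] [B mB ->]; exists (fun i => A i `&` B i).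
    by move=> i; exact: measurableI.
  apply/seteqP; split => [t [At Bt] i|t ABt]; first by split; [exact: At|exact: Bt].
  by split => i; case: (ABt i).
- by move=> Y [A mA ->]; exact: m12.
- by move=> _; rewrite m1T ltry.
move: mX; apply: smallest_sub; first exact: smallest_sigma_algebra.
have sG : sigma_algebra setT <<s G >> by exact: smallest_sigma_algebra.
rewrite -bigcup_seq; apply: bigcup_sub => i _ Y [B mB <-].
apply: sub_sigma_algebra; exists (fun j => if j == i then B else setT).
  by move=> j; case: ifP.
apply/seteqP; split => [t [_ /= Bt] j|t Bt]; first by case: eqP => // ->.
by split => //=; have := Bt i; rewrite eqxx.
Qed.

Lemma ge0_integral_prodnS (P : probability T R) n (f : n.+1.-tuple T -> \bar R) :
  measurable_fun setT f -> (forall y, (0 <= f y)%E) ->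
  (\int[prodn P n.+1]_y f y =
   \int[P]_x \int[prodn P n]_t f [tuple of x :: t])%E.
Proof.
move=> mf f0; rewrite ge0_integral_pushP//=.
rewrite (fubini_tonelli1 (fun z : T * n.-tuple T => f [tuple of z.1 :: z.2]))//=.
by apply: measurableT_comp => //; exact: measurable_tcons.
Qed.

End tuple_measure.

Section pushP_theory.
Context {d d'} {T : measurableType d} {T' : measurableType d'} {R : realType}.
Variables (P : probability T R) (f : T -> T') (mf : measurable_fun setT f).

Lemma intg_pushP (g : T' -> R) : measurable_fun setT g ->
  intg (pushP P mf) g <-> intg P (g \o f).
Proof.
move=> mg.
have mgf : measurable_fun setT (g \o f) by exact: measurableT_comp.
have E : (\int[pushP P mf]_y `|(g y)%:E| = \int[P]_x `|(g (f x))%:E|)%E.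
  rewrite ge0_integral_pushP//; apply: measurableT_comp => //.
  exact/measurable_EFinP.
split=> /integrableP[_ gi]; apply/integrableP; split;
  by [exact/measurable_EFinP|rewrite /= -?E|rewrite /= ?E].
Qed.

Lemma Ex_pushP (g : T' -> R) : measurable_fun setT g -> intg P (g \o f) ->
  Ex (pushP P mf) g = Ex P (g \o f).
Proof.
move=> mg gi; rewrite /Ex integral_distribution//.
exact/measurable_EFinP.
Qed.

End pushP_theory.

(** * Convolution steps on laws of vectors *)

Section kick.
Context {d} {T : measurableType d} {R : realType} {D : nat}.

Definition tadd (s t : D.-tuple R) : D.-tuple R :=
  [tuple tnth s j + tnth t j | j < D].

Lemma tnth_tadd s t j : tnth (tadd s t) j = tnth s j + tnth t j.
Proof. by rewrite tnth_mktuple. Qed.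

Lemma measurable_tadd {d0} {S : measurableType d0} (f g : S -> D.-tuple R) :
  measurable_fun setT f -> measurable_fun setT g ->
  measurable_fun setT (fun s => tadd (f s) (g s)).
Proof.
move=> /measurable_fun_tnthP mf /measurable_fun_tnthP mg.
apply/measurable_fun_tnthP => j /=.
rewrite (_ : _ \o _ = fun s => tnth (f s) j + tnth (g s) j); last first.
  by apply/funext => s; rewrite /= tnth_tadd.
by apply: measurable_funD; [exact: mf|exact: mg].
Qed.

Lemma measurable_kick (x : T -> D.-tuple R) (mx : measurable_fun setT x) :
  measurable_fun [set: D.-tuple R * T] (fun z => tadd z.1 (x z.2)).
Proof. by apply: measurable_tadd => //; exact: measurableT_comp. Qed.

(** The law of $S+x(Z)$ for independent $S\sim l$ and $Z\sim P$. Sums of independent vectors are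
    kept as iterated convolutions, so that replacing one summand never mentions a joint law. *)
Definition kick (l : probability (D.-tuple R) R) (P : probability T R)
    (x : T -> D.-tuple R) (mx : measurable_fun setT x) :=
  pushP (l \x P)%E (measurable_kick mx).

Lemma ge0_integral_kick l P x mx (f : D.-tuple R -> \bar R) :
  measurable_fun setT f -> (forall y, (0 <= f y)%E) ->
  (\int[@kick l P x mx]_s f s = \int[l]_s \int[P]_z f (tadd s (x z)))%E.
Proof.
move=> mf f0; rewrite ge0_integral_pushP//=.
rewrite (fubini_tonelli1 (fun z : D.-tuple R * T => f (tadd z.1 (x z.2))))//=.
by apply: measurableT_comp => //; exact: measurable_kick.
Qed.

Lemma meq_kick (l l' : probability (D.-tuple R) R) (P : probability T R)
  (x : T -> D.-tuple R) (mx : measurable_fun setT x) : meq l l' ->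
  meq (@kick l P x mx) (@kick l' P x mx).
Proof.
move=> ll'; apply: meqP => f mf f0.
by rewrite !ge0_integral_kick//; exact: meq_integral.
Qed.

End kick.

(** Tonelli's theorem. Commutation makes the order of the summands irrelevant, so that in a hybrid
    sum the summand to be swapped can always be taken last. *)
Lemma kickC {d1 d2} {T1 : measurableType d1} {T2 : measurableType d2}
    {R : realType} {D : nat} (l : probability (D.-tuple R) R)
    (P : probability T1 R) (Q : probability T2 R) (x : T1 -> D.-tuple R)
    (y : T2 -> D.-tuple R) (mx : measurable_fun setT x)
    (my : measurable_fun setT y) :
  meq (kick (kick l P mx) Q my) (kick (kick l Q my) P mx).
Proof.
have taddAC (s a b : D.-tuple R) : tadd (tadd s a) b = tadd (tadd s b) a.
  by apply: eq_from_tnth => j; rewrite !tnth_tadd addrAC.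
apply: meqP => f mf f0; rewrite !ge0_integral_kick//; last first.
- by move=> s; apply: integral_ge0.
- apply: (measurable_fun_fubini_tonelli_F (m2 := Q)
    (fun z => f (tadd z.1 (y z.2)))) => //=.
  by apply: measurableT_comp => //; exact: measurable_kick.
- by move=> s; apply: integral_ge0.
- apply: (measurable_fun_fubini_tonelli_F (m2 := P)
    (fun z => f (tadd z.1 (x z.2)))) => //=.
  by apply: measurableT_comp => //; exact: measurable_kick.
apply: eq_integral => s _.
rewrite (fubini_tonelli (fun z : T1 * T2 => f (tadd (tadd s (x z.1)) (y z.2))))//=.
  by do 2![apply: eq_integral => ? _]; congr f; exact: taddAC.
apply: measurableT_comp => //; apply: measurable_tadd.
  by apply: measurable_tadd => //; exact: measurableT_comp.
exact: measurableT_comp.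
Qed.

Lemma kickE {d} {T : measurableType d} {R : realType} {D : nat}
    (l : probability (D.-tuple R) R) (P : probability T R) (x : T -> D.-tuple R)
    (mx : measurable_fun setT x) A :
  kick l P mx A = (l \x P)%E [set z | A (tadd z.1 (x z.2))].
Proof. by []. Qed.

Lemma kick_bounded {d} {T : measurableType d} {R : realType} {D : nat}
    (l : probability (D.-tuple R) R) (P : probability T R) (x : T -> D.-tuple R)
    (mx : measurable_fun setT x) (f : D.-tuple R -> R) (c : R) :
  measurable_fun setT f -> (forall s, `|f s| <= c) ->
  intg (kick l P mx) f /\
  Ex (kick l P mx) f = Ex l (fun s => Ex P (fun z => f (tadd s (x z)))) /\
  intg l (fun s => Ex P (fun z => f (tadd s (x z)))).
Proof.
move=> mf fc; have mk := measurable_kick mx.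
have si s : intg P (fun z => f (tadd s (x z))).
  apply: (@intg_bounded _ _ _ _ _ c) => //.
  by apply: measurableT_comp => //; exact: measurable_tadd.
have ip : intg (l \x P)%E (fun z => f (tadd z.1 (x z.2))).
  apply: (@intg_bounded _ _ _ _ _ c) => //; exact: (measurableT_comp mf mk).
split; first exact: (intg_bounded _ mf fc).
split; last exact: (intg_prod1 (f := fun z => f (tadd z.1 (x z.2)))).
by rewrite Ex_pushP// (Ex_prod (f := fun z => f (tadd z.1 (x z.2)))).
Qed.

Lemma meq_pr {d} {T : measurableType d} {R : realType} (P Q : probability T R) A :
  meq P Q -> measurable A -> pr P A = pr Q A.
Proof. by move=> PQ mA; rewrite /pr PQ. Qed.

(* Keeps [done] from unfolding measures. *)
#[global] Opaque meq pushP kick.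

(** * Gaussian laws as iterated kicks *)

Section prodn_injective.
Context {d} {T : measurableType d} {R : realType}.

Lemma measurable_treindex n m (f : 'I_m -> 'I_n) :
  measurable_fun [set: n.-tuple T]
    (fun t : n.-tuple T => [tuple tnth t (f i) | i < m]).
Proof.
apply/measurable_fun_tnthP => i /=.
rewrite (_ : _ \o _ = fun t => tnth t (f i)); first exact: measurable_tnth.
by apply/funext => t /=; rewrite tnth_mktuple.
Qed.

(** The preimage of a rectangle is again a rectangle: coordinate [i] receives the constraint of its
    unique preimage under [f], or none, and unconstrained factors equal 1. *)
Lemma prodn_inj (P : probability T R) n m (f : 'I_m -> 'I_n) : injective f ->
  meq (pushP (prodn P n) (measurable_treindex f)) (prodn P m).
Proof.
move=> fI; apply: trect_unique; first exact: probability_setT.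
move=> A mA; rewrite [LHS]pushPE.
pose B (i : 'I_n) := [set x | forall j, f j = i -> A j x].
have mB i : measurable (B i).
  rewrite (_ : B i = \bigcap_(j in [set j | f j = i]) A j); last first.
    by apply/seteqP; split => x Bx j; exact: Bx.
  by apply: fin_bigcap_measurable.
rewrite (_ : _ @^-1` _ = trect B); last first.
  apply/seteqP; split => t /= At i.
    by move=> j <-; have := At j; rewrite tnth_mktuple.
  by rewrite tnth_mktuple; exact: At.
rewrite [RHS]prodn_trect// [LHS]prodn_trect//.
rewrite (bigID (mem (codom f)))/= [X in (_ * X)%E]big1 ?mule1; last first.
  move=> i; rewrite /= => /negP Ni; rewrite (_ : B i = setT) ?probability_setT//.
  by apply/seteqP; split => // x _ j fj; case: Ni; rewrite -fj codom_f.
rewrite -big_uniq/=; last by rewrite /codom /image_mem map_inj_uniq ?enum_uniq.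
rewrite /codom /image_mem big_map big_enum/=; apply: eq_bigr => i _.
congr (P _); apply/seteqP; split => x; first by move=> /(_ i erefl).
by move=> Ax j /fI ->.
Qed.

Lemma prodn_inj_Ex (P : probability T R) n m (f : 'I_m -> 'I_n)
    (g : m.-tuple T -> R) : injective f -> intg (prodn P m) g ->
  intg (prodn P n) (fun t => g [tuple tnth t (f i) | i < m]) /\
  Ex (prodn P n) (fun t => g [tuple tnth t (f i) | i < m]) = Ex (prodn P m) g.
Proof.
move=> fI gi; have mg := intg_measurable gi.
have gi' := meq_intg (meq_sym (prodn_inj P fI)) gi.
have := (intg_pushP (prodn P n) (measurable_treindex f) mg).1 gi'; split => //.
by rewrite -(meq_Ex _ (prodn_inj P fI)) Ex_pushP.
Qed.

Lemma intg_prodnS (P : probability T R) n (f : n.+1.-tuple T -> R) :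
  measurable_fun setT f ->
  intg (prodn P n.+1) f <->
  intg (P \x prodn P n)%E (fun z => f [tuple of z.1 :: z.2]).
Proof. by move=> mf; exact: intg_pushP. Qed.

Lemma Ex_prodnS (P : probability T R) n (f : n.+1.-tuple T -> R) :
  measurable_fun setT f -> intg (prodn P n.+1) f ->
  Ex (prodn P n.+1) f = Ex (P \x prodn P n)%E (fun z => f [tuple of z.1 :: z.2]).
Proof.
by move=> mf fi; rewrite [LHS]Ex_pushP//; exact/(intg_prodnS _ mf).
Qed.

Lemma intg_prodn1 (P : probability T R) (g : T -> R) : intg P g ->
  intg (prodn P 1) (fun t => g (thead t)) /\
  Ex (prodn P 1) (fun t => g (thead t)) = Ex P g.
Proof.
move=> gi; have mg := intg_measurable gi.
have mt : measurable_fun [set: 1.-tuple T] (fun t => g (thead t)).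
  by apply: measurableT_comp => //; exact: measurable_tnth.
have E : (\int[prodn P 1]_t `|(g (thead t))%:E| = \int[P]_x `|(g x)%:E|)%E.
  rewrite ge0_integral_prodnS//; last first.
    by apply: measurableT_comp => //; exact/measurable_EFinP.
  apply: eq_integral => x _; under eq_integral do rewrite theadE.
  by rewrite (integral_cst _ measurableT) /= (probability_setT (prodn P 0)) mule1.
have hi : intg (prodn P 1) (fun t => g (thead t)).
  apply/integrableP; split; first exact/measurable_EFinP.
  by rewrite /= E; case/integrableP: gi.
split => //; rewrite Ex_prodnS// Ex_prod.
- transitivity (Ex P (fun x => Ex (prodn P 0) (fun=> g x))).
    by do 2![apply: Ex_ext => ? /=]; rewrite /thead (tnth_nth point).
  by apply: Ex_ext => x; exact: Ex_cst.
- exact: (intg_prodnS _ mt).1 hi.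
- move=> x; apply: intg_ext (intg_cst (prodn P 0) (g x)) => y.
  by rewrite /thead (tnth_nth x).
Qed.

Lemma prodn_coord (P : probability T R) n (i : 'I_n) (g : T -> R) : intg P g ->
  intg (prodn P n) (fun t => g (tnth t i)) /\
  Ex (prodn P n) (fun t => g (tnth t i)) = Ex P g.
Proof.
move=> /intg_prodn1[gi Eg].
have [|hi Eh] := prodn_inj_Ex (f := fun=> i) _ gi; first by move=> x y; rewrite !ord1.
have tE : (fun t : n.-tuple T => g (thead [tuple tnth t (i) | _ < 1])) =
  (fun t => g (tnth t i)) by apply/funext => t; rewrite /thead tnth_mktuple.
by move: hi Eh; rewrite tE Eg.
Qed.

End prodn_injective.

(** * Rotation invariance of two independent standard normals *)

Section gaussian_integral.
Context {R : realType}.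
Import HBNNSimple.
Local Notation mu := lebesgue_measure.

(* [normal_prob] lives on [measurableTypeR R], whose display is not the default
   one of R *)
Lemma measurable_idR : measurable_fun setT (fun x : measurableTypeR R => (x : R)).
Proof. by move=> _ Y mY; rewrite setTI. Qed.

Definition N01 : probability R R := pushP (normal_prob 0 1) measurable_idR.

Definition phi : R -> R := normal_pdf 0 1.

Lemma phiE x : phi x = normal_peak (1 : R) * expR (- x ^+ 2 / 2).
Proof.
rewrite /phi normal_pdfE ?oner_eq0//; congr (_ * expR _).
by rewrite subr0 expr1n.
Qed.

Lemma phi_ge0 x : 0 <= phi x. Proof. exact: normal_pdf_ge0. Qed.

Lemma measurable_phi : measurable_fun setT phi.
Proof. exact: measurable_normal_pdf. Qed.

Lemma N01E (A : set R) : measurable A ->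
  N01 A = (\int[mu]_x ((\1_A x)%:E * (phi x)%:E))%E.
Proof.
move=> mA; rewrite /N01 pushPE /normal_prob [LHS]integral_mkcond.
apply: eq_integral => x _; rewrite patchE indicE.
by case: ifP => _; rewrite ?mul1e ?mul0e.
Qed.

(** [N01E] gives the density on sets; simple functions and monotone convergence extend it to
    nonnegative functions. *)
Lemma ge0_integral_N01 (f : R -> \bar R) : measurable_fun setT f ->
  (forall x, (0 <= f x)%E) ->
  (\int[N01]_x f x = \int[mu]_x (f x * (phi x)%:E))%E.
Proof.
move=> mf f0; pose g := nnsfun_approx measurableT mf.
have gcvg x : EFin \o g^~ x @ \oo --> f x by exact: cvg_nnsfun_approx.
have mg n : measurable_fun setT (EFin \o g n) by exact/measurable_EFinP.
have g0 n x : (0 <= (EFin \o g n) x)%E by rewrite lee_fin; exact: fun_ge0.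
have ndg x a b : (a <= b)%N -> ((g a x)%:E <= (g b x)%:E)%E.
  by move=> ab; rewrite lee_fin; exact/lefP/nd_nnsfun_approx.
have mi n y : measurable_fun setT (EFin \o (\1_(g n @^-1` [set y]) : R -> R)).
  by apply/measurable_EFinP; exact: measurable_indic.
have mphi : measurable_fun setT (EFin \o phi).
  by apply/measurable_EFinP; exact: measurable_phi.
transitivity (limn (fun n => \int[N01]_x (EFin \o g n) x))%E.
  rewrite -monotone_convergence//; last by move=> x _ a b; exact: ndg.
  by apply: eq_integral => x _; apply/esym/cvg_lim => //; exact: gcvg.
transitivity (limn (fun n => \int[mu]_x ((EFin \o g n) x * (phi x)%:E)))%E; last first.
  rewrite -monotone_convergence//.
  - apply: eq_integral => x _; apply/cvg_lim => //.
    rewrite /= muleC; under eq_fun do rewrite /= muleC.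
    exact: (cvgeZl _ (gcvg x)).
  - by move=> n; exact: (emeasurable_funM (mg n) mphi).
  - by move=> n x _; rewrite mule_ge0// lee_fin phi_ge0.
  - by move=> x _ a b ab; rewrite lee_wpmul2r ?lee_fin ?phi_ge0// -lee_fin ndg.
congr (limn _); apply/funext => n.
have gE x : (EFin \o g n) x =
    (\sum_(y \in range (g n)) y%:E * (\1_(g n @^-1` [set y]) x)%:E)%E.
  by rewrite /= fimfunE -fsumEFin.
under eq_integral do rewrite gE.
rewrite ge0_integral_fsum//; first last.
- by move=> y x _; exact: nnfun_muleindic_ge0.
- by move=> y; apply: emeasurable_funM => //; exact: mi.
under [RHS]eq_integral => x _.
  rewrite gE muleC ge0_mule_fsumr; last first.
    by move=> y; exact: nnfun_muleindic_ge0.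
  under eq_fsbigr do rewrite muleCA [X in (_ * X)%E]muleC.
  over.
rewrite [RHS]ge0_integral_fsum//; first last.
- move=> y x _; rewrite muleA mule_ge0 ?lee_fin ?phi_ge0//.
  exact: nnfun_muleindic_ge0.
- move=> y; apply: emeasurable_funM => //.
  exact: (emeasurable_funM (mi n y) mphi).
apply: eq_fsbigr => y /set_mem [x _ <-].
rewrite !ge0_integralZl//.
- congr (_ * _)%E; apply: etrans (N01E _) => //.
  by rewrite integral_indic// setIT.
- exact: (emeasurable_funM (mi n _) mphi).
- by move=> z _; rewrite mule_ge0 ?lee_fin ?phi_ge0.
- by rewrite lee_fin.
- exact: mi.
- by rewrite lee_fin.
Qed.

(** Translation invariance, from the uniqueness of Lebesgue measure: the translated measure gives
    half-open intervals the same length. *)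
Lemma ge0_integral_shift (f : R -> \bar R) (c : R) : measurable_fun setT f ->
  (forall x, (0 <= f x)%E) ->
  (\int[mu]_x (fun y : R => f (y + c)%R) x = \int[mu]_x f x)%E.
Proof.
move=> mf f0.
have mD : measurable_fun setT (fun x : measurableTypeR R => (x + c : measurableTypeR R)).
  by apply: measurable_funD.
have <- := @ge0_integral_pushforward _ _ _ _ _ _ mD mu setT f measurableT mf (fun y _ => f0 y).
apply: eq_measure_integral => A mA _; apply/esym/lebesgue_measure_unique => //.
move=> _ [[a b]] _ <-; transitivity (mu `](a - c), (b - c)]%classic); last first.
  congr mu; apply/seteqP; split => x /=.
    by rewrite !in_itv/= ltrBlDr lerBrDr.
  by rewrite !in_itv/= ltrBlDr lerBrDr.
rewrite !lebesgue_measure_itv/= !lte_fin ltrD2r; case: ifP => // _.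
by rewrite -!EFinB; congr EFin; lra.
Qed.

(** An iterated integral: a shear moves one variable by an amount depending on the other, so it acts
    as a translation inside the inner integral. *)
Definition leb2 (G : R * R -> \bar R) : \bar R :=
  (\int[mu]_u \int[mu]_v G (u, v))%E.

Lemma leb2_shear1 (k : R) (G : R * R -> \bar R) : measurable_fun setT G ->
  (forall z, (0 <= G z)%E) -> leb2 (fun z => G (z.1, z.2 + k * z.1)) = leb2 G.
Proof.
move=> mG G0; apply: eq_integral => u _.
have := @ge0_integral_shift (fun v : R => G ((u : R), v)) (k * u); apply => //.
by apply: measurableT_comp => //; exact: measurable_pair1.
Qed.

Lemma leb2C (G : R * R -> \bar R) : measurable_fun setT G ->
  (forall z, (0 <= G z)%E) -> leb2 (fun z => G (z.2, z.1)) = leb2 G.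
Proof.
by move=> mG G0; rewrite /leb2 -(@fubini_tonelli _ _ _ _ _ mu mu G).
Qed.

Lemma measurable_comp2 (G : R * R -> \bar R) (f g : R * R -> R) :
  measurable_fun setT G -> measurable_fun setT f -> measurable_fun setT g ->
  measurable_fun setT (fun z => G (f z, g z)).
Proof.
move=> mG mf mg; apply: (measurableT_comp mG).
exact: measurable_fun_pair.
Qed.

Lemma leb2_shear2 (k : R) (G : R * R -> \bar R) : measurable_fun setT G ->
  (forall z, (0 <= G z)%E) -> leb2 (fun z => G (z.1 + k * z.2, z.2)) = leb2 G.
Proof.
move=> mG G0; rewrite -leb2C; last 2 first.
- apply: measurable_comp2 => //; apply: measurable_funD => //.
  by apply: measurable_funM.
- by move=> z.
rewrite (leb2_shear1 _ (G := fun z => G (z.2, z.1)))//; first exact: leb2C.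
exact: measurable_comp2.
Qed.

(* A rotation is the product of three shears. *)
Lemma leb2_rotation (c s : R) (F : R * R -> \bar R) :
  s != 0 -> c ^+ 2 + s ^+ 2 = 1 -> measurable_fun setT F ->
  (forall z, (0 <= F z)%E) ->
  leb2 (fun z => F (c * z.1 - s * z.2, s * z.1 + c * z.2)) = leb2 F.
Proof.
move=> s0 cs1 mF F0.
(* [t] is the tangent of half the rotation angle. The rotation is a shear by [- t] in the first
   variable, then by [s] in the second, then by [- t] in the first again; [ts] and [tc] are the
   half-angle identities. *)
pose t := (1 - c) / s.
have ts : t * s = 1 - c by rewrite /t mulfVK.
have tc : t * (1 + c) = s.
  apply: (mulIf s0); rewrite mulrAC ts.
  by have -> : s * s = 1 - c ^+ 2 by [rewrite -cs1; ring]; ring.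
pose G1 z := F (z.1 + (- t) * z.2, z.2).
pose G2 z := G1 (z.1, z.2 + s * z.1).
have G10 z : (0 <= G1 z)%E by exact: F0.
have G20 z : (0 <= G2 z)%E by exact: F0.
have mG1 : measurable_fun setT G1.
  apply: measurable_comp2 => //; apply: measurable_funD => //.
  exact: measurable_funM.
have mG2 : measurable_fun setT G2.
  apply: measurable_comp2 => //; apply: measurable_funD => //.
  exact: measurable_funM.
rewrite -(leb2_shear2 (- t) mF F0) -/G1 -(leb2_shear1 s mG1 G10) -/G2.
rewrite -(leb2_shear2 (- t) mG2 G20); congr leb2; apply/funext => -[u v].
rewrite /G2 /G1 /=.
have -> : s * u + c * v = v + s * (u + - t * v).
  by transitivity (v + s * u - (t * s) * v); [rewrite ts; ring|ring].
congr (F (_, _)).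
transitivity (u - t * v - t * v - (t * s) * u + t * (t * s) * v); last by ring.
rewrite ts; transitivity (c * u - t * (1 + c) * v); first by rewrite tc.
by ring.
Qed.

Lemma phi_rotation (c s u v : R) : c ^+ 2 + s ^+ 2 = 1 ->
  phi (c * u - s * v) * phi (s * u + c * v) = phi u * phi v.
Proof.
move=> cs; rewrite !phiE.
have H (p a b : R) : p * expR a * (p * expR b) = p * p * expR (a + b).
  by rewrite expRD; ring.
rewrite !H; congr (_ * expR _).
transitivity (- (c ^+ 2 + s ^+ 2) * (u ^+ 2 + v ^+ 2) / 2); first by field.
by rewrite cs; field.
Qed.

(** The product density depends only on $u^2+v^2$, so this reduces to the invariance of planar
    Lebesgue measure. Sign changes, merging and isolation of Gaussian directions below all come from
    it. *)
Lemma N01_rotation (c s : R) (F : R * R -> \bar R) :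
  s != 0 -> c ^+ 2 + s ^+ 2 = 1 -> measurable_fun setT F ->
  (forall z, (0 <= F z)%E) ->
  (\int[N01]_u \int[N01]_v F (c * u - s * v, s * u + c * v)%R =
   \int[N01]_u \int[N01]_v F (u, v))%E.
Proof.
have I2 (G : R * R -> \bar R) : measurable_fun setT G ->
    (forall z, (0 <= G z)%E) -> (\int[N01]_u \int[N01]_v G (u, v) =
    leb2 (fun z => G z * (phi z.1 * phi z.2)%:E))%E.
  move=> mG G0; rewrite ge0_integral_N01; last 2 first.
  - exact: (measurable_fun_fubini_tonelli_F (m2 := N01) G).
  - by move=> x; apply: integral_ge0.
  rewrite /leb2; apply: eq_integral => u _.
  rewrite ge0_integral_N01//; last first.
    by apply: measurableT_comp => //; exact: measurable_pair1.
  rewrite muleC -ge0_integralZl//.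
  - by apply: eq_integral => v _; rewrite /= EFinM muleCA.
  - apply: emeasurable_funM; last by apply/measurable_EFinP; exact: measurable_phi.
    by apply: measurableT_comp => //; exact: measurable_pair1.
  - by move=> v _; rewrite mule_ge0// lee_fin phi_ge0.
  - by rewrite lee_fin phi_ge0.
move=> s0 cs mF F0.
have m1 : measurable_fun setT (fun z : R * R => c * z.1 - s * z.2).
  by apply: measurable_funB; apply: measurable_funM.
have m2 : measurable_fun setT (fun z : R * R => s * z.1 + c * z.2).
  by apply: measurable_funD; apply: measurable_funM.
pose H z := (F z * (phi z.1 * phi z.2)%:E)%E.
have mH : measurable_fun setT H.
  apply: emeasurable_funM => //; apply/measurable_EFinP.
  by apply: measurable_funM; apply: measurableT_comp => //; exact: measurable_phi.
have H0 z : (0 <= H z)%E by rewrite mule_ge0// lee_fin mulr_ge0 ?phi_ge0.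
rewrite [RHS](I2 F mF F0) -/H -(leb2_rotation s0 cs mH H0).
apply: etrans (I2 (fun z => F (c * z.1 - s * z.2, s * z.1 + c * z.2))
  (measurable_comp2 mF m1 m2) (fun=> F0 _)) _.
by congr leb2; apply/funext => z; rewrite /H /= (phi_rotation _ _ cs).
Qed.

End gaussian_integral.

Section gaussian_kicks.
Context {R : realType} {D : nat}.
Implicit Types (a b : D.-tuple R) (l : probability (D.-tuple R) R).

Definition tscale (z : R) a : D.-tuple R := [tuple z * tnth a j | j < D].

Lemma tnth_tscale z a j : tnth (tscale z a) j = z * tnth a j.
Proof. by rewrite tnth_mktuple. Qed.

Lemma measurable_tscale a : measurable_fun setT (tscale^~ a).
Proof.
apply/measurable_fun_tnthP => j /=.
rewrite (_ : _ \o _ = fun z => z * tnth a j); first exact: measurable_funM.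
by apply/funext => z; rewrite /= tnth_tscale.
Qed.

Definition gk l a := kick l N01 (measurable_tscale a).

Lemma ge0_integral_gk l a (f : D.-tuple R -> \bar R) : measurable_fun setT f ->
  (forall y, (0 <= f y)%E) ->
  (\int[gk l a]_s f s = \int[l]_s \int[N01]_z f (tadd s (tscale z a)))%E.
Proof. exact: ge0_integral_kick. Qed.

Opaque gk N01.

Definition tzero : D.-tuple R := [tuple 0 | j < D].

Lemma tnth_tzero j : tnth tzero j = 0. Proof. by rewrite tnth_mktuple. Qed.

(** A centred Gaussian vector encoded by directions: the law of $\sum_a z_a a$ with independent
    standard $z_a$, whose covariance is [gcov s]. A factorization of the covariance is thus part of
    the data and is never computed. *)
Definition gks (s : seq (D.-tuple R)) : probability (D.-tuple R) R :=
  foldr (fun a l => gk l a) (\d_tzero)%R s.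

Lemma meq_gk l l' a : meq l l' -> meq (gk l a) (gk l' a).
Proof. exact: meq_kick. Qed.

Lemma gkC l a b : meq (gk (gk l a) b) (gk (gk l b) a).
Proof. exact: kickC. Qed.

(** Rotating the two driving scalars does not change their joint law; collecting the coefficients of
    the new scalars gives the rotated directions. *)
Lemma gk_rotation l a b c s : s != 0 -> c ^+ 2 + s ^+ 2 = 1 ->
  meq (gk (gk l a) b)
      (gk (gk l (tadd (tscale c a) (tscale s b)))
          (tadd (tscale (- s) a) (tscale c b))).
Proof.
move=> s0 cs; apply: meqP => f mf f0.
have mi e : measurable_fun setT
    (fun s => (\int[N01]_z f (tadd s (tscale z e)))%E).
  apply: (measurable_fun_fubini_tonelli_F (m2 := N01)
    (fun z => f (tadd z.1 (tscale z.2 e)))) => //=.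
  by apply: (measurableT_comp mf); exact: (measurable_kick (measurable_tscale e)).
have I2 a' b' : (\int[gk (gk l a') b']_s f s = \int[l]_s \int[N01]_u \int[N01]_v
    f (tadd (tadd s (tscale u a')) (tscale v b')))%E.
  apply: etrans (ge0_integral_gk _ _ mf f0) _.
  apply: (ge0_integral_gk l a' (mi b')) => y.
  by apply: integral_ge0 => z _; exact: f0.
rewrite [LHS]I2 [RHS]I2.
apply: eq_integral => x _.
pose F (z : R * R) := f (tadd (tadd x (tscale z.1 a)) (tscale z.2 b)).
have mF : measurable_fun setT F.
  apply: measurableT_comp => //; apply: measurable_tadd; last first.
    by apply: (measurableT_comp (measurable_tscale b)).
  apply: measurable_tadd => //.
  by apply: (measurableT_comp (measurable_tscale a)).
rewrite -(N01_rotation s0 cs mF (fun=> f0 _)).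
apply: eq_integral => u _; apply: eq_integral => v _; congr f.
by apply: eq_from_tnth => j; rewrite !(tnth_tadd, tnth_tscale) /=; ring.
Qed.

Lemma gk0 l : meq (gk l tzero) l.
Proof.
apply: meqP => f mf f0; rewrite ge0_integral_gk//; apply: eq_integral => s _.
under eq_integral => z _.
  have -> : tadd s (tscale z tzero) = s; last over.
  by apply: eq_from_tnth => j; rewrite tnth_tadd tnth_tscale tnth_tzero mulr0 addr0.
by rewrite integral_cst//= probability_setT mule1.
Qed.

(** A quarter turn against a zero direction sends [a] to its opposite. *)
Lemma gkN l a : meq (gk l a) (gk l (tscale (-1) a)).
Proof.
have h1 : (1 : R) != 0 by exact: oner_neq0.
have h2 : (0 : R) ^+ 2 + 1 ^+ 2 = 1 by rewrite expr0n add0r expr1n.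
apply: meq_trans (meq_sym (gk0 _)) _.
apply: meq_trans (gk_rotation l a tzero h1 h2) _.
rewrite (_ : tadd _ (tscale 1 _) = tzero); last first.
  by apply: eq_from_tnth => j; rewrite !(tnth_tadd, tnth_tscale, tnth_tzero); ring.
rewrite (_ : tadd _ _ = tscale (-1) a); last first.
  by apply: eq_from_tnth => j; rewrite !(tnth_tadd, tnth_tscale, tnth_tzero); ring.
exact: meq_gk (gk0 _).
Qed.

(** With [r] the norm of [(x, y)], the rotation of cosine [x / r] and sine [y / r] turns the pair of
    directions [x a], [y a] into [r a] and 0. *)
Lemma gk_merge l a (x y : R) : 0 <= x -> meq (gk (gk l (tscale x a)) (tscale y a))
  (gk l (tscale (Num.sqrt (x ^+ 2 + y ^+ 2)) a)).
Proof.
move=> x0; have [->|y0] := eqVneq y 0.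
  have -> : tscale 0 a = tzero.
    by apply: eq_from_tnth => j; rewrite tnth_tscale mul0r tnth_tzero.
  rewrite expr0n /= addr0 sqrtr_sqr ger0_norm//; exact: gk0.
set r := Num.sqrt _.
have r2 : r ^+ 2 = x ^+ 2 + y ^+ 2.
  by rewrite /r sqr_sqrtr// addr_ge0// sqr_ge0.
have r0 : r != 0.
  apply/eqP => r0; move: r2; rewrite r0 expr0n /=.
  by apply/eqP; rewrite lt_eqF// ltr_wpDl ?sqr_ge0// exprn_even_gt0.
have h1 : y / r != 0 by rewrite mulf_neq0// invr_neq0.
have h2 : (x / r) ^+ 2 + (y / r) ^+ 2 = 1.
  by rewrite !exprMn -mulrDl -r2 exprVn divff// expf_neq0.
apply: meq_trans (gk_rotation l (tscale x a) (tscale y a) h1 h2) _.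
rewrite (_ : tadd _ (tscale (y / r) _) = tscale r a); last first.
  apply: eq_from_tnth => j; rewrite !(tnth_tadd, tnth_tscale).
  transitivity ((x ^+ 2 + y ^+ 2) / r * tnth a j); first by field.
  by rewrite -r2; field.
rewrite (_ : tadd _ _ = tzero); first exact: gk0.
by apply: eq_from_tnth => j; rewrite !(tnth_tadd, tnth_tscale, tnth_tzero); field.
Qed.

(** Infinite divisibility. The Gaussian law has to be cut into as many equal pieces as there are
    observations before summands can be swapped one for one. *)
Lemma gk_split l a n : (0 < n)%N ->
  meq (iter n (fun l => gk l (tscale (Num.sqrt n%:R)^-1 a)) l) (gk l a).
Proof.
move=> n0; set x := _^-1.
have x0 : 0 <= x by rewrite invr_ge0 sqrtr_ge0.
have H k : meq (iter k.+1 (fun l => gk l (tscale x a)) l)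
    (gk l (tscale (Num.sqrt k.+1%:R * x) a)).
  elim: k => [|k IH]; first by rewrite /= sqrtr1 mul1r; exact: meq_refl.
  rewrite iterS; apply: meq_trans (meq_gk _ IH) _.
  apply: meq_trans (gk_merge _ _ _ _) _; first by rewrite mulr_ge0 ?sqrtr_ge0.
  set e := (_ ^+ 2 + _); have -> : e = k.+2%:R * x ^+ 2.
    have K : Num.sqrt (k.+1%:R : R) ^+ 2 = k.+1%:R by rewrite sqr_sqrtr ?ler0n.
    by rewrite /e exprMn K -[in RHS]natr1; ring.
  have -> : Num.sqrt (k.+2%:R * x ^+ 2) = Num.sqrt k.+2%:R * x.
    by rewrite sqrtrM ?ler0n// sqrtr_sqr ger0_norm.
  exact: meq_refl.
rewrite -(prednK n0); apply: meq_trans (H _) _; rewrite prednK//.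
have -> : Num.sqrt n%:R * x = 1 by rewrite divff// sqrtr_eq0 -ltNge ltr0n.
have -> : tscale 1 a = a.
  by apply: eq_from_tnth => j; rewrite tnth_tscale mul1r.
exact: meq_refl.
Qed.

Definition gcov (s : seq (D.-tuple R)) i k : R :=
  \sum_(a <- s) tnth a i * tnth a k.

(* Rotating the driving Gaussians pairwise leaves a single one acting on
   coordinate j. *)
Lemma gks_isolate j (s : seq (D.-tuple R)) : exists a s',
  [/\ meq (gks s) (gks (a :: s')), 0 <= tnth a j,
      all (fun b => tnth b j == 0) s' & gcov (a :: s') =2 gcov s].
Proof.
elim: s => [|b s [a [s' [E a0 s0 cv]]]].
  exists tzero, [::]; split; [exact: meq_sym (gk0 _)| |by []|].
    by rewrite tnth_tzero.
  by move=> i k; rewrite /gcov big_cons tnth_tzero mul0r add0r.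
have cov2 c1 c2 i k :
    tnth c1 i * tnth c1 k + tnth c2 i * tnth c2 k =
    tnth a i * tnth a k + tnth b i * tnth b k ->
    gcov (c1 :: c2 :: s') i k = gcov (b :: s) i k.
  move=> H; rewrite /gcov big_cons big_cons [RHS]big_cons addrA H.
  by have := cv i k; rewrite /gcov big_cons => <-; ring.
have E1 : meq (gks (b :: s)) (gk (gk (gks s') a) b) by exact: meq_gk.
have [aj0|aj0] := eqVneq (tnth a j) 0.
  have [bj0|bj0] := leP 0 (tnth b j).
    exists b, (a :: s'); split; [exact: E1|by []|by rewrite /= aj0 eqxx|].
    by move=> i k; apply: cov2; ring.
  exists (tscale (-1) b), (a :: s'); split.
  - exact: meq_trans E1 (gkN _ _).
  - by rewrite tnth_tscale mulN1r oppr_ge0 ltW.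
  - by rewrite /= aj0 eqxx.
  - by move=> i k; apply: cov2; rewrite !tnth_tscale; ring.
set r := Num.sqrt (tnth a j ^+ 2 + tnth b j ^+ 2).
have r2 : r ^+ 2 = tnth a j ^+ 2 + tnth b j ^+ 2.
  by rewrite /r sqr_sqrtr// addr_ge0// sqr_ge0.
have r0 : r != 0.
  apply/eqP => r0; move: r2; rewrite r0 expr0n /=.
  by apply/eqP; rewrite lt_eqF// ltr_pwDl ?sqr_ge0// exprn_even_gt0.
have h1 : - (tnth a j / r) != 0 by rewrite oppr_eq0 mulf_neq0// invr_neq0.
have h2 : (tnth b j / r) ^+ 2 + (- (tnth a j / r)) ^+ 2 = 1.
  by rewrite sqrrN !exprMn -mulrDl addrC -r2 exprVn divff// expf_neq0.
have E2 := gk_rotation (gks s') a b h1 h2.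
eexists; eexists (_ :: s'); split.
- exact: meq_trans E1 E2.
- rewrite tnth_tadd !tnth_tscale opprK.
  have -> : tnth a j / r * tnth a j + tnth b j / r * tnth b j =
    (tnth a j ^+ 2 + tnth b j ^+ 2) / r by field.
  by rewrite -r2 expr2 mulfK// sqrtr_ge0.
- by rewrite /= s0 andbT tnth_tadd !tnth_tscale; apply/eqP; field.
- move=> i k; apply: cov2; rewrite !(tnth_tadd, tnth_tscale).
  set p := tnth b j / r in h2 *; set q := - _ in h2 *.
  transitivity ((p ^+ 2 + q ^+ 2) * (tnth a i * tnth a k + tnth b i * tnth b k)).
    by ring.
  by rewrite h2 mul1r.
Qed.

End gaussian_kicks.

(** * Gaussian anticoncentration *)

Section measurable_sets.
Context {d} {T : measurableType d} {R : realType}.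

Lemma measurable_ltset (f g : T -> R) : measurable_fun setT f ->
  measurable_fun setT g -> measurable [set x | f x < g x].
Proof.
move=> mf mg; rewrite (_ : [set x | _] = (fun x => g x - f x) @^-1` `]0, +oo[%classic).
  by rewrite -[X in measurable X]setTI; apply: measurable_funB.
by apply/seteqP; split => x /=; rewrite in_itv/= andbT subr_gt0.
Qed.

Lemma measurable_leset (f g : T -> R) : measurable_fun setT f ->
  measurable_fun setT g -> measurable [set x | f x <= g x].
Proof.
move=> mf mg; rewrite (_ : [set x | _] = (fun x => g x - f x) @^-1` `[0, +oo[%classic).
  by rewrite -[X in measurable X]setTI; apply: measurable_funB.
by apply/seteqP; split => x /=; rewrite in_itv/= andbT subr_ge0.
Qed.

Lemma measurable_forall (n : nat) (A : 'I_n -> set T) :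
  (forall i, measurable (A i)) -> measurable [set x | forall i, A i x].
Proof.
move=> mA; rewrite (_ : [set x | _] = \bigcap_(i in [set: 'I_n]) A i); last first.
  by apply/seteqP; split => [x Ax i _|x Ax i]; exact: Ax.
exact: fin_bigcap_measurable.
Qed.

End measurable_sets.

(** * One-dimensional window and tail bounds for the normal law *)

Section mills.
Context {R : realType}.
Notation N01 := (@N01 R).
Notation phi := (@phi R).

Lemma integral_itv_cst (a b M : R) (i1 i2 : bool) : a <= b -> 0 <= M ->
  (\int[lebesgue_measure]_x
     (M%:E * (\1_[set` Interval (BSide i1 a) (BSide i2 b)] x)%:E) =
   (M * (b - a))%:E)%E.
Proof.
move=> ab M0.
have mA : measurable_fun setT
    (EFin \o (\1_[set` Interval (BSide i1 a) (BSide i2 b)] : R -> R)).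
  by apply/measurable_EFinP; exact: measurable_indic.
rewrite ge0_integralZl//.
rewrite integral_indic//= setIT lebesgue_measure_itv/= lte_fin.
case: ltP => ab'; first by rewrite -EFinB -EFinM.
by rewrite mule0 (_ : b - a = 0) ?mulr0//; apply/eqP; rewrite subr_eq0 eq_le ab ab'.
Qed.

Lemma N01_itv_le (a b M : R) : a <= b -> (forall x, a <= x <= b -> phi x <= M) ->
  pr N01 `[a, b] <= M * (b - a).
Proof.
move=> ab H.
have M0 : 0 <= M by apply: le_trans (phi_ge0 a) (H a _); rewrite lexx.
have mA : measurable_fun setT (EFin \o (\1_(`[a, b]%classic) : R -> R)).
  by apply/measurable_EFinP; exact: measurable_indic.
have mphi : measurable_fun setT (EFin \o phi).
  by apply/measurable_EFinP; exact: measurable_phi.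
rewrite -lee_fin -prE// N01E// -(integral_itv_cst true false ab M0).
apply: ge0_le_integral => //.
- by move=> x _; rewrite mule_ge0 ?lee_fin ?phi_ge0.
- exact: (emeasurable_funM mA mphi).
- exact: (emeasurable_funM (measurable_cst _) mA).
- move=> x _; rewrite indicE; case: (boolP (x \in _)) => [|_].
    by rewrite inE/= in_itv/= => /H xM; rewrite mul1e mule1 lee_fin.
  by rewrite mul0e mule0.
Qed.

Lemma N01_itv_ge (a b M : R) : a <= b -> 0 <= M ->
  (forall x, a < x <= b -> M <= phi x) -> M * (b - a) <= pr N01 `]a, b].
Proof.
move=> ab M0 H.
have mA : measurable_fun setT (EFin \o (\1_(`]a, b]%classic) : R -> R)).
  by apply/measurable_EFinP; exact: measurable_indic.
have mphi : measurable_fun setT (EFin \o phi).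
  by apply/measurable_EFinP; exact: measurable_phi.
rewrite -lee_fin -prE// N01E// -(integral_itv_cst false false ab M0).
apply: ge0_le_integral => //.
- by move=> x _; rewrite mule_ge0 ?lee_fin.
- exact: (emeasurable_funM (measurable_cst _) mA).
- exact: (emeasurable_funM mA mphi).
- move=> x _; rewrite indicE; case: (boolP (x \in _)) => [|_].
    by rewrite inE/= in_itv/= => /H xM; rewrite mul1e mule1 lee_fin.
  by rewrite mul0e mule0.
Qed.

Lemma normal_peak1_le1 : normal_peak (1 : R) <= 1.
Proof.
have h : 1 <= pi *+ 2 :> R by have := pi_ge2 R; rewrite -mulr_natr; lra.
have h0 := lt_le_trans ltr01 h.
by rewrite /normal_peak expr1n mul1r invf_le1 ?sqrtr_gt0// -[leLHS]sqrtr1 ler_sqrt// ltW.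
Qed.

Lemma phi_le (x y : R) : 0 <= y -> y <= `|x| -> phi x <= phi y.
Proof.
move=> y0 yx; rewrite !phiE ler_wpM2l ?normal_peak_ge0// ler_expR.
rewrite ler_pM2r ?invr_gt0// lerN2 -[leRHS]real_normK ?num_real//.
by rewrite ler_pXn2r ?nnegrE.
Qed.

Let K := @expR R (3 / 2).

(** On an interval of length $e=1/(1+m)$ above $m$ the Gaussian exponent changes by
    $me+e^2/2\le3/2$, so the density stays above $\phi(m)/K$ with $K=\exp(3/2)$. *)
Lemma mills_lower (m : R) : 0 <= m ->
  phi m <= K * (1 + m) * pr N01 `]m, +oo[.
Proof.
move=> m0; pose e := (1 + m)^-1.
have m1 : 0 < 1 + m by rewrite ltr_pwDl.
have e0 : 0 < e by rewrite invr_gt0.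
have e1 : e <= 1 by rewrite invf_le1// lerDl.
have me : m * e <= 1 by rewrite ler_pdivrMr// mul1r lerDr.
have H : phi (m + e) * e <= pr N01 `]m, +oo[.
  apply: le_trans (_ : pr N01 `]m, (m + e)] <= _); last first.
    by apply: pr_le => // x /=; rewrite !in_itv/= andbT => /andP[].
  have := @N01_itv_ge m (m + e) (phi (m + e)).
  rewrite addrAC subrr add0r; apply; first by rewrite lerDl ltW.
    exact: phi_ge0.
  move=> x /andP[mx xm]; apply: phi_le; first exact: le_trans m0 (ltW mx).
  by rewrite ger0_norm ?addr_ge0// ltW.
have phiK : phi m <= K * phi (m + e).
  rewrite !phiE mulrCA ler_wpM2l ?normal_peak_ge0// -expRD ler_expR.
  have : e ^+ 2 <= 1 by rewrite expr_le1// ltW.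
  by rewrite sqrrD -mulr_natr; nra.
apply: le_trans phiK _; rewrite -mulrA ler_wpM2l ?expR_ge0//.
by rewrite mulrC -ler_pdivrMr// mulrC mulrC.
Qed.

Definition upclosed (U : set R) := forall x y, U x -> x <= y -> U y.

(** An up-closed set contains everything beyond the infimum [m] of its part above [a]. The mass in
    the window is at most [e] times the density at [p = max 0 m], and the Mills bound turns this
    density into the mass of the half-line beyond [p]. *)
Lemma hazard_bound (U : set R) (a e : R) : measurable U -> upclosed U -> 0 <= e ->
  pr N01 (U `&` `]a, (a + e)]) <=
  e * (K * (1 + Num.max 0 (a + e))) * pr N01 (U `&` `]a, +oo[).
Proof.
move=> mU upU e0; set t := Num.max 0 _.
have t0 : 0 <= t by rewrite le_max lexx.
have rhs0 (V : set R) : 0 <= e * (K * (1 + t)) * pr N01 V.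
  by rewrite !mulr_ge0 ?expR_ge0 ?pr_ge0 ?addr_ge0.
have [[x0 [Ux0 ax0]]|/nonemptyPn E] := pselect (U `&` `]a, (a + e)] !=set0); last first.
  by rewrite E /pr measure0; exact: rhs0.
move: ax0; rewrite /= in_itv/= => /andP[ax0 x0a].
pose V := U `&` `]a, +oo[; pose m := inf V.
have Vx0 : V x0 by split => //=; rewrite in_itv/= ax0.
have Vn : V !=set0 by exists x0.
have lbV : lbound V a by move=> x [_ /=]; rewrite in_itv/= andbT => /ltW.
have am : a <= m by exact: lb_le_inf.
have mx x : V x -> m <= x by move=> Vx; apply: ge_inf => //; exists a.
have mV x : m < x -> V x.
  move=> mx'; have [y [Uy ay] yx] := inf_lt Vn mx'; split.
    exact: upU Uy (ltW yx).
  by move: ay; rewrite /= !in_itv/= !andbT => /lt_trans; exact.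
have mae : m <= a + e by exact: le_trans (mx _ Vx0) x0a.
have mV' : measurable V by exact: measurableI.
pose p := Num.max 0 m.
have p0 : 0 <= p by rewrite le_max lexx.
have pt : p <= t by rewrite /p /t ge_max !le_max lexx mae orbT.
apply: (@le_trans _ _ (phi p * e)).
  apply: (@le_trans _ _ (pr N01 `[m, (m + e)])).
    apply: pr_le => //; first exact: measurableI.
    move=> x [Ux /=]; rewrite !in_itv/= => /andP[ax xa]; apply/andP; split.
      by apply: mx; split => //=; rewrite in_itv/= ax.
    by apply: le_trans xa _; rewrite lerD2r.
  have := @N01_itv_le m (m + e) (phi p); rewrite addrAC subrr add0r; apply.
    by rewrite lerDl.
  move=> x /andP[mx' _]; apply: phi_le => //.
  by rewrite /p ge_max normr_ge0 (le_trans mx')// ler_norm.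
rewrite mulrC -!mulrA ler_wpM2l//.
apply: le_trans (mills_lower p0) _; rewrite -!mulrA ler_wpM2l ?expR_ge0//.
apply: ler_pM; rewrite ?addr_ge0 ?pr_ge0 ?lerD2l//.
apply: pr_le => // x /=; rewrite in_itv/= andbT => px; apply: mV.
by apply: le_lt_trans px; rewrite le_max lexx orbT.
Qed.

Lemma window_bound (a e : R) : 0 <= a -> 0 <= e ->
  pr N01 `]a, (a + e)] <= e * phi a.
Proof.
move=> a0 e0; apply: (@le_trans _ _ (pr N01 `[a, (a + e)])).
  by apply: pr_le => // x /=; rewrite !in_itv/= => /andP[/ltW -> ->].
have := @N01_itv_le a (a + e) (phi a); rewrite addrAC subrr add0r mulrC; apply.
  by rewrite lerDl.
move=> x /andP[ax _]; apply: phi_le => //.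
by rewrite (le_trans ax)// ler_norm.
Qed.

End mills.

(** * Nazarov's inequality for orthants *)

Section nazarov.
Context {R : realType} {D : nat}.
Variables (s : seq (D.-tuple R)) (c sg : 'I_D -> R).
Hypotheses (sg0 : forall j, 0 < sg j) (sgE : forall j, gcov s j j = sg j ^+ 2).

Definition nrm (x : D.-tuple R) j : R := (tnth x j - c j) / sg j.

(* Breaking ties by the index makes these sets disjoint. *)
Definition amax (j : 'I_D) : set (D.-tuple R) :=
  [set x | forall i : 'I_D, if (i < j)%N then nrm x i < nrm x j
                           else nrm x i <= nrm x j].

Lemma measurable_nrm j : measurable_fun setT (nrm^~ j).
Proof.
apply: measurable_funM => //; apply: measurable_funB => //.
exact: measurable_tnth.
Qed.

Lemma measurable_amax j : measurable (amax j).
Proof.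
apply: (measurable_forall (A := fun i : 'I_D => [set x | if (i < j)%N
  then nrm x i < nrm x j else nrm x i <= nrm x j])) => i.
case ij : (i < j)%N.
  by apply: measurable_ltset; exact: measurable_nrm.
by apply: measurable_leset; exact: measurable_nrm.
Qed.

Lemma amax_disj j k x : amax j x -> amax k x -> j = k.
Proof.
move=> jx kx; have := jx k; have := kx j.
case: (ltngtP j k) => [jk|kj|/val_inj//].
  by move=> h1 h2; have := lt_le_trans h1 h2; rewrite ltxx.
by move=> h1 h2; have := lt_le_trans h2 h1; rewrite ltxx.
Qed.

(** Among the maximizers, the one of least index. *)
Lemma amax_ex (x : D.-tuple R) (j0 : 'I_D) : exists j, amax j x.
Proof.
pose M := nrm x [arg max_(i > j0) nrm x i]%O.
have HM i : nrm x i <= M.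
  by rewrite /M; case: arg_maxP => //= k _; apply.
have /ex_minnP[m /existsP[j /andP[/eqP jm /eqP jM]] min] :
    exists m, [exists j : 'I_D, (nat_of_ord j == m) && (nrm x j == M)].
  exists (nat_of_ord [arg max_(i > j0) nrm x i]%O); apply/existsP.
  by exists [arg max_(i > j0) nrm x i]%O; rewrite !eqxx.
exists j => i; rewrite jM; case: ifPn => // ij.
rewrite lt_neqAle HM andbT; apply/negP => /eqP iM.
have /min : [exists k : 'I_D, (nat_of_ord k == i) && (nrm x k == M)].
  by apply/existsP; exists i; rewrite eqxx iM eqxx.
by rewrite -jm leqNgt ij.
Qed.

(** If every direction vanishes at [j], the law lives on the hyperplane where coordinate [j] is 0.
    Stating this as a comparison of integrals avoids speaking of supports. *)
Lemma gks_restrict j (s' : seq (D.-tuple R)) (f g : D.-tuple R -> \bar R) :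
  all (fun b => tnth b j == 0) s' ->
  measurable_fun setT f -> measurable_fun setT g ->
  (forall x, (0 <= f x)%E) -> (forall x, (0 <= g x)%E) ->
  (forall x, tnth x j = 0 -> (f x <= g x)%E) ->
  (\int[gks s']_x f x <= \int[gks s']_x g x)%E.
Proof.
elim: s' f g => [|b s' IH] f g /=.
  move=> _ mf mg f0 g0 fg; rewrite !integral_dirac//= !diracT !mul1e.
  by apply: fg; rewrite tnth_tzero.
move=> /andP[/eqP b0 s0] mf mg f0 g0 fg; rewrite !ge0_integral_gk//.
have mi (f' : D.-tuple R -> \bar R) : measurable_fun setT f' ->
    (forall x, (0 <= f' x)%E) ->
    measurable_fun setT (fun s => (\int[N01]_z f' (tadd s (tscale z b)))%E).
  move=> mf' f0'; apply: (measurable_fun_fubini_tonelli_F (m2 := N01)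
    (fun z => f' (tadd z.1 (tscale z.2 b)))) => //=.
  by apply: (measurableT_comp mf'); exact: (measurable_kick (measurable_tscale b)).
have ms (f' : D.-tuple R -> \bar R) x : measurable_fun setT f' ->
    measurable_fun setT (fun z => f' (tadd x (tscale z b))).
  move=> mf'; apply: (measurableT_comp mf'); apply: measurable_tadd => //.
  exact: measurable_tscale.
apply: IH => //; try by [exact: mi|move=> x; exact: integral_ge0].
move=> x x0; apply: ge0_le_integral => //; try exact: ms.
by move=> z _; apply: fg; rewrite tnth_tadd tnth_tscale x0 b0 mulr0 addr0.
Qed.

Definition apos j := amax j `&` [set x | 0 < nrm x j].
Definition awin (e : R) j := amax j `&` [set x | 0 < nrm x j <= e].

Lemma measurable_apos j : measurable (apos j).
Proof.
apply: measurableI; first exact: measurable_amax.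
by apply: measurable_ltset => //; exact: measurable_nrm.
Qed.

Lemma measurable_awin e j : measurable (awin e j).
Proof.
apply: measurableI; first exact: measurable_amax.
rewrite (_ : [set x | _] = [set x | 0 < nrm x j] `&` [set x | nrm x j <= e]).
  apply: measurableI; first by apply: measurable_ltset => //; exact: measurable_nrm.
  by apply: measurable_leset => //; exact: measurable_nrm.
by apply/seteqP; split => x /=; [move/andP|move=> [-> ->]].
Qed.

Let K := @expR R (3 / 2).
Let t := Num.sqrt (2 * ln (D%:R : R)).

(** [t] is the level where the density falls to $1/D$: below it the hazard rate is of order
    $\sqrt{\log D}$, above it a sum over all $D$ coordinates is affordable. *)
Lemma phi_sqrt_ln : (0 < D)%N -> phi t <= D%:R^-1.
Proof.
move=> D0; rewrite phiE.
have lnD : 0 <= ln (D%:R : R) by rewrite ln_ge0// ler1n.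
rewrite /t sqr_sqrtr ?mulr_ge0// mulNr [2 * _]mulrC mulfK// expRN lnK ?posrE ?ltr0n//.
by rewrite ler_piMl ?invr_ge0 ?ler0n// normal_peak1_le1.
Qed.

(* Conditionally on everything but the Gaussian isolated at coordinate j, [awin e j]
   and [apos j] are a window and a half-line above a common level: below [t] their
   ratio is bounded by the hazard rate, above [t] the density is at most 1 / D. *)
Lemma awin_le e j : (0 < D)%N -> 0 <= e ->
  pr (gks s) (awin e j) <= e * (K * (1 + (t + e))) * pr (gks s) (apos j) + e / D%:R.
Proof.
move=> D0 e0; have [a [s' [E a0 s0 cv]]] := gks_isolate j s.
have t0 : 0 <= t by exact: sqrtr_ge0.
(* The other directions vanish at [j], so [a] carries the whole variance of coordinate [j]. *)
have aj : tnth a j = sg j.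
  have : tnth a j ^+ 2 = sg j ^+ 2.
    rewrite -sgE -cv /gcov big_cons big1_seq ?addr0//.
    by move=> b /= bs; have /allP/(_ _ bs)/eqP -> := s0; rewrite mulr0.
  by move/eqP; rewrite eqrXn2// ?(ltW (sg0 j))// => /eqP.
have ai i : tnth a i <= sg i.
  rewrite leNgt; apply/negP => H.
  have : tnth a i ^+ 2 <= sg i ^+ 2.
    rewrite -sgE -cv /gcov big_cons -expr2 lerDl sumr_ge0// => b _.
    by rewrite -expr2 sqr_ge0.
  by rewrite leNgt ltr_pXn2r ?nnegrE ?H// ltW// (lt_trans (sg0 i)).
have nE x z i : nrm (tadd x (tscale z a)) i = nrm x i + z * (tnth a i / sg i).
  by rewrite /nrm tnth_tadd tnth_tscale mulrA -mulrDl; congr (_ / _); ring.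
have [mA mB] := (measurable_awin e j, measurable_apos j).
have mi (A : set (D.-tuple R)) : measurable A ->
    measurable_fun setT (fun x => (\1_A x)%:E : \bar R).
  by move=> ?; apply/measurable_EFinP; exact: measurable_indic.
have mh x : measurable_fun setT (fun z : R => tadd x (tscale z a)).
  by apply: measurable_tadd => //; exact: measurable_tscale.
have mpre (A : set (D.-tuple R)) x : measurable A ->
    measurable ((fun z : R => tadd x (tscale z a)) @^-1` A).
  by move=> ?; rewrite -[X in measurable X]setTI; exact: mh.
have iE (A : set (D.-tuple R)) x : measurable A ->
    (\int[N01]_z (\1_A (tadd x (tscale z a)))%:E =
    (pr N01 ((fun z : R => tadd x (tscale z a)) @^-1` A))%:E)%E.
  move=> H; rewrite -prE; last exact: mpre.
  have := @integral_indic _ _ _ N01 setT measurableT _ (mpre A x H).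
  by rewrite setIT => <-.
have PE (A : set (D.-tuple R)) : measurable A -> (pr (gks s) A)%:E =
    (\int[gks s']_x (pr N01 ((fun z : R => tadd x (tscale z a)) @^-1` A))%:E)%E.
  move=> mA'; transitivity (\int[gks s]_x (\1_A x)%:E)%E.
    by rewrite -prE// integral_indic// setIT.
  rewrite (meq_integral _ E) /= ge0_integral_gk//; last exact: mi.
  by apply: eq_integral => x _; rewrite iE.
have mint (A : set (D.-tuple R)) : measurable A -> measurable_fun setT
    (fun x => (pr N01 ((fun z : R => tadd x (tscale z a)) @^-1` A))%:E : \bar R).
  move=> mA'; under eq_fun do rewrite -iE//.
  apply: (measurable_fun_fubini_tonelli_F (m2 := N01)
    (fun z => (\1_A (tadd z.1 (tscale z.2 a)))%:E)) => //=.
  by apply: (measurableT_comp (mi _ mA')); exact: (measurable_kick (measurable_tscale a)).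
pose k := e * (K * (1 + (t + e))).
have k0 : 0 <= k by rewrite !mulr_ge0 ?expR_ge0 ?addr_ge0.
rewrite -lee_fin EFinD EFinM PE// (PE _ mB) -/k -ge0_integralZl//; last 2 first.
- exact: mint.
- by move=> x _; rewrite lee_fin pr_ge0.
have -> : (e / D%:R)%:E = (\int[gks s']_x (e / D%:R)%:E)%E.
  by rewrite integral_cst//= probability_setT mule1.
rewrite -ge0_integralD//; last 3 first.
- by move=> x _; rewrite mule_ge0// lee_fin pr_ge0.
- by apply: emeasurable_funM => //; exact: mint.
- by move=> x _; rewrite lee_fin divr_ge0.
apply: (gks_restrict s0); [exact: mint| | | |].
- by apply: emeasurable_funD => //; apply: emeasurable_funM => //; exact: mint.
- by move=> x; rewrite lee_fin pr_ge0.
- by move=> x; rewrite adde_ge0// ?mule_ge0 ?lee_fin ?pr_ge0 ?divr_ge0.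
move=> x xj; rewrite -EFinM -EFinD lee_fin.
pose al := c j / sg j.
have nj z : nrm (tadd x (tscale z a)) j = z - al.
  by rewrite nE aj divff ?gt_eqF// mulr1 /nrm xj sub0r mulNr addrC.
pose U := (fun z : R => tadd x (tscale z a)) @^-1` amax j.
have mU : measurable U by apply: mpre; exact: measurable_amax.
(* Raising [z] raises normalized coordinate [j] at rate 1 and coordinate [i] at rate
   [tnth a i / sg i], which is at most 1 by [ai]; so once [j] is the argmax it remains so. *)
have upU : upclosed U.
  move=> z z' Uz zz' i; have := Uz i; rewrite !nE aj divff ?gt_eqF// !mulr1.
  have : (z' - z) * (tnth a i / sg i) <= z' - z.
    by rewrite ler_piMr ?subr_ge0// ler_pdivrMr// mul1r.
  by case: ifP => _; lra.
have -> : (fun z : R => tadd x (tscale z a)) @^-1` awin e j = U `&` `]al, (al + e)]%classic.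
  apply/seteqP; split => z [Uz] /= H; split => //=; move: H;
    by rewrite ?in_itv/= !nj => /andP[h1 h2]; apply/andP; split; lra.
have -> : (fun z : R => tadd x (tscale z a)) @^-1` apos j = U `&` `]al, +oo[%classic.
  apply/seteqP; split => z [Uz] /= H; split => //=; move: H;
    by rewrite ?in_itv/= ?andbT !nj; lra.
have [alt|alt] := leP al t.
  apply: le_trans (hazard_bound al mU upU e0) _.
  rewrite -[leLHS]addr0; apply: lerD; last by rewrite divr_ge0.
  rewrite ler_wpM2r ?pr_ge0// ler_wpM2l// ler_wpM2l ?expR_ge0// lerD2l.
  by rewrite ge_max addr_ge0//= lerD2r.
have al0 : 0 <= al by exact: le_trans t0 (ltW alt).
apply: (@le_trans _ _ (pr N01 `]al, (al + e)])).
  by apply: pr_le => //; exact: measurableI.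
apply: le_trans (window_bound al0 e0) _.
rewrite -[leLHS]add0r; apply: lerD; first by rewrite mulr_ge0 ?pr_ge0.
rewrite ler_wpM2l//; apply: le_trans (phi_sqrt_ln D0).
by apply: phi_le => //; rewrite ger0_norm// ltW.
Qed.

Lemma sum_apos : \sum_(j < D) pr (gks s) (apos j) <= 1.
Proof.
rewrite (eq_bigr (fun j => Ex (gks s) (\1_(apos j)))); last first.
  by move=> j _; rewrite Ex_indic//; exact: measurable_apos.
rewrite -Ex_sum; last by move=> j; apply: intg_indic; exact: measurable_apos.
rewrite -[leRHS](Ex_cst (gks s)); apply: Ex_le.
- by apply: intg_sum => j _; apply: intg_indic; exact: measurable_apos.
- exact: intg_cst.
move=> x; have [[j jx]|N] := pselect (exists j, apos j x); last first.
  rewrite big1 ?ler01// => j _; rewrite indicE memNset//.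
  by move=> jx; apply: N; exists j.
rewrite (bigD1 j)//= big1 ?addr0 ?indicE; first by case: (_ \in _).
move=> k kj; rewrite indicE memNset// => -[kx _]; case: jx => jx _.
by rewrite (amax_disj kx jx) eqxx in kj.
Qed.

(** The bounds [awin_le] are summed over [j]. The events [apos j] are disjoint, so the factor of
    order $\sqrt{\log D}$ is paid only once, while the $D$ remainders [e / D] add up to [e]. *)
Lemma nazarov (e : R) : 0 <= e ->
  pr (gks s) [set x | (exists j, 0 < nrm x j) /\ forall j, nrm x j <= e] <=
  e * (K * (1 + (t + e)) + 1).
Proof.
move=> e0; have [D0|D0] := posnP D.
  rewrite (_ : [set x | _] = set0); last first.
    by apply/seteqP; split => // x [[j _] _]; have := ltn_ord j; rewrite {2}D0.
  rewrite /pr measure0; apply: mulr_ge0 => //; apply: addr_ge0 => //.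
  by rewrite mulr_ge0 ?expR_ge0// addr_ge0// addr_ge0// sqrtr_ge0.
have mex : measurable [set x : D.-tuple R | exists j, 0 < nrm x j].
  have -> : [set x : D.-tuple R | exists j, 0 < nrm x j] =
      ~` [set x | forall j, nrm x j <= 0].
    apply/seteqP; split => x /=.
      by move=> [j jx] /(_ j); rewrite leNgt jx.
    by move=> /existsNP[j /negP]; rewrite -ltNge => jx; exists j.
  apply: measurableC; apply: measurable_forall => j.
  by apply: measurable_leset => //; exact: measurable_nrm.
have mE : measurable [set x : D.-tuple R |
    (exists j, 0 < nrm x j) /\ forall j, nrm x j <= e].
  apply: measurableI => //; apply: measurable_forall => j.
  by apply: measurable_leset => //; exact: measurable_nrm.
apply: (@le_trans _ _ (\sum_(j < D) pr (gks s) (awin e j))).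
  rewrite (eq_bigr (fun j => Ex (gks s) (\1_(awin e j)))); last first.
    by move=> j _; rewrite Ex_indic//; exact: measurable_awin.
  rewrite -Ex_indic// -Ex_sum; last by move=> j; apply: intg_indic; exact: measurable_awin.
  apply: Ex_le; first exact: intg_indic.
    by apply: intg_sum => j _; apply: intg_indic; exact: measurable_awin.
  move=> x; rewrite indicE; case: (boolP (x \in _)) => [|_]; last first.
    by apply: sumr_ge0.
  rewrite inE/= => -[[j0 j0x] xe]; have [j jx] := amax_ex x j0.
  rewrite (bigD1 j)//= -[leLHS]addr0; apply: lerD; last by apply: sumr_ge0.
  rewrite indicE mem_set//; split => //=; rewrite xe andbT.
  apply: lt_le_trans j0x _; have := jx j0.
  by case: ifP => _ // /ltW.
apply: le_trans (ler_sum _ (fun j _ => awin_le j D0 e0)) _.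
rewrite big_split/= -mulr_sumr [leRHS]mulrDr; apply: lerD.
  rewrite ler_piMr ?sum_apos// mulr_ge0// mulr_ge0 ?expR_ge0//.
  by rewrite addr_ge0// addr_ge0// sqrtr_ge0.
rewrite mulr1 sumr_const card_ord -[X in X <= _]mulr_natr mulfVK//.
by rewrite pnatr_eq0 -lt0n.
Qed.

End nazarov.

(** * Smoothed indicators of orthants *)

Section calculus.
Context {R : realType}.
Implicit Types f g : R -> R.

Definition der f (x a : R) := is_derive x (1 : R) f a.

Lemma der_eq f x a b : der f x a -> a = b -> der f x b.
Proof. by move=> H <-. Qed.

Lemma der_cst (c x : R) : der (fun=> c) x 0.
Proof. exact: is_derive_cst. Qed.

Lemma der_id (x : R) : der (fun t => t) x 1.
Proof. exact: is_derive_id. Qed.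

Lemma derD f g x a b : der f x a -> der g x b -> der (fun t => f t + g t) x (a + b).
Proof. by move=> fa gb; exact: is_deriveD. Qed.

Lemma derB f g x a b : der f x a -> der g x b -> der (fun t => f t - g t) x (a - b).
Proof. by move=> fa gb; exact: is_deriveB. Qed.

Lemma derZ f x a c : der f x a -> der (fun t => c * f t) x (c * a).
Proof. by move=> fa; exact: (is_deriveZ _ fa). Qed.

Lemma derM f g x a b : der f x a -> der g x b ->
  der (fun t => f t * g t) x (f x * b + g x * a).
Proof. by move=> fa gb; exact: is_deriveM. Qed.

Lemma der_comp f g x a b : der f (g x) a -> der g x b ->
  der (fun t => f (g t)) x (a * b).
Proof. by move=> fa gb; exact: is_derive1_comp. Qed.

Lemma derV f x a : f x != 0 -> der f x a ->
  der (fun t => (f t)^-1) x (- (f x) ^- 2 * a).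
Proof. by move=> f0 fa; exact: is_deriveV. Qed.

Lemma der_sum n (f : 'I_n -> R -> R) (x : R) (a : 'I_n -> R) :
  (forall i, der (f i) x (a i)) -> der (fun t => \sum_i f i t) x (\sum_i a i).
Proof.
elim: n f a => [|n IH] f a fa.
  rewrite big_ord0; under [X in der X]eq_fun do rewrite big_ord0; exact: der_cst.
rewrite big_ord_recl; under [X in der X]eq_fun do rewrite big_ord_recl.
by apply: derD; [exact: fa|apply: IH => i; exact: fa].
Qed.

Lemma derX n (x : R) : der (fun t => t ^+ n) x (n%:R * x ^+ n.-1).
Proof.
elim: n => [|n IH].
  by rewrite mul0r; under [X in der X]eq_fun do rewrite expr0; exact: der_cst.
under [X in der X]eq_fun do rewrite exprS.
apply: der_eq (derM (der_id x) IH) _ => /=.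
case: n IH => [|n] _ /=; first by ring.
by rewrite -[in RHS]natr1 exprS; ring.
Qed.

Lemma der_MVT f f' (M t : R) :
  (forall x, der f x (f' x)) -> 0 <= t ->
  (forall x, 0 <= x <= t -> `|f' x| <= M) -> `|f t - f 0| <= M * t.
Proof.
move=> df; rewrite le_eqVlt => /predU1P[<-|t0] H.
  by rewrite subrr normr0 mulr0.
have [|c /[!in_itv]/= /andP[c0 ct] ->] := MVT t0 (fun x _ => df x).
  apply: derivable_within_continuous => x _.
  by have [] := df x.
rewrite subr0 normrM (gtr0_norm t0) ler_wpM2r ?(ltW t0)// H//.
by rewrite !ltW.
Qed.

(** Three nested mean value estimates on the unit interval; the factor 1/6 of the sharp remainder is
    given up. *)
Lemma taylor3 f f1 f2 f3 (M : R) :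
  (forall x, der f x (f1 x)) -> (forall x, der f1 x (f2 x)) ->
  (forall x, der f2 x (f3 x)) -> (forall x, 0 <= x <= 1 -> `|f3 x| <= M) ->
  `|f 1 - f 0 - f1 0 - f2 0 / 2| <= M.
Proof.
move=> df df1 df2 H.
have M0 : 0 <= M by apply: le_trans (normr_ge0 _) (H 0 _); rewrite lexx ler01.
have le1 N t : 0 <= t <= 1 -> N <= M * t -> N <= M.
  by move=> /andP[t0 t1] /le_trans; apply; rewrite ler_piMr.
have h2 t : 0 <= t <= 1 -> `|f2 t - f2 0| <= M.
  move=> /andP[t0 t1]; apply: (le1 _ t); first by rewrite t0.
  apply: der_MVT df2 t0 _ => x /andP[x0 xt]; apply: H.
  by rewrite x0 (le_trans xt).
pose k1 t := f1 t - f2 0 * t.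
have dk1 x : der k1 x (f2 x - f2 0).
  apply: derB => //; apply: (der_eq (derZ _ (der_id _))).
  by rewrite mulr1.
have h1 t : 0 <= t <= 1 -> `|f1 t - f1 0 - f2 0 * t| <= M.
  move=> /andP[t0 t1]; apply: (le1 _ t); first by rewrite t0.
  have := @der_MVT k1 _ M t dk1 t0.
  rewrite /k1 mulr0 subr0 addrAC; apply => x /andP[x0 xt].
  by apply: h2; rewrite x0 (le_trans xt).
pose k2 t := f t - f1 0 * t - f2 0 / 2 * (t * t).
have dk2 x : der k2 x (f1 x - f1 0 - f2 0 * x).
  apply: der_eq (derB (derB (df x) (derZ (f1 0) (der_id x)))
    (derZ (f2 0 / 2) (derM (der_id x) (der_id x)))) _.
  by field.
have := @der_MVT k2 _ M 1 dk2 ler01.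
rewrite /k2 !mulr1 !mulr0 !subr0.
rewrite (_ : f 1 - f 0 - f1 0 - f2 0 / 2 = f 1 - f1 0 - f2 0 / 2 - f 0); last by ring.
by apply => x x01; exact: h1.
Qed.

End calculus.

Section scalar_bounds.
Context {R : realType}.

(** With $w=x(1-x)\le1/4$ and $z=|1-2x|$ these are the bounds for the first three derivatives of the
    step function below: $140/64\le3$, $420/16\le27$ and $840/4=210$. *)
Lemma sstep_bounds (w z : R) : 0 <= w -> w <= 4^-1 -> 0 <= z <= 1 ->
  [/\ 140 * (w * (w * w)) <= 3, 420 * (w * w) * z <= 27
    & 840 * w * `|1 - 4 * w - w| <= 210].
Proof.
move=> w0 w4 /andP[z0 z1].
have w2 : w * w <= 4^-1 * 4^-1 by apply: ler_pM.
have w2' : 0 <= w * w by exact: mulr_ge0.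
have w3 : w * (w * w) <= 4^-1 * (4^-1 * 4^-1) by apply: ler_pM.
split; first by lra.
  apply: (@le_trans _ _ (420 * (w * w))); last by lra.
  have c0 : (0 : R) <= 420 by rewrite ler0n.
  exact: (ler_piMr (mulr_ge0 c0 w2') z1).
have h : `|1 - 4 * w - w| <= 1 by rewrite ler_norml; apply/andP; split; lra.
apply: (@le_trans _ _ (840 * w)); last by lra.
have c0 : (0 : R) <= 840 by rewrite ler0n.
exact: (ler_piMr (mulr_ge0 c0 w0) h).
Qed.

(** The quantity bounded is the third derivative of $G(u(t))$ with $u=l\log Z$ up to a constant:
    [x1], [x2], [x3] are the first three derivatives of $Z$ divided by $Z$, and their combinations
    are the cumulants. The constant is $210+162+18$. *)
Lemma phi3_bound (g1 g2 g3 x1 x2 x3 l M1 M2 A : R) :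
  `|g1| <= 3 -> `|g2| <= 27 -> `|g3| <= 210 -> 0 <= l -> l <= 1 ->
  0 <= M1 -> 0 <= M2 -> `|x1| <= M1 -> `|x2| <= M2 -> `|x3| <= A ->
  M1 ^+ 2 <= M2 -> M1 * M2 <= A ->
  `|g3 * (l * x1) ^+ 3 + 3 * g2 * (l * x1) * (l * (x2 - x1 ^+ 2)) +
    g1 * (l * (x3 - 3 * x2 * x1 + 2 * x1 ^+ 3))| <= 390 * l * A.
Proof.
move=> hg1 hg2 hg3 l0 l1 M10 M20 h1 h2 h3 h4 h5.
have A0 : 0 <= A by apply: le_trans h5; rewrite mulr_ge0.
have M3 : M1 ^+ 3 <= A.
  by rewrite exprS; apply: le_trans h5; rewrite ler_wpM2l.
have n1 k : `|x1| ^+ k <= M1 ^+ k by apply: lerXn2r; rewrite ?nnegrE.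
have nv : `|x2 - x1 ^+ 2| <= M2 + M1 ^+ 2.
  by apply: le_trans (ler_normB _ _) _; rewrite normrX lerD.
have c0 k : 0 <= k%:R :> R by rewrite ler0n.
have e1 : `|g3 * (l * x1) ^+ 3| <= 210 * l * A.
  rewrite normrM normrX normrM (ger0_norm l0) exprMn.
  apply: le_trans (_ : 210 * (l ^+ 3 * A) <= _).
    apply: ler_pM => //; first by rewrite mulr_ge0// exprn_ge0.
    by rewrite ler_wpM2l ?exprn_ge0//; exact: le_trans (n1 3%N) M3.
  rewrite mulrA; apply: (ler_wpM2r A0); apply: (ler_wpM2l (c0 210%N)).
  by rewrite exprS ler_piMr// exprn_ile1.
have e2 : `|3 * g2 * (l * x1) * (l * (x2 - x1 ^+ 2))| <= 162 * l * A.
  rewrite !normrM normr_nat (ger0_norm l0).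
  apply: le_trans (_ : 3 * 27 * (l * M1) * (l * (M2 + M1 ^+ 2)) <= _).
    apply: ler_pM; rewrite ?mulr_ge0//; last by rewrite ler_wpM2l.
    by apply: ler_pM; rewrite ?mulr_ge0// ?ler_wpM2l.
  have -> : 3 * 27 * (l * M1) * (l * (M2 + M1 ^+ 2)) =
    81 * l ^+ 2 * (M1 * M2 + M1 ^+ 3) by ring.
  apply: le_trans (_ : 81 * l ^+ 2 * (A + A) <= _).
    apply: ler_wpM2l; last exact: lerD.
    by apply: mulr_ge0; [exact: c0 81%N|exact: exprn_ge0].
  have : l ^+ 2 * A <= l * A by rewrite ler_wpM2r// expr2 ler_piMr.
  by lra.
have e3 : `|g1 * (l * (x3 - 3 * x2 * x1 + 2 * x1 ^+ 3))| <= 18 * l * A.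
  rewrite normrM normrM (ger0_norm l0).
  have h6 : `|x3 - 3 * x2 * x1 + 2 * x1 ^+ 3| <= 6 * A.
    apply: le_trans (ler_normD _ _) _; rewrite [X in _ + X]normrM normr_nat normrX.
    apply: le_trans (_ : (A + 3 * A) + 2 * A <= _); last by lra.
    apply: lerD; last by rewrite ler_wpM2l//; exact: le_trans (n1 3%N) M3.
    apply: le_trans (ler_normB _ _) _; rewrite lerD// !normrM normr_nat -mulrA.
    rewrite ler_wpM2l// mulrC; apply: le_trans h5; exact: ler_pM.
  apply: le_trans (_ : 3 * (l * (6 * A)) <= _); last by lra.
  by apply: ler_pM; rewrite ?mulr_ge0// ler_wpM2l.
apply: le_trans (ler_normD _ _) _.
apply: le_trans (lerD (le_trans (ler_normD _ _) (lerD e1 e2)) e3) _.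
by lra.
Qed.

End scalar_bounds.

(** * A step from 1 to 0 with three bounded derivatives *)

Section smoothstep.
Context {R : realType}.

Definition clamp (x : R) : R := Num.min 1 (Num.max 0 x).

Lemma clamp_itv x : 0 <= clamp x <= 1.
Proof. by rewrite /clamp le_min ler01 le_max lexx/= ge_min lexx. Qed.

Lemma clamp_le0 x : x <= 0 -> clamp x = 0.
Proof. by move=> x0; rewrite /clamp max_l// min_r. Qed.

Lemma clamp_ge1 x : 1 <= x -> clamp x = 1.
Proof.
by move=> x1; rewrite /clamp min_l// le_max x1 orbT.
Qed.

Lemma clamp_id x : 0 <= x <= 1 -> clamp x = x.
Proof. by move=> /andP[x0 x1]; rewrite /clamp max_r// min_r. Qed.

Lemma clamp_lip x y : `|clamp x - clamp y| <= `|x - y|.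
Proof.
wlog xy : x y / x <= y.
  move=> H; have [xy|/ltW yx] := leP x y; first exact: H.
  by rewrite distrC [leRHS]distrC H.
have h : clamp x <= clamp y by rewrite /clamp le_min2// le_max2.
rewrite distrC [leRHS]distrC !ger0_norm ?subr_ge0//.
have [x0|x0] := leP x 0.
  rewrite (clamp_le0 x0) subr0; have [y0|y0] := leP y 0.
    by rewrite (clamp_le0 y0) subr_ge0.
  apply: (@le_trans _ _ y); last by rewrite lerDl oppr_ge0.
  by rewrite /clamp ge_min ge_max lexx (ltW y0) orbT.
have [x1|x1] := leP 1 x.
  by rewrite (clamp_ge1 x1) clamp_ge1 ?subrr ?subr_ge0//; exact: le_trans x1 xy.
have -> : clamp x = x by apply: clamp_id; rewrite !ltW.
rewrite lerD2r /clamp ge_min ge_max lexx (le_trans (ltW x0) xy) orbT//.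
Qed.

Lemma clamp_continuous : continuous clamp.
Proof.
move=> x; apply/cvgrPdist_lt => e e0; near=> z.
apply: le_lt_trans (clamp_lip _ _) _.
by near: z; apply: cvgr_dist_lt.
Unshelve. all: by end_near. Qed.

(** As [p'] vanishes at 0 and 1, the corners of [clamp] are invisible: Caratheodory's slope of [p]
    tends to 0 there, and the slope of [clamp] is at most 1 in absolute value. *)
Lemma der_clamp (p p' : R -> R) x : (forall y, der p y (p' y)) ->
  p' 0 = 0 -> p' 1 = 0 -> der (fun t => p (clamp t)) x (p' (clamp x)).
Proof.
move=> dp p0 p1.
have [/andP[x0 x1]|H] := boolP (0 < x < 1).
  have -> : clamp x = x by apply: clamp_id; rewrite !ltW.
    apply: near_eq_is_derive (dp x); near=> z.
  rewrite clamp_id// !ltW//; near: z.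
    by apply: lt_nbhsl.
  by apply: lt_nbhsr.
have pc : p' (clamp x) = 0.
  move: H; rewrite negb_and -!leNgt => /orP[xl|xl].
    by rewrite clamp_le0.
  by rewrite clamp_ge1.
have [g [gE gc g0]] := (is_derive1_caratheodory _ _ _).1 (dp (clamp x)).
apply/is_derive1_caratheodory; rewrite pc in g0 *.
exists (fun z => if z == x then 0 else g (clamp z) * ((clamp z - clamp x) / (z - x))).
split; [| |by rewrite eqxx].
  move=> z; case: eqVneq => [->|zx]; first by rewrite !subrr mulr0.
  by rewrite gE -mulrA divfK// subr_eq0.
have cg : {for x, continuous (fun z => g (clamp z))}.
  by apply: continuous_comp; [exact: clamp_continuous|exact: gc].
rewrite /prop_for /continuous_at /= eqxx; apply/cvgrPdist_lt => e e0.
move/cvgrPdist_lt: cg => /(_ e e0); rewrite g0; apply: filterS => z.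
rewrite !sub0r !normrN; case: eqVneq => [_|zx]; first by rewrite normr0.
apply: le_lt_trans; rewrite normrM ler_piMr// normrM normfV.
by rewrite ler_pdivrMr ?mul1r ?clamp_lip// normr_gt0 subr_eq0.
Unshelve. all: by end_near. Qed.

(** The reversed smoothstep polynomial of degree 7. Its derivative is $-140\,(x(1-x))^3$, so the
    derivatives up to order three vanish at both ends. *)
Let q0 x : R := 1 - 35 * x ^+ 4 + 84 * x ^+ 5 - 70 * x ^+ 6 + 20 * x ^+ 7.
Let q1 x : R := (- 140) * x ^+ 3 + 420 * x ^+ 4 - 420 * x ^+ 5 + 140 * x ^+ 6.
Let q2 x : R := (- 420) * x ^+ 2 + 1680 * x ^+ 3 - 2100 * x ^+ 4 + 840 * x ^+ 5.
Let q3 x : R := (- 840) * x ^+ 1 + 5040 * x ^+ 2 - 8400 * x ^+ 3 + 4200 * x ^+ 4.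

Let sstep1E x : q1 x = (- 140) * (x * (1 - x)) ^+ 3.
Proof. by rewrite /q1; ring. Qed.
Let sstep2E x : q2 x = (- 420) * (x * (1 - x)) ^+ 2 * (1 - 2 * x).
Proof. by rewrite /q2; ring. Qed.
Let sstep3E x : q3 x =
  (- 840) * (x * (1 - x)) * ((1 - 2 * x) ^+ 2 - x * (1 - x)).
Proof. by rewrite /q3; ring. Qed.

Definition G0 u : R := q0 (clamp u).
Definition G1 u : R := q1 (clamp u).
Definition G2 u : R := q2 (clamp u).
Definition G3 u : R := q3 (clamp u).

Lemma der_G0 u : der G0 u (G1 u).
Proof.
apply: der_clamp => [y||]; rewrite ?sstep1E; [|ring|ring].
apply: der_eq (derD (derB (derD (derB (der_cst 1 y) (derZ 35 (derX 4 y)))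
  (derZ 84 (derX 5 y))) (derZ 70 (derX 6 y))) (derZ 20 (derX 7 y))) _.
by rewrite /=; ring.
Qed.

Lemma der_G1 u : der G1 u (G2 u).
Proof.
apply: der_clamp => [y||]; rewrite ?sstep2E; [|ring|ring].
apply: der_eq (derD (derB (derD (derZ (- 140) (derX 3 y)) (derZ 420 (derX 4 y)))
  (derZ 420 (derX 5 y))) (derZ 140 (derX 6 y))) _.
by rewrite /=; ring.
Qed.

Lemma der_G2 u : der G2 u (G3 u).
Proof.
apply: der_clamp => [y||]; rewrite ?sstep3E; [|ring|ring].
apply: der_eq (derD (derB (derD (derZ (- 420) (derX 2 y)) (derZ 1680 (derX 3 y)))
  (derZ 2100 (derX 4 y))) (derZ 840 (derX 5 y))) _.
by rewrite /=; ring.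
Qed.

Lemma G0_itv u : 0 <= G0 u <= 1.
Proof.
rewrite /G0 /q0; have /andP[] := clamp_itv u; move: (clamp u) => x x0 x1.
have h1 : 0 <= 1 - x by lra.
have E : 1 - 35 * x ^+ 4 + 84 * x ^+ 5 - 70 * x ^+ 6 + 20 * x ^+ 7 =
  (1 - x) ^+ 4 * (1 + 4 * x + 10 * x ^+ 2 + 20 * x ^+ 3) by ring.
rewrite {1}E; apply/andP; split.
  by rewrite mulr_ge0 ?exprn_ge0// !addr_ge0 ?mulr_ge0 ?exprn_ge0.
have -> : 1 - 35 * x ^+ 4 + 84 * x ^+ 5 - 70 * x ^+ 6 + 20 * x ^+ 7 =
  1 - x ^+ 4 * (1 + 4 * (1 - x) + 10 * (1 - x) ^+ 2 + 20 * (1 - x) ^+ 3) by ring.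
rewrite gerBl mulr_ge0 ?exprn_ge0// !addr_ge0 ?mulr_ge0 ?exprn_ge0//.
Qed.

Lemma G0_1 u : u <= 0 -> G0 u = 1.
Proof. by move=> u0; rewrite /G0 clamp_le0// /q0; ring. Qed.

Lemma G0_0 u : 1 <= u -> G0 u = 0.
Proof. by move=> u1; rewrite /G0 clamp_ge1// /q0; ring. Qed.

Lemma G123_out u : ~~ (0 < u < 1) -> [/\ G1 u = 0, G2 u = 0 & G3 u = 0].
Proof.
rewrite negb_and -!leNgt => H; rewrite /G1 /G2 /G3 sstep1E sstep2E sstep3E.
have : clamp u = 0 \/ clamp u = 1.
  by case/orP: H => H; [left; exact: clamp_le0|right; exact: clamp_ge1].
by case=> ->; split; ring.
Qed.

Lemma G123_le u : [/\ `|G1 u| <= 3, `|G2 u| <= 27 & `|G3 u| <= 210].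
Proof.
rewrite /G1 /G2 /G3 sstep1E sstep2E sstep3E.
have /andP[] := clamp_itv u; move: (clamp u) => x x0 x1.
set w := x * (1 - x).
have w0 : 0 <= w by rewrite mulr_ge0// subr_ge0.
have w4 : w <= 4^-1.
  by have := sqr_ge0 (x - 2^-1); rewrite /w expr2; nra.
have z1 : `|1 - 2 * x| <= 1 by rewrite ler_norml; apply/andP; split; lra.
have z2 : (1 - 2 * x) ^+ 2 = 1 - 4 * w by rewrite /w; ring.
have z0 : 0 <= `|1 - 2 * x| <= 1 by rewrite normr_ge0.
have [b1 b2 b3] := sstep_bounds w0 w4 z0.
clearbody w; rewrite !normrM normrN !normr_nat z2 (ger0_norm w0); split => //.
all: by rewrite normrN normr_nat.
Qed.

End smoothstep.

(** * The smoothed maximum along a segment *)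

Section smooth_max.
Context {R : realType} {D : nat}.
Implicit Types w b p : 'I_D -> R.

Definition mom w b k t : R := \sum_j w j * b j ^+ k * expR (t * b j).

Lemma der_mom w b k t : der (mom w b k) t (mom w b k.+1 t).
Proof.
apply: der_eq (der_sum (a := fun j => w j * b j ^+ k.+1 * expR (t * b j)) _) _ => // j.
apply: der_eq (derZ (w j * b j ^+ k) (der_comp (is_derive_expR _)
   (der_eq (derM (der_id t) (der_cst (b j) t)) erefl))) _.
by rewrite exprS; ring.
Qed.

(** The first inequality is a double sum of $xy^2\le(x^3+2y^3)/3$, which is $(x-y)^2(x+2y)\ge0$; the
    second says that a variance is nonnegative. *)
Lemma wmean_le (p b : 'I_D -> R) : (forall j, 0 <= p j) -> (forall j, 0 <= b j) ->
  \sum_j p j = 1 ->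
  (\sum_j p j * b j) * (\sum_j p j * b j ^+ 2) <= \sum_j p j * b j ^+ 3 /\
  (\sum_j p j * b j) ^+ 2 <= \sum_j p j * b j ^+ 2.
Proof.
move=> p0 b0 p1; split.
  have -> : \sum_j p j * b j ^+ 3 = \sum_i \sum_j p i * p j * ((b i ^+ 3 + 2 * b j ^+ 3) / 3).
    transitivity (\sum_i \sum_j (p i * b i ^+ 3 / 3 * p j + p i * (2 / 3) * (p j * b j ^+ 3))).
      under [RHS]eq_bigr do rewrite big_split/= -!mulr_sumr p1 mulr1.
      rewrite big_split/= -!mulr_suml p1; set S := \sum_i _; lra.
    by apply: eq_bigr => i _; apply: eq_bigr => j _; field.
  rewrite mulr_suml; apply: ler_sum => i _; rewrite mulr_sumr; apply: ler_sum => j _.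
  rewrite mulrACA; apply: ler_wpM2l; first exact: mulr_ge0.
  have := b0 i; have := b0 j; move: (b i) (b j) => x y y0 x0.
  rewrite -subr_ge0; have -> : (x ^+ 3 + 2 * y ^+ 3) / 3 - x * y ^+ 2 =
    (x - y) ^+ 2 * (x + 2 * y) / 3 by field.
  by rewrite divr_ge0// mulr_ge0 ?sqr_ge0// addr_ge0// mulr_ge0.
rewrite -subr_ge0; set m := \sum_j p j * b j.
have -> : \sum_j p j * b j ^+ 2 - m ^+ 2 = \sum_j p j * (b j - m) ^+ 2.
  have -> : \sum_j p j * (b j - m) ^+ 2 =
      \sum_j (p j * b j ^+ 2 - 2 * m * (p j * b j) + m ^+ 2 * p j).
    by apply: eq_bigr => j _; ring.
  rewrite big_split/= sumrB -!mulr_sumr p1 -/m; ring.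
by apply: sumr_ge0 => j _; rewrite mulr_ge0// sqr_ge0.
Qed.

(* Third-order Taylor expansion of [G0 ((ln Z - u0) / L)] along a segment,
   [Z t] being the exponential sum [mom w b 0 t]. *)
Variables (w b : 'I_D -> R) (L u0 : R).
Hypotheses (w0 : forall j, 0 < w j) (D0 : (0 < D)%N) (L1 : 1 <= L).
Let Z k t := mom w b k t.
Let u t := (ln (Z 0%N t) - u0) / L.
Let m1 t := Z 1%N t / Z 0%N t.
Let m2 t := Z 2%N t / Z 0%N t.
Let m3 t := Z 3%N t / Z 0%N t.

Lemma Z_gt0 t : 0 < Z 0%N t.
Proof.
rewrite /Z /mom (bigD1 (Ordinal D0))//= ltr_pwDl//.
  by rewrite expr0 mulr1 mulr_gt0 ?expR_gt0.
by apply: sumr_ge0 => j _; rewrite expr0 mulr1 mulr_ge0 ?expR_ge0// ltW.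
Qed.

Definition phi0 t := G0 (u t).
Definition phi1 t := G1 (u t) * (L^-1 * m1 t).
Definition phi2 t := G2 (u t) * (L^-1 * m1 t) ^+ 2 + G1 (u t) * (L^-1 * (m2 t - m1 t ^+ 2)).
Definition phi3 t := G3 (u t) * (L^-1 * m1 t) ^+ 3 +
  3 * G2 (u t) * (L^-1 * m1 t) * (L^-1 * (m2 t - m1 t ^+ 2)) +
  G1 (u t) * (L^-1 * (m3 t - 3 * m2 t * m1 t + 2 * m1 t ^+ 3)).

Lemma der_ratio k t : der (fun t => Z k t / Z 0%N t) t
  (Z k.+1 t / Z 0%N t - Z k t / Z 0%N t * m1 t).
Proof.
have z0 := Z_gt0 t.
apply: der_eq (derM (der_mom w b k t) (derV _ (der_mom w b 0 t))) _.
  by rewrite gt_eqF.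
by rewrite /m1 /Z; field; rewrite gt_eqF.
Qed.

Lemma der_u t : der u t (L^-1 * m1 t).
Proof.
have z0 := Z_gt0 t.
apply: der_eq (derM (derB (der_comp (is_derive1_ln z0) (der_mom w b 0 t))
  (der_cst u0 t)) (der_cst L^-1 t)) _.
by rewrite /m1 /Z; field; rewrite gt_eqF//= gt_eqF// (lt_le_trans ltr01).
Qed.

Lemma der_phi0 t : der phi0 t (phi1 t).
Proof. exact: der_comp (der_G0 _) (der_u t). Qed.

Lemma der_phi1 t : der phi1 t (phi2 t).
Proof.
apply: der_eq (derM (der_comp (der_G1 _) (der_u t)) (derZ L^-1 (der_ratio 1 t))) _.
by rewrite /phi2 /m1 /m2; ring.
Qed.

Lemma der_phi2 t : der phi2 t (phi3 t).
Proof.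
apply: der_eq (derD (derM (der_comp (der_G2 _) (der_u t))
    (derM (derZ L^-1 (der_ratio 1 t)) (derZ L^-1 (der_ratio 1 t))))
  (derM (der_comp (der_G1 _) (der_u t)) (derZ L^-1 (derB (der_ratio 2 t)
   (derM (der_ratio 1 t) (der_ratio 1 t)))))) _.
by rewrite /phi3 /m1 /m2 /m3; ring.
Qed.

(** Gibbs weights at time [t]: the derivatives of $\log Z$ are the cumulants of [b] under them, and
    [A] controls the third-order ones. *)
Let p t j := w j * expR (t * b j) / Z 0%N t.
Let A t := \sum_j p t j * `|b j| ^+ 3.

Lemma p_ge0 t j : 0 <= p t j.
Proof. by rewrite divr_ge0 ?mulr_ge0 ?expR_ge0// ltW// Z_gt0. Qed.

Lemma sum_p t : \sum_j p t j = 1.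
Proof.
rewrite -mulr_suml (_ : \sum_(j < D) _ = Z 0%N t) ?divff ?gt_eqF ?Z_gt0//.
by apply: eq_bigr => j _; rewrite expr0 mulr1.
Qed.

Lemma ratioE k t : Z k t / Z 0%N t = \sum_j p t j * b j ^+ k.
Proof.
rewrite /Z {1}/mom mulr_suml; apply: eq_bigr => j _.
by rewrite /p /Z; ring.
Qed.

Lemma moments_le t : exists M1 M2, [/\ 0 <= M1, 0 <= M2,
  `|m1 t| <= M1, `|m2 t| <= M2 & `|m3 t| <= A t] /\
  [/\ M1 ^+ 2 <= M2, M1 * M2 <= A t &
  forall N : R, (forall j, `|b j| <= N) -> M1 <= N /\ M2 <= N ^+ 2].
Proof.
exists (\sum_j p t j * `|b j|), (\sum_j p t j * `|b j| ^+ 2).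
have p0 := p_ge0 t; have [h1 h2] := wmean_le p0 (fun j => normr_ge0 (b j)) (sum_p t).
have nb k : `|Z k t / Z 0%N t| <= \sum_j p t j * `|b j| ^+ k.
  rewrite ratioE; apply: le_trans (ler_norm_sum _ _ _) _; apply: ler_sum => j _.
  by rewrite normrM normrX ger0_norm.
split; split => //; try by apply: sumr_ge0 => j _; rewrite mulr_ge0 ?exprn_ge0.
- by have := nb 1%N; under eq_bigr do rewrite expr1.
- exact: nb.
- exact: nb.
- move=> N HN; have N0 : 'I_D -> 0 <= N by move=> j; exact: le_trans (normr_ge0 _) (HN j).
  have E (x : R) : x = \sum_j p t j * x by rewrite -mulr_suml sum_p mul1r.
  split; [rewrite [leRHS](E N)|rewrite [leRHS](E (N ^+ 2))];
    apply: ler_sum => j _; rewrite ler_wpM2l ?p0//.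
  by apply: lerXn2r; rewrite ?nnegrE// (N0 j).
Qed.

Lemma phi3_le t : `|phi3 t| <= 390 / L * A t.
Proof.
have [M1 [M2 [[M10 M20 h1 h2 h3] [h4 h5 _]]]] := moments_le t.
have [g1 g2 g3] := G123_le (u t).
have L0 : 0 < L by exact: lt_le_trans L1.
apply: phi3_bound h1 h2 h3 h4 h5 => //; first by rewrite invr_ge0 ltW.
by rewrite invf_le1.
Qed.

Lemma phi3_out t : ~~ (0 < u t < 1) -> phi3 t = 0.
Proof. by move=> /G123_out[g1 g2 g3]; rewrite /phi3 g1 g2 g3; ring. Qed.

(** No cancellation is sought for a large increment: the value, the first and the second order terms
    are bounded separately, by $1+3N+33N^2/2$ in total. *)
Lemma phi_rem_big (N : R) : 1 <= N -> (forall j, `|b j| <= N) ->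
  `|phi0 1 - phi0 0 - phi1 0 - phi2 0 / 2| <= 24 * N ^+ 2.
Proof.
move=> N1 HN; have [M1 [M2 [[M10 M20 h1 h2 _] [_ _ /(_ N HN)[k1 k2]]]]] := moments_le 0.
have [g1 g2 _] := G123_le (u 0).
have L0 : 0 < L by exact: lt_le_trans L1.
pose l := L^-1; have l0 : 0 <= l by rewrite invr_ge0 ltW.
have l1 : l <= 1 by rewrite invf_le1.
have N0 : 0 <= N by exact: le_trans N1.
have NN : N <= N ^+ 2 by rewrite expr2 ler_peMr.
have NN1 : 1 <= N ^+ 2 by exact: le_trans NN.
have q1 : `|l * m1 0| <= N.
  rewrite normrM (ger0_norm l0) -[leRHS]mul1r ler_pM//.
  exact: le_trans h1 k1.
have q2 : `|l * (m2 0 - m1 0 ^+ 2)| <= 2 * N ^+ 2.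
  rewrite normrM (ger0_norm l0) -[leRHS]mul1r ler_pM//.
  apply: le_trans (ler_normB _ _) _.
  have : `|m1 0 ^+ 2| <= N ^+ 2.
    by rewrite normrX ler_pXn2r ?nnegrE//; exact: le_trans h1 k1.
  by have := le_trans h2 k2; lra.
have e0 : `|phi0 1 - phi0 0| <= 1.
  have /andP[a1 a2] := G0_itv (u 1); have /andP[a3 a4] := G0_itv (u 0).
  by rewrite ler_norml /phi0; apply/andP; split; lra.
have e1 : `|phi1 0| <= 3 * N by rewrite normrM ler_pM.
have e2 : `|phi2 0| <= 27 * N ^+ 2 + 3 * (2 * N ^+ 2).
  apply: le_trans (ler_normD _ _) _; apply: lerD; rewrite normrM ler_pM//.
  by rewrite normrX ler_pXn2r ?nnegrE.
apply: le_trans (ler_normB _ _) _; rewrite normrM (ger0_norm (_ : 0 <= 2^-1))//.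
have := ler_normB (phi0 1 - phi0 0) (phi1 0).
by lra.
Qed.

(** With [|b j| <= 1] the Gibbs weights change by at most a factor $e^2$ along the segment and $\log
    Z$ by at most 1. Hence the third derivative vanishes unless the starting point lies in the
    window enlarged by 1. Keeping this indicator is what later makes the swaps a contraction. *)
Lemma phi_rem_small : (forall j, `|b j| <= 1) ->
  `|phi0 1 - phi0 0 - phi1 0 - phi2 0 / 2| <=
  390 * expR 2 / L * A 0 * (nat_of_bool (-1 < ln (Z 0%N 0) - u0 < L + 1)%R)%:R.
Proof.
move=> Hb; have L0 : 0 < L by exact: lt_le_trans L1.
have A00 : 0 <= A 0.
  by apply: sumr_ge0 => j _; rewrite mulr_ge0 ?p_ge0 ?exprn_ge0.
have eb t j : 0 <= t <= 1 -> expR (- 1) <= expR (t * b j) <= expR 1.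
  move=> /andP[t0 t1]; rewrite !ler_expR -ler_norml normrM (ger0_norm t0).
  by rewrite -[leRHS]mul1r ler_pM.
have Zb t : 0 <= t <= 1 -> expR (-1) * Z 0%N 0 <= Z 0%N t <= expR 1 * Z 0%N 0.
  move=> t01; rewrite /Z /mom !mulr_sumr; apply/andP; split; apply: ler_sum => j _;
    rewrite mul0r expR0 !expr0 !mulr1; have /andP[] := eb t j t01;
    by have := w0 j; nra.
have A0 t : 0 <= t <= 1 -> A t <= expR 2 * A 0.
  move=> t01; rewrite /A mulr_sumr; apply: ler_sum => j _.
  rewrite mulrA ler_wpM2r ?exprn_ge0// /p mul0r expR0 mulr1 mulrA.
  have /andP[zb _] := Zb t t01; have /andP[_ be] := eb t j t01.
  have z0 := Z_gt0 0; have zt := Z_gt0 t.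
  rewrite ler_pdivrMr// mulrAC ler_pdivlMr//.
  have E : expR 2 = expR 1 * expR 1 :> R by rewrite -expRD.
  have E1 : expR 1 * expR (-1) = 1 :> R by exact: expRxMexpNx_1.
  have H1 : expR (t * b j) * (expR 1 * (expR (-1) * Z 0%N 0)) <= expR 1 * (expR 1 * Z 0%N t).
    apply: ler_pM; rewrite ?expR_ge0//.
      by rewrite mulr_ge0 ?expR_ge0// mulr_ge0 ?expR_ge0// ltW.
    by rewrite ler_wpM2l ?expR_ge0.
  rewrite (mulrA (expR 1) (expR (-1))) E1 mul1r in H1.
  rewrite -mulrA [leRHS](_ : _ = w j * (expR 1 * (expR 1 * Z 0%N t))).
    by rewrite ler_wpM2l ?(ltW (w0 j)).
  by rewrite E; ring.
have uw t : 0 <= t <= 1 -> 0 < u t < 1 -> -1 < ln (Z 0%N 0) - u0 < L + 1.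
  move=> t01; rewrite /u ltr_pdivrMr// ltr_pdivlMr// mul0r mul1r => /andP[].
  have z0 := Z_gt0 0; have zt := Z_gt0 t.
  have /andP[z1 z2] := Zb t t01.
  have : ln (Z 0%N t) <= 1 + ln (Z 0%N 0).
    by rewrite -[1 in leRHS]expRK -lnM ?posrE ?expR_gt0// ler_ln ?posrE// mulr_gt0 ?expR_gt0.
  have : -1 + ln (Z 0%N 0) <= ln (Z 0%N t).
    by rewrite -[-1 in leLHS]expRK -lnM ?posrE ?expR_gt0// ler_ln ?posrE// mulr_gt0 ?expR_gt0.
  by move=> h1 h2 h3 h4; apply/andP; split; lra.
apply: (taylor3 der_phi0 der_phi1 der_phi2) => t t01.
have [ut|ut] := boolP (0 < u t < 1).
  rewrite (uw t t01 ut) mulr1; apply: le_trans (phi3_le t) _.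
  have -> : 390 * expR 2 / L * A 0 = 390 / L * (expR 2 * A 0) by ring.
  by apply: ler_wpM2l (A0 _ t01); apply: divr_ge0; [exact: ler0n|exact: ltW].
rewrite (phi3_out ut) normr0; apply: mulr_ge0; last exact: ler0n.
apply: (mulr_ge0 _ A00); apply: divr_ge0; last exact: ltW.
by apply: mulr_ge0; [exact: ler0n|exact: expR_ge0].
Qed.

End smooth_max.

(** * Lindeberg swapping on orthants *)

Lemma pr_setD {d} {T : measurableType d} {R : realType} (P : probability T R)
    (A B : set T) : measurable A -> measurable B -> B `<=` A ->
  pr P (A `\` B) = pr P A - pr P B.
Proof.
move=> mA mB BA; apply: EFin_inj; rewrite EFinB -!prE//; last exact: measurableD.
rewrite measureD ?(setIidr BA)//; apply: le_lt_trans (probability_le1 P mA) _.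
exact: ltry.
Qed.

Section sup_norm.
Context {R : realType} {D : nat}.
Implicit Types s y : D.-tuple R.

Definition supn y : R := \big[Num.max/0]_(j < D) `|tnth y j|.

Lemma supn_ge0 y : 0 <= supn y.
Proof. by rewrite /supn; elim/big_ind: _ => // a b a0 b0; rewrite le_max a0. Qed.

Lemma le_supn y j : `|tnth y j| <= supn y.
Proof. by rewrite /supn (bigD1 j)//= le_max lexx. Qed.

Lemma supn_le y (M : R) : 0 <= M -> (forall j, `|tnth y j| <= M) -> supn y <= M.
Proof.
move=> M0 H; rewrite /supn; elim/big_ind: _ => // a b aM bM.
by rewrite ge_max aM.
Qed.

(** Measures the increments too large for a Taylor expansion at inverse temperature [be]. *)
Definition cut_sq (be : R) y := if 1 < be * supn y then (be * supn y) ^+ 2 else 0.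

Lemma cut_sq_ge0 be y : 0 <= cut_sq be y.
Proof. by rewrite /cut_sq; case: ifP => // _; exact: sqr_ge0. Qed.

Lemma measurable_supn : measurable_fun setT supn.
Proof.
rewrite /supn; elim: (index_enum _) => [|j l IH].
  under eq_fun do rewrite big_nil; exact: measurable_cst.
under eq_fun do rewrite big_cons; apply: measurable_maxr => //.
by apply: measurableT_comp => //; exact: measurable_tnth.
Qed.

Definition orth (c : 'I_D -> R) : set (D.-tuple R) :=
  [set s | forall j, tnth s j <= c j].

Lemma measurable_orth c : measurable (orth c).
Proof.
apply: measurable_forall => j.
by apply: measurable_leset => //; exact: measurable_tnth.
Qed.

Lemma orth_le c c' : (forall j, c j <= c' j) -> orth c `<=` orth c'.
Proof. by move=> cc s sc j; exact: le_trans (sc j) (cc j). Qed.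

End sup_norm.

Section smooth_indicator.
Context {R : realType} {D : nat}.
Variables (c : 'I_D -> R) (be L : R).
Hypotheses (D0 : (0 < D)%N) (be0 : 0 < be) (L1 : 1 <= L) (lnD : ln (D%:R : R) <= 2 * L).
Implicit Types s y : D.-tuple R.

Let wt s j := expR (be * (tnth s j - c j)).
Let Z s := \sum_j wt s j.
Let u s := (ln (Z s) - ln D%:R) / L.
Let pw s j := wt s j / Z s.

(** Subtracting [ln D] makes the value 1 on the whole orthant, where $Z\le D$. The value is 0 once
    some coordinate exceeds its bound by more than [3 * (L / be)], since then $\log Z>3L\ge L+\log
    D$. *)
Definition msm s : R := G0 (u s).
Definition win s : bool := -1 < ln (Z s) - ln D%:R < L + 1.
Let g1 s := G1 (u s) / L.
Let g2 s := G2 (u s) / L ^+ 2 - G1 (u s) / L.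
(** For [S] the matrix $yy^T$, [be ^+ 2 * msm_quad S s] is the second derivative of [msm] at [s]
    along [y]; being linear in [S], it only sees the covariance of an increment after averaging. *)
Definition msm_quad (S : 'I_D -> 'I_D -> R) s : R :=
  g2 s * (\sum_j \sum_k pw s j * pw s k * S j k) + g1 s * \sum_j pw s j * S j j.
Let Rem s y := msm (tadd s y) - msm s - be * g1 s * (\sum_j pw s j * tnth y j)
  - be ^+ 2 / 2 * msm_quad (fun j k => tnth y j * tnth y k) s.
Let tail : D.-tuple R -> R := cut_sq be.

Let L0 : 0 < L. Proof. by apply: lt_le_trans L1. Qed.

Lemma Zs_gt0 s : 0 < Z s.
Proof.
rewrite /Z (bigD1 (Ordinal D0))//= ltr_pwDl ?expR_gt0//.
by apply: sumr_ge0 => j _; exact: expR_ge0.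
Qed.

Lemma pw_ge0 s j : 0 <= pw s j.
Proof. by rewrite divr_ge0 ?expR_ge0// ltW// Zs_gt0. Qed.

Lemma sum_pw s : \sum_j pw s j = 1.
Proof. by rewrite -mulr_suml divff// gt_eqF// Zs_gt0. Qed.

Lemma u_win s : 0 < u s < 1 -> win s.
Proof.
rewrite /u (ltr_pdivrMr _ _ L0) (ltr_pdivlMr _ _ L0) mul0r mul1r /win => /andP[h1 h2].
by apply/andP; split; lra.
Qed.

Lemma g12_le s : `|g1 s| <= 3 / L * (win s)%:R /\ `|g2 s| <= 30 / L * (win s)%:R.
Proof.
have [/u_win ->|/G123_out[h1 h2 _]] := boolP (0 < u s < 1); last first.
  have l k : 0 <= k%:R / L * (win s)%:R.
    by apply: mulr_ge0; [apply: divr_ge0; [exact: ler0n|exact: ltW L0]|exact: ler0n].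
  by rewrite /g1 /g2 h1 h2 !mul0r subr0 normr0; split; [exact: (l 3%N)|exact: (l 30%N)].
have [h1 h2 _] := G123_le (u s).
have l0 : 0 <= L^-1 by rewrite invr_ge0 ltW.
have H1 : `|g1 s| <= 3 / L by rewrite normrM (ger0_norm l0) ler_wpM2r.
rewrite !mulr1; split => //; apply: le_trans (ler_normB _ _) _.
have -> : 30 / L = 27 / L + 3 / L by rewrite -mulrDl; congr (_ / _); ring.
apply: lerD => //; rewrite normrM.
have e0 : `|(L ^+ 2)^-1| <= L^-1.
  rewrite ger0_norm ?invr_ge0 ?exprn_ge0 ?(ltW L0)//.
  by rewrite lef_pV2 ?posrE ?exprn_gt0// expr2 ler_peMl// ltW.
exact: ler_pM.
Qed.

Let momE0 s : mom (wt s) (fun j => 0) 0 0 = Z s.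
Proof. by apply: eq_bigr => j _; rewrite mul0r expR0 expr0 !mulr1. Qed.

(** The segment from [s] to [tadd s y] is the one-dimensional problem with weights [wt s] and slopes
    [be * tnth y j]; which remainder bound applies depends on whether [be * supn y] exceeds 1. *)
Lemma Rem_le s y : `|Rem s y| <=
  390 * expR 2 / L * be ^+ 3 * (win s)%:R * (\sum_j pw s j * `|tnth y j| ^+ 3)
  + 24 * tail y.
Proof.
pose b j := be * tnth y j.
have w0 j : 0 < wt s j by exact: expR_gt0.
have Zk k : mom (wt s) b k 0 = \sum_j wt s j * b j ^+ k.
  by apply: eq_bigr => j _; rewrite mul0r expR0 mulr1.
have Z0 : mom (wt s) b 0 0 = Z s.
  by rewrite Zk; apply: eq_bigr => j _; rewrite expr0 mulr1.
have Z1 : mom (wt s) b 0 1 = Z (tadd s y).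
  apply: eq_bigr => j _; rewrite expr0 mulr1 mul1r /wt -expRD tnth_tadd.
  by congr expR; rewrite /b; ring.
pose u0 := ln (D%:R : R).
have E0 : phi0 (wt s) b L u0 0 = msm s by rewrite /phi0 Z0.
have E1 : phi0 (wt s) b L u0 1 = msm (tadd s y) by rewrite /phi0 Z1.
have M1 k : mom (wt s) b k 0 / Z s = \sum_j pw s j * b j ^+ k.
  by rewrite Zk mulr_suml; apply: eq_bigr => j _; rewrite /pw mulrAC.
have P1 : \sum_j pw s j * b j ^+ 1 = be * \sum_j pw s j * tnth y j.
  by rewrite mulr_sumr; apply: eq_bigr => j _; rewrite /b; ring.
have P2 : \sum_j pw s j * b j ^+ 2 = be ^+ 2 * \sum_j pw s j * (tnth y j * tnth y j).
  by rewrite mulr_sumr; apply: eq_bigr => j _; rewrite /b; ring.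
have E2 : phi1 (wt s) b L u0 0 = be * g1 s * (\sum_j pw s j * tnth y j).
  by rewrite /phi1 Z0 M1 P1 /g1 /u /u0; ring.
have E3 : phi2 (wt s) b L u0 0 / 2 =
    be ^+ 2 / 2 * msm_quad (fun j k => tnth y j * tnth y k) s.
  rewrite /phi2 Z0 !M1 P1 P2 /msm_quad.
  have -> : \sum_j \sum_k pw s j * pw s k * (tnth y j * tnth y k) =
      (\sum_j pw s j * tnth y j) ^+ 2.
    rewrite expr2 mulr_suml; apply: eq_bigr => j _; rewrite mulr_sumr.
    by apply: eq_bigr => k _; ring.
  rewrite /g1 /g2 /u /u0; field; by rewrite gt_eqF.
have bN j : `|b j| <= be * supn y.
  by rewrite normrM gtr0_norm// ler_wpM2l ?(ltW be0)// le_supn.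
have S0 : 0 <= \sum_j pw s j * `|tnth y j| ^+ 3.
  by apply: sumr_ge0 => j _; rewrite mulr_ge0 ?pw_ge0 ?exprn_ge0.
have c0 : 0 <= 390 * expR 2 / L * be ^+ 3.
  by rewrite !mulr_ge0 ?ler0n ?expR_ge0 ?invr_ge0 ?exprn_ge0 ?(ltW L0) ?(ltW be0).
rewrite /Rem -E0 -E1 -E2 -E3 /tail /cut_sq; case: (ltP 1 (be * supn y)) => hN.
  apply: le_trans (phi_rem_big u0 w0 D0 L1 (ltW hN) bN) _.
  rewrite lerDr; apply: mulr_ge0 S0; apply: mulr_ge0 c0 _; exact: ler0n.
have b1 j : `|b j| <= 1 by exact: le_trans (bN j) hN.
apply: le_trans (phi_rem_small u0 w0 D0 L1 b1) _.
rewrite mulr0 addr0 Z0 -/(win s) le_eqVlt; apply/orP; left; apply/eqP.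
have -> : \sum_j wt s j * expR (0 * b j) / Z s * `|b j| ^+ 3 =
    be ^+ 3 * \sum_j pw s j * `|tnth y j| ^+ 3.
  rewrite mulr_sumr; apply: eq_bigr => j _.
  by rewrite mul0r expR0 mulr1 normrM exprMn (gtr0_norm be0) /pw; ring.
by ring.
Qed.

Lemma le_lnZ s j : be * (tnth s j - c j) <= ln (Z s).
Proof.
rewrite -[leLHS]expRK ler_ln ?posrE ?expR_gt0 ?Zs_gt0//.
rewrite /Z (bigD1 j)//= lerDl; apply: sumr_ge0 => i _; exact: expR_ge0.
Qed.

Lemma lnZ_le s (M : R) : (forall j, be * (tnth s j - c j) <= M) ->
  ln (Z s) <= ln D%:R + M.
Proof.
move=> H; have D0' : 0 < D%:R :> R by rewrite ltr0n.
rewrite -[M]expRK -lnM ?posrE ?expR_gt0//.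
rewrite ler_ln ?posrE ?Zs_gt0 ?mulr_gt0 ?expR_gt0//.
apply: (@le_trans _ _ (\sum_(j < D) expR M)).
  by apply: ler_sum => j _; rewrite ler_expR.
by rewrite sumr_const card_ord mulr_natl.
Qed.

Lemma msm_itv s : 0 <= msm s <= 1.
Proof. exact: G0_itv. Qed.

Lemma msm_in s : orth c s -> msm s = 1.
Proof.
move=> H; apply: G0_1; rewrite ler_pdivrMr// mul0r subr_le0.
have := @lnZ_le s 0; rewrite addr0; apply => j.
by rewrite pmulr_rle0// subr_le0; exact: H.
Qed.

Lemma msm_out s : ~ orth (fun j => c j + 3 * (L / be)) s -> msm s = 0.
Proof.
move=> /existsNP[j /negP]; rewrite -ltNge => H.
apply: G0_0; rewrite ler_pdivlMr// mul1r lerBrDl.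
apply: le_trans (le_lnZ s j).
have h : L / be * be = L by rewrite divfK// gt_eqF.
move: H; rewrite -ltrBrDl -(ltr_pM2l be0) => H.
have h' : be * (3 * (L / be)) = 3 * L by rewrite mulrCA (mulrC be) h.
rewrite h' in H; move: lnD H; set a := ln _; set b := be * _; lra.
Qed.

(* Points of the window stay near the boundary of the orthant after a small kick. *)
Lemma win_tadd s y : win s -> be * supn y <= 1 ->
  orth (fun j => c j + 5 * (L / be)) (tadd s y) /\
  ~ orth (fun j => c j - 2 * (L / be)) (tadd s y).
Proof.
move=> /andP[w1 w2] yb; have h : L / be * be = L by rewrite divfK// gt_eqF.
have by1 j : -1 <= be * tnth y j <= 1.
  rewrite -ler_norml normrM gtr0_norm//; apply: le_trans yb.
  by rewrite ler_pM2l// le_supn.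
split=> [j|H].
  rewrite tnth_tadd -(ler_pM2l be0).
  have h' : be * (5 * (L / be)) = 5 * L by rewrite mulrCA (mulrC be) h.
  have /andP[_] := by1 j; rewrite !mulrDr h'.
  have := le_lnZ s j; rewrite mulrDr mulrN => h1 h2.
  have aux (a a' b1 b2 b3 l : R) : 1 <= l -> a <= 2 * l -> a' - a < l + 1 ->
    b1 - b3 <= a' -> b2 <= 1 -> b1 + b2 <= b3 + 5 * l by move=> *; lra.
  exact: aux L1 lnD w2 h1 h2.
have h' : be * (2 * (L / be)) = 2 * L by rewrite mulrCA (mulrC be) h.
have : forall j, be * (tnth s j - c j) <= -1.
  move=> j; have := H j; rewrite tnth_tadd -(ler_pM2l be0).
  have aux (b1 b2 b3 l : R) : 1 <= l -> -1 <= b2 -> b1 + b2 <= b3 - 2 * l ->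
    b1 - b3 <= -1 by move=> *; lra.
  have /andP[h1 _] := by1 j; rewrite !mulrDr !mulrN h'; exact: aux L1 h1.
move/lnZ_le; lra.
Qed.

Lemma measurable_Z : measurable_fun setT Z.
Proof.
rewrite /Z; apply: measurable_sum => j; rewrite /wt.
apply: measurableT_comp => //; apply: measurable_funM => //.
apply: measurable_funB => //; exact: measurable_tnth.
Qed.

Lemma measurable_lnZ : measurable_fun setT (fun s => ln (Z s) - ln D%:R).
Proof. by apply: measurable_funB => //; apply: measurableT_comp => //; exact: measurable_Z. Qed.

Lemma measurable_msm : measurable_fun setT msm.
Proof.
apply: (measurableT_comp (f := G0)).
  apply: continuous_measurable_fun => x; apply: differentiable_continuous.
  by apply/derivable1_diffP; have [] := der_G0 x.
by apply: measurable_funM => //; exact: measurable_lnZ.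
Qed.

Lemma measurable_win : measurable [set s | win s].
Proof.
rewrite (_ : [set s | _] = [set s | -1 < ln (Z s) - ln D%:R] `&`
    [set s | ln (Z s) - ln D%:R < L + 1]).
  by apply: measurableI; apply: measurable_ltset => //; exact: measurable_lnZ.
by apply/seteqP; split => x /=; [move/andP|move/andP].
Qed.

Section one_step.
Context {d} {T : measurableType d} (P : probability T R) (x : T -> D.-tuple R).
Hypothesis mx : measurable_fun setT x.
Variables (ka eta : R) (S : 'I_D -> 'I_D -> R).

(** Requirements shared by the data summand and the Gaussian one. Third moments are coordinatewise,
    without a maximum inside the expectation, since the Gibbs weights average over coordinates; only
    the excess beyond [1 / be] is measured in sup norm. *)
Definition mcond := [/\ forall j, intg P (fun z => tnth (x z) j) /\
    Ex P (fun z => tnth (x z) j) = 0,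
  forall j k, intg P (fun z => tnth (x z) j * tnth (x z) k) /\
    Ex P (fun z => tnth (x z) j * tnth (x z) k) = S j k,
  forall j, intg P (fun z => `|tnth (x z) j| ^+ 3) /\
    Ex P (fun z => `|tnth (x z) j| ^+ 3) <= ka &
  intg P (cut_sq be \o x) /\ Ex P (cut_sq be \o x) <= eta].

Definition stepc : R := 390 * expR 2 / L * be ^+ 3.

Lemma stepc_ge0 : 0 <= stepc.
Proof.
apply: mulr_ge0; last by rewrite exprn_ge0// ltW.
apply: divr_ge0; last exact: ltW.
by apply: mulr_ge0; [exact: ler0n|exact: expR_ge0].
Qed.

Lemma intg_msm s : intg P (fun z => msm (tadd s (x z))).
Proof.
apply: (@intg_bounded _ _ _ _ _ 1).
  by apply: measurableT_comp; [exact: measurable_msm|exact: measurable_tadd].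
by move=> z; have /andP[a b] := msm_itv (tadd s (x z)); rewrite ger0_norm.
Qed.

Lemma one_step s : mcond ->
  `|Ex P (fun z => msm (tadd s (x z))) - msm s - be ^+ 2 / 2 * msm_quad S s| <=
  stepc * ka * (win s)%:R + 24 * eta.
Proof.
move=> [x1 x2 x3 [xt Ext]].
pose lin z := \sum_j pw s j * tnth (x z) j.
have ilin : intg P lin by apply: intg_sum => j _; apply: intgZ; exact: (x1 j).1.
have Elin : Ex P lin = 0.
  rewrite Ex_sum; last by move=> j; apply: intgZ; exact: (x1 j).1.
  by rewrite big1// => j _; rewrite ExZ ?(x1 j).2 ?mulr0//; exact: (x1 j).1.
pose q z := msm_quad (fun j k => tnth (x z) j * tnth (x z) k) s.
have i2 j k := (x2 j k).1.
have iA : intg P (fun z => \sum_j \sum_k pw s j * pw s k * (tnth (x z) j * tnth (x z) k)).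
  by do 2![apply: intg_sum => ? _]; exact: intgZ.
have iB : intg P (fun z => \sum_j pw s j * (tnth (x z) j * tnth (x z) j)).
  by apply: intg_sum => ? _; exact: intgZ.
have iq : intg P q by apply: intgD; exact: intgZ.
have Eq : Ex P q = msm_quad S s.
  rewrite /q /msm_quad ExD; [|exact: intgZ|exact: intgZ].
  rewrite (ExZ _ iA) (ExZ _ iB); congr (_ * _ + _ * _).
    rewrite Ex_sum; last by move=> j; apply: intg_sum => k _; exact: intgZ.
    apply: eq_bigr => j _; rewrite Ex_sum; last by move=> k; exact: intgZ.
    by apply: eq_bigr => k _; rewrite (ExZ _ (i2 j k)) (x2 j k).2.
  rewrite Ex_sum; last by move=> j; exact: intgZ.
  by apply: eq_bigr => k _; rewrite (ExZ _ (i2 k k)) (x2 k k).2.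
have iR : intg P (fun z => Rem s (x z)).
  apply: intgB; last exact: intgZ.
  apply: intgB; last exact: intgZ.
  apply: intgB; [exact: intg_msm|exact: intg_cst].
have -> : Ex P (fun z => msm (tadd s (x z))) - msm s - be ^+ 2 / 2 * msm_quad S s =
    Ex P (fun z => Rem s (x z)).
  have im := intg_msm s; have ic := intg_cst P (msm s).
  have il : intg P (fun z => be * g1 s * lin z) by exact: intgZ.
  have iqq : intg P (fun z => be ^+ 2 / 2 * q z) by exact: intgZ.
  rewrite /Rem ExB//; last by apply: intgB => //; exact: intgB.
  rewrite ExB//; last exact: intgB.
  by rewrite ExB// (ExZ _ ilin) Elin (ExZ _ iq) Eq Ex_cst mulr0 subr0.
apply: le_trans (Ex_abs iR) _.
have i3 : intg P (fun z => \sum_j pw s j * `|tnth (x z) j| ^+ 3).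
  by apply: intg_sum => j _; apply: intgZ; exact: (x3 j).1.
have ib : intg P (fun z => stepc * (win s)%:R * (\sum_j pw s j * `|tnth (x z) j| ^+ 3)
    + 24 * cut_sq be (x z)).
  by apply: intgD; exact: intgZ.
apply: le_trans (Ex_le (intg_abs iR) ib (fun z => Rem_le s (x z))) _.
rewrite ExD; [|exact: intgZ|exact: intgZ].
rewrite (ExZ _ i3) (ExZ _ xt); apply: lerD; last by rewrite ler_pM2l ?ltr0n.
rewrite (mulrAC stepc ka); apply: ler_wpM2l.
  by apply: mulr_ge0; [exact: stepc_ge0|exact: ler0n].
rewrite Ex_sum; last by move=> j; apply: intgZ; exact: (x3 j).1.
rewrite -[leRHS]mul1r -(sum_pw s) mulr_suml; apply: ler_sum => j _.
by rewrite (ExZ _ (x3 j).1) ler_wpM2l ?pw_ge0//; exact: (x3 j).2.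
Qed.

Lemma kick_msm l : intg (kick l P mx) msm /\
  Ex (kick l P mx) msm = Ex l (fun s => Ex P (fun z => msm (tadd s (x z)))) /\
  intg l (fun s => Ex P (fun z => msm (tadd s (x z)))).
Proof.
apply: (@kick_bounded _ _ _ _ _ _ _ _ _ 1); first exact: measurable_msm.
by move=> s; have /andP[a b] := msm_itv s; rewrite ger0_norm.
Qed.

(** [win] concerns the partial sum before the swapped summand, whereas anticoncentration concerns
    full sums. The summand is independent of it and small with probability at least 1/2, which
    carries the window over to the full sum at the price of a factor 2. *)
Lemma pr_win_kick l : mcond -> eta <= 2^-1 ->
  pr l [set s | win s] <= 2 * pr (kick l P mx)
    (orth (fun j => c j + 5 * (L / be)) `\` orth (fun j => c j - 2 * (L / be))).
Proof.
move=> [_ _ _ [xt Ext]] e2; set W := [set s | win s]; set V := _ `\` _.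
have mW : measurable W by exact: measurable_win.
have mV : measurable V by apply: measurableD; exact: measurable_orth.
pose G := [set z | be * supn (x z) <= 1].
have msx : measurable_fun setT (fun z => be * supn (x z)).
  apply: measurable_funM => //; apply: measurableT_comp => //; exact: measurable_supn.
have mG : measurable G by apply: measurable_leset.
have pG : 2^-1 <= pr P G.
  have -> : G = ~` [set z | 1 < be * supn (x z)].
    by apply/seteqP; split => z /=; rewrite /G/= leNgt => /negP.
  have mC : measurable [set z | 1 < be * supn (x z)] by apply: measurable_ltset.
  rewrite pr_setC//.
  have : pr P [set z | 1 < be * supn (x z)] <= eta.
    apply: le_trans Ext; rewrite -Ex_indic//; apply: Ex_le => //; first exact: intg_indic.
    move=> z; rewrite indicE /= /cut_sq; case: ifP => h.
      rewrite mem_set//=; apply: exprn_ege1; exact: ltW.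
    by rewrite memNset//= h.
  by lra.
have H : pr l W * pr P G <= pr (kick l P mx) V.
  rewrite -lee_fin EFinM -!prE//.
  have mVk : measurable ((fun z => tadd z.1 (x z.2)) @^-1` V).
    by rewrite -[X in measurable X]setTI; exact: measurable_kick.
  rewrite kickE -(product_measure1E l P mW mG); apply: le_measure; rewrite ?inE//.
    exact: measurableX.
  move=> [s z] /= [Ws Gz]; have [h1 h2] := win_tadd Ws Gz.
  by split.
have : pr l W * 2^-1 <= pr l W * pr P G by apply: ler_wpM2l => //; exact: pr_ge0.
by lra.
Qed.

End one_step.

Section two_laws.
Context {d1 d2} {T1 : measurableType d1} {T2 : measurableType d2}.
Variables (P : probability T1 R) (Q : probability T2 R).
Variables (x : T1 -> D.-tuple R) (y : T2 -> D.-tuple R).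
Hypotheses (mx : measurable_fun setT x) (my : measurable_fun setT y).
Variables (ka eta de : R) (S1 S2 : 'I_D -> 'I_D -> R).
Hypotheses (cx : mcond P x ka eta S1) (cy : mcond Q y ka eta S2).
Hypothesis S12 : forall j k, `|S1 j k - S2 j k| <= de.

(** Two third-order remainders plus the covariance mismatch; 33 is 30 + 3, the constants of [g12_le]
    for [g2] and [g1]. *)
Definition swapc : R := 2 * stepc * ka + be ^+ 2 / 2 * (33 / L * de).

Lemma msm_quad_diff s :
  `|msm_quad S1 s - msm_quad S2 s| <= 33 / L * de * (win s)%:R.
Proof.
have [h1 h2] := g12_le s.
have d0 : 0 <= de by apply: le_trans (normr_ge0 _) (S12 (Ordinal D0) (Ordinal D0)).
have -> : msm_quad S1 s - msm_quad S2 s =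
    g2 s * (\sum_j \sum_k pw s j * pw s k * (S1 j k - S2 j k)) +
    g1 s * \sum_j pw s j * (S1 j j - S2 j j).
  rewrite /msm_quad.
  have -> : \sum_j \sum_k pw s j * pw s k * (S1 j k - S2 j k) =
      \sum_j \sum_k pw s j * pw s k * S1 j k - \sum_j \sum_k pw s j * pw s k * S2 j k.
    rewrite -sumrB; apply: eq_bigr => j _; rewrite -sumrB; apply: eq_bigr => k _; ring.
  have -> : \sum_j pw s j * (S1 j j - S2 j j) =
      \sum_j pw s j * S1 j j - \sum_j pw s j * S2 j j.
    by rewrite -sumrB; apply: eq_bigr => j _; ring.
  by ring.
have k2 : `|\sum_j \sum_k pw s j * pw s k * (S1 j k - S2 j k)| <= de.
  apply: le_trans (ler_norm_sum _ _ _) _.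
  rewrite -[leRHS]mul1r -(sum_pw s) mulr_suml; apply: ler_sum => j _.
  apply: le_trans (ler_norm_sum _ _ _) _.
  rewrite -[leRHS]mul1r -(sum_pw s) mulr_suml; apply: ler_sum => k _.
  rewrite (normrM (_ * _)) (ger0_norm (mulr_ge0 (pw_ge0 s j) (pw_ge0 s k))).
  rewrite (mulrC (pw s j) (pw s k)) -mulrA; apply: ler_wpM2l; first exact: pw_ge0.
  by apply: ler_wpM2l; first exact: pw_ge0.
have k1 : `|\sum_j pw s j * (S1 j j - S2 j j)| <= de.
  apply: le_trans (ler_norm_sum _ _ _) _.
  rewrite -[leRHS]mul1r -(sum_pw s) mulr_suml; apply: ler_sum => j _.
  rewrite (normrM (pw s j)) (ger0_norm (pw_ge0 s j)).
  by apply: ler_wpM2l; first exact: pw_ge0.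
apply: le_trans (ler_normD _ _) _; rewrite !(normrM _ (\sum_j _)).
have := ler_pM (normr_ge0 _) (normr_ge0 _) h2 k2.
have := ler_pM (normr_ge0 _) (normr_ge0 _) h1 k1.
move=> a1 a2; apply: le_trans (lerD a2 a1) _.
by rewrite le_eqVlt; apply/orP; left; apply/eqP; ring.
Qed.

Lemma swap_step l :
  `|Ex (kick l P mx) msm - Ex (kick l Q my) msm| <=
  swapc * pr l [set s | win s] + 48 * eta.
Proof.
have [_ [-> ix]] := kick_msm P mx l.
have [_ [-> iy]] := kick_msm Q my l.
have iw : intg l (fun s => swapc * (win s)%:R + 48 * eta).
  apply: intgD; last exact: intg_cst.
  apply: intgZ; have := intg_indic l measurable_win; apply: intg_ext => s.
  by rewrite indicE; case: (boolP (win s)) => h; [rewrite mem_set|rewrite memNset//=; exact/negP].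
rewrite -ExB//; apply: le_trans (Ex_abs (intgB ix iy)) _.
apply: (@le_trans _ _ (Ex l (fun s => swapc * (win s)%:R + 48 * eta))).
  apply: Ex_le => //; first exact/intg_abs/intgB.
  move=> s; have h1 := one_step mx s cx; have h2 := one_step my s cy.
  have h3 := msm_quad_diff s.
  have b0 : 0 <= be ^+ 2 / 2 by rewrite divr_ge0// exprn_ge0// ltW.
  have h4 : `|be ^+ 2 / 2 * (msm_quad S1 s - msm_quad S2 s)| <=
      be ^+ 2 / 2 * (33 / L * de * (win s)%:R).
    by rewrite normrM (ger0_norm b0) ler_wpM2l.
  set A := Ex P _ in h1 *; set B := Ex Q _ in h2 *.
  have -> : A - B = (A - msm s - be ^+ 2 / 2 * msm_quad S1 s)
     - (B - msm s - be ^+ 2 / 2 * msm_quad S2 s)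
     + be ^+ 2 / 2 * (msm_quad S1 s - msm_quad S2 s) by ring.
  apply: le_trans (ler_normD _ _) _.
  apply: le_trans (lerD (le_trans (ler_normB _ _) (lerD h1 h2)) h4) _.
  by rewrite le_eqVlt; apply/orP; left; apply/eqP; rewrite /swapc; ring.
rewrite le_eqVlt; apply/orP; left; apply/eqP.
have iw' : intg l (fun s => (win s)%:R : R).
  have := intg_indic l measurable_win; apply: intg_ext => s.
  by rewrite indicE; case: (boolP (win s)) => h; [rewrite mem_set|rewrite memNset//=; exact/negP].
rewrite ExD; [|exact: intgZ|exact: intg_cst].
rewrite Ex_cst (ExZ _ iw') -Ex_indic; last exact: measurable_win.
congr (_ * _ + _); apply: Ex_ext => s.
by rewrite indicE; case: (boolP (win s)) => h; [rewrite mem_set|rewrite memNset//=; exact/negP].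
Qed.

Lemma swapc_ge0 : 0 <= ka -> 0 <= swapc.
Proof.
move=> k0.
have d0 : 0 <= de by apply: le_trans (normr_ge0 _) (S12 (Ordinal D0) (Ordinal D0)).
apply: addr_ge0.
  by apply: mulr_ge0 k0; apply: mulr_ge0; [exact: ler0n|exact: stepc_ge0].
apply: mulr_ge0; first by rewrite divr_ge0// exprn_ge0// ltW.
apply: mulr_ge0 d0; apply: divr_ge0; [exact: ler0n|exact: ltW].
Qed.

End two_laws.

End smooth_indicator.

(** * From one swap to all of them *)

Section lindeberg.
Context {R : realType} {D : nat} {d1 d2 : measure_display}.
Context {T1 : measurableType d1} {T2 : measurableType d2}.
Variables (P : probability T1 R) (Q : probability T2 R).
Variables (x : T1 -> D.-tuple R) (y : T2 -> D.-tuple R).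
Hypotheses (mx : measurable_fun setT x) (my : measurable_fun setT y).
Variables (be L ka eta de al : R) (S1 S2 : 'I_D -> 'I_D -> R).
Hypotheses (D0 : (0 < D)%N) (be0 : 0 < be) (L1 : 1 <= L) (lnD : ln (D%:R : R) <= 2 * L).
Hypotheses (cx : mcond be P x ka eta S1) (cy : mcond be Q y ka eta S2).
Hypothesis S12 : forall j k, `|S1 j k - S2 j k| <= de.
Variables (l0 : probability (D.-tuple R) R) (n : nat).

Definition hyb i m := iter i (fun l => kick l P mx) (iter m (fun l => kick l Q my) l0).

Let shift (c : 'I_D -> R) (r : R) := fun j => c j + r * (L / be).

(** The window of a swap reaches from 2 widths inside the orthant to 5 widths outside it, hence the
    shift by 7. *)
Hypothesis anti : forall c,
  pr (hyb 0 n) (orth (shift c 7)) - pr (hyb 0 n) (orth c) <= al.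

(** [kickC] carries one Gaussian summand past the [i] data summands, so that each swap takes place
    in the outermost position. *)
Lemma hyb_swap i m : meq (hyb i m.+1) (kick (hyb i m) Q my).
Proof.
elim: i => [|i IH]; first exact: meq_refl.
apply: meq_trans (meq_kick P mx IH) _; exact: kickC.
Qed.

Let K := swapc be L ka de.
Let f c i m := Ex (hyb i m) (msm c be L).

Let L0 : 0 < L. Proof. by apply: lt_le_trans L1. Qed.
Let e0 : 0 < L / be. Proof. exact: divr_gt0. Qed.

Lemma orth_shift c (r r' : R) : r <= r' ->
  orth (shift c r) `<=` (orth (shift c r') : set (D.-tuple R)).
Proof. by move=> rr; apply: orth_le => j; rewrite /shift lerD2l ler_pM2r. Qed.

Lemma msm_sandwich (l : probability (D.-tuple R) R) c :
  pr l (orth c) <= Ex l (msm c be L) /\ Ex l (msm c be L) <= pr l (orth (shift c 3)).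
Proof.
have mo c' := @measurable_orth R D c'.
have im : intg l (msm c be L).
  apply: (@intg_bounded _ _ _ _ _ 1); first exact: measurable_msm.
  by move=> s; have /andP[a b] := msm_itv c be L s; rewrite ger0_norm.
rewrite -!Ex_indic//; split; apply: Ex_le => //; try exact: intg_indic.
  move=> s; rewrite indicE; case: (boolP (s \in _)) => [|_] /=.
    by rewrite inE => sc; rewrite (msm_in D0 be0 L1).
  by have /andP[] := msm_itv c be L s.
move=> s; rewrite indicE; case: (boolP (s \in _)) => [_|] /=.
  by have /andP[] := msm_itv c be L s.
by rewrite notin_setE => sc; rewrite (msm_out D0 be0 L1 lnD).
Qed.

Section fixed_r.
Variable r : R.
Hypotheses (K0 : 0 <= K) (e2 : eta <= 2^-1).
Hypothesis Hr : forall i c, (i <= n)%N ->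
  `|pr (hyb i (n - i)) (orth c) - pr (hyb 0 n) (orth c)| <= r.

(** The window is a difference of two orthants. Under the hybrid law its probability exceeds the
    Gaussian one, at most [al], by at most twice the distance bound [r]. *)
Lemma f_step c i : (i < n)%N ->
  `|f c i.+1 (n - i.+1) - f c i (n - i)| <= K * (2 * (2 * r + al)) + 48 * eta.
Proof.
move=> i_n; set m := (n - i.+1)%N; have -> : (n - i = m.+1)%N by rewrite -subSn.
rewrite /f (meq_Ex _ (hyb_swap i m)).
apply: le_trans (swap_step c D0 be0 L1 mx my cx cy S12 (hyb i m)) _.
rewrite lerD2r; apply: ler_wpM2l => //.
apply: le_trans (pr_win_kick c D0 be0 L1 lnD mx (hyb i m) cx e2) _.
rewrite ler_pM2l//.
set A := orth _; set B := orth _.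
have mA : measurable A by exact: measurable_orth.
have mB : measurable B by exact: measurable_orth.
have BA : B `<=` A by apply: orth_le => j; rewrite lerD2l; move: e0; lra.
set l := kick _ _ _.
rewrite pr_setD//.
have h1 := Hr (fun j => c j + 5 * (L / be)) i_n.
have h2 := Hr (fun j => c j - 2 * (L / be)) i_n.
have h3 := anti (fun j => c j - 2 * (L / be)).
have -> : 2 * r + al = r + al + r by ring.
have E : shift (fun j => c j - 2 * (L / be)) 7 = fun j => c j + 5 * (L / be).
  by apply/funext => j; rewrite /shift; ring.
rewrite {}E in h3; have [_ {}h1] := ler_normlP _ _ h1; have [{}h2 _] := ler_normlP _ _ h2.
move: h1 h2 h3; rewrite -/m -/A -/B -/l.
set p1 := pr l A; set p2 := pr l B; set p3 := pr _ A; set p4 := pr _ B; lra.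
Qed.

Lemma f_dist c i : (i <= n)%N ->
  `|f c i (n - i) - f c 0 n| <= i%:R * (K * (2 * (2 * r + al)) + 48 * eta).
Proof.
elim: i => [|i IH] i_n; first by rewrite subn0 subrr normr0 mul0r.
have := IH (ltnW i_n); have := f_step c i_n.
rewrite -[i.+1%:R]natr1 (mulrDl i%:R) mul1r => a1 a2.
rewrite (_ : _ - f c 0 n = (f c i.+1 (n - i.+1) - f c i (n - i)) + (f c i (n - i) - f c 0 n));
  last by rewrite addrA subrK.
by apply: le_trans (ler_normD _ _) _; rewrite addrC lerD.
Qed.

(** The swaps cost at most $r/2+al/4$ besides the tails, and passing between orthants and their
    smoothed indicators costs one more [al]. The point is the factor 1/2 in front of [r]. *)
Lemma improve : n%:R * K <= 8^-1 -> 0 <= al -> 0 <= r -> 0 <= eta -> forall i c, (i <= n)%N ->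
  `|pr (hyb i (n - i)) (orth c) - pr (hyb 0 n) (orth c)|
    <= 2^-1 * r + (5 / 4 * al + 48 * (n%:R * eta)).
Proof.
move=> nK al0 r0 eta0 i c i_n.
set E := 2^-1 * r + al / 4 + 48 * (n%:R * eta).
have hE c' : `|f c' i (n - i) - f c' 0 n| <= E.
  apply: le_trans (f_dist c' i_n) _.
  apply: (@le_trans _ _ (n%:R * (K * (2 * (2 * r + al)) + 48 * eta))).
    apply: ler_wpM2r; last by rewrite ler_nat.
    apply: addr_ge0; last by apply: mulr_ge0 => //; exact: ler0n.
    by apply: mulr_ge0 => //; lra.
  have : n%:R * K * (2 * (2 * r + al)) <= 8^-1 * (2 * (2 * r + al)).
    by apply: ler_wpM2r => //; lra.
  by rewrite /E; lra.
have mo c' := @measurable_orth R D c'.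
have s0 c' : (shift c' 0) = c' by apply/funext => j; rewrite /shift mul0r addr0.
have an c' : pr (hyb 0 n) (orth (shift c' 3)) - pr (hyb 0 n) (orth c') <= al.
  apply: le_trans (anti c'); rewrite lerD2r; apply: pr_le => //.
  by apply: orth_shift; rewrite ler_nat.
have [a1 a2] := msm_sandwich (hyb i (n - i)) c.
have [a3 a4] := msm_sandwich (hyb 0 n) c.
pose c' := shift c (-3).
have c'E : shift c' 3 = c by apply/funext => j; rewrite /c' /shift; ring.
have [b1 b2] := msm_sandwich (hyb i (n - i)) c'.
have [b3 b4] := msm_sandwich (hyb 0 n) c'.
have x1 := an c; have x2 := an c'; rewrite c'E in x2 b2 b4.
have [y1 y2] := ler_normlP _ _ (hE c'); have [y3 y4] := ler_normlP _ _ (hE c).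
move: a1 a2 a3 a4 b1 b2 b3 b4 x1 x2 y1 y2 y3 y4; rewrite /f /E.
set p1 := pr _ _; set p2 := Ex _ _; set p3 := pr _ _; set p4 := pr _ _.
set p5 := Ex _ _; set p6 := pr _ _; set p7 := pr _ _; set p8 := Ex _ _.
set p9 := pr _ _; set p10 := Ex _ _.
by move=> *; apply/ler_normlP; split; lra.
Qed.

End fixed_r.

(* Each swap costs at most [K] times the probability of a window around the
   boundary of an orthant, which exceeds the Gaussian one, at most [al], by twice
   the current bound on the distance. As [n K <= 1/8] this is a contraction, which
   is iterated from the trivial bound 1. *)
Theorem lindeberg : 0 <= ka -> 0 <= eta <= 2^-1 -> n%:R * K <= 8^-1 -> 0 <= al ->
  forall c, `|pr (hyb n 0) (orth c) - pr (hyb 0 n) (orth c)| <=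
    5 / 2 * al + 96 * (n%:R * eta).
Proof.
move=> ka0 /andP[eta0 e2] nK al0 c.
have K0 : 0 <= K by exact: (swapc_ge0 D0 be0 L1 S12 ka0).
(* [M] is the fixed point of the recursion in [improve], so the bound $M+2^{-k}$ passes from [k] to
   [k + 1]. *)
set M := 5 / 2 * al + _.
have M0 : 0 <= M.
  by apply: addr_ge0; [apply: mulr_ge0 => //; exact: divr_ge0|rewrite !mulr_ge0// ler0n].
have H k : forall i c, (i <= n)%N ->
    `|pr (hyb i (n - i)) (orth c) - pr (hyb 0 n) (orth c)| <= M + 2^-1 ^+ k.
  elim: k => [|k IH] i c' i_n.
    apply: (@le_trans _ _ 1); last by rewrite expr0 lerDr.
    have q1 := pr_ge0 (hyb 0 n) (orth c'); have q2 := pr_ge0 (hyb i (n - i)) (orth c').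
    have q3 := pr_le1 (hyb 0 n) (measurable_orth c').
    have q4 := pr_le1 (hyb i (n - i)) (measurable_orth c').
    by rewrite ler_norml; apply/andP; split; lra.
  have r0 : 0 <= M + 2^-1 ^+ k by rewrite addr_ge0// exprn_ge0.
  apply: le_trans (improve K0 e2 IH nK al0 r0 eta0 c' i_n) _.
  by rewrite exprS /M; move: (2^-1 ^+ k) => t; lra.
apply/ler_addgt0Pr => e e_gt0.
have /cvgrPdist_lt/(_ _ e_gt0)[k _ /(_ k (leqnn k))] : 2^-1 ^+ k @[k --> \oo] --> (0 : R).
  by apply: cvg_expr; rewrite ger0_norm ?invf_lt1 ?ltr1n.
rewrite sub0r normrN ger0_norm ?exprn_ge0// => hk.
have := H k n c (leqnn n); rewrite subnn => /le_trans; apply.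
by rewrite lerD2l ltW.
Qed.

End lindeberg.

(** * A smooth maximal inequality *)

(* The smoothed square of the sup norm [(dl + \sum_j s_j^(2M))^(1/M)] satisfies
   [Phi (s + y) <= Phi s + (linear in y) + 16 M |y|^2] when [D <= 2^(M-1)], so
   that centred increments add up as in a Hilbert space, up to the factor [16 M]. *)
Section smooth_square.
Context {R : realType} {D : nat}.
Variables (m : nat) (dl : R).
Local Notation M := m.+1.
Hypotheses (dl0 : 0 < dl) (DM : (D <= 2 ^ m)%N).
Implicit Types s y : D.-tuple R.

(** The addend [dl] keeps the argument of the logarithm positive, hence the function smooth at the
    origin; it is sent to 0 in [pnsq_limit]. *)
Definition pnsq s : R := expR (ln (dl + \sum_j tnth s j ^+ (2 * M)) / M%:R).

Section line.
Variables s y : D.-tuple R.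
Let a j t := tnth s j + t * tnth y j.
Let N0 t := dl + \sum_j a j t ^+ (2 * M).
Let N1 t := \sum_j (2 * M)%:R * a j t ^+ (2 * M).-1 * tnth y j.
Let N2 t := \sum_j (2 * M)%:R * ((2 * M).-1%:R * a j t ^+ (2 * M).-2 * tnth y j) * tnth y j.
Let F0 t := expR (ln (N0 t) / M%:R).
Let F1 t := F0 t * (N1 t / N0 t / M%:R).
Let F2 t := F0 t * ((N1 t / N0 t / M%:R) ^+ 2 + (N2 t / N0 t - (N1 t / N0 t) ^+ 2) / M%:R).

Let a_ge0 j t : 0 <= a j t ^+ (2 * M).
Proof. by rewrite exprM exprn_ge0// sqr_ge0. Qed.

Let N0_gt0 t : 0 < N0 t.
Proof. by rewrite ltr_pwDl// sumr_ge0. Qed.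

Let der_a j t : der (a j) t (tnth y j).
Proof.
apply: der_eq (derD (der_cst _ _) (derM (der_id t) (der_cst (tnth y j) t))) _.
by rewrite mulr0 mulr1 !add0r.
Qed.

Let der_N0 t : der N0 t (N1 t).
Proof.
apply: der_eq (derD (der_cst _ _) (der_sum (fun j => der_comp (derX (2 * M) (a j t)) (der_a j t)))) _.
by rewrite add0r.
Qed.

Let der_N1 t : der N1 t (N2 t).
Proof.
apply: der_eq (der_sum (fun j => derM (derZ (2 * M)%:R
  (der_comp (derX (2 * M).-1 (a j t)) (der_a j t))) (der_cst (tnth y j) t))) _.
by apply: eq_bigr => j _; rewrite mulr0 add0r mulrC.
Qed.

Let der_F0 t : der F0 t (F1 t).
Proof.
apply: der_eq (der_comp (is_derive_expR _) (derM (der_comp (is_derive1_ln (N0_gt0 t)) (der_N0 t))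
  (der_cst M%:R^-1 t))) _.
by rewrite /F1 mulr0 add0r; congr (_ * _); rewrite mulrC (mulrC _^-1).
Qed.

Let der_F1 t : der F1 t (F2 t).
Proof.
have n0 : N0 t != 0 by rewrite gt_eqF.
apply: der_eq (derM (der_F0 t) (derM (derM (der_N1 t) (derV n0 (der_N0 t))) (der_cst M%:R^-1 t))) _.
have : (M%:R : R) != 0 by rewrite pnatr_eq0.
rewrite /F1 /F2; move: (F0 t) (N1 t) (N2 t) (N0 t) n0 (M%:R : R) => f n1 n2 n n0 k k0.
by field; rewrite n0 k0.
Qed.

Let F0_gt0 t : 0 < F0 t. Proof. exact: expR_gt0. Qed.

Let F0X t : F0 t ^+ M = N0 t.
Proof.
rewrite -expRM_natl /F0 mulrC divfK ?pnatr_eq0// lnK// posrE; exact: N0_gt0.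
Qed.

(** Young's inequality at scale $\lambda=F_0/2$: $b^m\le b^{m+1}/\lambda+\lambda^m$ for each
    coordinate. The $D$ copies of $\lambda^m$ are absorbed because $D\le2^m$. *)
Let youngs t : \sum_j (a j t ^+ 2) ^+ m <= 4 * (N0 t / F0 t).
Proof.
pose la := F0 t / 2; have la0 : 0 < la by rewrite divr_gt0.
have FE : N0 t / F0 t = F0 t ^+ m by rewrite -F0X exprS mulrAC divff ?mul1r ?gt_eqF.
have young j : (a j t ^+ 2) ^+ m <= (a j t) ^+ (2 * M) / la + la ^+ m.
  rewrite exprM; move: (a j t ^+ 2) (sqr_ge0 (a j t)) => b b0; rewrite (exprS b).
  have [lb|/ltW bl] := leP la b.
    apply: (@le_trans _ _ (b * b ^+ m / la)).
      by rewrite ler_pdivlMr// mulrC ler_wpM2r// exprn_ge0.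
    by rewrite lerDl exprn_ge0// ltW.
  apply: (@le_trans _ _ (la ^+ m)); first by apply: lerXn2r; rewrite ?nnegrE// ltW.
  by rewrite lerDr divr_ge0 ?(ltW la0)// mulr_ge0// exprn_ge0.
apply: le_trans (ler_sum _ (fun j _ => young j)) _.
rewrite big_split/= -mulr_suml sumr_const card_ord -[X in _ + X <= _]mulr_natl.
have h1 : (\sum_j a j t ^+ (2 * M)) / la <= 2 * (N0 t / F0 t).
  apply: (@le_trans _ _ (N0 t / la)).
    by rewrite ler_wpM2r ?invr_ge0 ?(ltW la0)// lerDr ltW.
  by rewrite /la invf_div mulrCA.
have h2 : D%:R * la ^+ m <= N0 t / F0 t.
  rewrite FE /la exprMn mulrCA ler_piMr ?exprn_ge0 ?(ltW (F0_gt0 t))//.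
  by rewrite exprVn ler_pdivrMr ?exprn_gt0// mul1r -natrX ler_nat.
have h3 : 0 <= N0 t / F0 t by rewrite FE exprn_ge0// ltW.
by apply: le_trans (lerD h1 h2) _; move: (N0 t / F0 t) h3 => r; lra.
Qed.

(** The terms in [N1] have a nonpositive total, because $1/M^2\le1/M$, and are dropped; the constant
    16 M is $(2M)^2\cdot4/M$. *)
Let F2_le t : F2 t <= 16 * M%:R * supn y ^+ 2.
Proof.
have k1 : 1 <= M%:R :> R by rewrite ler1n.
have k0 : 0 < M%:R :> R by rewrite ltr0n.
have S0 := supn_ge0 y.
have step1 : F2 t <= F0 t * (N2 t / N0 t / M%:R).
  rewrite ler_pM2l//; set r := N1 t / N0 t.
  suff : (r / M%:R) ^+ 2 <= r ^+ 2 / M%:R by rewrite mulrBl addrCA gerDl subr_le0.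
  rewrite exprMn ler_wpM2l ?sqr_ge0// expr2 ler_piMr ?invr_ge0 ?ler0n//.
  by rewrite invf_le1.
apply: le_trans step1 _.
have N2le : N2 t <= (2 * M)%:R * (2 * M)%:R * supn y ^+ 2 * (4 * (N0 t / F0 t)).
  apply: (@le_trans _ _ ((2 * M)%:R * (2 * M)%:R * supn y ^+ 2 * \sum_j (a j t ^+ 2) ^+ m)); last first.
    by apply: ler_wpM2l (youngs t); rewrite !mulr_ge0 ?ler0n ?exprn_ge0.
  rewrite mulr_sumr; apply: ler_sum => j _.
  have -> : ((2 * M).-2 = 2 * m)%N by rewrite mulnS.
  rewrite exprM; set b := (a j t ^+ 2) ^+ m.
  have b0 : 0 <= b by rewrite exprn_ge0// sqr_ge0.
  have yj : tnth y j ^+ 2 <= supn y ^+ 2.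
    by rewrite -(real_normK (num_real _)); apply: lerXn2r; rewrite ?nnegrE ?le_supn.
  have -> : (2 * M)%:R * ((2 * M).-1%:R * b * tnth y j) * tnth y j =
     (2 * M)%:R * (2 * M).-1%:R * tnth y j ^+ 2 * b by ring.
  apply: (ler_wpM2r b0); apply: ler_pM yj; last 1 first.
  - by apply: ler_wpM2l; rewrite ?ler0n// ler_nat leq_pred.
  - by apply: mulr_ge0; exact: ler0n.
  - exact: sqr_ge0.
have f0 := F0_gt0 t; have n0 := N0_gt0 t.
apply: (@le_trans _ _ (F0 t * ((2 * M)%:R * (2 * M)%:R * supn y ^+ 2 * (4 * (N0 t / F0 t)) / N0 t / M%:R))).
  rewrite ler_pM2l// !ler_pM2r ?invr_gt0//.
rewrite le_eqVlt; apply/orP; left; apply/eqP; rewrite natrM.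
move: (M%:R : R) k0 (F0 t) f0 (N0 t) n0 => k k0 f f0 n n0.
by field; rewrite !gt_eqF.
Qed.

Lemma pnsq_line : pnsq (tadd s y) <=
  pnsq s + F1 0 + 16 * M%:R * supn y ^+ 2.
Proof.
have n0E : N0 0 = dl + \sum_j tnth s j ^+ (2 * M).
  by rewrite /N0; congr (_ + _); apply: eq_bigr => j _; rewrite /a mul0r addr0.
have n1E : N0 1 = dl + \sum_j tnth (tadd s y) j ^+ (2 * M).
  by rewrite /N0; congr (_ + _); apply: eq_bigr => j _; rewrite /a mul1r tnth_tadd.
have E0 : F0 0 = pnsq s by rewrite /F0 n0E.
have E1 : F0 1 = pnsq (tadd s y) by rewrite /F0 n1E.
have C0 : 0 <= 16 * M%:R * supn y ^+ 2 by rewrite !mulr_ge0 ?ler0n ?supn_ge0.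
rewrite -E0 -E1.
have [|c /[!in_itv]/= /andP[c0 c1] h1] := MVT (@ltr01 R) (fun x _ => der_F0 x).
  by apply: derivable_within_continuous => x _; have [] := der_F0 x.
have [|e _ h2] := MVT c0 (fun x _ => der_F1 x).
  by apply: derivable_within_continuous => x _; have [] := der_F1 x.
rewrite subr0 mulr1 in h1; rewrite subr0 in h2.
have h3 : F2 e * c <= 16 * M%:R * supn y ^+ 2.
  apply: le_trans (_ : 16 * M%:R * supn y ^+ 2 * c <= _).
    by rewrite ler_wpM2r ?F2_le// ltW.
  by rewrite ler_piMr// ltW.
by move: h1 h2 h3; lra.
Qed.

Lemma F1E : F1 0 = \sum_j (pnsq s * (2 * tnth s j ^+ (2 * M).-1 /
  (dl + \sum_i tnth s i ^+ (2 * M)))) * tnth y j.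
Proof.
have k0 : (M%:R : R) != 0 by rewrite pnatr_eq0.
have E0 : N0 0 = dl + \sum_i tnth s i ^+ (2 * M).
  by rewrite /N0; congr (_ + _); apply: eq_bigr => j _; rewrite /a mul0r addr0.
have n0 := N0_gt0 0.
rewrite /F1 /F0 E0 -/(pnsq s) /N1 !mulr_suml mulr_sumr; apply: eq_bigr => j _.
rewrite -{}E0 /a mul0r addr0 natrM; move: (N0 0) n0 (M%:R : R) k0 => n n0 k k0.
by field; rewrite k0 gt_eqF.
Qed.

Lemma pnsq_tadd : pnsq (tadd s y) <= pnsq s +
  \sum_j (pnsq s * (2 * tnth s j ^+ (2 * M).-1 /
     (dl + \sum_i tnth s i ^+ (2 * M)))) * tnth y j + 16 * M%:R * supn y ^+ 2.
Proof. by rewrite -F1E; exact: pnsq_line. Qed.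

End line.

Lemma pnsq_ge0 s : 0 <= pnsq s. Proof. exact: expR_ge0. Qed.

Lemma supn_le_pnsq s : supn s ^+ 2 <= pnsq s.
Proof.
have S0 : 0 <= \sum_j tnth s j ^+ (2 * M).
  by apply: sumr_ge0 => j _; rewrite exprM exprn_ge0// sqr_ge0.
have N0 : 0 < dl + \sum_j tnth s j ^+ (2 * M) by rewrite ltr_pwDl.
suff H : supn s <= Num.sqrt (pnsq s).
  rewrite -[leRHS](@sqr_sqrtr _ (pnsq s))//; last exact: pnsq_ge0.
  by apply: lerXn2r; rewrite ?nnegrE ?supn_ge0 ?sqrtr_ge0.
apply: supn_le => [|j]; first exact: sqrtr_ge0.
rewrite -sqrtr_sqr ler_sqrt ?pnsq_ge0//.
rewrite -(@ler_pXn2r _ M) ?nnegrE ?pnsq_ge0 ?sqr_ge0//.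
rewrite -exprM -expRM_natl mulrC divfK ?pnatr_eq0// lnK//.
rewrite (bigD1 j)//=; apply: ler_wpDl; first exact: ltW.
rewrite lerDl; apply: sumr_ge0 => i _; by rewrite exprM exprn_ge0// sqr_ge0.
Qed.

Lemma measurable_pnsq : measurable_fun setT pnsq.
Proof.
apply: measurableT_comp => //; apply: measurable_funM => //.
apply: measurableT_comp => //; apply: measurable_funD => //.
by apply: measurable_sum => j; apply: measurable_funX; exact: measurable_tnth.
Qed.

(** Stated in extended reals: an infinite second moment makes the bound vacuous, so no hypothesis on
    second moments has to be carried through the inductions. *)
Lemma pnsq_integral {d} {T : measurableType d} (P : probability T R)
    (y : T -> D.-tuple R) (my : measurable_fun setT y) s :
  (forall j, intg P (fun z => tnth (y z) j) /\ Ex P (fun z => tnth (y z) j) = 0) ->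
  (\int[P]_z (pnsq (tadd s (y z)))%:E <=
   (pnsq s)%:E + (16 * M%:R)%:E * \int[P]_z (supn (y z) ^+ 2)%:E)%E.
Proof.
move=> y0; have c0 : 0 < 16 * M%:R :> R by rewrite mulr_gt0 ?ltr0n.
have mS : measurable_fun setT (fun z => supn (y z) ^+ 2).
  by apply: measurable_funX; apply: measurableT_comp => //; exact: measurable_supn.
have [fin|] := ltP (\int[P]_z (supn (y z) ^+ 2)%:E)%E +oo%E; last first.
  by rewrite leye_eq => /eqP ->; rewrite gt0_muley ?lte_fin// addey// leey.
have iS : intg P (fun z => supn (y z) ^+ 2).
  by apply: intg_ge0P => // z; exact: sqr_ge0.
pose b j := pnsq s * (2 * tnth s j ^+ (2 * M).-1 / (dl + \sum_i tnth s i ^+ (2 * M))).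
have ib : intg P (fun z => \sum_j b j * tnth (y z) j).
  by apply: intg_sum => j _; apply: intgZ; exact: (y0 j).1.
have iB : intg P (fun z => pnsq s + \sum_j b j * tnth (y z) j + 16 * M%:R * supn (y z) ^+ 2).
  by apply: intgD; [apply: intgD => //; exact: intg_cst|exact: intgZ].
have mp : measurable_fun setT (fun z => pnsq (tadd s (y z))).
  by apply: measurableT_comp; [exact: measurable_pnsq|exact: measurable_tadd].
apply: (@le_trans _ _ (\int[P]_z (pnsq s + \sum_j b j * tnth (y z) j + 16 * M%:R * supn (y z) ^+ 2)%:E)%E).
  apply: ge0_le_integral => //.
  - by move=> z _; rewrite lee_fin pnsq_ge0.
  - exact/measurable_EFinP.
  - exact/measurable_EFinP/(intg_measurable iB).
  - by move=> z _; rewrite lee_fin; exact: pnsq_tadd.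
rewrite ExE// (ExE iS) -EFinM -EFinD lee_fin.
rewrite ExD; [|by apply: intgD => //; exact: intg_cst|exact: intgZ].
rewrite ExD//; last exact: intg_cst.
rewrite Ex_cst (ExZ _ iS) lerD2r Ex_sum; last by move=> j; apply: intgZ; exact: (y0 j).1.
by rewrite big1 ?addr0// => j _; rewrite (ExZ _ (y0 j).1) (y0 j).2 mulr0.
Qed.

End smooth_square.

Lemma integral_Dcst {d} {T : measurableType d} {R : realType} (P : probability T R)
    (f : T -> \bar R) (a : \bar R) : measurable_fun setT f ->
  (forall x, (0 <= f x)%E) -> (0 <= a)%E ->
  (\int[P]_x (f x + a) = \int[P]_x f x + a)%E.
Proof.
move=> mf f0 a0; rewrite ge0_integralD// integral_cst//= probability_setT mule1//.
Qed.

Section independent_sums.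
Context {R : realType} {D : nat} {d : measure_display} {T : measurableType d}.
Variables (P : probability T R).
Implicit Types (y : nat -> T -> D.-tuple R) (f : nat -> nat -> T -> T -> D.-tuple R).

(* Elements of a sequence are indexed from its end. *)
Fixpoint ssum y (l : seq T) : D.-tuple R :=
  if l is z :: l' then tadd (ssum y l') (y (size l') z) else tzero.

(** Pairs are grouped by their first element: with the later ones fixed, the increment is centred in
    that element when the kernel is degenerate, so the sum builds up like a martingale. *)
Fixpoint csum f (l : seq T) : D.-tuple R :=
  if l is z :: l' then tadd (csum f l') (ssum (fun k => f (size l') k z) l')
  else tzero.

Lemma ssumE y n (t : n.-tuple T) j : tnth (ssum y t) j =
  \sum_(i < n) tnth (y (n - i.+1)%N (tnth t i)) j.
Proof.
elim: n t => [|n IH] t; first by rewrite tuple0 big_ord0 tnth_tzero.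
case/tupleP: t => z t; rewrite [ssum _ _]/= tnth_tadd IH size_tuple big_ord_recl addrC.
rewrite subn1/= tnth0; congr (_ + _); apply: eq_bigr => i _.
by rewrite tnthS.
Qed.

Lemma csumE f n (t : n.-tuple T) j : tnth (csum f t) j =
  \sum_(i < n) \sum_(k < n | (i < k)%N)
     tnth (f (n - i.+1)%N (n - k.+1)%N (tnth t i) (tnth t k)) j.
Proof.
elim: n t => [|n IH] t; first by rewrite tuple0 big_ord0 tnth_tzero.
case/tupleP: t => z t; rewrite [csum _ _]/= tnth_tadd IH size_tuple ssumE.
rewrite big_ord_recl addrC; congr (_ + _).
  rewrite [RHS]big_mkcond big_ord_recl/= add0r; apply: eq_bigr => i _.
  by rewrite tnth0 tnthS subn1.
apply: eq_bigr => i _; rewrite [RHS]big_mkcond big_ord_recl/= add0r big_mkcond.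
by apply: eq_bigr => k _; rewrite /bump/= !add1n ltnS !tnthS.
Qed.

Lemma measurable_ssum y n : (forall k, measurable_fun setT (y k)) ->
  measurable_fun setT (fun t : n.-tuple T => ssum y t).
Proof.
move=> my; apply/measurable_fun_tnthP => j /=.
rewrite (_ : _ \o _ = fun t : n.-tuple T =>
  \sum_(i < n) tnth (y (n - i.+1)%N (tnth t i)) j); last first.
  by apply/funext => t; rewrite /= ssumE.
apply: measurable_sum => i.
have /measurable_fun_tnthP := my (n - i.+1)%N => /(_ j) mj.
by apply: (measurableT_comp mj); exact: measurable_tnth.
Qed.

Lemma measurable_ssum2 f k n :
  (forall k m, measurable_fun setT (fun z : T * T => f k m z.1 z.2)) ->
  measurable_fun setT (fun z : T * n.-tuple T => ssum (fun m => f k m z.1) z.2).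
Proof.
move=> mf; apply/measurable_fun_tnthP => j /=.
rewrite (_ : _ \o _ = fun z : T * n.-tuple T =>
  \sum_(i < n) tnth (f k (n - i.+1)%N z.1 (tnth z.2 i)) j); last first.
  by apply/funext => t; rewrite /= ssumE.
apply: measurable_sum => i.
have mj := measurableT_comp (measurable_tnth j) (mf k (n - i.+1)%N).
have mp : measurable_fun setT (fun z : T * n.-tuple T => (z.1, tnth z.2 i)).
  apply: measurable_fun_pair => //.
  by apply: (measurableT_comp (measurable_tnth i)).
exact: (measurableT_comp mj mp).
Qed.

Lemma measurable_csum f n :
  (forall k m, measurable_fun setT (fun z : T * T => f k m z.1 z.2)) ->
  measurable_fun setT (fun t : n.-tuple T => csum f t).
Proof.
move=> mf; apply/measurable_fun_tnthP => j /=.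
rewrite (_ : _ \o _ = fun t : n.-tuple T => \sum_(i < n) \sum_(k < n | (i < k)%N)
     tnth (f (n - i.+1)%N (n - k.+1)%N (tnth t i) (tnth t k)) j); last first.
  by apply/funext => t; rewrite /= csumE.
apply: measurable_sum => i.
apply: (eq_measurable_fun (fun t : n.-tuple T => \sum_(k < n) if (i < k)%N then
  tnth (f (n - i.+1)%N (n - k.+1)%N (tnth t i) (tnth t k)) j else 0)).
  by move=> t _; rewrite [RHS]big_mkcond.
apply: measurable_sum => k; case: (i < k)%N; last exact: measurable_cst.
have mj := measurableT_comp (measurable_tnth j) (mf (n - i.+1)%N (n - k.+1)%N).
have mp : measurable_fun setT (fun t : n.-tuple T => (tnth t i, tnth t k)).
  by apply: measurable_fun_pair; exact: measurable_tnth.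
exact: (measurableT_comp mj mp).
Qed.

Variable m : nat.
Hypothesis DM : (D <= 2 ^ m)%N.
Let c : R := 16 * m.+1%:R.

Let c0 : 0 <= c. Proof. by rewrite mulr_ge0 ?ler0n. Qed.

Let msq {d'} {S : measurableType d'} (g : S -> D.-tuple R) : measurable_fun setT g ->
  measurable_fun setT (fun z => (supn (g z) ^+ 2)%:E).
Proof.
move=> mg; apply/measurable_EFinP; apply: measurable_funX.
by apply: measurableT_comp => //; exact: measurable_supn.
Qed.

Let mpn (dl : R) {d'} {S : measurableType d'} (g : S -> D.-tuple R) : measurable_fun setT g ->
  measurable_fun setT (fun z => (pnsq m dl (g z))%:E).
Proof.
move=> mg; apply/measurable_EFinP.
by apply: measurableT_comp => //; exact: measurable_pnsq.
Qed.

Lemma ssum_pnsq (dl : R) y n : 0 < dl -> (forall k, measurable_fun setT (y k)) ->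
  (forall k j, intg P (fun z => tnth (y k z) j) /\ Ex P (fun z => tnth (y k z) j) = 0) ->
  (\int[prodn P n]_t (pnsq m dl (ssum y t))%:E <=
   (pnsq m dl (@tzero R D))%:E + c%:E * \sum_(k < n) \int[P]_z (supn (y k z) ^+ 2)%:E)%E.
Proof.
move=> dl0 my y0; elim: n => [|n IH].
  rewrite /= integral_dirac//; last exact: (mpn dl (measurable_ssum (n := 0) my)).
  by rewrite diracT mul1e big_ord0 mule0 adde0.
rewrite ge0_integral_prodnS; last 2 first.
- exact: (mpn dl (measurable_ssum (n := n.+1) my)).
- by move=> t; rewrite lee_fin pnsq_ge0.
have mt : measurable_fun setT (fun z : T * n.-tuple T =>
    (pnsq m dl (tadd (ssum y z.2) (y n z.1)))%:E).
  apply: mpn; apply: measurable_tadd; last by apply: measurableT_comp.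
  by apply: (measurableT_comp (measurable_ssum (n := n) my)).
under eq_integral => x _ do under eq_integral => t _ do rewrite [ssum _ _]/= size_tuple.
rewrite (fubini_tonelli (fun z : T * n.-tuple T =>
  (pnsq m dl (tadd (ssum y z.2) (y n z.1)))%:E))//=; last first.
  by move=> z; rewrite lee_fin pnsq_ge0.
set V := (\int[P]_z (supn (y n z) ^+ 2)%:E)%E.
have V0 : (0 <= V)%E by apply: integral_ge0 => z _; rewrite lee_fin sqr_ge0.
rewrite big_ord_recr/= ge0_muleDr//; last first.
  by apply: sume_ge0 => k _; apply: integral_ge0 => z _; rewrite lee_fin sqr_ge0.
rewrite addeA; apply: (@le_trans _ _
  (\int[prodn P n]_t ((pnsq m dl (ssum y t))%:E + c%:E * V))%E); last first.
  rewrite integral_Dcst//; first by rewrite leeD2r.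
  - exact: (mpn dl (measurable_ssum (n := n) my)).
  - by move=> t; rewrite lee_fin pnsq_ge0.
  - by rewrite mule_ge0// lee_fin.
apply: ge0_le_integral => //.
- by move=> t _; apply: integral_ge0 => z _; rewrite lee_fin pnsq_ge0.
- apply: (measurable_fun_fubini_tonelli_G (m1 := P)
    (fun z : T * n.-tuple T => (pnsq m dl (tadd (ssum y z.2) (y n z.1)))%:E)) => //.
  by move=> z; rewrite lee_fin pnsq_ge0.
- by apply: emeasurable_funD => //; exact: (mpn dl (measurable_ssum (n := n) my)).
- by move=> t _; exact: pnsq_integral.
Qed.

(** With [dl = e ^+ m.+1] the smoothed square at the origin equals [e], so the additive error
    vanishes with [dl]. *)
Lemma pnsq_limit {d'} {S : measurableType d'} (Q : probability S R)
    (g : S -> D.-tuple R) (B : \bar R) : measurable_fun setT g ->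
  (forall dl, 0 < dl -> (\int[Q]_t (pnsq m dl (g t))%:E <=
     (pnsq m dl (@tzero R D))%:E + B)%E) ->
  (\int[Q]_t (supn (g t) ^+ 2)%:E <= B)%E.
Proof.
move=> mg H; apply/lee_addgt0Pr => e e0.
have dl0 : 0 < e ^+ m.+1 by rewrite exprn_gt0.
have pe : pnsq m (e ^+ m.+1) (@tzero R D) = e.
  rewrite /pnsq big1 ?addr0; last by move=> j _; rewrite tnth_tzero expr0n.
  by rewrite lnXn// -[ln e *+ _]mulr_natr mulfK ?pnatr_eq0// lnK.
have := H _ dl0; rewrite pe addeC; apply: le_trans.
apply: ge0_le_integral => //.
- by move=> t _; rewrite lee_fin sqr_ge0.
- exact: msq.
- exact: mpn.
- by move=> t _; rewrite lee_fin supn_le_pnsq.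
Qed.

Lemma ssum_sq y n : (forall k, measurable_fun setT (y k)) ->
  (forall k j, intg P (fun z => tnth (y k z) j) /\ Ex P (fun z => tnth (y k z) j) = 0) ->
  (\int[prodn P n]_t (supn (ssum y t) ^+ 2)%:E <=
   c%:E * \sum_(k < n) \int[P]_z (supn (y k z) ^+ 2)%:E)%E.
Proof.
move=> my y0; apply: pnsq_limit; first exact: (measurable_ssum (n := n) my).
by move=> dl dl0; exact: ssum_pnsq.
Qed.

(** Two uses of the smoothed square, hence [c] twice. With the tail fixed, the new increment is
    centred in the head [z]; with [z] fixed, it is a sum of independent centred vectors over the
    tail, to which [ssum_sq] applies. *)
Lemma csum_pnsq (dl : R) f n : 0 < dl ->
  (forall k l, measurable_fun setT (fun z : T * T => f k l z.1 z.2)) ->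
  (forall k l w j, intg P (fun z => tnth (f k l z w) j) /\
     Ex P (fun z => tnth (f k l z w) j) = 0) ->
  (forall k l z j, intg P (fun w => tnth (f k l z w) j) /\
     Ex P (fun w => tnth (f k l z w) j) = 0) ->
  (\int[prodn P n]_t (pnsq m dl (csum f t))%:E <=
   (pnsq m dl (@tzero R D))%:E + c%:E * (c%:E * \sum_(k < n) \sum_(l < k)
     \int[P]_z \int[P]_w (supn (f k l z w) ^+ 2)%:E))%E.
Proof.
move=> dl0 mf f1 f2.
have I0 k l : (0 <= \int[P]_z \int[P]_w (supn (f k l z w) ^+ 2)%:E)%E.
  by do 2![apply: integral_ge0 => ? _]; rewrite lee_fin sqr_ge0.
elim: n => [|n IH].
  rewrite /= integral_dirac//; last exact: (mpn dl (measurable_csum (n := 0) mf)).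
  by rewrite diracT mul1e big_ord0 !mule0 adde0.
rewrite ge0_integral_prodnS; last 2 first.
- exact: (mpn dl (measurable_csum (n := n.+1) mf)).
- by move=> t; rewrite lee_fin pnsq_ge0.
pose q (z : T) (t : n.-tuple T) := ssum (fun l => f n l z) t.
have mq : measurable_fun setT (fun z : T * n.-tuple T => q z.1 z.2).
  exact: (@measurable_ssum2 f n n mf).
have mt : measurable_fun setT (fun z : T * n.-tuple T =>
    (pnsq m dl (tadd (csum f z.2) (q z.1 z.2)))%:E).
  apply: mpn; apply: measurable_tadd => //.
  by apply: (measurableT_comp (measurable_csum (n := n) mf)).
under eq_integral => x _ do under eq_integral => t _ do rewrite [csum _ _]/= size_tuple -/(q _ _).
rewrite (fubini_tonelli (fun z : T * n.-tuple T =>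
  (pnsq m dl (tadd (csum f z.2) (q z.1 z.2)))%:E))//=; last first.
  by move=> z; rewrite lee_fin pnsq_ge0.
pose V t := (\int[P]_z (supn (q z t) ^+ 2)%:E)%E.
have V0 t : (0 <= V t)%E by apply: integral_ge0 => z _; rewrite lee_fin sqr_ge0.
have mqs : measurable_fun setT (fun z : T * n.-tuple T => (supn (q z.1 z.2) ^+ 2)%:E).
  exact: msq.
have mV : measurable_fun setT V.
  apply: (measurable_fun_fubini_tonelli_G (m1 := P)
    (fun z : T * n.-tuple T => (supn (q z.1 z.2) ^+ 2)%:E)) => //.
  by move=> z; rewrite lee_fin sqr_ge0.
have q0 t j : intg P (fun z => tnth (q z t) j) /\ Ex P (fun z => tnth (q z t) j) = 0.
  have qE : (fun z => tnth (q z t) j) =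
      fun z => \sum_(i < n) tnth (f n (n - i.+1)%N z (tnth t i)) j.
    by apply/funext => z; rewrite /q ssumE.
  rewrite qE; split; first by apply: intg_sum => i _; exact: (f1 _ _ _ _).1.
  rewrite Ex_sum; last by move=> i; exact: (f1 _ _ _ _).1.
  by rewrite big1// => i _; exact: (f1 _ _ _ _).2.
have VE : (\int[prodn P n]_t V t <= c%:E * \sum_(l < n)
     \int[P]_z \int[P]_w (supn (f n l z w) ^+ 2)%:E)%E.
  rewrite -(fubini_tonelli (fun z : T * n.-tuple T => (supn (q z.1 z.2) ^+ 2)%:E))//=; last first.
    by move=> z; rewrite lee_fin sqr_ge0.
  have mfs l : measurable_fun setT (fun z : T * T => (supn (f n l z.1 z.2) ^+ 2)%:E).
    exact: msq.
  have mfi l : measurable_fun setT (fun z => \int[P]_w (supn (f n l z w) ^+ 2)%:E)%E.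
    apply: (measurable_fun_fubini_tonelli_F (m2 := P)
      (fun z : T * T => (supn (f n l z.1 z.2) ^+ 2)%:E)) => //.
    by move=> z; rewrite lee_fin sqr_ge0.
  have fi0 l z : (0 <= \int[P]_w (supn (f n l z w) ^+ 2)%:E)%E.
    by apply: integral_ge0 => ? _; rewrite lee_fin sqr_ge0.
  rewrite -ge0_integral_sum// -ge0_integralZl//; last 2 first.
  - exact: emeasurable_sum.
  - by move=> z _; exact: sume_ge0.
  apply: ge0_le_integral => //.
  - by move=> z _; apply: integral_ge0 => ? _; rewrite lee_fin sqr_ge0.
  - apply: (measurable_fun_fubini_tonelli_F (m2 := prodn P n)
      (fun z : T * n.-tuple T => (supn (q z.1 z.2) ^+ 2)%:E)) => //.
    by move=> z; rewrite lee_fin sqr_ge0.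
  - by apply: measurable_funeM; exact: emeasurable_sum.
  - move=> z _; apply: (@ssum_sq (fun l => f n l z)) => // l.
    exact: (measurableT_comp (mf n l) (pair1_measurable z)).
set S := (\sum_(k < n.+1) _)%E.
have -> : (S = \sum_(k < n) \sum_(l < k) \int[P]_z \int[P]_w (supn (f k l z w) ^+ 2)%:E +
    \sum_(l < n) \int[P]_z \int[P]_w (supn (f n l z w) ^+ 2)%:E)%E.
  by rewrite /S big_ord_recr.
have s0 k : (0 <= \sum_(l < k) \int[P]_z \int[P]_w (supn (f k l z w) ^+ 2)%:E)%E.
  exact: sume_ge0.
have ss0 : (0 <= \sum_(k < n) \sum_(l < k) \int[P]_z \int[P]_w (supn (f k l z w) ^+ 2)%:E)%E.
  by apply: sume_ge0 => k _; exact: s0.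
rewrite (ge0_muleDr _ ss0 (s0 n)) ge0_muleDr; last 2 first.
- by rewrite mule_ge0// lee_fin.
- by rewrite mule_ge0// lee_fin.
rewrite addeA; apply: (@le_trans _ _
  (\int[prodn P n]_t ((pnsq m dl (csum f t))%:E + c%:E * V t))%E); last first.
  rewrite ge0_integralD//; last 4 first.
  - by move=> t _; rewrite lee_fin pnsq_ge0.
  - exact: (mpn dl (measurable_csum (n := n) mf)).
  - by move=> t _; rewrite mule_ge0// lee_fin.
  - exact: measurable_funeM.
  apply: leeD => //; rewrite ge0_integralZl//.
  by apply: lee_wpmul2l; rewrite ?lee_fin.
apply: ge0_le_integral => //.
- by move=> t _; apply: integral_ge0 => z _; rewrite lee_fin pnsq_ge0.
- apply: (measurable_fun_fubini_tonelli_G (m1 := P)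
    (fun z : T * n.-tuple T => (pnsq m dl (tadd (csum f z.2) (q z.1 z.2)))%:E)) => //.
  by move=> z; rewrite lee_fin pnsq_ge0.
- apply: emeasurable_funD; first exact: (mpn dl (measurable_csum (n := n) mf)).
  exact: measurable_funeM.
- move=> t _; apply: pnsq_integral => //.
  exact: (measurableT_comp mq (pair2_measurable t)).
Qed.

Lemma csum_sq f n :
  (forall k l, measurable_fun setT (fun z : T * T => f k l z.1 z.2)) ->
  (forall k l w j, intg P (fun z => tnth (f k l z w) j) /\
     Ex P (fun z => tnth (f k l z w) j) = 0) ->
  (forall k l z j, intg P (fun w => tnth (f k l z w) j) /\
     Ex P (fun w => tnth (f k l z w) j) = 0) ->
  (\int[prodn P n]_t (supn (csum f t) ^+ 2)%:E <=
   c%:E * (c%:E * \sum_(k < n) \sum_(l < k)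
     \int[P]_z \int[P]_w (supn (f k l z w) ^+ 2)%:E))%E.
Proof.
move=> mf f1 f2; apply: pnsq_limit; first exact: (measurable_csum (n := n) mf).
by move=> dl dl0; exact: csum_pnsq.
Qed.

End independent_sums.

(** * Exponential inequality for U-statistics *)

Section exp_bounds.
Context {R : realType}.

(** $e^{-x}\ge1-x$ gives $e^x(1-x)\le1$, while $(1+x+2x^2)(1-x)=1+x^2(1-2x)\ge1$. *)
Lemma expR_le_quad (x : R) : x <= 2^-1 -> expR x <= 1 + x + 2 * x ^+ 2.
Proof.
move=> x1; have h := expR_ge1Dx (- x); have e0 := expR_gt0 x.
have E : expR x * expR (- x) = 1 by rewrite -expRD subrr expR0.
have h0 : 0 < 1 - x by lra.
rewrite -(ler_pM2r h0); apply: (@le_trans _ _ 1).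
  by rewrite -[leRHS]E ler_pM2l.
have -> : (1 + x + 2 * x ^+ 2) * (1 - x) = 1 + x ^+ 2 * (1 - 2 * x) by ring.
by rewrite lerDl mulr_ge0 ?sqr_ge0//; lra.
Qed.

(** Jensen's inequality through the tangent at the mean. *)
Lemma expR_avg (I : finType) (x : I -> R) : (0 < #|I|)%N ->
  expR (\sum_i x i / #|I|%:R) <= \sum_i expR (x i) / #|I|%:R.
Proof.
move=> I0; set m := \sum_i _; have c0 : 0 < #|I|%:R :> R by rewrite ltr0n.
have H : \sum_i expR m * (1 + (x i - m)) / #|I|%:R = expR m.
  rewrite -mulr_suml -mulr_sumr big_split/= sumrB !sumr_const.
  have -> : \sum_i x i = m * #|I|%:R by rewrite /m -mulr_suml divfK// gt_eqF.
  rewrite -[m *+ _]mulr_natr subrr addr0 mulfK// gt_eqF//.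
rewrite -[leLHS]H; apply: ler_sum => i _; rewrite ler_pM2r ?invr_gt0//.
rewrite -[in leRHS](subrK m (x i)) expRD mulrC ler_pM2r ?expR_gt0//.
exact: expR_ge1Dx.
Qed.

End exp_bounds.

Section permutation_average.
Context {R : realType} {n : nat}.
Implicit Types p : 'I_n * 'I_n * 'I_n.

Definition dist3 p := [&& p.1.1 != p.1.2, p.1.1 != p.2 & p.1.2 != p.2].

Definition perm3 (s : {perm 'I_n}) p := (s p.1.1, s p.1.2, s p.2).

Lemma perm3_inj s : injective (perm3 s).
Proof.
by case=> [[a b] c] [[a' b'] c'] [] /perm.perm_inj -> /perm.perm_inj -> /perm.perm_inj ->.
Qed.

Lemma dist3_perm s p : dist3 (perm3 s p) = dist3 p.
Proof. by rewrite /dist3 /= !(inj_eq perm.perm_inj). Qed.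

Lemma perm3_transitive p q : dist3 p -> dist3 q -> exists s, perm3 s p = q.
Proof.
case: p q => [[a b] c] [[a' b'] c'] /and3P[/= ab ac bc] /and3P[/= ab' ac' bc'].
pose s1 := perm.tperm a a'; pose s2 := perm.tperm (s1 b) b'.
pose s3 := perm.tperm (s2 (s1 c)) c'.
exists (s1 * s2 * s3)%g; rewrite /perm3 /= !perm.permM.
have e1 : s1 a = a' by rewrite perm.tpermL.
have n1 : s1 b != a' by rewrite -e1 (inj_eq perm.perm_inj) eq_sym.
have e2 : s2 a' = a' by rewrite perm.tpermD// eq_sym.
have e3 : s2 (s1 b) = b' by rewrite perm.tpermL.
have n2 : s2 (s1 c) != a'.
  by rewrite -{1}e2 -{1}e1 !(inj_eq perm.perm_inj) eq_sym.
have n3 : s2 (s1 c) != b' by rewrite -{1}e3 !(inj_eq perm.perm_inj) eq_sym.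
have e4 : s3 (s2 (s1 c)) = c' by rewrite perm.tpermL.
have e5 : s3 a' = a' by rewrite perm.tpermD// eq_sym.
have e6 : s3 b' = b' by rewrite perm.tpermD// eq_sym.
by rewrite e1 e2 e3 e4 e5 e6.
Qed.

(** Permutations act transitively on triples of distinct indices, so the sum over the group does not
    depend on the starting triple; summing over all of them and exchanging the sums gives the
    identity. *)
Lemma sum_perm3 (f : 'I_n * 'I_n * 'I_n -> R) p0 : dist3 p0 ->
  (\sum_(p | dist3 p) 1) * (\sum_(s : {perm 'I_n}) f (perm3 s p0)) =
  #|{perm 'I_n}|%:R * \sum_(p | dist3 p) f p.
Proof.
move=> d0; rewrite mulr_suml.
transitivity (\sum_(p | dist3 p) \sum_(s : {perm 'I_n}) f (perm3 s p)).
  apply: eq_bigr => p dp; rewrite mul1r.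
  have [r <-] := perm3_transitive d0 dp.
  rewrite (reindex_inj (mulgI r)); apply: eq_bigr => s _.
  by rewrite /perm3 /= !perm.permM.
rewrite exchange_big/=.
transitivity (\sum_(s : {perm 'I_n}) \sum_(p | dist3 p) f p); last first.
  by rewrite sumr_const mulr_natl.
apply: eq_bigr => s _; rewrite [RHS](reindex_inj (@perm3_inj s)).
by apply: eq_bigl => p; rewrite dist3_perm.
Qed.

End permutation_average.

Section blocks.
Context {R : realType} {d : measure_display} {T : measurableType d}.
Variable P : probability T R.

Lemma ge0_integral_prodn_cat a m (f : (a + m).-tuple T -> \bar R) :
  measurable_fun setT f -> (forall t, (0 <= f t)%E) ->
  (\int[prodn P (a + m)]_t f t =
   \int[prodn P a]_s \int[prodn P m]_t f [tuple of s ++ t])%E.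
Proof.
have mcat a' m' : measurable_fun setT
    (fun z : a'.-tuple T * m'.-tuple T => [tuple of z.1 ++ z.2]).
  apply/measurable_fun_tnthP => i /=; case: (split_ordP i) => j ->.
    rewrite (_ : _ \o _ = fun z => tnth z.1 j).
      exact: (measurableT_comp (measurable_tnth j)).
    by apply/funext => z /=; rewrite tnth_lshift.
  rewrite (_ : _ \o _ = fun z => tnth z.2 j).
    exact: (measurableT_comp (measurable_tnth j)).
  by apply/funext => z /=; rewrite tnth_rshift.
elim: a f => [|a IH] f mf f0.
  rewrite [X in (_ = X)%E]integral_dirac//; last first.
    apply: (measurable_fun_fubini_tonelli_F (m2 := prodn P m)
      (fun z : 0.-tuple T * m.-tuple T => f [tuple of z.1 ++ z.2])) => //.
    exact: (measurableT_comp mf (mcat 0 m)).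
  rewrite diracT mul1e; apply: eq_integral => t _; congr f; exact: val_inj.
have mfc : measurable_fun setT (fun z : a.+1.-tuple T * m.-tuple T => f [tuple of z.1 ++ z.2]).
  exact: (measurableT_comp mf (mcat a.+1 m)).
rewrite (@ge0_integral_prodnS _ _ _ P (a + m))// ge0_integral_prodnS; last 2 first.
- by apply: (measurable_fun_fubini_tonelli_F (m2 := prodn P m) _ mfc).
- by move=> s; apply: integral_ge0.
apply: eq_integral => x _; rewrite (IH (fun t => f [tuple of x :: t])); last 2 first.
- have mx : measurable_fun setT (fun t : (a + m).-tuple T => (x, t)).
    exact: measurable_fun_pair.
  exact: (measurableT_comp mf (measurableT_comp (@measurable_tcons _ T (a + m)) mx)).
- by move=> t; exact: f0.
by do 2![apply: eq_integral => ? _]; congr f; exact: val_inj.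
Qed.

Variables (K : 3.-tuple T -> R) (mK : measurable_fun setT K).

Lemma block_lt N (b : 'I_N) (r : 'I_3) : (b * 3 + r < N * 3)%N.
Proof. by have := ltn_ord b; have := ltn_ord r; lia. Qed.

Definition block N (b : 'I_N) (r : 'I_3) : 'I_(N * 3) := Ordinal (block_lt b r).

Definition bsum N (t : (N * 3).-tuple T) : R :=
  \sum_(b < N) K [tuple tnth t (block b r) | r < 3].

Lemma measurable_bsum N : measurable_fun setT (@bsum N).
Proof.
apply: measurable_sum => b; apply: (measurableT_comp mK).
exact: measurable_treindex.
Qed.

Lemma bsumS N (s : 3.-tuple T) (t : (N * 3).-tuple T) :
  bsum ([tuple of s ++ t] : (N.+1 * 3).-tuple T) = K s + bsum t.
Proof.
have [x0 _] : exists x : T, True by exists (thead s).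
rewrite /bsum big_ord_recl; congr (K _ + _).
  apply: eq_from_tnth => r; rewrite tnth_mktuple !(tnth_nth x0) /=.
  by rewrite nth_cat size_tuple ltn_ord.
apply: eq_bigr => b _; congr K; apply: eq_from_tnth => r.
rewrite !tnth_mktuple !(tnth_nth x0) /= nth_cat size_tuple /bump/=.
by congr nth; lia.
Qed.

Lemma bsum_exp (th c : R) N : 0 <= c ->
  (\int[prodn P 3]_t (expR (th * K t))%:E <= c%:E)%E ->
  (\int[prodn P (N * 3)]_t (expR (th * bsum t))%:E <= (c ^+ N)%:E)%E.
Proof.
move=> c0 Hc; elim: N => [|N IH].
  rewrite (eq_integral (fun=> 1%E)) ?integral_cst//= ?probability_setT ?mule1 ?expr0//.
  by move=> t _; rewrite /bsum big_ord0 mulr0 expR0.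
have mb n : measurable_fun setT (fun t : (n * 3).-tuple T => (expR (th * bsum t))%:E).
  apply/measurable_EFinP; apply: measurableT_comp => //; apply: measurable_funM => //.
  exact: measurable_bsum.
have mk : measurable_fun setT (fun t => (expR (th * K t))%:E).
  by apply/measurable_EFinP; apply: measurableT_comp => //; apply: measurable_funM.
rewrite (@ge0_integral_prodn_cat 3 (N * 3) (fun t => (expR (th * @bsum N.+1 t))%:E))//; last exact: (mb N.+1).
under eq_integral => s _.
  under eq_integral => t _ do rewrite bsumS mulrDr expRD EFinM.
  rewrite ge0_integralZl//; last exact: (mb N).
  over.
set J := (\int[prodn P (N * 3)]_t _)%E in IH *.
have J0 : (0 <= J)%E by apply: integral_ge0 => t _; rewrite lee_fin expR_ge0.
under eq_integral do rewrite muleC.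
rewrite ge0_integralZl//.
rewrite exprSr EFinM; apply: lee_pmul => //.
by apply: integral_ge0 => t _; rewrite lee_fin expR_ge0.
Qed.

End blocks.

Section ustat3.
Context {R : realType} {d : measure_display} {T : measurableType d}.
Variable P : probability T R.
Variables (K : 3.-tuple T -> R) (mK : measurable_fun setT K).
Variables (b s2 mu : R).
Hypotheses (Kb : forall t, `|K t| <= b) (Kmu : Ex (prodn P 3) K = mu).
Hypothesis (Ks2 : Ex (prodn P 3) (fun t => K t ^+ 2) <= s2).

Definition tri n (t : n.-tuple T) (p : 'I_n * 'I_n * 'I_n) : 3.-tuple T :=
  [tuple tnth t p.1.1; tnth t p.1.2; tnth t p.2].

Definition usum3 n (t : n.-tuple T) : R := \sum_(p | dist3 p) K (tri t p).

Definition cnt3 n : R := \sum_(p : 'I_n * 'I_n * 'I_n | dist3 p) 1.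

Let K' t := K t - mu.
Let mK' : measurable_fun setT K'. Proof. exact: measurable_funB. Qed.

Let b0 : 0 <= b.
Proof.
have := Ex_le (intg_abs (intg_bounded (prodn P 3) mK Kb)) (intg_cst _ b) Kb.
by rewrite Ex_cst; apply: le_trans; apply: Ex_ge0.
Qed.

Let mub : `|mu| <= b.
Proof.
have iK := intg_bounded (prodn P 3) mK Kb.
rewrite -Kmu; apply: le_trans (Ex_abs iK) _; rewrite -[leRHS](Ex_cst (prodn P 3)).
by apply: Ex_le => //; [exact: intg_abs|exact: intg_cst].
Qed.

(** The centred kernel is bounded by [2 * b], which puts the exponent below 1/2, where the quadratic
    bound on the exponential holds; the linear term integrates to 0. *)
Lemma mgf3 (th : R) : 0 <= th -> th * (2 * b) <= 2^-1 ->
  (\int[prodn P 3]_t (expR (th * K' t))%:E <= (expR (2 * th ^+ 2 * s2))%:E)%E.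
Proof.
move=> th0 thb.
have iK := intg_bounded (prodn P 3) mK Kb.
have iK2 : intg (prodn P 3) (fun t => K t ^+ 2).
  apply: (@intg_bounded _ _ _ _ _ (b ^+ 2)); first exact: measurable_funX.
  by move=> t; rewrite normrX; apply: lerXn2r; rewrite ?nnegrE.
have K'b t : `|K' t| <= 2 * b.
  by apply: le_trans (ler_normB _ _) _; have := Kb t; have := mub; lra.
have thK t : th * K' t <= 2^-1.
  apply: le_trans thb; apply: ler_wpM2l => //.
  exact: le_trans (ler_norm _) (K'b t).
pose q t := 1 + th * K' t + 2 * (th * K' t) ^+ 2.
have qE t : q t = (1 - th * mu + 2 * th ^+ 2 * mu ^+ 2) +
    (th - 4 * th ^+ 2 * mu) * K t + 2 * th ^+ 2 * K t ^+ 2.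
  by rewrite /q /K'; ring.
have iq : intg (prodn P 3) q.
  rewrite (funext qE); apply: intgD; last exact: intgZ.
  by apply: intgD; [exact: intg_cst|exact: intgZ].
apply: (@le_trans _ _ (\int[prodn P 3]_t (q t)%:E)%E).
  apply: ge0_le_integral => //.
  - by apply/measurable_EFinP; apply: measurableT_comp => //; apply: measurable_funM.
  - by apply/measurable_EFinP; exact: (intg_measurable iq).
  - by move=> t _; rewrite lee_fin; exact: expR_le_quad.
rewrite ExE// lee_fin (funext qE).
rewrite ExD; [|by apply: intgD; [exact: intg_cst|exact: intgZ]|exact: intgZ].
rewrite ExD; [|exact: intg_cst|exact: intgZ].
rewrite Ex_cst (ExZ _ iK) (ExZ _ iK2) Kmu.
apply: le_trans (expR_ge1Dx _).
have h1 : 2 * th ^+ 2 * Ex (prodn P 3) (fun t => K t ^+ 2) <= 2 * th ^+ 2 * s2.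
  by apply: ler_wpM2l => //; rewrite mulr_ge0// sqr_ge0.
have h2 : 0 <= th ^+ 2 * mu ^+ 2 by rewrite mulr_ge0 ?sqr_ge0.
have -> : 1 - th * mu + 2 * th ^+ 2 * mu ^+ 2 + (th - 4 * th ^+ 2 * mu) * mu +
  2 * th ^+ 2 * Ex (prodn P 3) (fun t => K t ^+ 2) =
  1 - 2 * (th ^+ 2 * mu ^+ 2) + 2 * th ^+ 2 * Ex (prodn P 3) (fun t => K t ^+ 2) by ring.
by move: h1 h2; set e := 2 * th ^+ 2 * Ex _ _; set e' := 2 * th ^+ 2 * s2;
  set e2 := _ * mu ^+ 2; lra.
Qed.

Variables (n N : nat).
Hypotheses (N0 : (0 < N)%N) (Nn : (N * 3 <= n)%N).

Let reix (s : {perm 'I_n}) (i : 'I_(N * 3)) : 'I_n := s (widen_ord Nn i).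

Let reix_inj s : injective (reix s).
Proof. by move=> i j /perm.perm_inj /(congr1 val) /= /val_inj. Qed.

Let W s (t : n.-tuple T) := bsum K' [tuple tnth t (reix s i) | i < N * 3].

Lemma cnt3_gt0 : 0 < cnt3 n.
Proof.
have n3 : (2 < n)%N by apply: leq_trans Nn; lia.
have d0 : dist3 ((Ordinal (ltn_trans (isT : 0 < 2)%N n3) : 'I_n,
  Ordinal (ltn_trans (isT : 1 < 2)%N n3) : 'I_n), Ordinal n3 : 'I_n) by [].
rewrite /cnt3 (bigD1 _ d0)//= ltr_pwDl//; exact: sumr_ge0.
Qed.

(** Averaged over all permutations, each block becomes a uniformly chosen triple of distinct
    indices, so every one of the [N] blocks contributes the whole U-statistic. *)
Lemma avg_blocks t : \sum_(s : {perm 'I_n}) W s t / #|{perm 'I_n}|%:R =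
  N%:R * (usum3 t / cnt3 n - mu).
Proof.
have c0 : #|{perm 'I_n}|%:R != 0 :> R.
  by rewrite pnatr_eq0 -lt0n; apply/card_gt0P; exists 1%g.
have q0 := cnt3_gt0.
pose p (i : 'I_N) := (widen_ord Nn (block i ord0), widen_ord Nn (block i (inord 1)),
   widen_ord Nn (block i (inord 2))).
have dp i : dist3 (p i).
  by rewrite /dist3 /p /=; apply/and3P; split; apply/eqP => /(congr1 val);
    rewrite /= ?inordK//; lia.
have WE s : W s t = \sum_(i < N) (K (tri t (perm3 s (p i))) - mu).
  apply: eq_bigr => i _; rewrite /K'; congr (K _ - _); apply: eq_from_tnth => r.
  have [x0 _] : exists x : T, True by exists (tnth t (p i).1.1).
  rewrite !tnth_mktuple; case: r => -[|[|[|//]]] hr; rewrite [RHS](tnth_nth x0) /=;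
    by congr (tnth t (perm.fun_of_perm s _)); apply: val_inj; rewrite /= ?inordK.
under eq_bigr do rewrite WE.
rewrite -mulr_suml exchange_big/=.
under eq_bigr => i _.
  rewrite sumrB sumr_const -[mu *+ _]mulr_natl.
  have -> : \sum_(s : {perm 'I_n}) K (tri t (perm3 s (p i))) =
      #|{perm 'I_n}|%:R * (usum3 t / cnt3 n).
    apply: (mulfI (lt0r_neq0 q0)).
    rewrite (sum_perm3 (fun q => K (tri t q)) (dp i)) -/(usum3 t).
    by field; rewrite gt_eqF.
  over.
rewrite sumr_const card_ord -mulr_natl.
by field; rewrite gt_eqF// c0.
Qed.

(* Hoeffding: a U-statistic of order 3 is an average over permutations of means
   of [N] independent blocks, so its exponential moments are bounded by those of
   such a mean. *)
Lemma ustat_upper (th ta : R) : 0 < th -> th * (2 * b) <= 2^-1 ->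
  pr (prodn P n) [set t | cnt3 n * (mu + ta) < usum3 t] <=
  expR (N%:R * (2 * th ^+ 2 * s2 - th * ta)).
Proof.
move=> th0 thb; have q0 := cnt3_gt0; have n0 : 0 < N%:R :> R by rewrite ltr0n.
pose c := expR (2 * th ^+ 2 * s2).
have c0 : (0 < #|{perm 'I_n}|)%N by apply/card_gt0P; exists 1%g.
have mU : measurable_fun setT (@usum3 n).
  rewrite /usum3; under eq_fun do rewrite big_mkcond.
  apply: (@measurable_sum _ _ _ _ _ _ (fun p t => if dist3 p then K (tri t p) else 0)) => p.
  case: (dist3 p); last exact: measurable_cst.
  apply: (measurableT_comp mK); apply/measurable_fun_tnthP => -[[|[|[|//]]] hr] /=;
    exact: measurable_tnth.
pose Y (t : n.-tuple T) := expR (th * (N%:R * (usum3 t / cnt3 n - mu))).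
have mY : measurable_fun setT Y.
  apply: measurableT_comp => //; apply: measurable_funM => //; apply: measurable_funM => //.
  by apply: measurable_funB => //; exact: measurable_funM.
have mW s : measurable_fun setT (W s).
  exact: (measurableT_comp (measurable_bsum (N := N) mK') (measurable_treindex (reix s))).
have IW s : (\int[prodn P n]_t (expR (th * W s t))%:E <= (c ^+ N)%:E)%E.
  have mb : measurable_fun setT (fun t : (N * 3).-tuple T => (expR (th * bsum K' t))%:E).
    apply/measurable_EFinP; apply: measurableT_comp => //; apply: measurable_funM => //.
    exact: (measurable_bsum (N := N) mK').
  have := @bsum_exp _ _ _ P K' mK' th c N (ltW (expR_gt0 _)) (mgf3 (ltW th0) thb).
  rewrite -(meq_integral _ (prodn_inj P (@reix_inj s))) ge0_integral_pushP//.
have iW s : intg (prodn P n) (fun t => expR (th * W s t)).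
  apply: intg_ge0P.
  - by apply: measurableT_comp => //; apply: measurable_funM.
  - by move=> t; exact: expR_ge0.
  - by apply: le_lt_trans (IW s) _; exact: ltry.
have iav : intg (prodn P n) (fun t => \sum_s expR (th * W s t) / #|{perm 'I_n}|%:R).
  by apply: intg_sum => s _; under eq_fun do rewrite mulrC; exact: intgZ.
have Yle t : Y t <= \sum_s expR (th * W s t) / #|{perm 'I_n}|%:R.
  rewrite /Y -avg_blocks mulr_sumr; under eq_bigr do rewrite mulrA.
  exact: expR_avg.
have iY : intg (prodn P n) Y.
  by apply: intg_le iav => // t; rewrite ger0_norm ?expR_ge0.
have EY : Ex (prodn P n) Y <= c ^+ N.
  apply: le_trans (Ex_le iY iav Yle) _.
  rewrite Ex_sum; last by move=> s; under eq_fun do rewrite mulrC; exact: intgZ.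
  apply: (@le_trans _ _ (\sum_(s : {perm 'I_n}) c ^+ N / #|{perm 'I_n}|%:R)).
    apply: ler_sum => s _; under eq_fun do rewrite mulrC.
    rewrite ExZ// mulrC ler_wpM2r ?invr_ge0 ?ler0n//.
    by rewrite -lee_fin -ExE.
  by rewrite sumr_const -[_ *+ _]mulr_natr divfK// pnatr_eq0 -lt0n.
set A := [set t | _].
have -> : A = [set t | expR (th * (N%:R * ta)) < Y t].
  apply/seteqP; split => t; rewrite /A /Y /= ltr_expR ltr_pM2l// ltr_pM2l//;
    by rewrite ltrBrDl ltr_pdivlMr// mulrC.
apply: le_trans (markov_pr iY (fun t => expR_ge0 _) (expR_gt0 _)) _.
rewrite ler_pdivrMr ?expR_gt0//; apply: le_trans EY _.
rewrite /c -expRM_natl -expRD ler_expR le_eqVlt; apply/orP; left; apply/eqP; ring.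
Qed.

End ustat3.

(** * Gaussian linear forms *)

Section prodn_pair.
Context {R : realType} {d : measure_display} {T : measurableType d}.
Variables (P : probability T R) (n : nat) (i k : 'I_n).
Hypothesis ik : i != k.

Lemma measurable_tnth2 : measurable_fun [set: n.-tuple T]
  (fun t : n.-tuple T => (tnth t i, tnth t k)).
Proof. by apply: measurable_fun_pair; exact: measurable_tnth. Qed.

Lemma prodn_pair : meq (pushP (prodn P n) measurable_tnth2) (P \x P)%E.
Proof.
apply: meq_sym => A mA.
apply: (product_measure_unique (m1 := P) (m2 := P)) => // {mA}A B mA mB.
rewrite [LHS]pushPE.
pose C (l : 'I_n) := if l == i then A else if l == k then B else setT.
have mC l : measurable (C l) by rewrite /C; do 2![case: ifP => // _].
rewrite (_ : _ @^-1` _ = trect C); last first.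
  apply/seteqP; split => [t [/= tA tB] l|t Ct].
    by rewrite /C; case: eqP => [->//|_]; case: eqP => [->|].
  split => /=; first by have := Ct i; rewrite /C eqxx.
  by have := Ct k; rewrite /C eqxx eq_sym (negbTE ik).
rewrite [LHS]prodn_trect// (bigD1 i)//= (bigD1 k)/=; last by rewrite eq_sym.
rewrite big1 ?mule1; last first.
  by move=> l /andP[/negbTE li /negbTE lk]; rewrite /C li lk probability_setT.
by rewrite /C !eqxx eq_sym (negbTE ik).
Qed.

Lemma Ex_prodn_pair (f : T * T -> R) : intg (P \x P)%E f ->
  intg (prodn P n) (fun t => f (tnth t i, tnth t k)) /\
  Ex (prodn P n) (fun t => f (tnth t i, tnth t k)) = Ex (P \x P)%E f.
Proof.
move=> fi; have mf := intg_measurable fi.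
have fi' := meq_intg (meq_sym prodn_pair) fi.
have fi2 : intg (prodn P n) (f \o (fun t => (tnth t i, tnth t k))).
  exact/(intg_pushP _ measurable_tnth2).
split; first exact: fi2.
by rewrite -(meq_Ex _ prodn_pair) Ex_pushP.
Qed.

End prodn_pair.

Section N01_moments.
Context {R : realType}.
Local Notation N01 := (@N01 R).
Local Notation phi := (@phi R).

(** The one-dimensional case of [gkN], started at the origin. *)
Lemma N01_sym (f : R -> \bar R) : measurable_fun setT f -> (forall x, (0 <= f x)%E) ->
  (\int[N01]_z f (- z)%R = \int[N01]_z f z)%E.
Proof.
move=> mf f0; pose a : 1.-tuple R := [tuple 1].
have H b : (\int[gk (\d_(@tzero R 1))%R b]_s f (thead s) =
    \int[N01]_z f (z * tnth b ord0)%R)%E.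
  rewrite ge0_integral_gk; last 2 first.
  - by apply: (measurableT_comp mf); exact: measurable_tnth.
  - by move=> y; exact: f0.
  have mE : measurable_fun setT (fun x : 1.-tuple R =>
     \int[N01]_z f (thead (tadd x (tscale z b))))%E.
    apply: (measurable_fun_fubini_tonelli_F (m2 := N01)
      (fun z : 1.-tuple R * R => f (thead (tadd z.1 (tscale z.2 b))))).
      apply: (measurableT_comp mf); apply: (measurableT_comp (measurable_tnth ord0)).
      by apply: measurable_tadd => //; apply: (measurableT_comp (measurable_tscale b)).
    by move=> z.
  rewrite integral_dirac// diracT mul1e; apply: eq_integral => z _.
  by rewrite /thead tnth_tadd tnth_tscale tnth_tzero add0r.
have a1 : tnth a ord0 = 1 by [].
have b1 : tnth (tscale (-1) a) ord0 = -1 by rewrite tnth_tscale a1 mulr1.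
have E : (\int[N01]_z f (z * tnth a ord0)%R =
    \int[N01]_z f (z * tnth (tscale (-1) a) ord0)%R)%E.
  by rewrite -!H; exact: (meq_integral _ (gkN _ a)).
rewrite a1 b1 in E; transitivity (\int[N01]_z f (z * -1)%R)%E.
  by apply: eq_integral => z _; rewrite mulrN1.
by rewrite -E; apply: eq_integral => z _; rewrite mulr1.
Qed.

Lemma N01_mgf (la : R) : (\int[N01]_z (expR (la * z))%:E = (expR (la ^+ 2 / 2))%:E)%E.
Proof.
have me (g : R -> R) : measurable_fun setT g -> measurable_fun setT (fun z => (expR (g z))%:E).
  by move=> mg; apply/measurable_EFinP; exact: measurableT_comp.
rewrite ge0_integral_N01; last 2 first.
- by apply: me; exact: measurable_funM.
- by move=> z; rewrite lee_fin expR_ge0.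
transitivity (\int[lebesgue_measure]_z ((expR (la ^+ 2 / 2))%:E * (phi (z + (- la)))%:E))%E.
  apply: eq_integral => z _; rewrite -!EFinM; congr EFin.
  by rewrite !phiE mulrCA [RHS]mulrCA -!expRD; congr (_ * expR _); field.
rewrite ge0_integralZl//; last 2 first.
- apply/measurable_EFinP; apply: (measurableT_comp (measurable_phi)).
  exact: measurable_funD.
- by move=> z _; rewrite lee_fin phi_ge0.
rewrite (ge0_integral_shift (f := EFin \o phi) (- la)); last 2 first.
- by apply/measurable_EFinP; exact: measurable_phi.
- by move=> z; rewrite /= lee_fin phi_ge0.
have -> : (\int[lebesgue_measure]_z (EFin \o phi) z = 1)%E by exact: integral_normal_pdf.
by rewrite mule1.
Qed.

(** The tilt turns the standard density into [si] times the centred normal density of variance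
    [si ^+ 2]. Letting [si] tend to 1 from both sides gives the second moment below, in place of an
    integration by parts. *)
Lemma N01_sqexp (si : R) : 0 < si ->
  (\int[N01]_z (expR ((1 - si ^- 2) / 2 * z ^+ 2))%:E = si%:E)%E.
Proof.
move=> s0; have sn0 : si != 0 by rewrite gt_eqF.
rewrite ge0_integral_N01; last 2 first.
- apply/measurable_EFinP; apply: measurableT_comp => //; exact: measurable_funM.
- by move=> z; rewrite lee_fin expR_ge0.
transitivity (\int[lebesgue_measure]_z (si%:E * (normal_pdf 0 si z)%:E))%E.
  apply: eq_integral => z _; rewrite -!EFinM; congr EFin.
  rewrite normal_pdfE// /normal_fun phiE mulrCA -expRD.
  have pk : si * normal_peak si = normal_peak 1.
    rewrite /normal_peak expr1n mul1r -mulrnAr sqrtrM ?sqr_ge0// sqrtr_sqr gtr0_norm//.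
    by rewrite invfM mulrA divff// mul1r.
  have -> : - (z - 0) ^+ 2 / (si ^+ 2 *+ 2) = (1 - si ^- 2) / 2 * z ^+ 2 + - z ^+ 2 / 2.
    by rewrite -mulr_natl subr0; field.
  by rewrite [RHS]mulrA pk.
rewrite ge0_integralZl//; last 3 first.
- by apply/measurable_EFinP; exact: measurable_normal_pdf.
- by move=> z _; rewrite lee_fin normal_pdf_ge0.
- by rewrite lee_fin ltW.
by rewrite integral_normal_pdf// mule1.
Qed.

Lemma intg_N01_sq : intg N01 (fun z => z ^+ 2).
Proof.
pose s : R := (1 - 2 ^- 2) / 2; have s0 : 0 < s by rewrite /s; lra.
have ie : intg N01 (fun z => s^-1 * expR (s * z ^+ 2)).
  apply: intgZ; apply: intg_ge0P.
  - by apply: measurableT_comp => //; exact: measurable_funM.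
  - by move=> z; exact: expR_ge0.
  - by rewrite N01_sqexp// ltry.
apply: intg_le ie; first exact: measurable_funX.
move=> z; rewrite ger0_norm ?sqr_ge0// mulrC ler_pdivlMr//.
by apply: le_trans (expR_ge1Dx _); rewrite mulrC lerDr.
Qed.

Lemma Ex_N01_sq : Ex N01 (fun z => z ^+ 2) = 1.
Proof.
have isq := intg_N01_sq.
have H (si : R) : 0 < si -> 1 + (1 - si ^- 2) / 2 * Ex N01 (fun z => z ^+ 2) <= si.
  move=> s0; rewrite -(ExZ _ isq) -{1}(Ex_cst N01 1) -ExD; last 2 first.
  - exact: intg_cst.
  - exact: intgZ.
  rewrite -lee_fin -ExE; last by apply: intgD; [exact: intg_cst|exact: intgZ].
  rewrite -[leRHS](N01_sqexp s0).
  have i1 : intg N01 (fun z => expR ((1 - si ^- 2) / 2 * z ^+ 2)).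
    apply: intg_ge0P.
    - by apply: measurableT_comp => //; exact: measurable_funM.
    - by move=> z; exact: expR_ge0.
    - by rewrite N01_sqexp// ltry.
  rewrite !ExE//; last by apply: intgD; [exact: intg_cst|exact: intgZ].
  rewrite lee_fin; apply: Ex_le => //.
    by apply: intgD; [exact: intg_cst|exact: intgZ].
  by move=> z; exact: expR_ge1Dx.
set v := Ex _ _ in H *.
(* with [si = 1 +- e] the inequality reads [v <= 2 si^2 / (si + 1)] resp [>=] *)
have hi (e : R) : 0 < e -> e <= 2^-1 -> v <= 1 + 2 * e.
  move=> e0 e1; have s0 : 0 < 1 + e by lra.
  have := H _ s0.
  have -> : (1 - (1 + e) ^- 2) / 2 * v = e * ((2 + e) / (2 * (1 + e) ^+ 2) * v).
    by field; rewrite gt_eqF.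
  rewrite lerD2l -[leRHS]mulr1 ler_pM2l// mulrAC ler_pdivrMr ?mul1r; last first.
    by rewrite mulr_gt0 ?exprn_gt0.
  move=> h; rewrite -(ler_pM2l (_ : 0 < 2 + e)); last by lra.
  apply: le_trans h _; rewrite -subr_ge0.
  have -> : (2 + e) * (1 + 2 * e) - 2 * (1 + e) ^+ 2 = e by ring.
  exact: ltW.
have lo (e : R) : 0 < e -> e <= 2^-1 -> 1 - 2 * e <= v.
  move=> e0 e1; have s0 : 0 < 1 - e by lra.
  have := H _ s0.
  have -> : (1 - (1 - e) ^- 2) / 2 * v = - (e * ((2 - e) / (2 * (1 - e) ^+ 2) * v)).
    by field; rewrite gt_eqF.
  rewrite lerD2l lerN2 -[leLHS]mulr1 ler_pM2l// mulrAC ler_pdivlMr ?mul1r; last first.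
    by rewrite mulr_gt0 ?exprn_gt0.
  move=> h; rewrite -(ler_pM2l (_ : 0 < 2 - e)); last by lra.
  apply: le_trans h; rewrite -subr_ge0.
  have -> : 2 * (1 - e) ^+ 2 - (2 - e) * (1 - 2 * e) = e by ring.
  exact: ltW.
apply/eqP; rewrite eq_le; apply/andP; split; apply/ler_addgt0Pr => e e0.
  pose e' := Num.min (e / 2) 2^-1.
  have e'0 : 0 < e' by rewrite lt_min divr_gt0//= invr_gt0.
  have h1 : e' <= e / 2 by rewrite ge_min lexx.
  have h2 : e' <= 2^-1 by rewrite ge_min lexx orbT.
  by have := hi e' e'0 h2; lra.
pose e' := Num.min (e / 2) 2^-1.
have e'0 : 0 < e' by rewrite lt_min divr_gt0//= invr_gt0.
have h1 : e' <= e / 2 by rewrite ge_min lexx.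
have h2 : e' <= 2^-1 by rewrite ge_min lexx orbT.
by have := lo e' e'0 h2; lra.
Qed.

Lemma intg_N01_id : intg N01 (fun z => z).
Proof.
have H : intg N01 (fun z : R => 1 + z ^+ 2).
  by apply: intgD; [exact: intg_cst|exact: intg_N01_sq].
apply: (intg_le _ _ H) => [|z]; first exact: measurable_id.
rewrite -(real_normK (num_real z)); have := sqr_ge0 (`|z| - 1).
by have := normr_ge0 z; move: `|z| => t t0; rewrite !expr2; nra.
Qed.

Lemma Ex_N01_id : Ex N01 (fun z => z) = 0.
Proof.
have mo : measurable_fun setT (fun z : R => - z) by apply: measurableT_comp.
have E : meq (pushP N01 mo) N01.
  by apply: meqP => f mf f0; rewrite ge0_integral_pushP// N01_sym.
have := meq_Ex (fun z => z) E; rewrite Ex_pushP//; last first.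
  by apply: intgN; exact: intg_N01_id.
rewrite ExN; last exact: intg_N01_id.
by move=> h; lra.
Qed.

End N01_moments.

Section gaussian_linear.
Context {R : realType}.
Local Notation N01 := (@N01 R).

(* Coefficients are indexed from the end, as in [ssum]. *)
Definition glin {D} (a : nat -> D.-tuple R) n (t : n.-tuple R) : D.-tuple R :=
  ssum (fun k z => tscale z (a k)) t.

Fixpoint gkits {D} (a : nat -> D.-tuple R) n (l : probability (D.-tuple R) R) :=
  if n is n'.+1 then gk (gkits a n' l) (a n') else l.

Lemma measurable_glin {D} (a : nat -> D.-tuple R) n :
  measurable_fun setT (@glin D a n).
Proof. by apply: measurable_ssum => k; exact: measurable_tscale. Qed.

Lemma tnth_glin {D} (a : nat -> D.-tuple R) n (t : n.-tuple R) j :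
  tnth (glin a t) j = \sum_(i < n) tnth t i * tnth (a (n - i.+1)%N) j.
Proof. by rewrite /glin ssumE; apply: eq_bigr => i _; rewrite tnth_tscale. Qed.

Lemma kick_glin {D} (a : nat -> D.-tuple R) n l :
  meq (kick l (prodn N01 n) (measurable_glin a (n := n))) (gkits a n l).
Proof.
elim: n => [|n IH] /=; apply: meqP => f mf f0; rewrite ge0_integral_kick//.
  apply: eq_integral => s _; rewrite integral_dirac//; last first.
    apply: (measurableT_comp mf); apply: measurable_tadd => //.
    exact: (measurable_glin a (n := 0)).
  rewrite diracT mul1e; congr f; apply: eq_from_tnth => j.
  by rewrite tnth_tadd tnth_glin big_ord0 addr0.
rewrite ge0_integral_gk// -(meq_integral _ IH) ge0_integral_kick//; last 2 first.
- apply: (measurable_fun_fubini_tonelli_F (m2 := N01)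
    (fun z : D.-tuple R * R => f (tadd z.1 (tscale z.2 (a n))))) => //.
  apply: (measurableT_comp mf); apply: measurable_tadd => //.
  exact: (measurableT_comp (measurable_tscale (a n))).
- by move=> s; apply: integral_ge0.
apply: eq_integral => s _.
rewrite ge0_integral_prodnS//; last first.
  apply: (measurableT_comp mf); apply: measurable_tadd => //.
  exact: (measurable_glin a (n := n.+1)).
rewrite (fubini_tonelli (fun z : R * n.-tuple R =>
    f (tadd s (glin a [tuple of z.1 :: z.2])))); last 2 first.
- apply: (measurableT_comp mf); apply: measurable_tadd; first exact: measurable_cst.
  exact: (measurableT_comp (measurable_glin a (n := n.+1)) (@measurable_tcons _ R n)).
- by move=> z; exact: f0.
apply: eq_integral => t _; apply: eq_integral => z _; congr f.
apply: eq_from_tnth => j; rewrite /glin /= !tnth_tadd size_tuple.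
by rewrite addrA.
Qed.

Lemma lin_mgf (al : nat -> R) n : (\int[prodn N01 n]_t
    (expR (\sum_(i < n) tnth t i * al (n - i.+1)%N))%:E =
    (expR ((\sum_(i < n) al i ^+ 2) / 2))%:E)%E.
Proof.
have ms m : measurable_fun setT (fun t : m.-tuple R =>
    (expR (\sum_(i < m) tnth t i * al (m - i.+1)%N))%:E).
  apply/measurable_EFinP; apply: measurableT_comp => //.
  apply: measurable_sum => i; apply: measurable_funM => //; exact: measurable_tnth.
elim: n => [|n IH].
  rewrite (eq_integral (fun=> 1%E)) ?integral_cst//= ?probability_setT ?mule1 ?big_ord0 ?mul0r ?expR0//.
  by move=> t _; rewrite big_ord0 expR0.
rewrite ge0_integral_prodnS; last 2 first.
- exact: ms.
- by move=> t; rewrite lee_fin expR_ge0.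
under eq_integral => z _.
  under eq_integral => t _.
    rewrite big_ord_recl tnth0 subn1/=.
    under eq_bigr do rewrite tnthS /bump/= add1n subSS.
    rewrite expRD EFinM; over.
  rewrite ge0_integralZl//; last exact: ms.
  rewrite IH muleC; over.
rewrite ge0_integralZl//; last first.
  by apply/measurable_EFinP; apply: measurableT_comp => //; exact: measurable_funM.
under eq_integral do rewrite mulrC.
rewrite N01_mgf -EFinM -expRD big_ord_recr/=; congr (expR _)%:E.
by rewrite mulrDl.
Qed.

Variables (n : nat) (al : nat -> R).
Let c (be : nat -> R) (t : n.-tuple R) := \sum_(i < n) tnth t i * be (n - i.+1)%N.

Let mc be : measurable_fun setT (c be).
Proof.
by apply: measurable_sum => i; apply: measurable_funM => //; exact: measurable_tnth.
Qed.

Let rsum (be : nat -> R) : \sum_(i < n) be (n - i.+1)%N = \sum_(i < n) be i.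
Proof. by rewrite -(big_mkord xpredT be) big_nat_rev /= big_mkord. Qed.

Let coord2 (i k : 'I_n) : intg (prodn N01 n) (fun t => tnth t i * tnth t k) /\
  Ex (prodn N01 n) (fun t => tnth t i * tnth t k) = (i == k)%:R.
Proof.
have [->|ik] := eqVneq i k.
  by have := prodn_coord k (@intg_N01_sq R); rewrite Ex_N01_sq.
have i1 : intg (prodn N01 n) (fun t => tnth t i * tnth t k).
  have ia : intg (prodn N01 n) (fun t => tnth t i ^+ 2 + tnth t k ^+ 2).
    by apply: intgD; [have [] := prodn_coord i (@intg_N01_sq R)|have [] := prodn_coord k (@intg_N01_sq R)].
  apply: (intg_le _ _ ia) => [|t].
    by apply: measurable_funM; exact: measurable_tnth.
  rewrite normrM -(real_normK (num_real (tnth t i))) -(real_normK (num_real (tnth t k))).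
  have := sqr_ge0 (`|tnth t i| - `|tnth t k|); move: (normr_ge0 (tnth t i)) (normr_ge0 (tnth t k)).
  by move: `|tnth t i| `|tnth t k| => u v u0 v0; rewrite !expr2; nra.
have iN2 : intg (N01 \x N01)%E (fun z => z.1 * z.2).
  apply: (meq_intg (prodn_pair N01 ik)); apply/intg_pushP => //.
  by apply: measurable_funM.
split => //; have [_] := Ex_prodn_pair ik iN2 => /= ->.
rewrite Ex_prod//; last by move=> x; apply: intgZ; exact: intg_N01_id.
rewrite (@Ex_ext _ _ _ N01 _ (fun=> 0)) ?Ex_cst// => x.
by rewrite ExZ ?Ex_N01_id ?mulr0//; exact: intg_N01_id.
Qed.

Lemma lin_mean : intg (prodn N01 n) (c al) /\ Ex (prodn N01 n) (c al) = 0.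
Proof.
have i1 (i : 'I_n) : intg (prodn N01 n) (fun t => tnth t i * al (n - i.+1)%N).
  under eq_fun do rewrite mulrC.
  by apply: intgZ; have [] := prodn_coord i (@intg_N01_id R).
split; first exact: intg_sum.
rewrite Ex_sum// big1// => i _; have [h1 h2] := prodn_coord i (@intg_N01_id R).
by under eq_fun do rewrite mulrC; rewrite ExZ// h2 Ex_N01_id mulr0.
Qed.

Lemma lin_cov (be : nat -> R) : intg (prodn N01 n) (fun t => c al t * c be t) /\
  Ex (prodn N01 n) (fun t => c al t * c be t) = \sum_(i < n) al i * be i.
Proof.
have E t : c al t * c be t = \sum_(i < n) \sum_(k < n)
    (al (n - i.+1)%N * be (n - k.+1)%N) * (tnth t i * tnth t k).
  rewrite /c mulr_suml; apply: eq_bigr => i _; rewrite mulr_sumr.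
  by apply: eq_bigr => k _; ring.
have i1 (i k : 'I_n) : intg (prodn N01 n) (fun t =>
    (al (n - i.+1)%N * be (n - k.+1)%N) * (tnth t i * tnth t k)).
  by apply: intgZ; exact: (coord2 i k).1.
rewrite (funext E); split; first by do 2![apply: intg_sum => ? _].
rewrite Ex_sum; last by move=> i; apply: intg_sum.
rewrite -(rsum (fun i => al i * be i)); apply: eq_bigr => i _.
rewrite Ex_sum// (bigD1 i)//= big1 ?addr0.
  by rewrite ExZ ?(coord2 i i).2 ?eqxx ?mulr1//; exact: (coord2 i i).1.
move=> k ki; rewrite ExZ ?(coord2 i k).2; last exact: (coord2 i k).1.
by rewrite eq_sym (negbTE ki) mulr0.
Qed.

Let ta2 := \sum_(i < n) al i ^+ 2.

Lemma lin_exp_abs (la : R) : 0 <= la ->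
  intg (prodn N01 n) (fun t => expR (la * `|c al t|)) /\
  Ex (prodn N01 n) (fun t => expR (la * `|c al t|)) <= 2 * expR (la ^+ 2 * ta2 / 2).
Proof.
move=> la0; pose S k := expR (la * k) + expR (- la * k).
have me (k : R) : measurable_fun setT (fun t => expR (k * c al t)).
  by apply: measurableT_comp => //; exact: measurable_funM.
have I1 (k : R) : intg (prodn N01 n) (fun t => expR (k * c al t)) /\
    Ex (prodn N01 n) (fun t => expR (k * c al t)) = expR (k ^+ 2 * ta2 / 2).
  have := lin_mgf (fun i => k * al i) n.
  under eq_integral => t _.
    under eq_bigr do rewrite mulrCA.
    rewrite -mulr_sumr -/(c al t); over.
  have -> : \sum_(i < n) (k * al i) ^+ 2 = k ^+ 2 * ta2.
    by rewrite mulr_sumr; apply: eq_bigr => i _; rewrite exprMn.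
  move=> E; split; last by rewrite /Ex E.
  by apply: intg_ge0P => //; rewrite E ltry.
have iS : intg (prodn N01 n) (fun t => S (c al t)).
  by apply: intgD; [exact: (I1 la).1|exact: (I1 (- la)).1].
have le1 t : expR (la * `|c al t|) <= S (c al t).
  rewrite /S; have [h|h] := leP 0 (c al t).
    by rewrite ger0_norm// lerDl expR_ge0.
  by rewrite ltr0_norm// mulrN mulNr lerDr expR_ge0.
have i0 : intg (prodn N01 n) (fun t => expR (la * `|c al t|)).
  apply: (intg_le _ _ iS) => [|t]; last by rewrite ger0_norm ?expR_ge0.
  by apply: measurableT_comp => //; apply: measurable_funM => //; exact: measurableT_comp.
split => //; apply: le_trans (Ex_le i0 iS le1) _.
rewrite ExD ?(I1 la).2 ?(I1 (- la)).2; [|exact: (I1 la).1|exact: (I1 (- la)).1].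
by rewrite sqrrN mulr_natl mulr2n.
Qed.

Lemma cube_le_exp (x : R) : 0 <= x -> x ^+ 3 <= 27 * expR x.
Proof.
move=> x0; have h : x / 3 <= expR (x / 3).
  by apply: le_trans (expR_ge1Dx _); rewrite lerDr.
have -> : 27 * expR x = 27 * expR (x / 3) ^+ 3.
  by congr (_ * _); rewrite -expRM_natl mulrC divfK.
have -> : x ^+ 3 = 27 * (x / 3) ^+ 3 by field.
by rewrite ler_pM2l//; apply: lerXn2r; rewrite ?nnegrE ?expR_ge0// divr_ge0.
Qed.

(** At $\lambda=1/ta$ the exponential moment of $\lambda|c|$ is at most $2e^{1/2}\le4$, and
    $x^3\le27e^x$: hence $108=27\cdot4$. *)
Lemma lin_third (ta : R) : 0 < ta -> ta2 <= ta ^+ 2 ->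
  intg (prodn N01 n) (fun t => `|c al t| ^+ 3) /\
  Ex (prodn N01 n) (fun t => `|c al t| ^+ 3) <= 108 * ta ^+ 3.
Proof.
move=> ta0 le_ta; have la0 : 0 <= ta^-1 by rewrite invr_ge0 ltW.
have [ie Ee] := lin_exp_abs la0.
have le1 t : `|c al t| ^+ 3 <= 27 * ta ^+ 3 * expR (ta^-1 * `|c al t|).
  have := @cube_le_exp (ta^-1 * `|c al t|); rewrite mulr_ge0// => /(_ isT).
  rewrite exprMn exprVn ler_pdivrMl ?exprn_gt0//.
  by rewrite mulrA (mulrC (_ ^+ 3) 27).
have ie' : intg (prodn N01 n) (fun t => 27 * ta ^+ 3 * expR (ta^-1 * `|c al t|)) by exact: intgZ.
have i3 : intg (prodn N01 n) (fun t => `|c al t| ^+ 3).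
  apply: (intg_le _ _ ie') => [|t]; last by rewrite ger0_norm// exprn_ge0.
  by apply: measurable_funX; exact: measurableT_comp.
split => //; apply: le_trans (Ex_le i3 ie' le1) _; rewrite ExZ//.
have e2 : expR (ta^-1 ^+ 2 * ta2 / 2) <= 2.
  have h : ta^-1 ^+ 2 * ta2 / 2 <= 2^-1.
    rewrite ler_piMl// exprVn mulrC ler_pdivrMr ?exprn_gt0// mul1r//.
  apply: le_trans (_ : expR 2^-1 <= _); first by rewrite ler_expR.
  by apply: le_trans (@expR_le_quad R 2^-1 _) _; rewrite ?lexx//; lra.
have t3 : 0 <= ta ^+ 3 by rewrite exprn_ge0// ltW.
apply: le_trans (_ : 27 * ta ^+ 3 * 4 <= _); last by lra.
apply: ler_wpM2l; first by rewrite mulr_ge0.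
by lra.
Qed.

(** Where $|c|>1$, $c^2\le e^{2|c|}e^{\lambda(|c|-1)}$. The hypothesis on [ta2] keeps the
    exponential moment at [la + 2] below $2e^{\lambda/2}$, so that $e^{-\lambda/2}$ is left of the
    factor $e^{-\lambda}$. *)
Lemma lin_tail (la : R) : 0 <= la -> (la + 2) ^+ 2 * ta2 <= la ->
  intg (prodn N01 n) (fun t => if 1 < `|c al t| then `|c al t| ^+ 2 else 0) /\
  Ex (prodn N01 n) (fun t => if 1 < `|c al t| then `|c al t| ^+ 2 else 0) <=
    2 * expR (- la / 2).
Proof.
move=> la0 h; have la2 : 0 <= la + 2 by rewrite addr_ge0.
have [ie Ee] := lin_exp_abs la2.
have le1 t : (if 1 < `|c al t| then `|c al t| ^+ 2 else 0) <=
    expR (- la) * expR ((la + 2) * `|c al t|).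
  case: ifPn => [c1|_]; last by rewrite mulr_ge0 ?expR_ge0.
  set x := `|c al t| in c1 *.
  have x0 : 0 <= x by exact: normr_ge0.
  have -> : expR (- la) * expR ((la + 2) * x) = expR (la * (x - 1)) * expR x ^+ 2.
    by rewrite -expRM_natl -!expRD; congr expR; ring.
  have h1 : x <= expR x by apply: le_trans (expR_ge1Dx _); rewrite lerDr.
  have h2 : 1 <= expR (la * (x - 1)).
    by rewrite -[leLHS]expR0 ler_expR; apply: mulr_ge0 => //; rewrite subr_ge0 ltW.
  rewrite -[leLHS]mul1r; apply: ler_pM; rewrite ?exprn_ge0//.
  by apply: lerXn2r; rewrite ?nnegrE ?expR_ge0.
have mt : measurable_fun setT (fun t => if 1 < `|c al t| then `|c al t| ^+ 2 else 0).
  apply: measurable_fun_ifT => //.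
    by apply: measurable_fun_ltr => //; exact: measurableT_comp.
  by apply: measurable_funX; exact: measurableT_comp.
have ie' : intg (prodn N01 n) (fun t => expR (- la) * expR ((la + 2) * `|c al t|)) by exact: intgZ.
have i0 : intg (prodn N01 n) (fun t => if 1 < `|c al t| then `|c al t| ^+ 2 else 0).
  apply: (intg_le mt _ ie') => t; rewrite ger0_norm//.
  by case: ifP => // _; rewrite exprn_ge0.
split => //; apply: le_trans (Ex_le i0 ie' le1) _; rewrite ExZ//.
apply: (@le_trans _ _ (expR (- la) * (2 * expR (la / 2)))).
  rewrite ler_wpM2l ?expR_ge0//; apply: le_trans Ee _.
  by rewrite ler_pM2l// ler_expR ler_pM2r ?invr_gt0.
rewrite mulrCA -expRD le_eqVlt; apply/orP; left; apply/eqP; congr (_ * expR _); by field.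
Qed.

End gaussian_linear.

Section kick_sums.
Context {R : realType} {D : nat} {d : measure_display} {T : measurableType d}.
Variables (P : probability T R) (y : nat -> T -> D.-tuple R).
Hypothesis my : forall k, measurable_fun setT (y k).

Fixpoint kicks n (l : probability (D.-tuple R) R) :=
  if n is n'.+1 then kick (kicks n' l) P (my n') else l.

Lemma kick_ssum n l :
  meq (kick l (prodn P n) (measurable_ssum my (n := n))) (kicks n l).
Proof.
elim: n => [|n IH] /=; apply: meqP => f mf f0; rewrite ge0_integral_kick//.
  apply: eq_integral => s _; rewrite integral_dirac//; last first.
    apply: (measurableT_comp mf); apply: measurable_tadd => //.
    exact: (measurable_ssum my (n := 0)).
  rewrite diracT mul1e; congr f; apply: eq_from_tnth => j.
  by rewrite tnth_tadd ssumE big_ord0 addr0.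
rewrite ge0_integral_kick// -(meq_integral _ IH) ge0_integral_kick//; last 2 first.
- apply: (measurable_fun_fubini_tonelli_F (m2 := P)
    (fun z : D.-tuple R * T => f (tadd z.1 (y n z.2)))) => //.
  exact: (measurableT_comp mf (measurable_kick (my n))).
- by move=> s; apply: integral_ge0.
apply: eq_integral => s _.
rewrite ge0_integral_prodnS//; last first.
  apply: (measurableT_comp mf); apply: measurable_tadd => //.
  exact: (measurable_ssum my (n := n.+1)).
rewrite (fubini_tonelli (fun z : T * n.-tuple T =>
    f (tadd s (ssum y [tuple of z.1 :: z.2])))); last 2 first.
- apply: (measurableT_comp mf); apply: measurable_tadd; first exact: measurable_cst.
  exact: (measurableT_comp (measurable_ssum my (n := n.+1)) (@measurable_tcons _ T n)).
- by move=> z; exact: f0.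
apply: eq_integral => t _; apply: eq_integral => z _; congr f.
by apply: eq_from_tnth => j; rewrite /= !tnth_tadd size_tuple addrA.
Qed.

End kick_sums.

Section kick_facts.
Context {R : realType} {D : nat} {d : measure_display} {T : measurableType d}.
Variables (P : probability T R) (x : T -> D.-tuple R) (mx : measurable_fun setT x).

Lemma pr_kick0 A : measurable A ->
  pr (kick (\d_(@tzero R D))%R P mx) A = pr P (x @^-1` A).
Proof.
move=> mA; have mxA : measurable (x @^-1` A) by rewrite -[X in measurable X]setTI; exact: mx.
rewrite -!Ex_indic//.
have b1 s : `|\1_A s| <= 1 :> R.
  by rewrite indicE; case: (s \in A); rewrite ?normr1 ?normr0.
have mI : measurable_fun setT (\1_A : D.-tuple R -> R) by exact: measurable_indic.
have [_ [-> /intg_measurable mE]] := kick_bounded (\d_(@tzero R D))%R P mx mI b1.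
rewrite /Ex integral_dirac//; last exact/measurable_EFinP.
rewrite diracT mul1e /=; congr fine; apply: eq_integral => z _.
have -> : tadd tzero (x z) = x z.
  by apply: eq_from_tnth => j; rewrite tnth_tadd tnth_tzero add0r.
by [].
Qed.

End kick_facts.

Section gaussian_splitting.
Context {R : realType} {D : nat}.
Implicit Types (a b : nat -> D.-tuple R) (l : probability (D.-tuple R) R).

Lemma meq_gkits a n l l' : meq l l' -> meq (gkits a n l) (gkits a n l').
Proof. by move=> H; elim: n => [|n IH] //=; exact: meq_gk. Qed.

Lemma gkits_gk a n l u : meq (gkits a n (gk l u)) (gk (gkits a n l) u).
Proof.
elim: n => [|n IH] /=; first exact: meq_refl.
exact: meq_trans (meq_gk (a n) IH) (gkC _ _ _).
Qed.

Lemma gkits_iter a n m l u :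
  meq (gkits a n (iter m (fun l => gk l u) l)) (iter m (fun l => gk l u) (gkits a n l)).
Proof.
elim: m => [|m IH] /=; first exact: meq_refl.
exact: meq_trans (gkits_gk _ _ _ _) (meq_gk u IH).
Qed.

Lemma iter_gkitsS a n k l : meq (iter k (gkits a n.+1) l)
  (iter k (fun l => gk l (a n)) (iter k (gkits a n) l)).
Proof.
elim: k => [|k IHk]; first exact: meq_refl.
rewrite iterS.
apply: meq_trans (_ : meq _ (gkits a n.+1 (iter k (fun l => gk l (a n)) (iter k (gkits a n) l)))) _.
  exact: meq_gkits IHk.
rewrite [gkits a n.+1 _]/= [iter k.+1 _ (iter k.+1 _ _)]/=; apply: meq_gk.
exact: gkits_iter.
Qed.

(** The Gaussian vector is a sum of [m] independent copies of itself scaled by $1/\sqrt m$; taken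
    with [m = n], this supplies one Gaussian summand for each observation. *)
Lemma iter_gkits m a n l : (0 < m)%N ->
  meq (iter m (gkits (fun k => tscale (Num.sqrt m%:R)^-1 (a k)) n) l) (gkits a n l).
Proof.
move=> m0; set a' := fun k => _; elim: n l => [|n IH] l.
  by rewrite /= iter_fix//; exact: meq_refl.
apply: meq_trans (iter_gkitsS _ _ _ _) _.
apply: meq_trans (gk_split _ (a n) m0) _.
exact: meq_gk (IH l).
Qed.

Fixpoint glist a n : seq (D.-tuple R) := if n is n'.+1 then a n' :: glist a n' else [::].

Lemma gkits_gks a n : gkits a n (\d_(@tzero R D))%R = gks (glist a n).
Proof. by elim: n => //= n ->. Qed.

Lemma gcov_glist a n j k : gcov (glist a n) j k = \sum_(i < n) tnth (a i) j * tnth (a i) k.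
Proof.
elim: n => [|n IH]; first by rewrite /gcov big_nil big_ord0.
by rewrite big_ord_recr/= -IH /gcov big_cons addrC.
Qed.

(** In coordinates normalized by their standard deviations, all at least [s0], the shift [r] becomes
    a window of width at most [r / s0]. *)
Lemma gks_anti (s : seq (D.-tuple R)) (s0 r : R) c : 0 < s0 -> 0 <= r ->
  (forall j, s0 ^+ 2 <= gcov s j j) ->
  pr (gks s) (orth (fun j => c j + r)) - pr (gks s) (orth c) <=
  r / s0 * (expR (3 / 2) * (1 + (Num.sqrt (2 * ln (D%:R : R)) + r / s0)) + 1).
Proof.
move=> s00 r0 Hs; pose sg j := Num.sqrt (gcov s j j).
have g0 j : 0 < gcov s j j by apply: lt_le_trans (Hs j); rewrite exprn_gt0.
have sg0 j : 0 < sg j by rewrite sqrtr_gt0.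
have sgE j : gcov s j j = sg j ^+ 2 by rewrite sqr_sqrtr// ltW.
have s0sg j : s0 <= sg j.
  rewrite /sg -[leLHS](ger0_norm (ltW s00)) -sqrtr_sqr ler_sqrt; last exact: ltW.
  exact: Hs.
have mo c' := @measurable_orth R D c'.
have sub : orth c `<=` (orth (fun j => c j + r) : set (D.-tuple R)).
  by apply: orth_le => j; rewrite lerDl.
rewrite -pr_setD//.
have e0 : 0 <= r / s0 by rewrite divr_ge0// ltW.
have := nazarov c sg0 sgE e0; apply: le_trans.
have mn j := measurable_nrm c sg j.
have mset : measurable [set x | (exists j, 0 < nrm c sg x j) /\ forall j, nrm c sg x j <= r / s0].
  rewrite (_ : [set x | _] = (\bigcup_(j in [set: 'I_D]) [set x | 0 < nrm c sg x j]) `&`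
      [set x | forall j, nrm c sg x j <= r / s0]).
    apply: measurableI.
      by apply: fin_bigcup_measurable => // j _; exact: measurable_ltset.
    by apply: measurable_forall => j; exact: measurable_leset.
  apply/seteqP; split => [x [[j hj] H]|x [[j _ hj] H]]; first by split => //; exists j.
  by split => //; exists j.
apply: pr_le => //; first exact: measurableD.
move=> x [h1 /existsNP[j /negP hj]]; split; last first.
  move=> k; rewrite /nrm ler_pdivrMr//; have := h1 k; rewrite -lerBlDl => /le_trans; apply.
  rewrite -[leLHS](divfK (lt0r_neq0 s00)) ler_wpM2l//.
by exists j; rewrite /nrm divr_gt0// subr_gt0 ltNge.
Qed.

End gaussian_splitting.

Section perturbation.
Context {R : realType} {D : nat} {d : measure_display} {T : measurableType d}.
Variables (P : probability T R) (X Y Z : T -> D.-tuple R) (rho e : R).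
Hypotheses (mX : measurable_fun setT X) (mY : measurable_fun setT Y).
Hypothesis (mZ : measurable_fun setT Z).
Hypotheses (XYZ : forall t, X t = tadd (Y t) (Z t)) (e0 : 0 < e).
Hypothesis (Zrho : (\int[P]_t (supn (Z t) ^+ 2)%:E <= rho%:E)%E).

Lemma orth_perturb c :
  pr P (X @^-1` orth c) <= pr P (Y @^-1` orth (fun j => c j + e)) + rho / e ^+ 2 /\
  pr P (Y @^-1` orth (fun j => c j - e)) - rho / e ^+ 2 <= pr P (X @^-1` orth c).
Proof.
have mpre (V : T -> D.-tuple R) c' : measurable_fun setT V -> measurable (V @^-1` orth c').
  by move=> mV; rewrite -[X in measurable X]setTI; apply: mV => //; exact: measurable_orth.
pose A := [set t | e ^+ 2 < supn (Z t) ^+ 2].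
have mS : measurable_fun setT (fun t => supn (Z t) ^+ 2).
  by apply: measurable_funX; apply: (measurableT_comp measurable_supn).
have iS : intg P (fun t => supn (Z t) ^+ 2).
  apply: intg_ge0P => // [t|]; first exact: sqr_ge0.
  by apply: le_lt_trans Zrho _; exact: ltry.
have mA : measurable A by exact: measurable_ltset.
have pA : pr P A <= rho / e ^+ 2.
  apply: le_trans (markov_pr iS (fun t => sqr_ge0 _) _) _; first by rewrite exprn_gt0.
  by rewrite ler_pM2r ?invr_gt0 ?exprn_gt0// -lee_fin -ExE.
have small t : ~ A t -> forall j, `|tnth (Z t) j| <= e.
  move=> /negP; rewrite -leNgt ler_pXn2r ?nnegrE ?supn_ge0 ?(ltW e0)// => h j.
  exact: le_trans (le_supn _ j) h.
split.
  apply: le_trans (lerD (lexx _) pA).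
  have := pr_setU P (mpre Y (fun j => c j + e) mY) mA; apply: le_trans.
  apply: pr_le; [exact: mpre|by apply: measurableU => //; exact: mpre|].
  move=> t Xt; have [At|At] := pselect (A t); [by right|left => j].
  have := Xt j; rewrite XYZ tnth_tadd; have := small t At j; rewrite ler_norml => /andP[h _].
  by move: h; lra.
rewrite lerBlDr; apply: le_trans (lerD (lexx _) pA).
have := pr_setU P (mpre X c mX) mA; apply: le_trans.
apply: pr_le; [exact: mpre|by apply: measurableU => //; exact: mpre|].
move=> t Yt; have [At|At] := pselect (A t); [by right|left => j].
rewrite XYZ tnth_tadd; have := Yt j; have := small t At j; rewrite ler_norml => /andP[_ h].
by move: h; lra.
Qed.

End perturbation.

(** * Decomposition of the statistic and of its bootstrap *)

Section double_sums.
Context {R : realType} {n : nat}.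
Implicit Types (A : 'I_n -> 'I_n -> R).

Lemma sum_neq_sym A : (forall i k, A i k = A k i) ->
  \sum_(i < n) \sum_(k < n | i != k) A i k =
  2 * \sum_(i < n) \sum_(k < n | (i < k)%N) A i k.
Proof.
move=> AC.
have E (i : 'I_n) : \sum_(k | i != k) A i k =
    \sum_(k : 'I_n | (i < k)%N) A i k + \sum_(k : 'I_n | (k < i)%N) A i k.
  rewrite (bigID (fun k : 'I_n => (i < k)%N))/=; congr (_ + _); apply: eq_bigl => k.
    by rewrite andbC -(inj_eq val_inj) /=; case: ltngtP.
  by rewrite -(inj_eq val_inj) /=; case: ltngtP.
under eq_bigr do rewrite E.
rewrite big_split/= mulr_natl mulr2n; congr (_ + _).
rewrite (exchange_big_dep xpredT)//=; apply: eq_bigr => i _.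
by apply: eq_bigr => k _; rewrite AC.
Qed.

Lemma sum_neq_weights A (p : 'I_n -> R) : (forall i k, A i k = A k i) ->
  \sum_i \sum_(k | i != k) (p i + p k) * A i k =
  2 * \sum_i p i * \sum_(k | i != k) A i k.
Proof.
move=> AC.
under eq_bigr do under eq_bigr do rewrite mulrDl.
under eq_bigr do rewrite big_split/=.
rewrite big_split/= mulr_natl mulr2n; congr (_ + _).
  by apply: eq_bigr => i _; rewrite mulr_sumr.
rewrite (exchange_big_dep xpredT)//=; apply: eq_bigr => i _.
rewrite mulr_sumr; apply: eq_big => k; first by rewrite eq_sym.
by rewrite AC.
Qed.

Lemma card_neq (i : 'I_n) : \sum_(k | i != k) (1 : R) = n%:R - 1.
Proof.
have : \sum_(k : 'I_n) (1 : R) = n%:R by rewrite sumr_const card_ord.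
rewrite (bigD1 i)//= => <-; rewrite [RHS]addrC addKr; apply: eq_bigl => k.
by rewrite eq_sym.
Qed.

Lemma sum_rev_lt (f : nat -> nat -> R) :
  \sum_(k < n) \sum_(l < k) f (n - k.+1)%N (n - l.+1)%N =
  \sum_(i < n) \sum_(k < n | (i < k)%N) f i k.
Proof.
rewrite (reindex_inj rev_ord_inj)/=; apply: eq_bigr => i _.
rewrite (big_ord_widen n (fun l => f (n - (n - i.+1).+1)%N (n - l.+1)%N)); last first.
  by rewrite leq_subr.
rewrite (reindex_inj rev_ord_inj)/=; apply: eq_big => k.
  by have := ltn_ord i; have := ltn_ord k; lia.
move=> _; congr f; [have := ltn_ord i|have := ltn_ord k]; lia.
Qed.

End double_sums.

Section sup_norm_facts.
Context {R : realType} {D : nat}.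
Implicit Types s y : D.-tuple R.

Lemma supn_tscale (z : R) y : supn (tscale z y) = `|z| * supn y.
Proof.
apply/eqP; rewrite eq_le; apply/andP; split.
  apply: supn_le => [|j]; first by rewrite mulr_ge0 ?supn_ge0.
  by rewrite tnth_tscale normrM ler_wpM2l// le_supn.
have [->|z0] := eqVneq z 0; first by rewrite normr0 mul0r supn_ge0.
have nz : 0 < `|z| by rewrite normr_gt0.
rewrite mulrC -ler_pdivlMr//; apply: supn_le => [|j].
  by rewrite divr_ge0 ?supn_ge0.
rewrite ler_pdivlMr// mulrC; apply: le_trans (le_supn _ j).
by rewrite tnth_tscale normrM.
Qed.

Lemma supn_tadd s y : supn (tadd s y) <= supn s + supn y.
Proof.
apply: supn_le => [|j]; first by rewrite addr_ge0 ?supn_ge0.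
by rewrite tnth_tadd (le_trans (ler_normD _ _))// lerD// le_supn.
Qed.

Lemma supn2_tadd3 (a b c : D.-tuple R) : supn (tadd a (tadd b c)) ^+ 2 <=
  3 * (supn a ^+ 2 + supn b ^+ 2 + supn c ^+ 2).
Proof.
have h : supn (tadd a (tadd b c)) <= supn a + supn b + supn c.
  by rewrite -addrA; apply: le_trans (supn_tadd _ _) _; rewrite lerD2l supn_tadd.
apply: (@le_trans _ _ ((supn a + supn b + supn c) ^+ 2)).
  by apply: lerXn2r; rewrite ?nnegrE ?addr_ge0 ?supn_ge0.
move: (supn a) (supn b) (supn c) => x y z; rewrite -subr_ge0.
have -> : 3 * (x ^+ 2 + y ^+ 2 + z ^+ 2) - (x + y + z) ^+ 2 =
  (x - y) ^+ 2 + (x - z) ^+ 2 + (y - z) ^+ 2 by ring.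
by rewrite !addr_ge0 ?sqr_ge0.
Qed.

Lemma coord_sq_le y j : tnth y j ^+ 2 <= supn y ^+ 2.
Proof.
by rewrite -(real_normK (num_real _)); apply: lerXn2r; rewrite ?nnegrE ?le_supn ?supn_ge0.
Qed.

Lemma norm_le_sq1 (x : R) : `|x| <= 1 + x ^+ 2.
Proof.
rewrite -(real_normK (num_real x)); have := sqr_ge0 (`|x| - 1).
by have := normr_ge0 x; move: `|x| => t t0; rewrite !expr2; nra.
Qed.

End sup_norm_facts.

Lemma Ex_sq_le {d} {T : measurableType d} {R : realType} (P : probability T R)
    (u : T -> R) : intg P u -> intg P (fun x => u x ^+ 2) ->
  Ex P u ^+ 2 <= Ex P (fun x => u x ^+ 2).
Proof.
move=> iu iu2; set m := Ex P u.
have i1 : intg P (fun x => u x ^+ 2 - 2 * m * u x) by apply: intgB => //; exact: intgZ.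
have : 0 <= Ex P (fun x => u x ^+ 2 - 2 * m * u x + m ^+ 2).
  apply: Ex_ge0 => x; have -> : u x ^+ 2 - 2 * m * u x + m ^+ 2 = (u x - m) ^+ 2 by ring.
  exact: sqr_ge0.
rewrite ExD//; last exact: intg_cst.
rewrite ExB//; last exact: intgZ.
by rewrite (ExZ _ iu) Ex_cst -/m; lra.
Qed.

(** * Hoeffding's decomposition of the kernel and the two statistics *)

Section kernel.
Context {R : realType} {d : measure_display} {S : measurableType d} {D : nat}.
Variables (F : probability S R) (h : S -> S -> D.-tuple R).
Hypothesis mh : measurable_fun setT (fun z : S * S => h z.1 z.2).
Hypothesis hC : forall x y, h x y = h y x.
Hypothesis hsec : forall x, intg F (fun y => supn (h x y) ^+ 2).
Hypothesis h2 : intg (F \x F)%E (fun z => supn (h z.1 z.2) ^+ 2).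
Hypothesis h0 : forall j, Ex F (fun x => Ex F (fun y => tnth (h x y) j)) = 0.

Definition tau2 : R := Ex (F \x F)%E (fun z => supn (h z.1 z.2) ^+ 2).

Definition hg x : D.-tuple R := [tuple Ex F (fun y => tnth (h x y) j) | j < D].

(** The second-order term of Hoeffding's decomposition; it is centred in each argument because [h0]
    makes [hg] centred. *)
Definition hdeg x y := tadd (h x y) (tadd (tscale (-1) (hg x)) (tscale (-1) (hg y))).

Lemma measurable_hj j : measurable_fun setT (fun z : S * S => tnth (h z.1 z.2) j).
Proof. exact: (measurableT_comp (measurable_tnth j) mh). Qed.

Lemma measurable_hx x : measurable_fun setT (h x).
Proof. exact: (measurableT_comp mh (measurable_pair1 x)). Qed.

Lemma intg_hj x j : intg F (fun y => tnth (h x y) j).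
Proof.
apply: (intg_le _ _ (intgD (intg_cst F 1) (hsec x))) => [|y].
  exact: (measurableT_comp (measurable_tnth j) (measurable_hx x)).
by apply: le_trans (norm_le_sq1 _) _; rewrite lerD2l coord_sq_le.
Qed.

Lemma intg_hj2 j : intg (F \x F)%E (fun z => tnth (h z.1 z.2) j).
Proof.
apply: (intg_le (measurable_hj j) _ (intgD (intg_cst _ 1) h2)) => z.
by apply: le_trans (norm_le_sq1 _) _; rewrite lerD2l coord_sq_le.
Qed.

Lemma measurable_hg : measurable_fun setT hg.
Proof.
apply/measurable_fun_tnthP => j /=.
rewrite (_ : _ \o _ = fun x => Ex F (fun y => tnth (h x y) j)); last first.
  by apply/funext => x; rewrite /= tnth_mktuple.
by have /intg_measurable := intg_prod1 (intg_hj2 j) (fun x => intg_hj x j).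
Qed.

Lemma measurable_hdeg : measurable_fun setT (fun z : S * S => hdeg z.1 z.2).
Proof.
have ms : measurable_fun setT (fun x => tscale (-1) (hg x)).
  apply/measurable_fun_tnthP => j /=.
  rewrite (_ : _ \o _ = fun x => -1 * tnth (hg x) j); last first.
    by apply/funext => x; rewrite /= tnth_tscale.
  by apply: measurable_funM => //; exact: (measurableT_comp (measurable_tnth j) measurable_hg).
apply: measurable_tadd => //; apply: measurable_tadd.
  exact: (measurableT_comp ms).
exact: (measurableT_comp ms).
Qed.

Lemma hdegC x y : hdeg x y = hdeg y x.
Proof.
by rewrite /hdeg hC; congr tadd; apply: eq_from_tnth => j; rewrite !tnth_tadd addrC.
Qed.

Lemma intg_hg j : intg F (fun x => tnth (hg x) j).
Proof.
have := intg_prod1 (intg_hj2 j) (fun x => intg_hj x j).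
by apply: intg_ext => x; rewrite tnth_mktuple.
Qed.

Lemma Ex_hg j : Ex F (fun x => tnth (hg x) j) = 0.
Proof. by rewrite -(h0 j); apply: Ex_ext => x; rewrite tnth_mktuple. Qed.

Lemma tnth_hdeg x y j : tnth (hdeg x y) j =
  tnth (h x y) j - tnth (hg x) j - tnth (hg y) j.
Proof. by rewrite /hdeg !tnth_tadd !tnth_tscale; ring. Qed.

Lemma hdeg_mean x j : intg F (fun y => tnth (hdeg x y) j) /\
  Ex F (fun y => tnth (hdeg x y) j) = 0.
Proof.
under [X in intg _ X]eq_fun do rewrite tnth_hdeg.
under [X in Ex _ X]eq_fun do rewrite tnth_hdeg.
have i1 : intg F (fun y => tnth (h x y) j - tnth (hg x) j).
  by apply: intgB; [exact: intg_hj|exact: intg_cst].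
split; first by apply: intgB => //; exact: intg_hg.
rewrite ExB//; last exact: intg_hg.
rewrite ExB; [|exact: intg_hj|exact: intg_cst].
by rewrite Ex_cst Ex_hg tnth_mktuple subrr subr0.
Qed.

Let q x := Ex F (fun y => supn (h x y) ^+ 2).

Lemma intg_q : intg F q.
Proof. exact: (intg_prod1 h2 hsec). Qed.

Lemma Ex_q : Ex F q = tau2.
Proof. by rewrite /tau2 Ex_prod. Qed.

Lemma supn_hg x : supn (hg x) ^+ 2 <= q x.
Proof.
have isq : intg F (fun y => supn (h x y)).
  apply: (intg_le _ _ (intgD (intg_cst F 1) (hsec x))) => [|y].
    exact: (measurableT_comp measurable_supn (measurable_hx x)).
  exact: norm_le_sq1.
apply: le_trans (Ex_sq_le isq (hsec x)).
apply: lerXn2r; rewrite ?nnegrE ?supn_ge0//; first by apply: Ex_ge0 => y; exact: supn_ge0.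
apply: supn_le => [|j]; first by apply: Ex_ge0 => y; exact: supn_ge0.
rewrite tnth_mktuple; apply: le_trans (Ex_abs (intg_hj x j)) _.
by apply: Ex_le => // [|y]; [exact: intg_abs (intg_hj x j)|exact: le_supn].
Qed.

Lemma intg_hg2 : intg F (fun x => supn (hg x) ^+ 2).
Proof.
apply: (intg_le _ _ intg_q) => [|x]; last by rewrite ger0_norm ?sqr_ge0// supn_hg.
by apply: measurable_funX; exact: (measurableT_comp measurable_supn measurable_hg).
Qed.

Lemma tau2_ge0 : 0 <= tau2.
Proof. by apply: Ex_ge0 => z; exact: sqr_ge0. Qed.

(** The square of a sum of three terms is at most three times the sum of the squares, and each of
    the three has mean at most [tau2], for the projections by Jensen's inequality. *)
Lemma hdeg_sq : (\int[F]_x \int[F]_y (supn (hdeg x y) ^+ 2)%:E <= (9 * tau2)%:E)%E.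
Proof.
have md : measurable_fun setT (fun z : S * S => (supn (hdeg z.1 z.2) ^+ 2)%:E).
  apply/measurable_EFinP; apply: measurable_funX.
  exact: (measurableT_comp measurable_supn measurable_hdeg).
have hd0 z : (0 <= (supn (hdeg z.1 z.2) ^+ 2)%:E)%E by rewrite lee_fin sqr_ge0.
have i1 x : intg F (fun y => 3 * (supn (h x y) ^+ 2 + q x + q y)).
  apply: intgZ; apply: intgD; last exact: intg_q.
  by apply: intgD; [exact: hsec|exact: intg_cst].
have le1 x y : supn (hdeg x y) ^+ 2 <= 3 * (supn (h x y) ^+ 2 + q x + q y).
  apply: le_trans (supn2_tadd3 _ _ _) _; rewrite !supn_tscale normrN1 !mul1r.
  by rewrite ler_pM2l// !lerD// supn_hg.
have in1 x : (\int[F]_y (supn (hdeg x y) ^+ 2)%:E <= (3 * (q x + q x + tau2))%:E)%E.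
  apply: (@le_trans _ _ (\int[F]_y (3 * (supn (h x y) ^+ 2 + q x + q y))%:E)%E).
    apply: ge0_le_integral => //.
    - by move=> y _; exact: hd0 (x, y).
    - exact: (measurableT_comp md (measurable_pair1 x)).
    - by apply/measurable_EFinP; exact: (intg_measurable (i1 x)).
    - by move=> y _; rewrite lee_fin.
  rewrite ExE// lee_fin ExZ; last first.
    by apply: intgD; [apply: intgD; [exact: hsec|exact: intg_cst]|exact: intg_q].
  rewrite ExD; [|by apply: intgD; [exact: hsec|exact: intg_cst]|exact: intg_q].
  by rewrite ExD ?Ex_cst ?Ex_q//; exact: intg_cst.
have i2 : intg F (fun x => 3 * (q x + q x + tau2)).
  apply: intgZ; apply: intgD; last exact: intg_cst.
  by apply: intgD; exact: intg_q.
apply: (@le_trans _ _ (\int[F]_x (3 * (q x + q x + tau2))%:E)%E).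
  apply: ge0_le_integral => //.
  - by move=> x _; apply: integral_ge0 => y _; exact: hd0 (x, y).
  - apply: (measurable_fun_fubini_tonelli_F (m2 := F)
      (fun z : S * S => (supn (hdeg z.1 z.2) ^+ 2)%:E)) => //.
  - by apply/measurable_EFinP; exact: (intg_measurable i2).
rewrite ExE// lee_fin ExZ; last first.
  by apply: intgD; [by apply: intgD; exact: intg_q|exact: intg_cst].
rewrite ExD; [|by apply: intgD; exact: intg_q|exact: intg_cst].
rewrite ExD ?Ex_cst ?Ex_q; [|exact: intg_q|exact: intg_q].
by rewrite le_eqVlt; apply/orP; left; apply/eqP; ring.
Qed.

Section statistics.
Variable n : nat.
Hypothesis n2 : (1 < n)%N.
Let N0 : 0 < n%:R :> R. Proof. by rewrite ltr0n ltnW. Qed.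
Let N1 : 0 < n%:R - 1 :> R. Proof. by rewrite subr_gt0 ltr1n. Qed.

Definition hT (t : n.-tuple S) : D.-tuple R := [tuple
  Num.sqrt n%:R * ((n%:R * (n%:R - 1))^-1 *
    \sum_(i < n) \sum_(k < n | i != k) tnth (h (tnth t i) (tnth t k)) j) / 2 | j < D].

(** Written in the centred weights $\xi=w-1$: $(1+\xi_i)(1+\xi_k)-1=\xi_i+\xi_k+\xi_i\xi_k$ splits
    into a Gaussian linear form and a degenerate chaos for the fixed sample [t]. *)
Definition hTb (t : n.-tuple S) (xi : n.-tuple R) : D.-tuple R := [tuple
  Num.sqrt n%:R * ((n%:R * (n%:R - 1))^-1 *
    \sum_(i < n) \sum_(k < n | i != k) ((1 + tnth xi i) * (1 + tnth xi k) - 1) *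
      tnth (h (tnth t i) (tnth t k)) j) / 2 | j < D].

(** The factor 1/2 of the statistic cancels against the two orders of each pair, since [csum] runs
    over [i < k] only. *)
Definition sc : R := Num.sqrt n%:R / (n%:R * (n%:R - 1)).

Definition hlin (k : nat) (x : S) : D.-tuple R := tscale (Num.sqrt n%:R)^-1 (hg x).

Definition hrem (t : n.-tuple S) := tscale sc (csum (fun _ _ => hdeg) t).

Lemma sqrt_div : (Num.sqrt n%:R)^-1 = Num.sqrt n%:R / n%:R :> R.
Proof.
have s0 : 0 < Num.sqrt n%:R :> R by rewrite sqrtr_gt0.
by rewrite -[X in _ / X](sqr_sqrtr (ltW N0)) expr2 invfM mulrA divff ?mul1r ?gt_eqF.
Qed.

Lemma hT_decomp t : hT t = tadd (ssum hlin t) (hrem t).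
Proof.
apply: eq_from_tnth => j; rewrite tnth_tadd /hrem tnth_tscale ssumE csumE tnth_mktuple.
pose p (i : 'I_n) := tnth (hg (tnth t i)) j.
have hE : \sum_(i < n) \sum_(k < n | i != k) tnth (h (tnth t i) (tnth t k)) j =
    \sum_(i < n) \sum_(k < n | i != k) (p i + p k) * 1 +
    \sum_(i < n) \sum_(k < n | i != k) tnth (hdeg (tnth t i) (tnth t k)) j.
  rewrite -big_split; apply: eq_bigr => i _; rewrite -big_split; apply: eq_bigr => k _.
  by rewrite tnth_hdeg /= /p; ring.
rewrite hE (@sum_neq_weights R n (fun _ _ => 1) p)// sum_neq_sym; last first.
  by move=> i k; rewrite hdegC.
under [X in 2 * X]eq_bigr do rewrite card_neq.
rewrite -mulr_suml.
have -> : \sum_(i < n) tnth (hlin (n - i.+1)%N (tnth t i)) j =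
    Num.sqrt n%:R / n%:R * \sum_i p i.
  by rewrite -sqrt_div mulr_sumr; apply: eq_bigr => i _; rewrite tnth_tscale.
rewrite /sc; move: (\sum_i p i) (\sum_i \sum_(k | _) _) (Num.sqrt n%:R) => a b s.
have := N0; have := N1; move: (n%:R : R) => N h1 h3.
by field; rewrite !gt_eqF.
Qed.

Lemma measurable_hlin k : measurable_fun setT (hlin k).
Proof.
apply/measurable_fun_tnthP => j /=.
rewrite (_ : _ \o _ = fun x => (Num.sqrt n%:R)^-1 * tnth (hg x) j); last first.
  by apply/funext => x; rewrite /= tnth_tscale.
by apply: measurable_funM => //; exact: (measurableT_comp (measurable_tnth j) measurable_hg).
Qed.

Lemma measurable_tscale2 {d'} {T' : measurableType d'} (z : R) (f : T' -> D.-tuple R) :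
  measurable_fun setT f -> measurable_fun setT (fun x => tscale z (f x)).
Proof.
move=> mf; apply/measurable_fun_tnthP => j /=.
rewrite (_ : _ \o _ = fun x => z * tnth (f x) j); last first.
  by apply/funext => x; rewrite /= tnth_tscale.
by apply: measurable_funM => //; exact: (measurableT_comp (measurable_tnth j) mf).
Qed.

Lemma measurable_hrem : measurable_fun setT hrem.
Proof. by apply: measurable_tscale2; apply: measurable_csum => k l; exact: measurable_hdeg. Qed.

Lemma measurable_hT : measurable_fun setT hT.
Proof.
rewrite (funext hT_decomp); apply: measurable_tadd; last exact: measurable_hrem.
by apply: measurable_ssum => k; exact: measurable_hlin.
Qed.

Lemma sc2 : sc ^+ 2 * (n%:R * (n%:R - 1) / 2) = (2 * (n%:R - 1))^-1.
Proof.
rewrite /sc exprMn sqr_sqrtr ?(ltW N0)//; have := N0; have := N1.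
by move: (n%:R : R) => N h1 h3; field; rewrite !gt_eqF.
Qed.

Lemma sum_lt_cst : \sum_(i < n) \sum_(k < n | (i < k)%N) (1 : R) = n%:R * (n%:R - 1) / 2.
Proof.
apply: (mulfI (_ : (2 : R) != 0)) => //.
rewrite -(@sum_neq_sym R n (fun _ _ => 1))//; under eq_bigr do rewrite card_neq.
by rewrite sumr_const card_ord -[_ *+ n]mulr_natl; field.
Qed.

Variable m : nat.
Hypothesis Dm : (D <= 2 ^ m)%N.
Let cc : R := 16 * m.+1%:R.

Lemma hrem_sq : (\int[prodn F n]_t (supn (hrem t) ^+ 2)%:E <=
  (cc ^+ 2 * (9 * tau2) / (2 * (n%:R - 1)))%:E)%E.
Proof.
have mc : measurable_fun setT (fun t : n.-tuple S => csum (fun _ _ => hdeg) t).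
  by apply: measurable_csum => k l; exact: measurable_hdeg.
under eq_integral do rewrite /hrem supn_tscale exprMn real_normK ?num_real// EFinM.
rewrite ge0_integralZl//; last 3 first.
- apply/measurable_EFinP; apply: measurable_funX.
  exact: (measurableT_comp measurable_supn mc).
- by move=> t _; rewrite lee_fin sqr_ge0.
- by rewrite lee_fin sqr_ge0.
have C := csum_sq (P := F) (f := fun _ _ => hdeg) Dm n.
apply: (@le_trans _ _ ((sc ^+ 2)%:E * (cc%:E * (cc%:E *
    \sum_(k < n) \sum_(l < k) (9 * tau2)%:E)))%E).
  apply: lee_wpmul2l; first by rewrite lee_fin sqr_ge0.
  apply: le_trans (C _ _ _) _.
  - by move=> _ _; exact: measurable_hdeg.
  - move=> _ _ w j; have [i1 e1] := hdeg_mean w j.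
    by split; [move: i1; apply: intg_ext => z; rewrite hdegC|rewrite -[RHS]e1; apply: Ex_ext => z; rewrite hdegC].
  - by move=> _ _ z j; exact: hdeg_mean.
  have c0 : (0 <= cc%:E)%E by rewrite lee_fin mulr_ge0 ?ler0n.
  do 2![apply: lee_wpmul2l => //]; apply: lee_sum => k _; apply: lee_sum => l _.
  exact: hdeg_sq.
under eq_bigr do rewrite sumEFin.
rewrite sumEFin -!EFinM lee_fin le_eqVlt; apply/orP; left; apply/eqP.
have -> : \sum_(k < n) \sum_(l < k) (9 * tau2) = 9 * tau2 * (n%:R * (n%:R - 1) / 2).
  rewrite -sum_lt_cst -(@sum_rev_lt R n (fun _ _ => 1)) mulr_sumr; apply: eq_bigr => k _.
  by rewrite mulr_sumr; apply: eq_bigr => l _; rewrite mulr1.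
have := sc2; move: (_ / 2) (sc ^+ 2) => u s E.
rewrite mulrA -[RHS]mulrA -[(2 * _)^-1]E; ring.
Qed.

Section bootstrap.
Variable t : n.-tuple S.
Let i0 : 'I_n := Ordinal (ltnW n2).
Let hn p q : D.-tuple R := h (nth (tnth t i0) t p) (nth (tnth t i0) t q).

Let hnE (i k : 'I_n) : hn i k = h (tnth t i) (tnth t k).
Proof. by rewrite /hn -!tnth_nth. Qed.

Definition ghat (i : 'I_n) : D.-tuple R :=
  [tuple (n%:R - 1)^-1 * \sum_(k < n | i != k) tnth (h (tnth t i) (tnth t k)) j | j < D].

(** Indexed from the end, as [glin] requires, and extended arbitrarily beyond the sample size. *)
Definition bcoef (k : nat) : D.-tuple R :=
  tscale (Num.sqrt n%:R)^-1 (nth tzero [seq ghat i | i <- enum 'I_n] (n - k.+1)).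

Definition Hbar : R := (n%:R * (n%:R - 1))^-1 *
  \sum_(i < n) \sum_(k < n | i != k) supn (h (tnth t i) (tnth t k)) ^+ 2.

Let fq (k l : nat) (z w : R) := tscale (z * w) (hn (n - k.+1) (n - l.+1)).

Definition brem (xi : n.-tuple R) := tscale sc (csum fq xi).

Lemma bcoefE (i : 'I_n) : bcoef (n - i.+1)%N = tscale (Num.sqrt n%:R)^-1 (ghat i).
Proof.
rewrite /bcoef; congr tscale.
have -> : (n - (n - i.+1).+1 = i)%N by rewrite subnSK ?subKn// ltnW.
by rewrite (nth_map i0) ?size_enum_ord// nth_ord_enum.
Qed.

Lemma hTb_decomp xi : hTb t xi = tadd (glin bcoef xi) (brem xi).
Proof.
apply: eq_from_tnth => j; rewrite tnth_tadd /brem tnth_tscale csumE tnth_glin tnth_mktuple.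
pose A i k := tnth (h (tnth t i) (tnth t k)) j.
have AC i k : A i k = A k i by rewrite /A hC.
have -> : \sum_(i < n) \sum_(k < n | i != k) ((1 + tnth xi i) * (1 + tnth xi k) - 1) * A i k =
    \sum_(i < n) \sum_(k < n | i != k) (tnth xi i + tnth xi k) * A i k +
    \sum_(i < n) \sum_(k < n | i != k) tnth xi i * tnth xi k * A i k.
  rewrite -big_split; apply: eq_bigr => i _; rewrite -big_split; apply: eq_bigr => k _.
  by rewrite /=; ring.
rewrite sum_neq_weights// sum_neq_sym; last by move=> i k; rewrite AC; ring.
have -> : \sum_(i < n) tnth xi i * tnth (bcoef (n - i.+1)) j =
    Num.sqrt n%:R / n%:R / (n%:R - 1) * \sum_i tnth xi i * \sum_(k | i != k) A i k.
  rewrite -sqrt_div mulr_sumr; apply: eq_bigr => i _.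
  by rewrite bcoefE tnth_tscale tnth_mktuple /A; ring.
have -> : \sum_(i < n) \sum_(k < n | (i < k)%N)
      tnth (fq (n - i.+1) (n - k.+1) (tnth xi i) (tnth xi k)) j =
    \sum_(i < n) \sum_(k < n | (i < k)%N) tnth xi i * tnth xi k * A i k.
  apply: eq_bigr => i _; apply: eq_bigr => k _; rewrite /fq tnth_tscale; congr (_ * _).
  have -> : (n - (n - i.+1).+1 = i)%N by rewrite subnSK ?subKn// ltnW.
  have -> : (n - (n - k.+1).+1 = k)%N by rewrite subnSK ?subKn// ltnW.
  by rewrite hnE.
rewrite /sc; move: (\sum_i tnth xi i * _) (\sum_i \sum_(k | _) _) (Num.sqrt n%:R) => a b s.
have := N0; have := N1; move: (n%:R : R) => N h1 h3.
by field; rewrite !gt_eqF.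
Qed.

Lemma measurable_brem : measurable_fun setT brem.
Proof.
apply: measurable_tscale2; apply: measurable_csum => k l; rewrite /fq.
apply: (measurableT_comp (measurable_tscale _)); exact: measurable_funM.
Qed.

Lemma measurable_hTb : measurable_fun setT (hTb t).
Proof.
rewrite (funext hTb_decomp); apply: measurable_tadd; last exact: measurable_brem.
exact: (measurable_glin _ (n := n)).
Qed.

(** The centred weights are independent with variance 1, so for a fixed sample the chaos is
    degenerate in both arguments and [csum_sq] applies as it does to [hrem]. *)
Lemma brem_sq : (\int[prodn N01 n]_xi (supn (brem xi) ^+ 2)%:E <=
  (cc ^+ 2 * Hbar / (2 * (n%:R - 1)))%:E)%E.
Proof.
have mf k l : measurable_fun setT (fun z : R * R => fq k l z.1 z.2).
  by rewrite /fq; apply: (measurableT_comp (measurable_tscale _)); exact: measurable_funM.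
have mc : measurable_fun setT (fun xi : n.-tuple R => csum fq xi) by exact: measurable_csum.
under eq_integral do rewrite /brem supn_tscale exprMn real_normK ?num_real// EFinM.
rewrite ge0_integralZl//; last 3 first.
- apply/measurable_EFinP; apply: measurable_funX.
  exact: (measurableT_comp measurable_supn mc).
- by move=> xi _; rewrite lee_fin sqr_ge0.
- by rewrite lee_fin sqr_ge0.
have inner k l : (\int[N01]_z \int[N01]_w (supn (fq k l z w) ^+ 2)%:E =
    (supn (hn (n - k.+1) (n - l.+1)) ^+ 2)%:E)%E.
  set b := supn (hn _ _) ^+ 2.
  have isq := @intg_N01_sq R.
  have E z : (\int[N01]_w (supn (fq k l z w) ^+ 2)%:E = (b * z ^+ 2)%:E)%E.
    under eq_integral => w _.
      rewrite /fq supn_tscale exprMn real_normK ?num_real// exprMn -/b.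
      rewrite (_ : z ^+ 2 * w ^+ 2 * b = b * z ^+ 2 * w ^+ 2); last by ring.
      over.
    by rewrite ExE ?(ExZ _ isq) ?Ex_N01_sq ?mulr1//; exact: intgZ.
  under eq_integral do rewrite E.
  by rewrite ExE ?(ExZ _ isq) ?Ex_N01_sq ?mulr1//; exact: intgZ.
have C := csum_sq (P := N01) (f := fq) Dm n.
apply: (@le_trans _ _ ((sc ^+ 2)%:E * (cc%:E * (cc%:E *
    \sum_(k < n) \sum_(l < k) (supn (hn (n - k.+1) (n - l.+1)) ^+ 2)%:E)))%E).
  apply: lee_wpmul2l; first by rewrite lee_fin sqr_ge0.
  apply: le_trans (C mf _ _) _.
  - move=> k l w j; rewrite /fq.
    have E : (fun z => tnth (tscale (z * w) (hn (n - k.+1) (n - l.+1))) j) =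
        fun z => w * tnth (hn (n - k.+1) (n - l.+1)) j * z.
      by apply/funext => z; rewrite tnth_tscale; ring.
    rewrite E; split; first by apply: intgZ; exact: intg_N01_id.
    by rewrite ExZ ?Ex_N01_id ?mulr0//; exact: intg_N01_id.
  - move=> k l z j; rewrite /fq.
    have E : (fun w => tnth (tscale (z * w) (hn (n - k.+1) (n - l.+1))) j) =
        fun w => z * tnth (hn (n - k.+1) (n - l.+1)) j * w.
      by apply/funext => w; rewrite tnth_tscale; ring.
    rewrite E; split; first by apply: intgZ; exact: intg_N01_id.
    by rewrite ExZ ?Ex_N01_id ?mulr0//; exact: intg_N01_id.
  have c0 : (0 <= cc%:E)%E by rewrite lee_fin mulr_ge0 ?ler0n.
  do 2![apply: lee_wpmul2l => //]; apply: lee_sum => k _; apply: lee_sum => l _.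
  by rewrite inner.
under eq_bigr do rewrite sumEFin.
rewrite sumEFin -!EFinM lee_fin le_eqVlt; apply/orP; left; apply/eqP.
rewrite (@sum_rev_lt R n (fun p q => supn (hn p q) ^+ 2)).
have -> : \sum_(i < n) \sum_(k < n | (i < k)%N) supn (hn i k) ^+ 2 =
    Hbar * (n%:R * (n%:R - 1) / 2).
  have := @sum_neq_sym R n (fun i k => supn (h (tnth t i) (tnth t k)) ^+ 2).
  rewrite /Hbar => -> => [|i k]; last by rewrite hC.
  have -> : \sum_(i < n) \sum_(k < n | (i < k)%N) supn (hn i k) ^+ 2 =
      \sum_(i < n) \sum_(k < n | (i < k)%N) supn (h (tnth t i) (tnth t k)) ^+ 2.
    by apply: eq_bigr => i _; apply: eq_bigr => k _; rewrite hnE.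
  move: (\sum_i \sum_(k | _) _) => a; have := N0; have := N1.
  by move: (n%:R : R) => N h1 h3; field; rewrite !gt_eqF.
have := sc2; move: (_ / 2) (sc ^+ 2) => u s E.
rewrite mulrA -[RHS]mulrA -[(2 * _)^-1]E; ring.
Qed.

End bootstrap.
End statistics.
End kernel.

(** * Concentration of the empirical covariance *)

Section finite_union.
Context {d} {T : measurableType d} {R : realType} (P : probability T R).

Lemma measurable_exists (I : finType) (A : I -> set T) :
  (forall i, measurable (A i)) -> measurable [set x | exists i, A i x].
Proof.
move=> mA; rewrite (_ : [set x | _] = \bigcup_(i in [set: I]) A i).
  by apply: fin_bigcup_measurable.
by apply/seteqP; split => [x [i Ai]|x [i _ Ai]]; exists i.
Qed.

Lemma pr_exists (I : finType) (A : I -> set T) (c : R) :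
  (forall i, measurable (A i)) -> (forall i, pr P (A i) <= c) ->
  pr P [set x | exists i, A i x] <= #|I|%:R * c.
Proof.
move=> mA Ac; have mE := measurable_exists mA.
rewrite -Ex_indic//; apply: (@le_trans _ _ (Ex P (fun x => \sum_i \1_(A i) x))).
  apply: Ex_le; [exact: intg_indic|by apply: intg_sum => i _; exact: intg_indic|].
  move=> x; rewrite {1}indicE; case: (boolP (x \in _)) => [|_]; last first.
    by apply: sumr_ge0 => i _; rewrite indicE ler0n.
  rewrite inE => -[i Ai]; rewrite (bigD1 i)//= {1}indicE mem_set//= lerDl.
  by apply: sumr_ge0 => k _; rewrite indicE ler0n.
rewrite Ex_sum; last by move=> i; exact: intg_indic.
rewrite mulr_natl -sumr_const; apply: ler_sum => i _.
by rewrite Ex_indic.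
Qed.

End finite_union.

Section independent_pair.
Context {d} {T : measurableType d} {R : realType} (P : probability T R).

Lemma Ex_indep2 (u v : T -> R) : intg P u -> intg P v ->
  intg P (fun x => u x ^+ 2) -> intg P (fun x => v x ^+ 2) ->
  intg (prodn P 2) (fun s => u (tnth s ord0) * v (tnth s ord_max)) /\
  Ex (prodn P 2) (fun s => u (tnth s ord0) * v (tnth s ord_max)) = Ex P u * Ex P v.
Proof.
move=> iu iv iu2 iv2; have mu := intg_measurable iu; have mv := intg_measurable iv.
have ia : intg (prodn P 2) (fun s => u (tnth s ord0) ^+ 2 + v (tnth s ord_max) ^+ 2).
  by apply: intgD; [exact: (prodn_coord ord0 iu2).1|exact: (prodn_coord ord_max iv2).1].
have m1 : measurable_fun setT (fun s : 2.-tuple T => u (tnth s ord0) * v (tnth s ord_max)).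
  by apply: measurable_funM; [apply: (measurableT_comp mu)|apply: (measurableT_comp mv)];
    exact: measurable_tnth.
have i1 : intg (prodn P 2) (fun s => u (tnth s ord0) * v (tnth s ord_max)).
  apply: (intg_le m1 _ ia) => s; rewrite normrM -(real_normK (num_real (u _))) -(real_normK (num_real (v _))).
  have := sqr_ge0 (`|u (tnth s ord0)| - `|v (tnth s ord_max)|).
  have := normr_ge0 (u (tnth s ord0)); have := normr_ge0 (v (tnth s ord_max)).
  by move: `|u _| `|v _| => a b a0 b0; rewrite !expr2; nra.
have o01 : (ord0 : 'I_2) != ord_max by [].
have i2 : intg (P \x P)%E (fun z => u z.1 * v z.2).
  apply: (meq_intg (prodn_pair P o01)); apply/intg_pushP => //.
  by apply: measurable_funM; exact: measurableT_comp.
split => //; have [_] := Ex_prodn_pair o01 i2 => /= ->.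
rewrite Ex_prod//; last by move=> x; exact: (intgZ (u x) iv).
rewrite mulrC -(ExZ _ iu); apply: Ex_ext => x /=.
by rewrite ExZ// mulrC.
Qed.

End independent_pair.

Section covariance.
Context {R : realType} {d : measure_display} {S : measurableType d} {D : nat}.
Variables (F : probability S R) (h : S -> S -> D.-tuple R).
Hypothesis mh : measurable_fun setT (fun z : S * S => h z.1 z.2).
Hypothesis hC : forall x y, h x y = h y x.
Hypothesis hsec : forall x, intg F (fun y => supn (h x y) ^+ 2).
Hypothesis h2 : intg (F \x F)%E (fun z => supn (h z.1 z.2) ^+ 2).

(** Excess of the squared kernel over a truncation level. Its mean [tau] is the only route by which
    the exponential or the envelope condition enters. *)
Definition rho (M : R) (z : S * S) : R :=
  if M < supn (h z.1 z.2) then supn (h z.1 z.2) ^+ 2 else 0.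

Definition tau (M : R) : R := Ex (F \x F)%E (rho M).

Let mN : measurable_fun setT (fun z : S * S => supn (h z.1 z.2)).
Proof. exact: (measurableT_comp measurable_supn mh). Qed.

Lemma rho_ge0 M z : 0 <= rho M z.
Proof. by rewrite /rho; case: ifP => // _; exact: sqr_ge0. Qed.

Lemma measurable_rho M : measurable_fun setT (rho M).
Proof.
rewrite /rho; apply: measurable_fun_ifT => //; last exact: measurable_funX.
exact: measurable_fun_ltr.
Qed.

Lemma intg_rho M : intg (F \x F)%E (rho M).
Proof.
apply: (intg_le (measurable_rho M) _ h2) => z; rewrite ger0_norm ?rho_ge0//.
by rewrite /rho; case: ifP => // _; exact: sqr_ge0.
Qed.

Lemma sq_le_rho M z : 0 <= M -> supn (h z.1 z.2) ^+ 2 <= M ^+ 2 + rho M z.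
Proof.
move=> M0; rewrite /rho; case: ltP => hM; first by rewrite lerDr sqr_ge0.
by rewrite addr0; apply: lerXn2r; rewrite ?nnegrE ?supn_ge0.
Qed.

Lemma tau2_le M : 0 <= M -> tau2 F h <= M ^+ 2 + tau M.
Proof.
move=> M0; rewrite -[M ^+ 2](Ex_cst (F \x F)%E) -ExD; [|exact: intg_cst|exact: intg_rho].
apply: Ex_le => //; first by apply: intgD; [exact: intg_cst|exact: intg_rho].
by move=> z; exact: sq_le_rho.
Qed.

Let o0 : 'I_3 := Ordinal (isT : 0 < 3)%N.
Let o1 : 'I_3 := Ordinal (isT : 1 < 3)%N.
Let o2 : 'I_3 := Ordinal (isT : 2 < 3)%N.

Definition Sig j k : R := Ex F (fun x => tnth (hg F h x) j * tnth (hg F h x) k).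

(** Not symmetrized, since all ordered triples are summed. Its mean is [Sig j k] because, given the
    shared argument, the two factors are independent. *)
Definition Kfull j k (s : 3.-tuple S) : R :=
  tnth (h (tnth s o0) (tnth s o1)) j * tnth (h (tnth s o0) (tnth s o2)) k.

Definition Ktr M j k (s : 3.-tuple S) : R :=
  if (supn (h (tnth s o0) (tnth s o1)) <= M) && (supn (h (tnth s o0) (tnth s o2)) <= M)
  then Kfull j k s else 0.

Let mpair (a b : 'I_3) : measurable_fun setT (fun s : 3.-tuple S => (tnth s a, tnth s b)).
Proof. by apply: measurable_fun_pair; exact: measurable_tnth. Qed.

Let mhp a b j : measurable_fun setT (fun s : 3.-tuple S => tnth (h (tnth s a) (tnth s b)) j).
Proof. exact: (measurableT_comp (measurable_hj mh j) (mpair a b)). Qed.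

Lemma measurable_Kfull j k : measurable_fun setT (Kfull j k).
Proof. by apply: measurable_funM; exact: mhp. Qed.

Lemma measurable_Ktr M j k : measurable_fun setT (Ktr M j k).
Proof.
rewrite /Ktr; apply: measurable_fun_ifT => //; last exact: measurable_Kfull.
by apply: measurable_and; apply: measurable_fun_ler => //;
  [exact: (measurableT_comp mN (mpair o0 o1))|exact: (measurableT_comp mN (mpair o0 o2))].
Qed.

Let i01 (f : S * S -> R) : intg (F \x F)%E f ->
  intg (prodn F 3) (fun s => f (tnth s o0, tnth s o1)) /\
  Ex (prodn F 3) (fun s => f (tnth s o0, tnth s o1)) = Ex (F \x F)%E f.
Proof. exact: Ex_prodn_pair. Qed.

Let i02 (f : S * S -> R) : intg (F \x F)%E f ->
  intg (prodn F 3) (fun s => f (tnth s o0, tnth s o2)) /\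
  Ex (prodn F 3) (fun s => f (tnth s o0, tnth s o2)) = Ex (F \x F)%E f.
Proof. exact: Ex_prodn_pair. Qed.

Lemma normM_le_sq (a b : R) : `|a * b| <= a ^+ 2 + b ^+ 2.
Proof.
rewrite normrM -(real_normK (num_real a)) -(real_normK (num_real b)).
have := sqr_ge0 (`|a| - `|b|); have := normr_ge0 a; have := normr_ge0 b.
by move: `|a| `|b| => u v u0 v0; rewrite !expr2; nra.
Qed.

Lemma intg_Kfull j k : intg (prodn F 3) (Kfull j k).
Proof.
apply: (intg_le (measurable_Kfull j k) _ (intgD (i01 h2).1 (i02 h2).1)) => s.
by apply: le_trans (normM_le_sq _ _) _; rewrite lerD// coord_sq_le.
Qed.

Lemma Ex_Kfull j k : Ex (prodn F 3) (Kfull j k) = Sig j k.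
Proof.
have mK := measurable_Kfull j k; have iK := intg_Kfull j k.
have iu x j' : intg F (fun y => tnth (h x y) j') by exact: intg_hj.
have iu2 x j' : intg F (fun y => tnth (h x y) j' ^+ 2).
  apply: (intg_le _ _ (hsec x)) => [|y]; last by rewrite ger0_norm ?sqr_ge0// coord_sq_le.
  by apply: measurable_funX; exact: (intg_measurable (iu x j')).
have KE x (s : 2.-tuple S) : Kfull j k [tuple of x :: s] =
    tnth (h x (tnth s ord0)) j * tnth (h x (tnth s ord_max)) k.
  rewrite /Kfull; congr (tnth (h _ _) _ * tnth (h _ _) _); rewrite (tnth_nth x)//=.
    by rewrite (tnth_nth x).
  by rewrite (tnth_nth x).
have I2 x := Ex_indep2 (iu x j) (iu x k) (iu2 x j) (iu2 x k).
rewrite Ex_prodnS// Ex_prod; last 2 first.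
- exact/(intg_prodnS _ mK).
- by move=> x; have := (I2 x).1; apply: intg_ext => s; rewrite /= KE.
apply: Ex_ext => x; rewrite !tnth_mktuple -(I2 x).2.
by apply: Ex_ext => s; rewrite /= KE.
Qed.

Lemma Ktr_close M j k s : 0 <= M -> `|Kfull j k s - Ktr M j k s| <=
  rho M (tnth s o0, tnth s o1) + rho M (tnth s o0, tnth s o2).
Proof.
move=> M0; rewrite /Ktr /rho /=; set a := supn _; set b := supn _.
have a0 : 0 <= a by exact: supn_ge0.
have b0 : 0 <= b by exact: supn_ge0.
have Kab : `|Kfull j k s| <= a * b by rewrite normrM; apply: ler_pM => //; exact: le_supn.
case: (leP a M) => ha; case: (leP b M) => hb /=; first by rewrite subrr normr0 addr0.
all: rewrite subr0 ?add0r ?addr0; apply: le_trans Kab _.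
- by rewrite expr2 ler_wpM2r//; exact: le_trans ha (ltW hb).
- by rewrite expr2 ler_wpM2l//; exact: le_trans hb (ltW ha).
- by have := sqr_ge0 (a - b); rewrite !expr2; nra.
Qed.

Lemma Ktr_le M j k s : 0 <= M -> `|Ktr M j k s| <= M ^+ 2.
Proof.
move=> M0; rewrite /Ktr; case: ifP => [/andP[ha hb]|_]; last by rewrite normr0 sqr_ge0.
rewrite normrM expr2; apply: ler_pM => //.
  exact: le_trans (le_supn _ _) ha.
exact: le_trans (le_supn _ _) hb.
Qed.

Lemma intg_Ktr M j k : 0 <= M -> intg (prodn F 3) (Ktr M j k).
Proof.
by move=> M0; apply: (intg_bounded _ (measurable_Ktr M j k)) => s; exact: Ktr_le.
Qed.

Lemma Ktr_mean M j k : 0 <= M ->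
  `|Ex (prodn F 3) (Ktr M j k) - Sig j k| <= 2 * tau M.
Proof.
move=> M0; rewrite -Ex_Kfull distrC -ExB; [|exact: intg_Kfull|exact: intg_Ktr].
have iB : intg (prodn F 3) (fun s => Kfull j k s - Ktr M j k s).
  by apply: intgB; [exact: intg_Kfull|exact: intg_Ktr].
apply: le_trans (Ex_abs iB) _.
have [j1 e1] := i01 (intg_rho M); have [j2 e2] := i02 (intg_rho M).
rewrite mulr_natl mulr2n -{1}[tau M]e1 -[tau M]e2 -ExD//.
apply: Ex_le; [exact: intg_abs|exact: intgD|move=> s; exact: Ktr_close].
Qed.

(** From $2(ab)^2\le a^4+b^4$: the variance proxy is a coordinatewise fourth moment, free of the
    dimension and of the truncation level. *)
Lemma Ktr_sq M (s2 : R) j k : 0 <= M ->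
  (forall j, intg (F \x F)%E (fun z => tnth (h z.1 z.2) j ^+ 4) /\
     Ex (F \x F)%E (fun z => tnth (h z.1 z.2) j ^+ 4) <= s2) ->
  Ex (prodn F 3) (fun s => Ktr M j k s ^+ 2) <= s2.
Proof.
move=> M0 h4; have [j1 e1] := i01 (h4 j).1; have [j2 e2] := i02 (h4 k).1.
have ia : intg (prodn F 3) (fun s => 2^-1 * tnth (h (tnth s o0) (tnth s o1)) j ^+ 4 +
    2^-1 * tnth (h (tnth s o0) (tnth s o2)) k ^+ 4).
  by apply: intgD; exact: intgZ.
apply: (@le_trans _ _ (Ex (prodn F 3) (fun s => 2^-1 * tnth (h (tnth s o0) (tnth s o1)) j ^+ 4 +
    2^-1 * tnth (h (tnth s o0) (tnth s o2)) k ^+ 4))).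
  apply: Ex_le => //.
    apply: (@intg_bounded _ _ _ _ _ (M ^+ 2 ^+ 2)); first by apply: measurable_funX; exact: measurable_Ktr.
    by move=> s; rewrite normrX; apply: lerXn2r; rewrite ?nnegrE ?sqr_ge0// Ktr_le.
  move=> s; apply: (@le_trans _ _ (Kfull j k s ^+ 2)).
    by rewrite /Ktr; case: ifP => // _; rewrite expr0n/= sqr_ge0.
  rewrite /Kfull; move: (tnth (h _ _) j) (tnth (h _ _) k) => a b.
  have := sqr_ge0 (a ^+ 2 - b ^+ 2).
  have -> : (a ^+ 2 - b ^+ 2) ^+ 2 = a ^+ 4 + b ^+ 4 - 2 * (a * b) ^+ 2 by ring.
  by move: (a ^+ 4) (b ^+ 4) ((a * b) ^+ 2) => x y z; lra.
rewrite ExD; [|exact: intgZ|exact: intgZ].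
rewrite (ExZ _ j1) (ExZ _ j2) /= in e1 e2 *.
have := (h4 j).2; have := (h4 k).2; rewrite -e1 -e2.
by move=> a1 a2; move: a1 a2; set x := Ex _ _; set y := Ex _ _; lra.
Qed.

Section sample.
Variable n : nat.
Hypothesis n4 : (3 < n)%N.
Let N0 : 0 < n%:R :> R. Proof. by rewrite ltr0n; lia. Qed.
Let N1 : 0 < n%:R - 1 :> R. Proof. by rewrite subr_gt0 ltr1n; lia. Qed.
Let N2 : 0 < n%:R - 2 :> R. Proof. by rewrite subr_gt0 ltr_nat; lia. Qed.

Definition Shat (t : n.-tuple S) j k : R :=
  n%:R^-1 * \sum_(i < n) tnth (ghat h t i) j * tnth (ghat h t i) k.

(** Empirical counterpart of [tau]. It controls the effect of truncation on the sample, and Markov's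
    inequality suffices for it because its mean can be made small. *)
Definition rbar M (t : n.-tuple S) : R := (n%:R * (n%:R - 1))^-1 *
  \sum_(i < n) \sum_(k < n | i != k) rho M (tnth t i, tnth t k).

Lemma rbar_ge0 M t : 0 <= rbar M t.
Proof.
rewrite mulr_ge0 ?invr_ge0 ?mulr_ge0 ?(ltW N0) ?(ltW N1)//.
by do 2![apply: sumr_ge0 => ? _]; exact: rho_ge0.
Qed.

Lemma rbar_mean M : intg (prodn F n) (rbar M) /\ Ex (prodn F n) (rbar M) = tau M.
Proof.
have I (i k : 'I_n) (ik : i != k) := Ex_prodn_pair ik (intg_rho M).
have J (i k : 'I_n) : intg (prodn F n) (fun t => if i != k then rho M (tnth t i, tnth t k) else 0).
  by case: (boolP (i != k)) => [ik|_]; [exact: (I i k ik).1|exact: intg_cst].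
have i1 : intg (prodn F n) (fun t =>
    \sum_(i < n) \sum_(k < n | i != k) rho M (tnth t i, tnth t k)).
  apply: intg_sum => i _; under eq_fun do rewrite big_mkcond; exact: intg_sum.
split; first exact: intgZ.
rewrite (ExZ _ i1).
have -> : Ex (prodn F n) (fun t =>
    \sum_(i < n) \sum_(k < n | i != k) rho M (tnth t i, tnth t k)) =
    \sum_(i < n) \sum_(k < n | i != k) tau M.
  rewrite Ex_sum; last by move=> i; under eq_fun do rewrite big_mkcond; exact: intg_sum.
  apply: eq_bigr => i _; under [X in Ex _ X]eq_fun do rewrite big_mkcond.
  rewrite Ex_sum// [RHS]big_mkcond; apply: eq_bigr => k _.
  by case: (boolP (i != k)) => [ik|_]; [exact: (I i k ik).2|exact: Ex_cst].
have -> : \sum_(i < n) \sum_(k < n | i != k) tau M = n%:R * (n%:R - 1) * tau M.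
  transitivity (\sum_(i < n) (n%:R - 1) * tau M).
    by apply: eq_bigr => i _; rewrite -(card_neq i) mulr_suml; apply: eq_bigr => k _; rewrite mul1r.
  by rewrite sumr_const card_ord -[LHS]mulr_natl mulrA.
by rewrite mulKf// gt_eqF// mulr_gt0.
Qed.

Lemma Hbar_le M t : 0 <= M -> Hbar h t <= M ^+ 2 + rbar M t.
Proof.
move=> M0; have q0 : 0 < n%:R * (n%:R - 1) :> R by rewrite mulr_gt0.
rewrite /Hbar /rbar -(ler_pM2l q0) mulVKf ?gt_eqF// mulrDr mulVKf ?gt_eqF//.
have -> : n%:R * (n%:R - 1) * M ^+ 2 = \sum_(i < n) \sum_(k < n | i != k) M ^+ 2.
  transitivity (\sum_(i < n) (n%:R - 1) * M ^+ 2).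
    by rewrite sumr_const card_ord -[RHS]mulr_natl mulrA.
  by apply: eq_bigr => i _; rewrite -(card_neq i) mulr_suml; apply: eq_bigr => k _; rewrite mul1r.
rewrite -big_split; apply: ler_sum => i _; rewrite -big_split; apply: ler_sum => k _.
exact: (@sq_le_rho M (tnth t i, tnth t k)).
Qed.

Lemma sum_dist3 (f : 'I_n -> 'I_n -> 'I_n -> R) :
  \sum_(p | dist3 p) f p.1.1 p.1.2 p.2 =
  \sum_i \sum_(k | i != k) \sum_(l | (i != l) && (k != l)) f i k l.
Proof.
rewrite (eq_bigr (fun p : 'I_n * 'I_n * 'I_n => (fun q l => f q.1 q.2 l) p.1 p.2))//.
rewrite (eq_bigl (fun p : 'I_n * 'I_n * 'I_n => (p.1.1 != p.1.2) &&
  ((p.1.1 != p.2) && (p.1.2 != p.2))))//.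
rewrite -(pair_big_dep (fun q : 'I_n * 'I_n => q.1 != q.2)
  (fun q l => (q.1 != l) && (q.2 != l)) (fun q l => f q.1 q.2 l))/=.
by rewrite (pair_big_dep xpredT (fun i k => i != k)
  (fun i k => \sum_(l | (i != l) && (k != l)) f i k l))/=.
Qed.

Lemma card_neq2 (i k : 'I_n) : i != k ->
  \sum_(l | (i != l) && (k != l)) (1 : R) = n%:R - 2.
Proof.
move=> ik; have := card_neq (R := R) i; rewrite (bigD1 k)//= => /(congr1 (fun x => x - 1)).
rewrite addrAC subrr add0r => E; have -> : n%:R - 2 = n%:R - 1 - 1 :> R by ring.
rewrite -E.
by apply: eq_bigl => l; rewrite [l == k]eq_sym.
Qed.

Lemma cnt3E : cnt3 n = n%:R * (n%:R - 1) * (n%:R - 2) :> R.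
Proof.
rewrite /cnt3 (sum_dist3 (fun _ _ _ => 1)).
transitivity (\sum_(i < n) \sum_(k < n | i != k) (n%:R - 2 : R)).
  by apply: eq_bigr => i _; apply: eq_bigr => k ik; exact: card_neq2.
transitivity (\sum_(i < n) (n%:R - 1) * (n%:R - 2 : R)).
  by apply: eq_bigr => i _; rewrite -(card_neq i) mulr_suml; apply: eq_bigr => k _; rewrite mul1r.
by rewrite sumr_const card_ord -[LHS]mulr_natl mulrA.
Qed.

(** In the product of two means over indices different from [i], distinct indices give the
    U-statistic of order 3 and coinciding ones a diagonal of relative order $1/n$. *)
Lemma ShatE t j k : Shat t j k = (n%:R * (n%:R - 1) ^+ 2)^-1 *
  (usum3 (Kfull j k) t +
   \sum_(i < n) \sum_(l < n | i != l) tnth (h (tnth t i) (tnth t l)) j *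
      tnth (h (tnth t i) (tnth t l)) k).
Proof.
pose a i l := tnth (h (tnth t i) (tnth t l)) j.
pose b i l := tnth (h (tnth t i) (tnth t l)) k.
have -> : usum3 (Kfull j k) t = \sum_i \sum_(l | i != l) \sum_(r | (i != r) && (l != r)) a i l * b i r.
  by rewrite -(sum_dist3 (fun i l r => a i l * b i r)); apply: eq_bigr => -[[i l] r] _.
rewrite -big_split/= /Shat invfM -mulrA; congr (_ * _).
rewrite mulr_sumr; apply: eq_bigr => i _; rewrite !tnth_mktuple -/(a _ _).
rewrite mulrACA -exprVn expr2; congr (_ * _).
rewrite -big_split/= mulr_suml; apply: eq_bigr => l il.
rewrite mulr_sumr (bigD1 l)//= addrC; congr (_ + _).
by apply: eq_bigl => r; rewrite [r == l]eq_sym.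
Qed.

Lemma usum3_close M t j k : 0 <= M ->
  `|usum3 (Kfull j k) t - usum3 (Ktr M j k) t| <=
  2 * (n%:R * (n%:R - 1) * (n%:R - 2)) * rbar M t.
Proof.
move=> M0; rewrite /usum3 -sumrB; apply: le_trans (ler_norm_sum _ _ _) _.
pose r i l := rho M (tnth t i, tnth t l).
apply: (@le_trans _ _ (\sum_(p : 'I_n * 'I_n * 'I_n | dist3 p) (r p.1.1 p.1.2 + r p.1.1 p.2))).
  apply: ler_sum => p _; exact: (Ktr_close j k (tri t p) M0).
rewrite big_split/=.
have E1 : \sum_(p : 'I_n * 'I_n * 'I_n | dist3 p) r p.1.1 p.1.2 =
    (n%:R - 2) * \sum_i \sum_(l | i != l) r i l.
  rewrite (sum_dist3 (fun i l _ => r i l)) mulr_sumr; apply: eq_bigr => i _.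
  rewrite mulr_sumr; apply: eq_bigr => l il.
  by rewrite -(card_neq2 il) mulr_suml; apply: eq_bigr => ? _; rewrite mul1r.
have E2 : \sum_(p : 'I_n * 'I_n * 'I_n | dist3 p) r p.1.1 p.2 =
    (n%:R - 2) * \sum_i \sum_(l | i != l) r i l.
  rewrite -E1 (reindex_inj (h := fun p : 'I_n * 'I_n * 'I_n => ((p.1.1, p.2), p.1.2))); last first.
    by move=> [[? ?] ?] [[? ?] ?] [] -> -> ->.
  apply: eq_bigl => -[[i l] m]; rewrite /dist3 /= [m == l]eq_sym.
  by rewrite andbCA.
rewrite E1 E2 /rbar -/r le_eqVlt; apply/orP; left; apply/eqP.
rewrite -(mulrA 2) [X in _ = 2 * X]mulrC -mulrA; have := N0; have := N1.
move: (\sum_i _) (n%:R : R) => s N h1 h3.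
by field; rewrite !gt_eqF.
Qed.

Lemma Shat_close M t j k (e mu : R) : 0 <= M ->
  `|usum3 (Ktr M j k) t - cnt3 n * mu| <= cnt3 n * e ->
  `|mu - Sig j k| <= 2 * tau M ->
  `|Sig j k| <= tau2 F h ->
  `|Shat t j k - Sig j k| <= e + 2 * tau M + 2 * rbar M t +
     (tau2 F h + Hbar h t) / (n%:R - 1).
Proof.
move=> M0 hU hmu hS; rewrite ShatE.
set W := \sum_(i < n) \sum_(l < n | i != l) _.
have hW : `|W| <= n%:R * (n%:R - 1) * Hbar h t.
  rewrite /Hbar mulVKf ?gt_eqF ?mulr_gt0//.
  apply: le_trans (ler_norm_sum _ _ _) _; apply: ler_sum => i _.
  apply: le_trans (ler_norm_sum _ _ _) _; apply: ler_sum => l _.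
  by rewrite normrM expr2; apply: ler_pM => //; exact: le_supn.
have hK := usum3_close t j k M0.
rewrite cnt3E in hU.
set U := usum3 (Ktr M j k) t in hU hK; set V := usum3 (Kfull j k) t in hK *.
set s := Sig j k in hmu hS *.
pose N : R := n%:R; have h0 : 0 < N by exact: N0.
have h1 : 0 < N - 1 by exact: N1.
have h2' : 0 < N - 2 by exact: N2.
pose r := (N - 2) / (N - 1).
have r0 : 0 <= r by rewrite divr_ge0// ltW.
have r1 : r <= 1 by rewrite ler_pdivrMr// mul1r lerD2l lerN2 ler1n.
have c0 : 0 < (N * (N - 1) ^+ 2)^-1 by rewrite invr_gt0 mulr_gt0// exprn_gt0.
(* The terms are, in order: fluctuation of the truncated U-statistic, truncation in the sample,
   diagonal, truncation of the mean, and the mismatch between the normalizations $n(n-1)^2$ and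
   $n(n-1)(n-2)$. *)
have -> : (N * (N - 1) ^+ 2)^-1 * (V + W) - s =
   (N * (N - 1) ^+ 2)^-1 * (U - N * (N - 1) * (N - 2) * mu) +
   (N * (N - 1) ^+ 2)^-1 * (V - U) + (N * (N - 1) ^+ 2)^-1 * W +
   r * (mu - s) - s / (N - 1).
  by rewrite /r; field; rewrite !gt_eqF.
have b1 : `|(N * (N - 1) ^+ 2)^-1 * (U - N * (N - 1) * (N - 2) * mu)| <= e.
  rewrite normrM gtr0_norm//; apply: le_trans (ler_wpM2l (ltW c0) hU) _.
  have -> : (N * (N - 1) ^+ 2)^-1 * (N * (N - 1) * (N - 2) * e) = r * e.
    by rewrite /r; field; rewrite !gt_eqF.
  have e0 : 0 <= e.
    have q : 0 < N * (N - 1) * (N - 2) by rewrite !mulr_gt0.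
    by rewrite -(pmulr_rge0 _ q); apply: le_trans hU.
  by rewrite ler_piMl.
have b2 : `|(N * (N - 1) ^+ 2)^-1 * (V - U)| <= 2 * rbar M t.
  rewrite normrM gtr0_norm//; apply: le_trans (ler_wpM2l (ltW c0) hK) _.
  have -> : (N * (N - 1) ^+ 2)^-1 * (2 * (N * (N - 1) * (N - 2)) * rbar M t) =
      r * (2 * rbar M t).
    by rewrite /r; field; rewrite !gt_eqF.
  by rewrite ler_piMl// mulr_ge0// rbar_ge0.
have b3 : `|(N * (N - 1) ^+ 2)^-1 * W| <= Hbar h t / (N - 1).
  rewrite normrM gtr0_norm//; apply: le_trans (ler_wpM2l (ltW c0) hW) _.
  rewrite le_eqVlt; apply/orP; left; apply/eqP.
  by rewrite -/N; field; rewrite !gt_eqF.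
have b4 : `|r * (mu - s)| <= 2 * tau M.
  by rewrite normrM ger0_norm//; apply: le_trans hmu; rewrite ler_piMl.
have b5 : `|s / (N - 1)| <= tau2 F h / (N - 1).
  by rewrite normrM (gtr0_norm (_ : 0 < (N - 1)^-1)) ?invr_gt0// ler_pM2r ?invr_gt0.
apply: le_trans (ler_normB _ _) _; apply: le_trans (lerD (ler_normD _ _) (lexx _)) _.
apply: le_trans (lerD (lerD (ler_normD _ _) (lexx _)) (lexx _)) _.
apply: le_trans (lerD (lerD (lerD (ler_normD _ _) (lexx _)) (lexx _)) (lexx _)) _.
rewrite -/N (mulrDl (tau2 F h)); move: b1 b2 b3 b4 b5.
move: `|_ * (U - _)| `|_ * (V - U)| `|_ * W| `|r * _| `|s / _| => x1 x2 x3 x4 x5.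
by move: (_ / (N - 1)) (_ / (N - 1)) (2 * tau M) (2 * rbar M t) => y1 y2 y3 y4; lra.
Qed.

Lemma measurable_usum3 (K : 3.-tuple S -> R) : measurable_fun setT K ->
  measurable_fun setT (@usum3 R _ S K n).
Proof.
move=> mK; rewrite /usum3; under eq_fun do rewrite big_mkcond.
apply: (@measurable_sum _ _ _ _ _ _ (fun p t => if dist3 p then K (tri t p) else 0)) => p.
case: (dist3 p); last exact: measurable_cst.
apply: (measurableT_comp mK); apply/measurable_fun_tnthP => -[[|[|[|//]]] hr] /=;
  exact: measurable_tnth.
Qed.

Lemma Sig_le j k : `|Sig j k| <= tau2 F h.
Proof.
have i2 := intg_hg2 mh hsec h2.
have mg l := intg_measurable (intg_hg mh hsec h2 l).
have le1 x : `|tnth (hg F h x) j * tnth (hg F h x) k| <= supn (hg F h x) ^+ 2.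
  by rewrite normrM expr2; apply: ler_pM => //; exact: le_supn.
have i1 : intg F (fun x => tnth (hg F h x) j * tnth (hg F h x) k).
  by apply: (intg_le _ le1 i2); exact: measurable_funM.
apply: le_trans (Ex_abs i1) _; apply: le_trans (Ex_le (intg_abs i1) i2 le1) _.
rewrite -(Ex_q hsec h2); apply: Ex_le => //; first exact: intg_q.
by move=> x; exact: supn_hg.
Qed.

(** The probability is spent as [gamma / 4] on the $2D^2$ exponential bounds and [gamma / 2],
    [gamma / 8] on the two Markov bounds. The error is spent as [De / 8] on the fluctuation,
    [De / 8] and [De / 4] on truncation in the mean and in the sample, and [De / 2] on the terms of
    order $1/n$. *)
Lemma good_event (gamma De M1 M2 th s2 : R) N : (0 < N)%N -> (N * 3 <= n)%N ->
  0 < gamma <= 1 -> 0 < De -> 0 <= M1 -> 0 < M2 -> 0 < th ->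
  (forall j, intg (F \x F)%E (fun z => tnth (h z.1 z.2) j ^+ 4) /\
     Ex (F \x F)%E (fun z => tnth (h z.1 z.2) j ^+ 4) <= s2) ->
  16 * tau M1 <= gamma * De -> 8 * tau M2 <= gamma * M2 ^+ 2 ->
  8 * M2 ^+ 2 <= (n%:R - 1) * De ->
  th * (2 * M1 ^+ 2) <= 2^-1 ->
  8 * (D * D)%:R * expR (N%:R * (2 * th ^+ 2 * s2 - th * (De / 8))) <= gamma ->
  exists G : set (n.-tuple S), [/\ measurable G, 1 - gamma <= pr (prodn F n) G &
    forall t, G t -> (forall j k, `|Shat t j k - Sig j k| <= De) /\
      Hbar h t <= 2 * M2 ^+ 2].
Proof.
move=> N0' Nn /andP[g0 g1] De0 M10 M20 th0 h4 H1 H2 H3 H4 H5.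
have q0 : 0 < cnt3 n :> R by rewrite cnt3E !mulr_gt0.
have e8 : 0 < De / 8 by rewrite divr_gt0.
set E := expR _ in H5.
pose mu (p : 'I_D * 'I_D) := Ex (prodn F 3) (Ktr M1 p.1 p.2).
pose K p s := Ktr M1 p.1 p.2 s; pose K' p s := - Ktr M1 p.1 p.2 s.
have mK p : measurable_fun setT (K p) by exact: measurable_Ktr.
have mK' p : measurable_fun setT (K' p) by exact: measurableT_comp (mK p).
pose A1 p := [set t : n.-tuple S | cnt3 n * (mu p + De / 8) < usum3 (K p) t].
pose A2 p := [set t : n.-tuple S | cnt3 n * (- mu p + De / 8) < usum3 (K' p) t].
pose A3 := [set t : n.-tuple S | De / 8 < rbar M1 t].
pose A4 := [set t : n.-tuple S | M2 ^+ 2 < rbar M2 t].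
have mA1 p : measurable (A1 p).
  by apply: measurable_ltset => //; exact: measurable_usum3.
have mA2 p : measurable (A2 p).
  by apply: measurable_ltset => //; exact: measurable_usum3.
have mr M := intg_measurable (rbar_mean M).1.
have mA3 : measurable A3 by exact: measurable_ltset.
have mA4 : measurable A4 by exact: measurable_ltset.
have iK p : intg (prodn F 3) (K p) by exact: intg_Ktr.
have pA1 p : pr (prodn F n) (A1 p) <= E.
  apply: (@ustat_upper R _ S F (K p) (mK p) (M1 ^+ 2) s2 (mu p)) => //.
  - by move=> s; exact: Ktr_le.
  - exact: Ktr_sq.
have pA2 p : pr (prodn F n) (A2 p) <= E.
  apply: (@ustat_upper R _ S F (K' p) (mK' p) (M1 ^+ 2) s2 (- mu p)) => //.
  - by move=> s; rewrite /K' normrN; exact: Ktr_le.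
  - by rewrite /K' ExN//; exact: iK p.
  - rewrite (@Ex_ext _ _ _ (prodn F 3) _ (fun s => Ktr M1 p.1 p.2 s ^+ 2)); last first.
      by move=> s; rewrite /K' sqrrN.
    exact: Ktr_sq.
have pA3 : pr (prodn F n) A3 <= gamma / 2.
  have [i1 e1] := rbar_mean M1.
  apply: le_trans (markov_pr i1 (@rbar_ge0 M1) e8) _.
  rewrite e1 ler_pdivrMr//; move: H1; move: (tau M1) => x.
  by rewrite mulrACA; set y := gamma * De; lra.
have pA4 : pr (prodn F n) A4 <= gamma / 8.
  have [i1 e1] := rbar_mean M2; have m2 : 0 < M2 ^+ 2 by rewrite exprn_gt0.
  apply: le_trans (markov_pr i1 (@rbar_ge0 M2) m2) _.
  rewrite e1 ler_pdivrMr//; move: H2; move: (tau M2) => x.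
  by rewrite mulrAC; set y := gamma * _; lra.
pose B := [set t | exists p, A1 p t] `|` [set t | exists p, A2 p t] `|` A3 `|` A4.
have mE1 : measurable [set t | exists p, A1 p t] by exact: measurable_exists.
have mE2 : measurable [set t | exists p, A2 p t] by exact: measurable_exists.
have mB : measurable B by do 3![apply: measurableU => //].
exists (~` B); split; first exact: measurableC.
  rewrite pr_setC// lerD2l lerN2.
  have c1 := pr_exists (P := prodn F n) mA1 pA1.
  have c2 := pr_exists (P := prodn F n) mA2 pA2.
  rewrite !card_prod !card_ord in c1 c2.
  apply: le_trans (pr_setU _ _ mA4) _; first by do 2![apply: measurableU => //].
  apply: le_trans (lerD (pr_setU _ _ mA3) pA4) _; first by apply: measurableU.
  apply: le_trans (lerD (lerD (pr_setU _ mE1 mE2) pA3) (lexx _)) _.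
  move: c1 c2 H5; rewrite -mulrA; set y := _ * E.
  by move: (pr _ _) (pr _ _) => x1 x2; lra.
move=> t /not_orP[/not_orP[/not_orP[n1 n2] n3] n4'].
have r1 : rbar M1 t <= De / 8 by rewrite leNgt; exact/negP.
have r2 : rbar M2 t <= M2 ^+ 2 by rewrite leNgt; exact/negP.
have HH : Hbar h t <= 2 * M2 ^+ 2.
  by apply: le_trans (Hbar_le t (ltW M20)) _; rewrite mulr_natl mulr2n lerD2l.
split => // j k.
have hU : `|usum3 (Ktr M1 j k) t - cnt3 n * mu (j, k)| <= cnt3 n * (De / 8).
  rewrite ler_norml; apply/andP; split.
    have : ~ A2 (j, k) t by move=> hh; apply: n2; exists (j, k).
    move=> /negP; rewrite -leNgt.
    have -> : usum3 (K' (j, k)) t = - usum3 (Ktr M1 j k) t.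
      by rewrite /usum3 sumrN.
    by rewrite mulrDr mulrN; set a := cnt3 n * mu _; set b := cnt3 n * _; lra.
  have : ~ A1 (j, k) t by move=> hh; apply: n1; exists (j, k).
  by move=> /negP; rewrite -leNgt mulrDr; set a := cnt3 n * mu _; set b := cnt3 n * _; lra.
apply: le_trans (Shat_close M10 hU (Ktr_mean _ _ M10) (Sig_le j k)) _.
have t1 : tau M1 <= De / 16.
  have : gamma * De <= De by rewrite ler_piMl// ltW.
  by move: H1; set y := gamma * De; lra.
have t2 : tau2 F h <= 2 * M2 ^+ 2.
  apply: le_trans (tau2_le (ltW M20)) _.
  have : gamma * M2 ^+ 2 <= M2 ^+ 2 by rewrite ler_piMl// sqr_ge0.
  have := sqr_ge0 M2.
  by move: H2; set y := gamma * _; move: (M2 ^+ 2) => z; lra.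
have h5 : (tau2 F h + Hbar h t) / (n%:R - 1) <= De / 2.
  rewrite ler_pdivrMr//; move: H3 HH t2; rewrite (mulrC _ De) [De / 2 * _]mulrAC.
  by move: (M2 ^+ 2) (De * _) => z y; lra.
by move: h5 r1 t1; move: (_ / (n%:R - 1)) => y; lra.
Qed.

End sample.
End covariance.

(** * Comparison for a fixed sample *)

Section fixed_sample.
Context {R : realType} {d : measure_display} {S : measurableType d} {D : nat}.
Variables (F : probability S R) (h : S -> S -> D.-tuple R).
Hypothesis mh : measurable_fun setT (fun z : S * S => h z.1 z.2).
Hypothesis hC : forall x y, h x y = h y x.
Hypothesis hsec : forall x, intg F (fun y => supn (h x y) ^+ 2).
Hypothesis h2 : intg (F \x F)%E (fun z => supn (h z.1 z.2) ^+ 2).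
Hypothesis h0 : forall j, Ex F (fun x => Ex F (fun y => tnth (h x y) j)) = 0.
Variables (n m : nat).
Hypotheses (n2 : (1 < n)%N) (Dm : (D <= 2 ^ m)%N) (D0 : (0 < D)%N).
Variables (t : n.-tuple S) (be L B3 ka ta la eta De s0 : R).
Hypotheses (be0 : 0 < be) (L1 : 1 <= L) (lnD : ln (D%:R : R) <= 2 * L).
Hypothesis g3 : forall j, intg F (fun x => `|tnth (hg F h x) j| ^+ 3) /\
  Ex F (fun x => `|tnth (hg F h x) j| ^+ 3) <= B3.
Hypotheses (kaB : B3 * (Num.sqrt n%:R)^-1 ^+ 3 <= ka) (kat : 108 * ta ^+ 3 <= ka).
Hypotheses (ta0 : 0 < ta) (Sta : forall j, Shat h t j j / n%:R <= ta ^+ 2).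
Hypothesis tailx : intg F (fun x => cut_sq be (tscale (Num.sqrt n%:R)^-1 (hg F h x))) /\
  Ex F (fun x => cut_sq be (tscale (Num.sqrt n%:R)^-1 (hg F h x))) <= eta.
Hypotheses (la0 : 0 <= la) (tala : (la + 2) ^+ 2 * (be * ta) ^+ 2 <= la).
Hypotheses (laeta : D%:R * (2 * expR (- la / 2)) <= eta) (eta2 : eta <= 2^-1).
Hypothesis SDe : forall j k, `|Shat h t j k - Sig F h j k| <= De.
Hypothesis swap8 : n%:R * swapc be L ka (De / n%:R) <= 8^-1.
Hypotheses (s00 : 0 < s0) (Ss0 : forall j, s0 ^+ 2 <= Shat h t j j).

Let n0 : (0 < n)%N. Proof. exact: ltnW. Qed.
Let N0 : 0 < n%:R :> R. Proof. by rewrite ltr0n. Qed.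
Let sq0 : 0 < Num.sqrt n%:R :> R. Proof. by rewrite sqrtr_gt0. Qed.
Let sqi2 : (Num.sqrt n%:R)^-1 ^+ 2 = n%:R^-1 :> R.
Proof. by rewrite exprVn sqr_sqrtr// ltW. Qed.

Let bc := bcoef h t.
(** A second factor $1/\sqrt n$: each of the [n] Gaussian summands is a scaled copy of the whole
    linear form of the bootstrap. *)
Let a k := tscale (Num.sqrt n%:R)^-1 (bc k).
Let mx : measurable_fun setT (hlin F h n 0) := measurable_hlin mh hsec h2 n 0.
Let my : measurable_fun setT (@glin R D a n) := measurable_glin a (n := n).

Lemma bcoef_cov j k : \sum_(i < n) tnth (bc i) j * tnth (bc i) k = Shat h t j k.
Proof.
rewrite (reindex_inj rev_ord_inj)/= /Shat mulr_sumr; apply: eq_bigr => i _.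
rewrite /bc (bcoefE h n2 t i) !tnth_tscale mulrACA -expr2 sqi2.
by [].
Qed.

Lemma mcond_x : mcond be F (hlin F h n 0) ka eta (fun j k => Sig F h j k / n%:R).
Proof.
have mg j := intg_measurable (intg_hg mh hsec h2 j).
split.
- move=> j; rewrite /hlin; under [X in intg _ X]eq_fun do rewrite tnth_tscale.
  under [X in Ex _ X]eq_fun do rewrite tnth_tscale.
  have ig := intg_hg mh hsec h2 j; split; first exact: intgZ.
  by rewrite (ExZ _ ig) (Ex_hg h0) mulr0.
- move=> j k; rewrite /hlin.
  have E : (fun x => tnth (tscale (Num.sqrt n%:R)^-1 (hg F h x)) j *
      tnth (tscale (Num.sqrt n%:R)^-1 (hg F h x)) k) =
      fun x => n%:R^-1 * (tnth (hg F h x) j * tnth (hg F h x) k).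
    by apply/funext => x; rewrite !tnth_tscale mulrACA -expr2 sqi2.
  have i1 : intg F (fun x => tnth (hg F h x) j * tnth (hg F h x) k).
    apply: (intg_le _ _ (intg_hg2 mh hsec h2)); first exact: measurable_funM.
    by move=> x; rewrite normrM expr2; apply: ler_pM => //; exact: le_supn.
  by rewrite E; split; [exact: intgZ|rewrite (ExZ _ i1) mulrC].
- move=> j; have [i3 e3] := g3 j; rewrite /hlin.
  have E : (fun x => `|tnth (tscale (Num.sqrt n%:R)^-1 (hg F h x)) j| ^+ 3) =
      fun x => (Num.sqrt n%:R)^-1 ^+ 3 * `|tnth (hg F h x) j| ^+ 3.
    have si : 0 <= (Num.sqrt n%:R)^-1 :> R by rewrite invr_ge0 ltW.
    by apply/funext => x; rewrite tnth_tscale normrM (ger0_norm si) exprMn.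
  rewrite E; split; first exact: intgZ.
  rewrite (ExZ _ i3); apply: le_trans kaB; rewrite mulrC; apply: ler_wpM2r e3.
  by rewrite exprn_ge0// invr_ge0 ltW.
- exact: tailx.
Qed.

Let al j k := tnth (a k) j.

Let cE j (xi : n.-tuple R) : tnth (glin a xi) j = \sum_(i < n) tnth xi i * al j (n - i.+1)%N.
Proof. exact: tnth_glin. Qed.

Let al_cov j k : \sum_(i < n) al j i * al k i = Shat h t j k / n%:R.
Proof.
rewrite -bcoef_cov mulr_suml; apply: eq_bigr => i _.
by rewrite /al /a !tnth_tscale mulrACA -expr2 sqi2 mulrC.
Qed.

Let al_sq j : \sum_(i < n) al j i ^+ 2 <= ta ^+ 2.
Proof. by apply: le_trans (Sta j); rewrite -(al_cov j j); under eq_bigr do rewrite expr2. Qed.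

(** Some coordinate attains the sup norm, so its tail is at most the sum of the coordinate tails;
    the factor [D] is paid for by [laeta]. *)
Lemma mcond_y : mcond be (prodn N01 n) (@glin R D a n) ka eta (fun j k => Shat h t j k / n%:R).
Proof.
split.
- move=> j; rewrite (funext (cE j)); exact: lin_mean.
- move=> j k; under [X in intg _ X]eq_fun do rewrite !cE.
  under [X in Ex _ X]eq_fun do rewrite !cE.
  have [i1 e1] := lin_cov n (al j) (al k); split; first exact: i1.
  by rewrite e1 al_cov.
- move=> j; under [X in intg _ X]eq_fun do rewrite cE.
  under [X in Ex _ X]eq_fun do rewrite cE.
  have [i1 e1] := lin_third ta0 (al_sq j); split; first exact: i1.
  exact: le_trans e1 kat.
- pose bl j k := be * al j k.
  have bE j (xi : n.-tuple R) : \sum_(i < n) tnth xi i * bl j (n - i.+1)%N =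
      be * tnth (glin a xi) j.
    by rewrite cE mulr_sumr; apply: eq_bigr => i _; rewrite /bl; ring.
  have bs j : (la + 2) ^+ 2 * (\sum_(i < n) bl j i ^+ 2) <= la.
    apply: le_trans tala; apply: ler_wpM2l; first exact: sqr_ge0.
    rewrite exprMn; have -> : \sum_(i < n) bl j i ^+ 2 = be ^+ 2 * \sum_(i < n) al j i ^+ 2.
      by rewrite mulr_sumr; apply: eq_bigr => i _; rewrite exprMn.
    by apply: ler_wpM2l; [exact: sqr_ge0|exact: al_sq].
  have T j := lin_tail la0 (bs j).
  pose u j xi := let c := \sum_(i < n) tnth xi i * bl j (n - i.+1)%N in
    if 1 < `|c| then `|c| ^+ 2 else 0 : R.
  have u0 j xi : 0 <= u j xi by rewrite /u /=; case: ifP => // _; rewrite exprn_ge0.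
  have iS : intg (prodn N01 n) (fun xi => \sum_j u j xi).
    by apply: intg_sum => j _; exact: (T j).1.
  have le1 xi : cut_sq be (glin a xi) <= \sum_j u j xi.
    rewrite /cut_sq; case: ifPn => [h1|_]; last by apply: sumr_ge0 => j _; exact: u0.
    have [j hj] : exists j, supn (glin a xi) <= `|tnth (glin a xi) j|.
      have : ~ forall j, `|tnth (glin a xi) j| < supn (glin a xi).
        move=> H; pose M := \big[Num.max/0]_(j < D) `|tnth (glin a xi) j|.
        have : M < supn (glin a xi).
          rewrite /M; elim/big_ind: _ => // [|x y x1 y1]; last by rewrite gt_max x1.
          by apply: le_lt_trans (H (Ordinal D0)).
        by rewrite ltxx.
      by move=> /existsNP[j /negP]; rewrite -leNgt => hj; exists j.
    rewrite (bigD1 j)//=; apply: ler_wpDr; first by apply: sumr_ge0 => k _; exact: u0.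
    have h3 : be * supn (glin a xi) <= `|be * tnth (glin a xi) j|.
      by rewrite normrM gtr0_norm// ler_pM2l.
    rewrite /u /= bE (lt_le_trans h1 h3).
    by apply: lerXn2r; rewrite ?nnegrE// mulr_ge0 ?supn_ge0// ltW.
  have mc : measurable_fun setT (fun xi : n.-tuple R => cut_sq be (glin a xi)).
    have ms : measurable_fun setT (fun xi : n.-tuple R => be * supn (glin a xi)).
      by apply: measurable_funM => //; exact: (measurableT_comp measurable_supn my).
    rewrite /cut_sq; apply: measurable_fun_ifT => //; last exact: measurable_funX.
    exact: measurable_fun_ltr.
  have ic : intg (prodn N01 n) (fun xi => cut_sq be (glin a xi)).
    by apply: (intg_le mc _ iS) => xi; rewrite ger0_norm ?cut_sq_ge0.
  split; first exact: ic.
  apply: le_trans (Ex_le ic iS le1) _; rewrite Ex_sum; last by move=> j; exact: (T j).1.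
  apply: le_trans laeta; rewrite -[X in X%:R * _](card_ord D) mulr_natl -sumr_const.
  by apply: ler_sum => j _; exact: (T j).2.
Qed.

Definition gauss : probability (D.-tuple R) R := gks (glist bc n).

Let l0 : probability (D.-tuple R) R := (\d_(@tzero R D))%R.

Lemma hyb_gauss : meq (hyb F (prodn N01 n) mx my l0 0 n) gauss.
Proof.
have E l : meq (kick l (prodn N01 n) my) (gkits a n l) by exact: kick_glin.
have H k : meq (iter k (fun l => kick l (prodn N01 n) my) l0) (iter k (gkits a n) l0).
  elim: k => [|k IH]; first exact: meq_refl.
  exact: meq_trans (meq_kick _ my IH) (E _).
apply: meq_trans (H n) _; rewrite /gauss -gkits_gks.
exact: iter_gkits.
Qed.

Lemma hyb_sum A : measurable A -> pr (hyb F (prodn N01 n) mx my l0 n 0) A =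
  pr (prodn F n) ((fun s => ssum (hlin F h n) s) @^-1` A).
Proof.
move=> mA.
have E k : hyb F (prodn N01 n) mx my l0 k 0 =
    kicks (y := hlin F h n) F (fun _ => mx) k l0.
  by elim: k => //= k <-.
rewrite E -(pr_kick0 _ (measurable_ssum (y := hlin F h n) (fun _ => mx) (n := n)))//.
apply/esym/(meq_pr _ mA).
exact: (@kick_ssum R D _ S F (hlin F h n) (fun _ => mx) n l0).
Qed.

Definition anti_const : R := 7 * (L / be) / s0 *
  (expR (3 / 2) * (1 + (Num.sqrt (2 * ln (D%:R : R)) + 7 * (L / be) / s0)) + 1).

Let e := L / be.
Let e0 : 0 < e. Proof. by apply: divr_gt0 => //; apply: lt_le_trans L1. Qed.

Lemma gauss_anti c : pr gauss (orth (fun j => c j + 7 * e)) - pr gauss (orth c) <= anti_const.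
Proof.
apply: gks_anti => //; first by rewrite mulr_ge0// ltW.
by move=> j; rewrite gcov_glist bcoef_cov.
Qed.

Lemma anti_const_ge0 : 0 <= anti_const.
Proof.
have q : 0 <= 7 * (L / be) / s0.
  by apply: divr_ge0; [apply: mulr_ge0 => //; exact: ltW|exact: ltW].
apply: mulr_ge0 => //; apply: addr_ge0 => //; apply: mulr_ge0; first exact: expR_ge0.
by apply: addr_ge0 => //; apply: addr_ge0 => //; exact: sqrtr_ge0.
Qed.

Lemma sum_gauss c :
  `|pr (prodn F n) ((fun s => ssum (hlin F h n) s) @^-1` orth c) - pr gauss (orth c)| <=
  5 / 2 * anti_const + 96 * (n%:R * eta).
Proof.
have ka0 : 0 <= ka.
  by apply: le_trans kat; rewrite mulr_ge0// exprn_ge0// ltW.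
have eta0 : 0 <= eta.
  by apply: le_trans laeta; rewrite mulr_ge0 ?ler0n// mulr_ge0// expR_ge0.
have S12 j k : `|Sig F h j k / n%:R - Shat h t j k / n%:R| <= De / n%:R.
  rewrite -mulrBl normrM (gtr0_norm (_ : 0 < n%:R^-1)) ?invr_gt0//.
  by rewrite ler_pM2r ?invr_gt0// distrC.
have anti c' : pr (hyb F (prodn N01 n) mx my l0 0 n) (orth (fun j => c' j + 7 * (L / be))) -
    pr (hyb F (prodn N01 n) mx my l0 0 n) (orth c') <= anti_const.
  rewrite !(meq_pr hyb_gauss); [exact: gauss_anti| |]; exact: measurable_orth.
have eta01 : 0 <= eta <= 2^-1 by rewrite eta0.
have := lindeberg D0 be0 L1 lnD mcond_x mcond_y S12 anti ka0 eta01 swap8 anti_const_ge0 c.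
rewrite hyb_sum; last exact: measurable_orth.
by rewrite (meq_pr hyb_gauss)//; exact: measurable_orth.
Qed.

Lemma shift_anti c r : 0 <= r <= 7 * e ->
  pr gauss (orth (fun j => c j + r)) - pr gauss (orth c) <= anti_const.
Proof.
move=> /andP[r0 r7]; apply: le_trans (gauss_anti c); rewrite lerD2r.
apply: pr_le; [exact: measurable_orth|exact: measurable_orth|].
by apply: orth_le => j; rewrite lerD2l.
Qed.

Let cc : R := 16 * m.+1%:R.

(** The degenerate parts are removed on both sides at the scale [e] of the smoothing. Each removal
    costs one [anti_const], which together with the 5/2 for the linear parts makes 9/2. *)
Theorem core_compare c :
  `|pr (prodn F n) (hT h (n := n) @^-1` orth c) -
    pr (prodn N01 n) (hTb h t @^-1` orth c)| <=
  9 / 2 * anti_const + 96 * (n%:R * eta) +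
  cc ^+ 2 * (9 * tau2 F h + Hbar h t) / (2 * (n%:R - 1)) / e ^+ 2.
Proof.
set E0 := 5 / 2 * anti_const + 96 * (n%:R * eta).
have e7 : 0 <= e <= 7 * e.
  by apply/andP; split; move: e0; lra.
have mT := measurable_hT mh hC hsec h2 n2.
have mW : measurable_fun setT (fun s : n.-tuple S => ssum (hlin F h n) s).
  by apply: measurable_ssum => k; exact: measurable_hlin.
have mR := measurable_hrem mh hsec h2 (n := n).
have [t1 t2] := orth_perturb mT mW mR (hT_decomp F hC n2) e0
  (hrem_sq mh hC hsec h2 h0 n2 Dm) c.
have mTb := measurable_hTb hC n2 t.
have mG : measurable_fun setT (@glin R D bc n) by exact: measurable_glin.
have mQ := measurable_brem h n2 t.
have [u1 u2] := orth_perturb mTb mG mQ (hTb_decomp hC n2 t) e0 (brem_sq hC n2 Dm t) c.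
have GE A : measurable A -> pr (prodn N01 n) ((fun xi => glin bc xi) @^-1` A) = pr gauss A.
  move=> mA; rewrite -(pr_kick0 _ (measurable_glin bc (n := n)))//.
  apply: (meq_pr _ mA); rewrite /gauss -gkits_gks.
  exact: (@kick_glin R D bc n l0).
rewrite !GE in u1 u2; [|exact: measurable_orth|exact: measurable_orth].
have w1 := sum_gauss (fun j => c j + e); have w2 := sum_gauss (fun j => c j - e).
have v1 := shift_anti c e7.
have v2 := shift_anti (fun j => c j - e) e7.
have cE' : (fun j => c j - e + e) = c by apply/funext => j; rewrite subrK.
rewrite cE' in v2.
have {w1} [_ w1] := ler_normlP _ _ w1; have {w2} [w2 _] := ler_normlP _ _ w2.
have n1 : 0 < n%:R - 1 :> R by rewrite subr_gt0 ltr1n.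
have -> : cc ^+ 2 * (9 * tau2 F h + Hbar h t) / (2 * (n%:R - 1)) / e ^+ 2 =
  cc ^+ 2 * (9 * tau2 F h) / (2 * (n%:R - 1)) / e ^+ 2 +
  cc ^+ 2 * Hbar h t / (2 * (n%:R - 1)) / e ^+ 2.
  by rewrite mulrDr !mulrDl.
move: t1 t2 u1 u2 v1 v2 w1 w2; rewrite -/cc.
set p1 := pr _ _; set p2 := pr _ _; set r1 := _ / e ^+ 2; set p3 := pr _ _.
set p4 := pr _ _; set p5 := pr _ _; set r2 := _ / e ^+ 2; set p6 := pr _ _; set p7 := pr _ (orth c).
by move=> *; apply/ler_normlP; split; lra.
Qed.

End fixed_sample.

(** * Choice of the parameters *)

(** Jensen's inequality through the tangent of the cube at the mean, $a^3\ge3m^2a-2m^3$. *)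
Lemma Ex_cube_le {d} {T : measurableType d} {R : realType} (P : probability T R)
    (u : T -> R) : intg P u -> intg P (fun x => `|u x| ^+ 3) ->
  `|Ex P u| ^+ 3 <= Ex P (fun x => `|u x| ^+ 3).
Proof.
move=> iu iu3; have iau := intg_abs iu; set m := Ex P (fun x => `|u x|).
have m0 : 0 <= m by apply: Ex_ge0.
apply: (@le_trans _ _ (m ^+ 3)).
  by apply: lerXn2r; rewrite ?nnegrE//; exact: Ex_abs.
have E : Ex P (fun x => 3 * m ^+ 2 * `|u x| - 2 * m ^+ 3) = m ^+ 3.
  rewrite ExB; [|exact: intgZ|exact: intg_cst].
  by rewrite (ExZ _ iau) Ex_cst -/m; ring.
rewrite -E; apply: Ex_le => //.
  by apply: intgB; [exact: intgZ|exact: intg_cst].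
move=> x /=; have a0 := normr_ge0 (u x); rewrite -subr_ge0.
have -> : `|u x| ^+ 3 - (3 * m ^+ 2 * `|u x| - 2 * m ^+ 3) =
  (`|u x| - m) ^+ 2 * (`|u x| + 2 * m) by ring.
by rewrite mulr_ge0 ?sqr_ge0// addr_ge0// mulr_ge0.
Qed.

Lemma powers_le_four {R : realType} (a : R) : 0 <= a -> a ^+ 2 <= 1 + a ^+ 4 /\ a ^+ 3 <= 1 + a ^+ 4.
Proof.
move=> a0; have h1 := sqr_ge0 (a ^+ 2 - 1); have h2 := sqr_ge0 (a - 1).
have h3 := sqr_ge0 (a ^+ 2 - a); have h4 := sqr_ge0 a.
have E1 : (a ^+ 2 - 1) ^+ 2 = a ^+ 4 - 2 * a ^+ 2 + 1 by ring.
have E3 : (a ^+ 2 - a) ^+ 2 = a ^+ 4 - 2 * a ^+ 3 + a ^+ 2 by ring.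
by rewrite E1 in h1; rewrite E3 in h3; split; lra.
Qed.

Section fourth_moment.
Context {R : realType} {d : measure_display} {S : measurableType d} {D : nat}.
Variables (F : probability S R) (h : S -> S -> D.-tuple R).
Hypothesis mh : measurable_fun setT (fun z : S * S => h z.1 z.2).
Hypothesis hsec4 : forall x, intg F (fun y => supn (h x y) ^+ 4).
Hypothesis h4 : intg (F \x F)%E (fun z => supn (h z.1 z.2) ^+ 4).

Lemma hsec_of4 x : intg F (fun y => supn (h x y) ^+ 2).
Proof.
apply: (intg_le _ _ (intgD (intg_cst F 1) (hsec4 x))) => [|y].
  by apply: measurable_funX; exact: (measurableT_comp measurable_supn (measurable_hx mh x)).
by rewrite ger0_norm ?sqr_ge0//; apply: (powers_le_four _).1; exact: supn_ge0.
Qed.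

Lemma h2_of4 : intg (F \x F)%E (fun z => supn (h z.1 z.2) ^+ 2).
Proof.
apply: (intg_le _ _ (intgD (intg_cst _ 1) h4)) => [|z].
  by apply: measurable_funX; exact: (measurableT_comp measurable_supn mh).
by rewrite ger0_norm ?sqr_ge0//; apply: (powers_le_four _).1; exact: supn_ge0.
Qed.

Let hsec := hsec_of4.
Let h2 := h2_of4.

Let cube_le y j : `|tnth y j| ^+ 3 <= 1 + @supn R D y ^+ 4.
Proof.
apply: (@le_trans _ _ (supn y ^+ 3)); last by apply: (powers_le_four _).2; exact: supn_ge0.
by apply: lerXn2r; rewrite ?nnegrE ?supn_ge0//; exact: le_supn.
Qed.

Lemma hg_cube (B3 : R) j : Ex (F \x F)%E (fun z => `|tnth (h z.1 z.2) j| ^+ 3) <= B3 ->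
  intg F (fun x => `|tnth (hg F h x) j| ^+ 3) /\
  Ex F (fun x => `|tnth (hg F h x) j| ^+ 3) <= B3.
Proof.
move=> hB.
have i3 : intg (F \x F)%E (fun z => `|tnth (h z.1 z.2) j| ^+ 3).
  apply: (intg_le _ _ (intgD (intg_cst _ 1) h4)) => [|z].
    by apply: measurable_funX; apply: measurableT_comp => //; exact: measurable_hj.
  by rewrite ger0_norm ?exprn_ge0//; exact: cube_le.
have s3 x : intg F (fun y => `|tnth (h x y) j| ^+ 3).
  apply: (intg_le _ _ (intgD (intg_cst _ 1) (hsec4 x))) => [|y].
    apply: measurable_funX; apply: measurableT_comp => //.
    exact: (measurableT_comp (measurable_tnth j) (measurable_hx mh x)).
  by rewrite ger0_norm ?exprn_ge0//; exact: cube_le.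
have q3 := intg_prod1 i3 s3.
have le1 x : `|tnth (hg F h x) j| ^+ 3 <= Ex F (fun y => `|tnth (h x y) j| ^+ 3).
  rewrite tnth_mktuple; apply: Ex_cube_le => //; exact: (intg_hj mh hsec).
have i1 : intg F (fun x => `|tnth (hg F h x) j| ^+ 3).
  apply: (intg_le _ _ q3) => [|x].
    apply: measurable_funX; apply: measurableT_comp => //.
    exact: (intg_measurable (intg_hg mh hsec h2 j)).
  by rewrite ger0_norm ?exprn_ge0.
split => //; apply: le_trans hB; rewrite (Ex_prod i3 s3).
exact: Ex_le.
Qed.

(** Conditional expectation does not commute with truncation, so the kernel is cut at half the
    level: the projection is at most [M] plus the mean of the part [w] above [M], and [M]
    contributes exactly 1/2 to the scaled norm. When that norm exceeds 1, it is at most twice the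
    contribution of [w]. *)
Lemma cut_sq_hg (be : R) (n : nat) : 0 < be -> (0 < n)%N ->
  intg F (fun x => cut_sq be (tscale (Num.sqrt n%:R)^-1 (hg F h x))) /\
  Ex F (fun x => cut_sq be (tscale (Num.sqrt n%:R)^-1 (hg F h x))) <=
    4 * be ^+ 2 / n%:R * tau F h (Num.sqrt n%:R / (2 * be)).
Proof.
move=> be0 n0; have N0 : 0 < n%:R :> R by rewrite ltr0n.
have s0 : 0 < Num.sqrt n%:R :> R by rewrite sqrtr_gt0.
set M := Num.sqrt n%:R / (2 * be).
have M0 : 0 <= M by apply: divr_ge0; [exact: ltW|rewrite mulr_ge0// ltW].
have ir := intg_rho (F := F) mh h2 M.
have mr x : measurable_fun setT (fun y => rho h M (x, y)).
  by apply: (measurableT_comp (measurable_rho mh M)); exact: measurable_pair1.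
have isx x : intg F (fun y => rho h M (x, y)).
  apply: (intg_le (mr x) _ (hsec x)) => y; rewrite ger0_norm ?rho_ge0//.
  by rewrite /rho; case: ifP => //= _; exact: sqr_ge0.
have q := intg_prod1 ir isx.
set k := 4 * be ^+ 2 / n%:R.
have k0 : 0 <= k by rewrite /k divr_ge0 ?(ltW N0)// mulr_ge0// exprn_ge0// ltW.
have le1 x : cut_sq be (tscale (Num.sqrt n%:R)^-1 (hg F h x)) <=
    k * Ex F (fun y => rho h M (x, y)).
  rewrite /cut_sq supn_tscale ger0_norm ?invr_ge0 ?(ltW s0)//.
  set u := be * _; case: ifPn => [u1|_]; last first.
    by apply: mulr_ge0 => //; apply: Ex_ge0 => y; exact: rho_ge0.
  pose w y := if M < supn (h x y) then supn (h x y) else 0.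
  have w2 y : w y ^+ 2 = rho h M (x, y).
    by rewrite /w /rho /=; case: ifP => // _; rewrite expr0n.
  have mw : measurable_fun setT w.
    have ms : measurable_fun setT (fun y => supn (h x y)).
      exact: (measurableT_comp measurable_supn (measurable_hx mh x)).
    rewrite /w; apply: measurable_fun_ifT => //.
    exact: measurable_fun_ltr.
  have iw : intg F w.
    apply: (intg_le mw _ (intgD (intg_cst F 1) (isx x))) => y.
    by apply: le_trans (norm_le_sq1 _) _; rewrite w2.
  have iw2 : intg F (fun y => w y ^+ 2) by apply: intg_ext (isx x) => y; rewrite w2.
  have gw : supn (hg F h x) <= M + Ex F w.
    have w0 y : 0 <= w y by rewrite /w; case: ifP => // _; exact: supn_ge0.
    apply: supn_le => [|j]; first by rewrite addr_ge0//; exact: Ex_ge0.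
    rewrite tnth_mktuple; apply: le_trans (Ex_abs (intg_hj mh hsec x j)) _.
    rewrite -[M](Ex_cst F) -ExD//; last exact: intg_cst.
    apply: Ex_le; [exact: intg_abs (intg_hj mh hsec x j)|by apply: intgD => //; exact: intg_cst|].
    move=> y; apply: le_trans (le_supn _ j) _; rewrite /w; case: ltP => hM.
      by rewrite lerDr.
    by rewrite addr0.
  have b2 : be * ((Num.sqrt n%:R)^-1 * M) = 2^-1.
    by rewrite /M; field; rewrite !gt_eqF.
  have u2 : u <= 2 * (be * ((Num.sqrt n%:R)^-1 * Ex F w)).
    have : u <= be * ((Num.sqrt n%:R)^-1 * (M + Ex F w)).
      by rewrite /u !ler_pM2l// invr_gt0.
    by rewrite !mulrDr b2; move: u1; lra.
  have -> : Ex F (fun y => rho h M (x, y)) = Ex F (fun y => w y ^+ 2).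
    by apply: Ex_ext => y; rewrite w2.
  apply: (@le_trans _ _ (k * Ex F w ^+ 2)); last by apply: ler_wpM2l => //; exact: Ex_sq_le.
  have -> : k * Ex F w ^+ 2 = (2 * (be * ((Num.sqrt n%:R)^-1 * Ex F w))) ^+ 2.
    by rewrite /k -[in LHS](sqr_sqrtr (ltW N0)); field; rewrite gt_eqF.
  by apply: (lerXn2r _ _ _ u2); rewrite nnegrE; move: u1 u2; lra.
have mc : measurable_fun setT (fun x => cut_sq be (tscale (Num.sqrt n%:R)^-1 (hg F h x))).
  have ms : measurable_fun setT (fun x => be * supn (tscale (Num.sqrt n%:R)^-1 (hg F h x))).
    apply: measurable_funM => //; apply: (measurableT_comp measurable_supn).
    by apply: measurable_tscale2; exact: (measurable_hg mh hsec h2).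
  rewrite /cut_sq; apply: measurable_fun_ifT => //; last exact: measurable_funX.
  exact: measurable_fun_ltr.
have i1 : intg F (fun x => cut_sq be (tscale (Num.sqrt n%:R)^-1 (hg F h x))).
  by apply: (intg_le mc _ (intgZ k q)) => x; rewrite ger0_norm ?cut_sq_ge0.
split => //; rewrite /tau (Ex_prod ir isx) -(ExZ _ q).
by apply: Ex_le => //; exact: intgZ.
Qed.

End fourth_moment.

Lemma cube_root {R : realType} (B : R) : 1 <= B -> exists2 a : R, 1 <= a & a ^+ 3 = B.
Proof.
move=> B1; have B0 : 0 <= B by apply: le_trans B1.
have E : (B `^ 3^-1) ^+ 3 = B.
  by rewrite -powR_mulrn ?powR_ge0// -powRrM mulVf// powRr1.
exists (B `^ 3^-1) => //; rewrite leNgt; apply/negP => h.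
have : (B `^ 3^-1) ^+ 3 < 1 by rewrite exprn_ilt1// powR_ge0.
by rewrite E ltNge B1.
Qed.

(** Turns the logarithmic bound on the dimension into an exponent for the smoothed square; the
    constant uses $\log2\ge1/2$. *)
Lemma log2_ceil {R : realType} (L : R) (D : nat) : (0 < D)%N -> 1 <= L ->
  ln (D%:R : R) <= 2 * L -> exists2 m, (D <= 2 ^ m)%N & m.+1%:R <= 6 * L.
Proof.
move=> D0 L1 lD; exists (trunc_log 2 D).+1; first exact/ltnW/trunc_log_ltn.
have h : (2 ^ trunc_log 2 D <= D)%N by rewrite trunc_logP.
have ln2 : 2^-1 <= ln (2 : R).
  rewrite -[X in X <= _]expRK ler_ln ?posrE ?expR_gt0//.
  by have := expR_le_quad (lexx (2^-1 : R)); move=> h'; apply: le_trans h' _; lra.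
have : (trunc_log 2 D)%:R * ln (2 : R) <= 2 * L.
  apply: le_trans lD; rewrite mulr_natl -lnXn// -natrX.
  by rewrite ler_ln ?posrE ?ltr0n ?expn_gt0// ler_nat.
move=> h1; have h2 : (trunc_log 2 D)%:R * 2^-1 <= 2 * L :> R.
  by apply: le_trans h1; apply: ler_wpM2l.
rewrite -[_.+2%:R]natr1 -[_.+1%:R]natr1.
by move: h2 L1; set k := (trunc_log 2 D)%:R; clearbody k => *; lra.
Qed.

Section rate_arithmetic.
Context {R : realType}.
Variables (b K A0 A : R).
Hypotheses (b0 : 0 < b) (K0 : 0 < K) (A00 : 264 <= A0) (A0b : 2 <= A0 * b)
  (A1 : 16 * A0 <= A) (A2 : 384 * (7 + K) <= A) (A3 : 32 * 96 * (7 + K) * A0 ^+ 2 <= A)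
  (A4 : 780 * 864 * 16 * expR 2 <= A) (A5 : 10 ^+ 6 <= A).
Variables (n : nat) (r sn v B : R).
Hypotheses (n4 : (3 < n)%N) (r1 : 1 <= r) (sn0 : 0 < sn) (snE : sn ^+ 2 = n%:R)
  (v0 : 0 < v) (v1 : v <= 1) (B1 : 1 <= B).
Hypothesis c4 : A * (r ^+ 7 * B) <= sn * v ^+ 3.

Let r0 : 0 < r. Proof. exact: lt_le_trans r1. Qed.
Let B0 : 0 < B. Proof. exact: lt_le_trans B1. Qed.
Let A00' : 0 < A0. Proof. exact: lt_le_trans A00. Qed.
Let A26 : 26 <= A. Proof. by move: A1 A00; lra. Qed.
Let A1' : 1 <= A. Proof. by apply: le_trans A26; rewrite ler1n. Qed.
Let AA0 : 0 < A. Proof. exact: lt_le_trans A1'. Qed.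
Let N0 : 0 < n%:R :> R. Proof. by rewrite ltr0n; apply: leq_ltn_trans n4. Qed.

Local Notation L := (r ^+ 2).
Local Notation be := (r ^+ 3 / v).
Local Notation De := (v ^+ 2 / (A0 * L ^+ 2)).

(** Two parts of at most 1/16 each. [780 * 864] is twice the 390 of [stepc] times the constant in
    the third moment bound, and 264 is 8 times the 33 of [swapc]. *)
Lemma rate_swap : n%:R * swapc be L (864 * B * sn^-1 ^+ 3) (De / n%:R) <= 8^-1.
Proof.
have E : n%:R * swapc be L (864 * B * sn^-1 ^+ 3) (De / n%:R) =
    (780 * 864 * 16 * expR 2) * (r ^+ 7 * B) / (sn * v ^+ 3) / 16 + 264 / A0 / 16.
  rewrite /swapc /stepc -snE; field.
  by rewrite !gt_eqF.
rewrite E; have h1 : (780 * 864 * 16 * expR 2) * (r ^+ 7 * B) / (sn * v ^+ 3) <= 1.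
  have p : 0 < sn * v ^+ 3 by rewrite mulr_gt0// exprn_gt0.
  rewrite ler_pdivrMr// mul1r; apply: le_trans c4; apply: ler_wpM2r A4.
  by rewrite mulr_ge0 ?exprn_ge0// ltW.
have h2 : 264 / A0 <= 1 by rewrite ler_pdivrMr// mul1r.
move: h1 h2; set x := _ / (sn * _); set y := _ / A0; clearbody x y => h1 h2; lra.
Qed.

Lemma rate_De : De <= b / 2 /\ De <= 1.
Proof.
have L1 : 1 <= L by rewrite exprn_ege1.
have L21 : 1 <= L ^+ 2 by rewrite exprn_ege1.
have D1 : De <= A0^-1.
  rewrite ler_pdivrMr; last by rewrite mulr_gt0// exprn_gt0// exprn_gt0.
  rewrite mulrA mulVf ?gt_eqF// mul1r; apply: le_trans L21.
  by rewrite exprn_ile1// ltW.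
split; apply: le_trans D1 _.
  rewrite -[X in X <= _]mul1r ler_pdivrMr//; move: A0b; lra.
by rewrite invf_le1//; apply: le_trans A00; rewrite ler1n.
Qed.

(** [be] times the bound [2 * a / sn] on a standard deviation is at most $1/(13L)$, and
    $24L+2\le26L$; so the left-hand side is at most 4. *)
Lemma rate_la (a : R) : 1 <= a -> a ^+ 3 = B ->
  (24 * L + 2) ^+ 2 * (be * (2 * a / sn)) ^+ 2 <= 24 * L.
Proof.
move=> a1 aB; have a0 : 0 < a by apply: lt_le_trans a1.
have L1 : 1 <= L by rewrite exprn_ege1.
have aB' : a <= B by rewrite -aB; apply: ler_eXnr.
have h1 : be * a / sn * r ^+ 2 <= 26^-1.
  have E : be * a / sn * r ^+ 2 = r ^+ 5 * a / (sn * v) by field; rewrite !gt_eqF.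
  rewrite E ler_pdivrMr; last exact: mulr_gt0.
  have h2 : r ^+ 5 * a * 26 <= A * (r ^+ 7 * B).
    rewrite mulrC; apply: ler_pM => //; first by rewrite mulr_ge0 ?exprn_ge0// ltW.
    apply: ler_pM aB'; rewrite ?exprn_ge0 ?(ltW r0) ?(ltW a0)//.
    exact: ler_weXn2l.
  have h3 : sn * v ^+ 3 <= sn * v.
    by rewrite ler_pM2l//; apply: ler_iXnr => //; rewrite ltW// v0.
  rewrite ler_pdivlMl// mulrC.
  exact: le_trans (le_trans c4 h3).
have h0 : 0 <= be * a / sn * r ^+ 2.
  by rewrite !mulr_ge0 ?invr_ge0 ?exprn_ge0// ltW.
have E : (24 * L + 2) ^+ 2 * (be * (2 * a / sn)) ^+ 2 =
   ((24 * L + 2) * 2 * (be * a / sn)) ^+ 2 by ring.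
rewrite E.
have h2 : (24 * L + 2) * 2 * (be * a / sn) <= 2.
  apply: (@le_trans _ _ (26 * 2 * (be * a / sn * r ^+ 2))); last by move: h1; lra.
  have -> : 26 * 2 * (be * a / sn * r ^+ 2) = 26 * L * 2 * (be * a / sn) by ring.
  apply: ler_wpM2r; first by rewrite !mulr_ge0 ?invr_ge0 ?exprn_ge0// ltW.
  by move: L1; lra.
have h3 : 0 <= (24 * L + 2) * 2 * (be * a / sn).
  by rewrite !mulr_ge0 ?invr_ge0 ?exprn_ge0 ?addr_ge0 ?mulr_ge0 ?exprn_ge0// ltW.
apply: (@le_trans _ _ (2 ^+ 2)); first by apply: lerXn2r => //; exact: ler0n.
by move: L1; lra.
Qed.

(** The factor $e^{-12L}$ pays for $D\le e^{2L}$, for $n^2\le e^{2L}$, where one power of $n$ comes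
    from $v\ge1/n$, and for $192\le e^{8L}$. *)
Lemma rate_laeta (D : nat) : (0 < D)%N -> ln (D%:R : R) <= 2 * L -> ln (n%:R : R) <= L ->
  D%:R * (2 * expR (- (24 * L) / 2)) <= v / (96 * n%:R).
Proof.
move=> D0 lD ln'; have L1 : 1 <= L by rewrite exprn_ege1.
have DE : D%:R <= expR (2 * L) by rewrite -ler_ln ?posrE ?expR_gt0 ?ltr0n// expRK.
have NE : n%:R <= expR L by rewrite -ler_ln ?posrE ?expR_gt0// expRK.
have vn : n%:R^-1 <= v.
  have h : 1 <= sn * v ^+ 3.
    apply: le_trans c4; rewrite -[1]mulr1; apply: ler_pM => //.
    by rewrite -[1]mulr1; apply: ler_pM => //; rewrite exprn_ege1.
  have s1 : 1 <= sn.
    apply: le_trans h _; rewrite ler_piMr ?(ltW sn0)// exprn_ile1// ltW//.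
  rewrite -div1r ler_pdivrMr// -snE; apply: le_trans h _.
  rewrite mulrC; apply: ler_pM; rewrite ?exprn_ge0 ?(ltW v0) ?(ltW sn0)//.
    by apply: ler_iXnr => //; rewrite ltW// v0.
  by apply: ler_eXnr.
apply: (@le_trans _ _ (n%:R^-1 / (96 * n%:R))); last first.
  by apply: ler_wpM2r vn; rewrite invr_ge0 mulr_ge0// ltW.
have -> : n%:R^-1 / (96 * n%:R) = (96 * n%:R ^+ 2)^-1 :> R by field; rewrite gt_eqF.
rewrite -[X in _ <= X]div1r ler_pdivlMr; last by rewrite mulr_gt0// exprn_gt0.
have -> : D%:R * (2 * expR (- (24 * L) / 2)) * (96 * n%:R ^+ 2) =
  192 * (D%:R * n%:R ^+ 2) * expR (- (24 * L) / 2) by ring.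
have e1 : 192 <= expR (8 * L).
  have h : 2 <= expR L by apply: le_trans (expR_ge1Dx _); move: L1; lra.
  rewrite -[8 * L]mulrC expRM_natr.
  by apply: (@le_trans _ _ (2 ^+ 8)); [lra|apply: lerXn2r; rewrite ?nnegrE ?expR_ge0].
have E : expR (8 * L) * (expR (2 * L) * expR L ^+ 2) * expR (- (24 * L) / 2) = 1.
  by rewrite -expRM_natr -!expRD -[RHS]expR0; congr expR; field.
rewrite -[X in _ <= X]E; apply: ler_wpM2r; first exact: expR_ge0.
apply: ler_pM => //.
apply: ler_pM => //.
by apply: lerXn2r; rewrite ?nnegrE ?expR_ge0.
Qed.

(** [th] is the usual Bernstein choice, limited either by the truncation level or by the variance
    [B ^+ 2]. The exponent reaches $-(7+K)L$: 3 units for the factor 8, 4 for $D^2$ and [K] for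
    [gamma]. *)
Lemma rate_bernstein (D N : nat) (gamma M1 : R) : (0 < D)%N -> (n <= 6 * N)%N ->
  ln (D%:R : R) <= 2 * L -> expR (- (K * L)) <= gamma -> 0 < M1 ->
  A * M1 ^+ 2 * L <= n%:R * De ->
  let th := Num.min (4 * M1 ^+ 2)^-1 (De / (32 * B ^+ 2)) in
  [/\ 0 < th, th * (2 * M1 ^+ 2) <= 2^-1 &
  8 * (D * D)%:R * expR (N%:R * (2 * th ^+ 2 * B ^+ 2 - th * (De / 8))) <= gamma].
Proof.
move=> D0 nN lD ga M10 cM th'.
have L1 : 1 <= L by rewrite exprn_ege1.
have De0 : 0 < De by rewrite divr_gt0 ?exprn_gt0// mulr_gt0// !exprn_gt0.
have B20 : 0 < 32 * B ^+ 2 by rewrite mulr_gt0// exprn_gt0.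
have M20 : 0 < 4 * M1 ^+ 2 by rewrite mulr_gt0// exprn_gt0.
have th0 : 0 < th' by rewrite lt_min invr_gt0 M20 divr_gt0.
have tM : th' * (4 * M1 ^+ 2) <= 1.
  by rewrite -ler_pdivlMr// div1r ge_min lexx.
have tB : th' * (32 * B ^+ 2) <= De by rewrite -ler_pdivlMr// ge_min lexx orbT.
split => //; first by move: tM; lra.
have nN' : n%:R <= 6 * N%:R :> R by rewrite -natrM ler_nat.
have key : (7 + K) * L <= N%:R * (th' * De / 16).
  have s : (7 + K) * L * 96 <= n%:R * (th' * De).
    rewrite /th'; case: (leP (4 * M1 ^+ 2)^-1 (De / (32 * B ^+ 2))) => hh.
      have -> : n%:R * ((4 * M1 ^+ 2)^-1 * De) = n%:R * De / (4 * M1 ^+ 2) by ring.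
      rewrite ler_pdivlMr//; apply: le_trans cM.
      have -> : (7 + K) * L * 96 * (4 * M1 ^+ 2) = 384 * (7 + K) * (M1 ^+ 2 * L) by ring.
      rewrite -(mulrA A); apply: ler_wpM2r A2; rewrite mulr_ge0 ?exprn_ge0// ltW//.
    have -> : n%:R * (De / (32 * B ^+ 2) * De) =
        sn ^+ 2 * v ^+ 4 / (32 * A0 ^+ 2 * (r ^+ 8 * B ^+ 2)).
      by rewrite -snE; field; rewrite !gt_eqF.
    rewrite ler_pdivlMr; last by rewrite !mulr_gt0// !exprn_gt0.
    have -> : (7 + K) * L * 96 * (32 * A0 ^+ 2 * (r ^+ 8 * B ^+ 2)) =
      32 * 96 * (7 + K) * A0 ^+ 2 * (r ^+ 10 * B ^+ 2) by ring.
    apply: (@le_trans _ _ ((sn * v ^+ 3) ^+ 2)); last first.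
      rewrite exprMn; apply: ler_wpM2l; first exact: sqr_ge0.
      by rewrite -exprM; apply: ler_wiXn2l => //; exact: ltW.
    apply: (@le_trans _ _ ((A * (r ^+ 7 * B)) ^+ 2)); last first.
      by apply: lerXn2r c4; rewrite nnegrE ?mulr_ge0 ?exprn_ge0// ltW.
    have -> : (A * (r ^+ 7 * B)) ^+ 2 = A ^+ 2 * (r ^+ 14 * B ^+ 2) by ring.
    apply: ler_pM.
    - apply: mulr_ge0 (sqr_ge0 _); apply: mulr_ge0; first exact: mulr_ge0.
      by move: K0; lra.
    - by rewrite mulr_ge0 ?exprn_ge0// ltW.
    - by apply: le_trans A3 _; apply: ler_eXnr.
    - by apply: ler_wpM2r; rewrite ?sqr_ge0//; exact: ler_weXn2l.
  have s' : n%:R * (th' * De) <= 6 * N%:R * (th' * De).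
    by apply: ler_wpM2r nN'; rewrite mulr_ge0// ltW.
  move: s s'; set x := _ * De; set y := (7 + K) * L.
  have -> : N%:R * (x / 16) = N%:R * x / 16 by ring.
  have -> : 6 * N%:R * x = 6 * (N%:R * x) by ring.
  set z := N%:R * x; clearbody x y z => *; lra.
apply: le_trans ga.
have ex : N%:R * (2 * th' ^+ 2 * B ^+ 2 - th' * (De / 8)) <= - ((7 + K) * L).
  apply: (@le_trans _ _ (- (N%:R * (th' * De / 16)))); last by rewrite lerN2.
  rewrite -[X in _ <= X]mulrN; apply: ler_wpM2l => //.
  have h : th' * (th' * (32 * B ^+ 2)) <= th' * De by rewrite ler_pM2l.
  have -> : 2 * th' ^+ 2 * B ^+ 2 = th' * (th' * (32 * B ^+ 2)) / 16 by field.
  move: h; set x := th' * (th' * _).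
  have -> : th' * (De / 8) = th' * De / 8 by ring.
  set y := th' * De; clearbody x y => *; lra.
have DE : D%:R <= expR (2 * L) by rewrite -ler_ln ?posrE ?expR_gt0 ?ltr0n// expRK.
have e8 : 8 <= expR (3 * L).
  have h : 2 <= expR L by apply: le_trans (expR_ge1Dx _); move: L1; lra.
  rewrite -[3 * L]mulrC expRM_natr.
  by apply: (@le_trans _ _ (2 ^+ 3)); [lra|apply: lerXn2r; rewrite ?nnegrE ?expR_ge0].
apply: (@le_trans _ _ (expR (3 * L) * (expR (2 * L) * expR (2 * L)) * expR (- ((7 + K) * L)))).
  rewrite natrM; apply: ler_pM; rewrite ?expR_ge0 ?mulr_ge0//; last by rewrite ler_expR.
  by apply: ler_pM => //; apply: ler_pM.
by rewrite -!expRD ler_expR; move: L1 K0; nra.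
Qed.

End rate_arithmetic.

(** 9/2 times the constant of [anti_const_le], plus one unit for the tails and one for the
    degenerate parts. *)
Definition core_const {R : realType} (s0 : R) : R :=
  9 / 2 * (7 / s0 * (expR (3 / 2) * (3 + 7 / s0) + 1)) + 2.

(** The smoothing width is $v/r$ while $\sqrt{2\log D}\le2r$, so the logarithms cancel. *)
Lemma anti_const_le {R : realType} (D : nat) (r v s0 : R) : 1 <= r -> 0 < v -> v <= 1 -> 0 < s0 ->
  ln (D%:R : R) <= 2 * r ^+ 2 ->
  anti_const (D := D) (r ^+ 3 / v) (r ^+ 2) s0 <=
  7 / s0 * (expR (3 / 2) * (3 + 7 / s0) + 1) * v.
Proof.
move=> r1 v0 v1 s00 lD; have r0 : 0 < r by apply: lt_le_trans r1.
have E : r ^+ 2 / (r ^+ 3 / v) = v / r by field; rewrite !gt_eqF.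
rewrite /anti_const E.
have vr : v / r <= 1 by rewrite ler_pdivrMr// mul1r (le_trans v1).
have vr0 : 0 <= v / r by rewrite divr_ge0// ltW.
have sq : Num.sqrt (2 * ln (D%:R : R)) <= 2 * r.
  rewrite -[X in _ <= X]ger0_norm ?mulr_ge0 ?(ltW r0)// -sqrtr_sqr.
  by apply: ler_wsqrtr; move: lD; lra.
have e0 := expR_gt0 (3 / 2 : R); set e := expR _ in e0 *.
have k0 : 0 <= 7 / s0 by rewrite divr_ge0// ltW.
have -> : 7 * (v / r) / s0 = 7 / s0 * (v / r) by ring.
set k := 7 / s0 in k0 *; have -> : k * (e * (3 + k) + 1) * v =
  k * (v / r) * ((e * (3 + k) + 1) * r) by field; rewrite gt_eqF.
apply: ler_wpM2l; first exact: mulr_ge0.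
have h : e * (1 + (Num.sqrt (2 * ln (D%:R : R)) + k * (v / r))) <= e * ((3 + k) * r).
  rewrite ler_pM2l//; have : k * (v / r) <= k * r by apply: ler_wpM2l => //; exact: le_trans r1.
  by move: sq r1; set x := Num.sqrt _; set y := k * (v / r); rewrite [(3 + k) * r]mulrDl; set z := k * r; lra.
by apply: le_trans (lerD h (lexx 1)) _; move: r1; lra.
Qed.

(* Here [r ^+ 2] is the logarithmic factor and [v] the rate: the orthants are
   smoothed at scale [v / r], with inverse temperature [be = r ^+ 3 / v], and [De]
   is the admissible error on the covariances. [M1] truncates the kernel for the
   covariances, [M2] for the degenerate parts. *)
Section core_rate.
Context {R : realType}.
Variables (b K A0 A : R).
Hypotheses (b0 : 0 < b) (K0 : 0 < K) (A00 : 264 <= A0) (A0b : 2 <= A0 * b)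
  (A1 : 16 * A0 <= A) (A2 : 384 * (7 + K) <= A) (A3 : 32 * 96 * (7 + K) * A0 ^+ 2 <= A)
  (A4 : 780 * 864 * 16 * expR 2 <= A) (A5 : 10 ^+ 6 <= A).
Variables (n : nat) (r v B : R).
Hypotheses (n4 : (3 < n)%N) (r1 : 1 <= r) (v0 : 0 < v) (v1 : v <= 1) (B1 : 1 <= B).
Hypothesis c4 : A * (r ^+ 7 * B) <= Num.sqrt n%:R * v ^+ 3.
Context {d : measure_display} {S : measurableType d} {D : nat}.
Variables (F : probability S R) (h : S -> S -> D.-tuple R).
Hypothesis mh : measurable_fun setT (fun z : S * S => h z.1 z.2).
Hypothesis hC : forall x y, h x y = h y x.
Hypothesis hsec4 : forall x, intg F (fun y => supn (h x y) ^+ 4).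
Hypothesis h4 : intg (F \x F)%E (fun z => supn (h z.1 z.2) ^+ 4).
Hypothesis h0 : forall j, Ex F (fun x => Ex F (fun y => tnth (h x y) j)) = 0.
Hypothesis m2 : forall j, b <= Ex F (fun x => tnth (hg F h x) j ^+ 2).
Hypothesis m3 : forall j, Ex (F \x F)%E (fun z => `|tnth (h z.1 z.2) j| ^+ 3) <= B.
Hypothesis m4 : forall j, Ex (F \x F)%E (fun z => tnth (h z.1 z.2) j ^+ 4) <= B ^+ 2.
Hypotheses (D0 : (0 < D)%N) (lD : ln (D%:R : R) <= 2 * r ^+ 2) (ln' : ln (n%:R : R) <= r ^+ 2).
Variables (gamma M1 M2 : R).
Hypotheses (g01 : 0 < gamma <= 1) (gK : expR (- (K * r ^+ 2)) <= gamma) (M10 : 0 < M1) (M20 : 0 < M2).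

Local Notation L := (r ^+ 2).
Local Notation be := (r ^+ 3 / v).
Local Notation De := (v ^+ 2 / (A0 * L ^+ 2)).
Local Notation sn := (Num.sqrt (n%:R : R)).

Hypotheses (c1 : 16 * tau F h M1 <= gamma * De) (c1' : A * M1 ^+ 2 * L <= n%:R * De)
  (c2 : 8 * tau F h M2 <= gamma * M2 ^+ 2) (c2' : A * (L ^+ 3 * M2 ^+ 2) <= n%:R * v ^+ 3)
  (c3 : 384 * be ^+ 2 * tau F h (sn / (2 * be)) <= v).

Let r0 : 0 < r. Proof. exact: lt_le_trans r1. Qed.
Let B0 : 0 < B. Proof. exact: lt_le_trans B1. Qed.
Let A00' : 0 < A0. Proof. exact: lt_le_trans A00. Qed.
Let AA0 : 0 < A. Proof. by move: A1 A00; lra. Qed.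
Let N0 : 0 < n%:R :> R. Proof. by rewrite ltr0n; apply: leq_ltn_trans n4. Qed.
Let sn0 : 0 < sn. Proof. by rewrite sqrtr_gt0. Qed.
Let snE : sn ^+ 2 = n%:R. Proof. by rewrite sqr_sqrtr// ltW. Qed.
Let L1 : 1 <= L. Proof. by rewrite exprn_ege1. Qed.
Let be0 : 0 < be. Proof. by rewrite divr_gt0// exprn_gt0. Qed.
Let De0 : 0 < De. Proof. by rewrite divr_gt0 ?exprn_gt0// mulr_gt0// !exprn_gt0. Qed.
Let hsec := hsec_of4 mh hsec4.
Let h2 := h2_of4 mh h4.
Let n2 : (1 < n)%N. Proof. by apply: leq_trans n4. Qed.

Lemma rate_third (m : nat) (H : R) : m.+1%:R <= 6 * L -> 0 <= H -> H <= 2 * M2 ^+ 2 ->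
  (16 * m.+1%:R) ^+ 2 * (9 * tau2 F h + H) / (2 * (n%:R - 1)) / (L / be) ^+ 2 <= v.
Proof.
move=> mL H0 HM.
have t2 : tau2 F h <= 2 * M2 ^+ 2.
  apply: le_trans (tau2_le mh h2 (ltW M20)) _.
  have : gamma * M2 ^+ 2 <= M2 ^+ 2.
    by apply: ler_piMl; [exact: sqr_ge0|case/andP: g01].
  by have := c2; have := sqr_ge0 M2; lra.
have t20 : 0 <= tau2 F h by exact: tau2_ge0.
have n1 : n%:R <= 2 * (n%:R - 1) :> R.
  have : 2 <= n%:R :> R by rewrite ler_nat.
  by lra.
have -> : L / be = v / r by field; rewrite !gt_eqF.
have n10 : 0 < 2 * (n%:R - 1) :> R by apply: lt_le_trans n1.
rewrite ler_pdivrMr; last by rewrite exprn_gt0// divr_gt0.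
rewrite ler_pdivrMr//.
apply: (@le_trans _ _ ((96 * L) ^+ 2 * (20 * M2 ^+ 2))).
  apply: ler_pM; rewrite ?sqr_ge0//.
  - by rewrite addr_ge0// mulr_ge0.
  - apply: lerXn2r; rewrite ?nnegrE ?mulr_ge0 ?exprn_ge0 ?(ltW r0)//.
    by move: mL; lra.
  - by move: t2 HM; lra.
apply: (@le_trans _ _ (v * (v / r) ^+ 2 * n%:R)); last first.
  by apply: ler_wpM2l => //; rewrite mulr_ge0 ?(ltW v0)// exprn_ge0// divr_ge0// ltW.
have -> : v * (v / r) ^+ 2 * n%:R = n%:R * v ^+ 3 / L by field; rewrite gt_eqF.
rewrite ler_pdivlMr; last exact: exprn_gt0.
apply: le_trans c2'.
have -> : (96 * L) ^+ 2 * (20 * M2 ^+ 2) * L = (96 ^+ 2 * 20) * (L ^+ 3 * M2 ^+ 2) by ring.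
apply: ler_wpM2r; first by rewrite mulr_ge0 ?exprn_ge0// ltW.
by apply: le_trans A5; lra.
Qed.

Theorem core_rate : exists G : set (n.-tuple S),
  [/\ measurable G, 1 - gamma <= pr (prodn F n) G &
   forall t, G t -> forall c,
  `|pr (prodn F n) (hT h (n := n) @^-1` orth c) -
    pr (prodn N01 n) (hTb h t @^-1` orth c)| <= core_const (Num.sqrt (b / 2)) * v].
Proof.
have [m Dm m6] := log2_ceil D0 L1 lD.
have [a a1 aB] := cube_root B1; have a0 : 0 < a by apply: lt_le_trans a1.
have [De1 De2] := rate_De A00 A0b r1 v0 v1.
(* The number of disjoint blocks of three observations, at least [n / 6]. *)
pose N := (n %/ 3)%N.
have N3 : (N * 3 <= n)%N by exact: leq_trunc_div.
have N1 : (0 < N)%N by rewrite divn_gt0// ltnW.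
have N6 : (n <= 6 * N)%N.
  have := divn_eq n 3; have := ltn_pmod n (isT : 0 < 3)%N; rewrite -/N.
  by move: N1; clear; lia.
have [th0 thM thN] := rate_bernstein K0 A00 A1 A2 A3 r1 sn0 snE v0 v1 B1 c4
  D0 N6 lD gK M10 c1'.
set th := Num.min _ _ in th0 thM thN.
have h4j j : intg (F \x F)%E (fun z => tnth (h z.1 z.2) j ^+ 4) /\
    Ex (F \x F)%E (fun z => tnth (h z.1 z.2) j ^+ 4) <= B ^+ 2.
  split => //; apply: (intg_le _ _ h4) => [|z].
    by apply: measurable_funX; exact: measurable_hj.
  rewrite normrX; apply: lerXn2r; rewrite ?nnegrE ?supn_ge0//; exact: le_supn.
have H3 : 8 * M2 ^+ 2 <= (n%:R - 1) * De.
  have n1 : n%:R <= 2 * (n%:R - 1) :> R.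
    have : 2 <= n%:R :> R by rewrite ler_nat.
    by lra.
  have hh : 8 * M2 ^+ 2 * 2 <= n%:R * De.
    rewrite mulrA ler_pdivlMr; last by rewrite mulr_gt0// !exprn_gt0.
    apply: (@le_trans _ _ (A * (L ^+ 3 * M2 ^+ 2))).
      have -> : 8 * M2 ^+ 2 * 2 * (A0 * L ^+ 2) = 16 * A0 * (L ^+ 2 * M2 ^+ 2) by ring.
      apply: ler_pM => //; [by rewrite mulr_ge0// ltW|by rewrite mulr_ge0 ?exprn_ge0// ltW|].
      by apply: ler_wpM2r; [exact: sqr_ge0|exact: ler_weXn2l].
    apply: le_trans c2' _; apply: ler_wpM2l; first exact: ltW.
    by apply: ler_wiXn2l => //; exact: ltW.
  have : n%:R * De <= 2 * (n%:R - 1) * De by apply: ler_wpM2r => //; exact: ltW.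
  have -> : 2 * (n%:R - 1) * De = 2 * ((n%:R - 1) * De) by ring.
  by move: hh; lra.
have [G [mG pG gG]] := good_event mh hsec h2 n4 N1 N3 g01 De0 (ltW M10) M20 th0 h4j
  c1 c2 H3 thM thN.
exists G; split => // t Gt c; have [SDe HM] := gG _ Gt.
have g3 j := hg_cube mh hsec4 h4 (m3 j).
have [k1 k2] := cut_sq_hg mh hsec4 h4 be0 (ltnW n2).
(* [a] is the cube root of [B]. The variances are at most $a^2$ and [De <= 1], so the empirical ones
   stay below $4a^2$; then [108 * ta ^+ 3] equals [ka], as $864=108\cdot8$. *)
pose ta := 2 * a / sn; pose ka := 864 * B * sn^-1 ^+ 3.
have s0 : 0 < Num.sqrt (b / 2) by rewrite sqrtr_gt0 divr_gt0.
have s02 : Num.sqrt (b / 2) ^+ 2 = b / 2 by rewrite sqr_sqrtr// divr_ge0// ltW.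
have Siglo j : b <= Sig F h j j.
  by apply: le_trans (m2 j) _; rewrite /Sig; under eq_fun do rewrite expr2.
have Sighi j : Sig F h j j <= a ^+ 2.
  have [i3 e3] := g3 j.
  have i2 : intg F (fun x => tnth (hg F h x) j * tnth (hg F h x) j).
    apply: (intg_le _ _ (intg_hg2 mh hsec h2)) => [|x].
      by apply: measurable_funM; exact: (intg_measurable (intg_hg mh hsec h2 j)).
    by rewrite normrM expr2; apply: ler_pM => //; exact: le_supn.
  (* Young's inequality $3z^2\le a^2+2z^3/a$ stands in for the comparison of second and third
     moments. *)
  have ie : intg F (fun x => 3^-1 * (a ^+ 2 + 2 / a * `|tnth (hg F h x) j| ^+ 3)).
    by apply/intgZ/intgD; [exact: intg_cst|exact: intgZ].
  apply: (@le_trans _ _ (Ex F (fun x => 3^-1 * (a ^+ 2 + 2 / a * `|tnth (hg F h x) j| ^+ 3)))).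
    apply: Ex_le => // x; set y := tnth _ _.
    rewrite -expr2 -[y ^+ 2]real_normK ?num_real//; have := normr_ge0 y; move: (`|y|) => z z0.
    rewrite -(ler_pM2r (_ : 0 < 3 * a)); last by rewrite mulr_gt0.
    have -> : 3^-1 * (a ^+ 2 + 2 / a * z ^+ 3) * (3 * a) = a ^+ 3 + 2 * z ^+ 3.
      by field; rewrite gt_eqF.
    rewrite -subr_ge0; have -> : a ^+ 3 + 2 * z ^+ 3 - z ^+ 2 * (3 * a) = (z - a) ^+ 2 * (2 * z + a) by ring.
    by rewrite mulr_ge0 ?sqr_ge0// addr_ge0 ?mulr_ge0// ltW.
  rewrite ExZ; last by apply: intgD; [exact: intg_cst|exact: intgZ].
  rewrite ExD; [|exact: intg_cst|exact: intgZ].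
  rewrite Ex_cst (ExZ _ i3) -[X in _ <= X](_ : 3^-1 * (a ^+ 2 + 2 / a * B) = _).
    by rewrite ler_pM2l ?invr_gt0// lerD2l ler_pM2l// divr_gt0.
  by rewrite -aB; field; rewrite gt_eqF.
have SD j := SDe j j.
have Slo j : Num.sqrt (b / 2) ^+ 2 <= Shat h t j j.
  by rewrite s02; have := Siglo j; have /ler_normlP[x1 _] := SD j; move: x1 De1; lra.
have Shi j : Shat h t j j / n%:R <= ta ^+ 2.
  rewrite ler_pdivrMr// /ta -[X in _ * X]snE.
  have -> : (2 * a / sn) ^+ 2 * sn ^+ 2 = 4 * a ^+ 2 by field; rewrite gt_eqF.
  have := Sighi j; have /ler_normlP[_ x1] := SD j.
  have : 1 <= a ^+ 2 by rewrite exprn_ege1.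
  by move: x1 De2; lra.
have ta0 : 0 < ta by rewrite divr_gt0// mulr_gt0.
have kaB : B * sn^-1 ^+ 3 <= ka.
  rewrite /ka; apply: ler_wpM2r; first by rewrite exprn_ge0// invr_ge0 ltW.
  by rewrite ler_pMl//; lra.
have kat : 108 * ta ^+ 3 <= ka.
  rewrite le_eqVlt /ta /ka -aB; apply/orP; left; apply/eqP; field; by rewrite gt_eqF.
pose eta := v / (96 * n%:R).
have tx : intg F (fun x => cut_sq be (tscale sn^-1 (hg F h x))) /\
    Ex F (fun x => cut_sq be (tscale sn^-1 (hg F h x))) <= eta.
  split => //; apply: le_trans k2 _; rewrite /eta ler_pdivlMr ?mulr_gt0//.
  set tt := tau _ _ _; have -> : 4 * be ^+ 2 / n%:R * tt * (96 * n%:R) = 384 * be ^+ 2 * tt.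
    by field; rewrite !gt_eqF.
  exact: c3.
have la0 : 0 <= 24 * L by rewrite mulr_ge0// exprn_ge0// ltW.
have tala := rate_la A00 A1 r1 sn0 v0 v1 c4 a1 aB.
have laeta := rate_laeta A00 A1 n4 r1 sn0 snE v0 v1 B1 c4 D0 lD ln'.
have eta2 : eta <= 2^-1.
  rewrite /eta ler_pdivrMr ?mulr_gt0//.
  have : 1 <= n%:R :> R by rewrite ler1n ltnW.
  by move: v1; lra.
have sw := rate_swap A00 A4 r1 sn0 snE v0 B1 c4.
have core := core_compare mh hC hsec h2 h0 n2 Dm D0 be0 L1 lD g3 kaB kat ta0 Shi tx la0 tala
  laeta eta2 SDe sw s0 Slo c.
apply: le_trans core _.
have H0 : 0 <= Hbar h t.
  rewrite /Hbar mulr_ge0//; last by do 2![apply: sumr_ge0 => ? _]; exact: sqr_ge0.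
  by rewrite invr_ge0 mulr_ge0// subr_ge0 ler1n ltnW.
have t3 := rate_third m6 H0 HM.
have an := anti_const_le r1 v0 v1 s0 lD.
have e96 : 96 * (n%:R * eta) = v by rewrite /eta; field; rewrite gt_eqF.
rewrite e96 /core_const; apply: le_trans (lerD (lerD (ler_wpM2l _ an) (lexx v)) t3) _ => //.
set x := 7 / _ * _; clearbody x; lra.
Qed.

End core_rate.

(** * From the bootstrap model to product measures *)

Lemma measurable_joint {d dO} {Omega : measurableType dO} {S : measurableType d} {R : realType}
    {n} (P : probability Omega R) (Y : 'I_n -> {RV P >-> S}) :
  measurable_fun setT (joint Y).
Proof.
apply/measurable_fun_tnthP => i /=.
rewrite (_ : _ \o _ = Y i); last by apply/funext => o; rewrite /= /joint tnth_mktuple.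
exact: measurable_funP.
Qed.

Lemma joint_law {d dO} {Omega : measurableType dO} {S : measurableType d} {R : realType}
    {n} (P : probability Omega R) (Y : 'I_n -> {RV P >-> S}) (F : set S -> \bar R)
    (Q : probability (n.-tuple S) R) :
  iid Y F -> (forall A : 'I_n -> set S, (forall i, measurable (A i)) ->
    Q (trect A) = (\prod_(i < n) F (A i))%E) ->
  meq (pushP P (measurable_joint Y)) Q.
Proof.
move=> [ind law] HQ; apply: trect_unique; first exact: probability_setT.
move=> A mA; apply: etrans (esym (HQ _ mA)); rewrite [LHS]pushPE.
rewrite (_ : _ @^-1` _ = \bigcap_(i in [set: 'I_n]) (Y i @^-1` A i)); last first.
  by apply/seteqP; split => o /= H i => [_|]; have := H i; rewrite /joint tnth_mktuple //; exact.
by rewrite ind//; apply: eq_bigr => i _; exact: law.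
Qed.

Section shifted_normal.
Context {R : realType}.
Local Notation mu := lebesgue_measure.

Lemma measurable_add1 : measurable_fun setT (fun x : R => 1 + x).
Proof. exact: measurable_funD. Qed.

Lemma normal_prob11 (A : set R) : measurable A ->
  normal_prob 1 1 A = N01 ((fun x : R => 1 + x) @^-1` A).
Proof.
move=> mA; have mA' : measurable ((fun x : R => 1 + x) @^-1` A).
  by rewrite -[X in measurable X]setTI; exact: measurable_add1.
rewrite (N01E mA') /normal_prob [LHS]integral_mkcond.
pose g0 := (fun x : R => (normal_pdf 1 1 x)%:E) \_ A.
transitivity (\int[mu]_x (fun y : R => g0 (y + 1)%R) x)%E.
  apply/esym; apply: (@ge0_integral_shift R g0 1).
    apply/(measurable_restrictT _ mA); apply/measurable_EFinP; apply: measurable_funTS.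
    exact: measurable_normal_pdf.
  by move=> x; rewrite /g0 erestrict_ge0// => y _; rewrite lee_fin normal_pdf_ge0.
apply: eq_integral => x _; rewrite /g0 patchE indicE addrC.
have -> : (x \in (fun x : R => 1 + x) @^-1` A) = (1 + x \in A).
  by apply/idP/idP => /set_mem H; exact/mem_set.
case: ifP => _; rewrite ?mul1e ?mul0e//; congr EFin.
rewrite /phi !normal_pdfE ?oner_eq0//; congr (_ * expR _).
by rewrite subr0 [1 + x]addrC addrK.
Qed.

Definition shift1 {n} (xi : n.-tuple R) : n.-tuple R := [tuple 1 + tnth xi i | i < n].

Lemma measurable_shift1 n : measurable_fun setT (@shift1 n).
Proof.
apply/measurable_fun_tnthP => i /=.
rewrite (_ : _ \o _ = fun xi => 1 + tnth xi i); last by apply/funext => o; rewrite /= tnth_mktuple.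
by apply: measurable_funD => //; exact: measurable_tnth.
Qed.

Lemma prodn_shift1 n (A : 'I_n -> set R) : (forall i, measurable (A i)) ->
  pushP (prodn N01 n) (@measurable_shift1 n) (trect A) = (\prod_(i < n) normal_prob 1 1 (A i))%E.
Proof.
move=> mA; rewrite [LHS]pushPE.
rewrite (_ : _ @^-1` _ = trect (fun i => (fun x : R => 1 + x) @^-1` A i)); last first.
  by apply/seteqP; split => t /= H i; have := H i; rewrite tnth_mktuple.
rewrite prodn_trect; last first.
  by move=> i; rewrite -[X in measurable X]setTI; exact: measurable_add1.
by apply: eq_bigr => i _; rewrite normal_prob11.
Qed.

End shifted_normal.

Section conditional_law.
Context {dO d1 d2 d3} {Omega : measurableType dO} {S1 : measurableType d1}
  {S2 : measurableType d2} {S3 : measurableType d3} {R : realType}.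
Variables (P : probability Omega R) (Y : Omega -> S1) (Z : Omega -> S2)
  (PY : probability S1 R) (PZ : probability S2 R).
Hypotheses (mY : measurable_fun setT Y) (mZ : measurable_fun setT Z).
Hypotheses (lY : meq (pushP P mY) PY) (lZ : meq (pushP P mZ) PZ).
Hypothesis ind : independent P Y Z.

Let mYZ : measurable_fun setT (fun o => (Y o, Z o)).
Proof. exact: measurable_fun_pair. Qed.

Let lYE A : measurable A -> P (Y @^-1` A) = PY A.
Proof. by move=> mA; have := lY mA; rewrite [LHS]pushPE. Qed.
Let lZE A : measurable A -> P (Z @^-1` A) = PZ A.
Proof. by move=> mA; have := lZ mA; rewrite [LHS]pushPE. Qed.

Lemma joint_product C : measurable C -> P ((fun o => (Y o, Z o)) @^-1` C) = (PY \x PZ)%E C.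
Proof.
move=> mC; rewrite (product_measure_unique (m' := pushP P mYZ))//.
move=> A B mA mB; apply: etrans (congr2 (fun a b => a * b)%E (lYE mA) (lZE mB)).
by rewrite [LHS]pushPE -ind.
Qed.

Variables (f : S1 * S2 -> S3) (k : R.-pker S1 ~> S3).
Hypothesis mf : measurable_fun setT f.
Hypothesis kreg : regular_conditional_law P Y (fun o => f (Y o, Z o)) k.

(** Both sides have the same integral over every measurable set of values of [Y], by the defining
    property of [k] on one side and independence with Fubini's theorem on the other. The null set
    depends on [B], so only countably many sets [B] can be treated at once. *)
Lemma conditional_law_ae B : measurable B ->
  {ae PY, forall y, k y B = PZ ((fun z => f (y, z)) @^-1` B)}.
Proof.
move=> mB.
have mfB : measurable (f @^-1` B) by rewrite -[X in measurable X]setTI; exact: mf.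
have mk := measurable_kernel k B mB.
have E : (fun y => PZ ((fun z => f (y, z)) @^-1` B)) = PZ \o xsection (f @^-1` B).
  by apply/funext => y /=; congr (PZ _); rewrite /xsection; apply/seteqP; split => z /=; rewrite in_setE.
have mx : measurable_fun setT (fun y => PZ ((fun z => f (y, z)) @^-1` B)).
  by rewrite E; exact: measurable_fun_xsection.
have ky y : (k y B <= 1)%E by rewrite -(prob_kernel (s := k) y) le_measure ?inE.
have : ae_eq PY setT (fun y => k y B) (fun y => PZ ((fun z => f (y, z)) @^-1` B)).
  apply: (integral_ae_eq measurableT) => //.
    apply: (@le_integrable _ _ R PY setT measurableT (fun y => k y B) (EFin \o cst 1)) => //.
      by move=> y _; rewrite gee0_abs//= normr1.
    exact: finite_measure_integrable_cst.
  move=> A _ mA.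
  have := kreg mA mB.
  have -> : (\int[P]_(o in Y @^-1` A) k (Y o) B)%E = (\int[PY]_(y in A) k y B)%E.
    rewrite -(eq_measure_integral PY (m1 := pushP P mY)); last by move=> C mC _; exact: lY.
    rewrite (ge0_integral_pushforward mY P mA (f := fun y => k y B))//.
    exact: measurable_funTS.
  move=> <-.
  rewrite (_ : _ `&` _ = (fun o => (Y o, Z o)) @^-1` ((A `*` setT) `&` f @^-1` B)); last first.
    by apply/seteqP; split => o /=; [case|case=> -[]].
  rewrite joint_product; last by apply: measurableI => //; exact: measurableX.
  rewrite [LHS]/product_measure1 integral_mkcond [RHS]integral_mkcond.
  apply: eq_integral => y _; rewrite /= !patchE in_setT.
  case: ifPn => yA.
    congr (PZ _); apply/seteqP; split => z /=; rewrite /xsection /= in_setE.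
      by case=> _.
    by move=> fB; split => //; split => //=; exact/set_mem.
  apply/eqP; rewrite (_ : xsection _ _ = set0) ?measure0//.
  apply/seteqP; split => z //=; rewrite /xsection /= in_setE => -[[/= yA' _] _].
  by move/negP: yA; apply; exact/mem_set.
by apply: filterS => y; apply.
Qed.

End conditional_law.

(** * Reduction of the supremum to rational boxes *)

Section rational_boxes.
Context {R : realType} {d : nat}.

Definition box (a b : 'I_d -> R) : set (d.-tuple R) :=
  [set s | forall j, a j <= tnth s j <= b j].

Definition qbox (q : {ffun 'I_d -> rat * rat}) : set (d.-tuple R) :=
  box (fun j => ratr (q j).1) (fun j => ratr (q j).2).

Lemma measurable_box a b : measurable (box a b).
Proof.
rewrite (_ : box a b = [set s | forall j, ((fun s => tnth s j) @^-1` `[a j, b j]%classic) s]); last first.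
  by apply/seteqP; split => s /= H j; have := H j; rewrite in_itv.
apply: measurable_forall => j.
by rewrite -[X in measurable X]setTI; apply: measurable_tnth.
Qed.

(** Rationals strictly below a finite [e] and tending to it decide the closed condition [e <= x]
    correctly from some rank on, also at [x = e]; for infinite endpoints integers do. *)
Lemma rat_lower_approx (e : \bar R) : exists u : nat -> rat,
  forall x : R, \forall m \near \oo, (ratr (u m) <= x) = (e <= x%:E)%E.
Proof.
case: e => [r| |].
- have H m : exists q : rat, ratr q \in `]r - m.+1%:R^-1, r[.
    by apply: rat_in_itvoo; rewrite ltrBlDr ltrDl invr_gt0.
  have [u Hu] := choice H; exists u => x.
  have [rx|xr] := leP r x.
    near=> m; have := Hu m; rewrite in_itv/= lee_fin rx => /andP[_ h].
    by rewrite (ltW (lt_le_trans h rx)).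
  have : \forall m \near \oo, m.+1%:R^-1 < r - x.
    by apply: near_infty_natSinv_lt (PosNum _); rewrite subr_gt0.
  apply: filterS => m hm; have := Hu m; rewrite in_itv/= lee_fin => /andP[h _].
  rewrite [RHS]leNgt xr /=; apply/negbTE; rewrite -ltNge; move: h hm.
  by set z := _^-1; set y := ratr _; clearbody z y => *; lra.
- exists (fun m => m%:R) => x; have := nbhs_infty_gtr x; apply: filterS => m hm.
  by rewrite leye_eq /= ratr_nat; apply/negbTE; rewrite -ltNge.
- exists (fun m => - m%:R) => x; have := nbhs_infty_gtr (- x); apply: filterS => m hm.
  by rewrite leNye rmorphN /= ratr_nat; move: hm; rewrite ltrNl => /ltW.
Unshelve. all: by end_near.
Qed.

Lemma hyperrectangle_approx (A : set (d.-tuple R)) : hyperrectangle A ->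
  exists q : nat -> {ffun 'I_d -> rat * rat},
    forall s, \forall m \near \oo, qbox (q m) s <-> A s.
Proof.
move=> [a [b [_ ->]]].
have [u Hu] := choice (fun j => rat_lower_approx (a j)).
have [v Hv] := choice (fun j => rat_lower_approx (- b j)%E).
exists (fun m => [ffun j => (u j m, - v j m)]) => s.
have Hj j : \forall m \near \oo,
    (ratr (u j m) <= tnth s j) = (a j <= (tnth s j)%:E)%E /\
    (ratr (v j m) <= - tnth s j) = (- b j <= (- tnth s j)%:E)%E.
  by apply: filterS2 (Hu j (tnth s j)) (Hv j (- tnth s j)) => m.
have : \forall m \near \oo, forall j,
    (ratr (u j m) <= tnth s j) = (a j <= (tnth s j)%:E)%E /\
    (ratr (v j m) <= - tnth s j) = (- b j <= (- tnth s j)%:E)%E.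
  exact: filter_forall.
apply: filterS => m Hm; rewrite /qbox /box /=.
by split => H j; have := H j; have [h1 h2] := Hm j;
  rewrite ffunE /= rmorphN /= lerNr h1 h2 EFinN leeN2.
Unshelve. all: by end_near.
Qed.

End rational_boxes.

Lemma measure_near_cvg {d} {T : measurableType d} {R : realType} (mu : {measure set T -> \bar R})
    (A_ : nat -> set T) (A : set T) : mu setT = 1%E ->
  (forall m, measurable (A_ m)) -> measurable A ->
  (forall s, \forall m \near \oo, A_ m s <-> A s) ->
  (fun m => fine (mu (A_ m))) @ \oo --> fine (mu A).
Proof.
move=> mu1 mA_ mA H.
have ifin : mu.-integrable setT (EFin \o cst 1).
  apply/integrableP; split; first exact/measurable_EFinP.
  rewrite (eq_integral (cst 1%E)); last by move=> x _; rewrite /= normr1.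
  by rewrite integral_cst//= mu1 mule1 ltry.
have mI B : measurable B -> measurable_fun setT (EFin \o (\1_B : T -> R)).
  by move=> mB; apply/measurable_EFinP; exact: measurable_indic.
have cv : {ae mu, forall x, setT x ->
    (EFin \o (\1_(A_ m) : T -> R)) x @[m --> \oo] --> (EFin \o (\1_A : T -> R)) x}.
  apply: aeW => x _; apply: cvg_near_cst; near=> m.
  have Hx : A_ m x <-> A x by near: m; exact: H.
  rewrite /= !indicE; congr (_%:R%:E); congr nat_of_bool.
  by apply/idP/idP => /set_mem h; apply/mem_set/Hx.
have bd : {ae mu, forall x, forall m, setT x -> (`|(EFin \o (\1_(A_ m) : T -> R)) x| <= (EFin \o (cst 1%R : T -> R)) x)%E}.
  by apply: aeW => x m _ /=; rewrite lee_fin ger0_norm// indicE lern1 leq_b1.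
have [_ _ K] := @dominated_convergence _ T R mu setT measurableT
  (fun m => EFin \o \1_(A_ m)) (EFin \o \1_A) (EFin \o cst 1)
  (fun m => mI _ (mA_ m)) (mI _ mA) cv ifin bd.
have E B : measurable B -> (\int[mu]_x (EFin \o \1_B) x)%E = mu B.
  by move=> mB; rewrite integral_indic// setIT.
have f1 B : measurable B -> mu B \is a fin_num.
  by move=> mB; rewrite ge0_fin_numE//; apply: le_lt_trans (ltry 1); rewrite -mu1 le_measure ?inE.
rewrite E// in K; apply: fine_cvg; rewrite fineK ?f1//.
rewrite (_ : (fun m => mu (A_ m)) = (fun m => (\int[mu]_x (EFin \o \1_(A_ m)) x)%E)).
  exact: K.
by apply/funext => m; rewrite E.
Unshelve. all: by end_near.
Qed.

(** Indicators of rational boxes converge pointwise to that of any hyperrectangle, so countably many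
    boxes decide the supremum. This makes the event measurable and lets the null sets of the
    conditional law be merged into one. *)
Lemma rhoB_le {dO} {Omega : measurableType dO} {R : realType} {d : nat}
    (P : probability Omega R) (T : Omega -> d.-tuple R)
    (Q : {measure set (d.-tuple R) -> \bar R}) (C : R) :
  measurable_fun setT T -> Q setT = 1%E -> 0 <= C ->
  (rhoB P T Q <= C%:E)%E <->
  forall q, `|pr P (T @^-1` qbox q) - fine (Q (qbox q))| <= C.
Proof.
move=> mT Q1 C0.
have mTA A : measurable A -> measurable (T @^-1` A).
  by move=> mA; rewrite -[X in measurable X]setTI; exact: mT.
have mq q : measurable (qbox q : set (d.-tuple R)) by exact: measurable_box.
have QE A : measurable A -> Q A = (fine (Q A))%:E.
  move=> mA; rewrite fineK// ge0_fin_numE//; apply: le_lt_trans (ltry 1).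
  by rewrite -Q1 le_measure ?inE.
split=> [H q|H].
  (* A rational box with reversed endpoints is empty and is not presented as a hyperrectangle; both
     of its probabilities are 0. *)
  have [[j hj]|nj] := pselect (exists j, ratr (q j).2 < ratr (q j).1 :> R).
    have E : qbox q = set0 :> set (d.-tuple R).
      apply/seteqP; split => // s /(_ j) /andP[h1 h2].
      by have := lt_le_trans hj (le_trans h1 h2); rewrite ltxx.
    by rewrite E preimage_set0 /pr !measure0 subrr normr0.
  have hq : hyperrectangle (qbox q : set (d.-tuple R)).
    exists (fun j => (ratr (q j).1)%:E), (fun j => (ratr (q j).2)%:E); split => [j|].
      by rewrite lee_fin leNgt; apply/negP => h; apply: nj; exists j.
    by apply/seteqP; split => s hs j; have := hs j; rewrite !lee_fin.
  have : (`|P (T @^-1` qbox q) - Q (qbox q)| <= rhoB P T Q)%E.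
    by apply: ereal_sup_ubound; exists (qbox q).
  move=> h; have := le_trans h H.
  by rewrite (prE P (mTA _ (mq q))) QE// -EFinB abse_EFin lee_fin.
apply: ge_ereal_sup => _ [A hA <-].
have [q hq] := hyperrectangle_approx hA.
have mA : measurable A.
  have [a [b [_ ->]]] := hA.
  rewrite (_ : [set x | _] = [set s | forall j, ((fun s => (tnth s j)%:E) @^-1` `[a j, b j]%classic) s]); last first.
    by apply/seteqP; split => s /= h j; have := h j; rewrite in_itv.
  apply: measurable_forall => j; rewrite -[X in measurable X]setTI.
  have : measurable_fun setT (fun s : d.-tuple R => (tnth s j)%:E).
    by apply/measurable_EFinP; exact: measurable_tnth.
  by apply => //; exact: emeasurable_itv.
rewrite (prE P (mTA _ mA)) QE// -EFinB abse_EFin lee_fin.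
have c1 : (fun m => pr P (T @^-1` qbox (q m))) @ \oo --> pr P (T @^-1` A).
  apply: (measure_near_cvg (mu := P)); [exact: probability_setT|by move=> m; exact: mTA|exact: mTA|].
  by move=> o; exact: hq.
have c2 := measure_near_cvg Q1 (fun m => mq (q m)) mA hq.
have c3 : `|pr P (T @^-1` qbox (q m)) - fine (Q (qbox (q m)))| @[m --> \oo] -->
    `|pr P (T @^-1` A) - fine (Q A)| by exact: cvg_norm (cvgB c1 c2).
rewrite -(cvg_lim _ c3)//; apply: limr_le; first by apply/cvg_ex; eexists; exact: c3.
by near=> m; exact: H.
Unshelve. all: by end_near.
Qed.

Section model.
Context {dO} {Omega : measurableType dO} {R : realType} {n p d : nat}.
Variables (P : probability Omega R) (h : p.-tuple R -> p.-tuple R -> d.-tuple R)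
  (F : probability (p.-tuple R) R) (X : 'I_n -> {RV P >-> p.-tuple R})
  (w : 'I_n -> {RV P >-> R}) (k : R.-pker (n.-tuple (p.-tuple R)) ~> (d.-tuple R)).
Hypothesis mh : measurable_fun [set: p.-tuple R * p.-tuple R] (fun z => h z.1 z.2).
Hypothesis model : bootstrap_model h F X w k.

Local Notation S := (p.-tuple R).

Let mhij (i j : 'I_n) (l : 'I_d) :
  measurable_fun setT (fun t : n.-tuple S => tnth (h (tnth t i) (tnth t j)) l).
Proof.
apply: (measurableT_comp (measurable_tnth l)).
apply: (measurableT_comp mh (g := fun t : n.-tuple S => (tnth t i, tnth t j))).
by apply: measurable_fun_pair; exact: measurable_tnth.
Qed.

Lemma measurable_T_stat th : measurable_fun setT (fun t : n.-tuple S => T_stat h th t).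
Proof.
apply/measurable_fun_tnthP => l /=.
rewrite (_ : _ \o _ = fun t => Num.sqrt n%:R * (U_stat h t l - th l) / 2); last first.
  by apply/funext => t; rewrite /= tnth_mktuple.
apply: measurable_funM => //; apply: measurable_funM => //; apply: measurable_funB => //.
rewrite /U_stat; apply: measurable_funM => //.
by apply: measurable_sum => i; under eq_fun do rewrite big_mkcond/=;
  apply: measurable_sum => j; case: (i != j).
Qed.

Lemma measurable_T_boot : measurable_fun setT (fun z : n.-tuple S * n.-tuple R => T_boot h z.1 z.2).
Proof.
have m1 : measurable_fun setT (fun z : n.-tuple S * n.-tuple R => z.1) by exact: measurable_fst.
have m2 : measurable_fun setT (fun z : n.-tuple S * n.-tuple R => z.2) by exact: measurable_snd.
apply/measurable_fun_tnthP => l /=.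
rewrite (_ : _ \o _ = fun z : n.-tuple S * n.-tuple R =>
    Num.sqrt n%:R * (U_boot h z.1 z.2 l - U_stat h z.1 l) / 2); last first.
  by apply/funext => t; rewrite /= tnth_mktuple.
apply: measurable_funM => //; apply: measurable_funM => //; apply: measurable_funB => //.
  rewrite /U_boot; apply: measurable_funM => //.
  apply: measurable_sum => i; under eq_fun do rewrite big_mkcond/=.
  apply: measurable_sum => j; case: (i != j) => //.
  apply: measurable_funM; last exact: (measurableT_comp (mhij i j l) m1).
  apply: measurable_funM; first exact: (measurableT_comp (measurable_tnth i) m2).
  exact: (measurableT_comp (measurable_tnth j) m2).
rewrite /U_stat; apply: measurable_funM => //.
apply: measurable_sum => i; under eq_fun do rewrite big_mkcond/=.
apply: measurable_sum => j; case: (i != j) => //.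
exact: (measurableT_comp (mhij i j l) m1).
Qed.

Let mX : measurable_fun setT (joint X) := measurable_joint X.
Let mw : measurable_fun setT (joint w) := measurable_joint w.

Lemma law_X : meq (pushP P mX) (prodn F n).
Proof. by have [iX _ _ _] := model; apply: (joint_law iX) => A mA; exact: prodn_trect. Qed.

Lemma law_w : meq (pushP P mw) (pushP (prodn N01 n) (@measurable_shift1 R n)).
Proof. by have [_ iw _ _] := model; apply: (joint_law iw) => A mA; exact: prodn_shift1. Qed.

(** Passes from fixed samples and product measures to the model: for almost every sample the
    conditional law agrees with the law of the reweighted statistic on all rational boxes at once,
    and the exceptional null set leaves the probability of [G] unaffected. *)
Theorem model_rho_le (th : 'I_d -> R) (gamma C : R) (G : set (n.-tuple S)) : 0 <= C ->
  measurable G -> 1 - gamma <= pr (prodn F n) G ->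
  (forall t, G t -> forall a b,
    `|pr (prodn F n) ((fun t => T_stat h th t) @^-1` box a b) -
      pr (prodn N01 n) ((fun xi => T_boot h t (shift1 xi)) @^-1` box a b)| <= C) ->
  ((1 - gamma)%:E <= P [set o | rhoB P (fun o' => T_stat h th (joint X o')) (k (joint X o)) <= C%:E])%E.
Proof.
move=> C0 mG pG HG; have [iX iw ind reg] := model.
have mTX : measurable_fun setT (fun o => T_stat h th (joint X o)).
  exact: (measurableT_comp (measurable_T_stat th) mX).
have mT A : measurable A -> measurable ((fun t : n.-tuple S => T_stat h th t) @^-1` A).
  by move=> mA; rewrite -[X in measurable X]setTI; exact: measurable_T_stat.
have PT A : measurable A -> pr P ((fun o => T_stat h th (joint X o)) @^-1` A) =
    pr (prodn F n) ((fun t => T_stat h th t) @^-1` A).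
  by move=> mA; rewrite /pr -(law_X (mT _ mA)) pushPE.
pose E := [set t | forall q, `|pr (prodn F n) ((fun t => T_stat h th t) @^-1` qbox q) -
   fine (k t (qbox q))| <= C].
have RB o := rhoB_le P (Q := k (joint X o)) mTX (prob_kernel (joint X o)) C0.
have EE : [set o | (rhoB P (fun o' => T_stat h th (joint X o')) (k (joint X o)) <= C%:E)%E] =
    joint X @^-1` E.
  apply/seteqP; split => o /= H.
    move=> q; rewrite -PT; last exact: measurable_box.
    exact: ((RB o).1 H).
  apply/(RB o) => q; rewrite PT; last exact: measurable_box.
  exact: H.
have mE : measurable E.
  (* Enumerating the boxes by [unpickle] exhibits [E] as a countable intersection of measurable
     sets. *)
  pose E_ i := [set t | if unpickle i is Some q then
     `|pr (prodn F n) ((fun t => T_stat h th t) @^-1` qbox q) - fine (k t (qbox q))| <= C else true].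
  rewrite (_ : E = \bigcap_i E_ i); last first.
    apply/seteqP; split => t H.
      by move=> i _; rewrite /E_ /=; case: unpickle.
    by move=> q; have := H (pickle q) I; rewrite /E_ /= pickleK.
  apply: bigcapT_measurable => i; rewrite /E_; case: unpickle => [q|].
    apply: measurable_leset => //.
    apply: measurableT_comp => //; apply: measurable_funB => //.
    by apply: measurableT_comp => //; apply: measurable_kernel; exact: measurable_box.
  by rewrite (_ : [set _ | _] = setT)//; apply/seteqP; split.
rewrite EE.
have -> : P (joint X @^-1` E) = prodn F n E by rewrite -(law_X mE) pushPE.
rewrite (prE _ mE) lee_fin; apply: le_trans pG _.
have aeq q : {ae prodn F n, forall t, k t (qbox q) =
    pushP (prodn N01 n) (@measurable_shift1 R n) ((fun z => T_boot h t z) @^-1` qbox q)}.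
  exact: (conditional_law_ae law_X law_w ind measurable_T_boot reg (measurable_box _ _)).
have ae_all : {ae prodn F n, forall t, G t -> E t}.
  have : {ae prodn F n, forall t, forall i : nat, if unpickle i is Some q then
    k t (qbox q) = pushP (prodn N01 n) (@measurable_shift1 R n) ((fun z => T_boot h t z) @^-1` qbox q)
    else True}.
    apply/ae_foralln => i; case: unpickle => [q|]; last exact: aeW.
    exact: aeq.
  apply: filterS => t H Gt q; have := H (pickle q); rewrite pickleK => ->.
  rewrite -[fine _]/(pr _ _) /pr pushPE; exact: (HG _ Gt).
have [N [mN N0 NE]] := ae_all.
have mGN : measurable (E `|` N) by exact: measurableU.
apply: (@le_trans _ _ (pr (prodn F n) (E `|` N))).
  apply: pr_le => // t Gt; have [Et|nE] := pselect (E t); first by left.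
  by right; apply: NE => /= H; apply: nE; exact: H.
apply: le_trans (pr_setU _ mE mN) _.
by rewrite /pr N0 addr0.
Qed.

End model.

(** * From boxes to orthants *)

Lemma ae_Ex {d} {T : measurableType d} {R : realType} (P : probability T R) (f g : T -> R)
    (G : set T) : measurable G -> P G = 1%E -> measurable_fun setT f -> measurable_fun setT g ->
  {in G, f =1 g} -> (\int[P]_x (f x)%:E = \int[P]_x (g x)%:E)%E.
Proof.
move=> mG G1 mf mg fg; apply: ae_eq_integral => //; [exact/measurable_EFinP|exact/measurable_EFinP|].
exists (~` G); split; first exact: measurableC.
  by apply: etrans (probability_setC P mG) _; rewrite [X in (1 - X)%E](_ : _ = 1%E)// subee.
by move=> x /= nx Gx; apply: nx => _; rewrite fg// inE.
Qed.

Section doubling.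
Context {R : realType} {d : nat}.
Implicit Type s : d.-tuple R.

(* Two-sided boxes in dimension d are lower orthants in dimension 2d. *)
Definition dbl s : (d + d).-tuple R :=
  [tuple match fintype.split i with inl j => tnth s j | inr j => - tnth s j end | i < d + d].

Lemma tnth_dbl s i : tnth (dbl s) i =
  match fintype.split i with inl j => tnth s j | inr j => - tnth s j end.
Proof. by rewrite tnth_mktuple. Qed.

Lemma dbl_norm s i : exists j, `|tnth (dbl s) i| = `|tnth s j|.
Proof. by rewrite tnth_dbl; case: fintype.split => j; exists j; rewrite ?normrN. Qed.

Lemma supn_dbl s : supn (dbl s) <= supn s.
Proof.
apply: supn_le => [|i]; first exact: supn_ge0.
by have [j ->] := dbl_norm s i; exact: le_supn.
Qed.

Lemma measurable_dbl : measurable_fun setT dbl.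
Proof.
apply/measurable_fun_tnthP => i /=.
rewrite (_ : _ \o _ = fun s => match fintype.split i with inl j => tnth s j | inr j => - tnth s j end).
  by case: fintype.split => j; [|apply: measurableT_comp => //]; exact: measurable_tnth.
by apply/funext => s; rewrite /= tnth_mktuple.
Qed.

Definition cdbl (a b : 'I_d -> R) (i : 'I_(d + d)) : R :=
  match fintype.split i with inl j => b j | inr j => - a j end.

Lemma orth_dbl a b s : orth (cdbl a b) (dbl s) <-> box a b s.
Proof.
split=> H j; last first.
  rewrite tnth_dbl /cdbl; case: fintype.split => l; have /andP[h1 h2] := H l => //.
  by rewrite lerN2.
have := H (lshift d j); have := H (rshift d j).
rewrite !tnth_dbl /cdbl (unsplitK (inl j : 'I_d + 'I_d)) (unsplitK (inr j : 'I_d + 'I_d)).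
by rewrite lerN2 => -> ->.
Qed.

End doubling.

(** * Repairing the sections of the kernel on a null set *)

Section modified_kernel.
Context {R : realType} {dS : measure_display} {S : measurableType dS} {d : nat}.
Variables (F : probability S R) (h : S -> S -> d.-tuple R) (b B : R).
Hypothesis mh : measurable_fun setT (fun z : S * S => h z.1 z.2).
Hypothesis hC : forall x y, h x y = h y x.
Hypothesis h0 : forall m, Ex (F \x F)%E (fun z => tnth (h z.1 z.2) m) = 0.
Hypothesis hb : forall m,
  (b%:E <= \int[F]_x ((Ex F (fun y => tnth (h x y) m)) ^+ 2)%:E)%E.
Hypothesis h3 : forall m, (\int[F \x F]_z (`|tnth (h z.1 z.2) m| ^+ 3)%:E <= B%:E)%E.
Hypothesis h4 : forall m, (\int[F \x F]_z (`|tnth (h z.1 z.2) m| ^+ 4)%:E <= (B ^+ 2)%:E)%E.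

Let mhj m : measurable_fun setT (fun z : S * S => tnth (h z.1 z.2) m).
Proof. exact: (measurableT_comp (measurable_tnth m) mh). Qed.

Let mns : measurable_fun setT (fun z : S * S => supn (h z.1 z.2) ^+ 4).
Proof. by apply: measurable_funX; exact: (measurableT_comp measurable_supn mh). Qed.

Lemma intg_hj4 m : intg (F \x F)%E (fun z => `|tnth (h z.1 z.2) m| ^+ 4).
Proof.
apply: intg_ge0P; [by apply: measurable_funX; exact: measurableT_comp| |] => [z|].
  exact: exprn_ge0.
exact: le_lt_trans (h4 m) (ltry _).
Qed.

(** A crude bound, growing with the dimension, which serves integrability and enters no rate. *)
Lemma supn4_le (s : d.-tuple R) : supn s ^+ 4 <= \sum_m `|tnth s m| ^+ 4.
Proof.
rewrite /supn; elim/big_ind: _ => [|x y hx hy|m _].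
- by rewrite expr0n; apply: sumr_ge0 => m _; exact: exprn_ge0.
- by rewrite /Num.max; case: ifP.
- by rewrite (bigD1 m)//= lerDl; apply: sumr_ge0 => i _; exact: exprn_ge0.
Qed.

Lemma intg_supn4 : intg (F \x F)%E (fun z => supn (h z.1 z.2) ^+ 4).
Proof.
apply: (intg_le mns (g := fun z => \sum_m `|tnth (h z.1 z.2) m| ^+ 4)) => [z|]; last first.
  by apply: intg_sum => m _; exact: intg_hj4.
by rewrite ger0_norm ?exprn_ge0 ?supn_ge0//; exact: supn4_le.
Qed.

Lemma intg_supn2 : intg (F \x F)%E (fun z => supn (h z.1 z.2) ^+ 2).
Proof. exact: h2_of4 intg_supn4. Qed.

Lemma intg_hj1 m : intg (F \x F)%E (fun z => tnth (h z.1 z.2) m).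
Proof.
apply: (intg_le (mhj m) _ (intgD (intg_cst _ 1) intg_supn2)) => z.
by apply: le_trans (norm_le_sq1 _) _; rewrite lerD2l coord_sq_le.
Qed.

Let q x := (\int[F]_y (supn (h x y) ^+ 4)%:E)%E.

Let mq : measurable_fun setT q.
Proof.
apply: (measurable_fun_fubini_tonelli_F (m2 := F) (fun z => (supn (h z.1 z.2) ^+ 4)%:E)).
  exact/measurable_EFinP.
by move=> z; rewrite lee_fin exprn_ge0// supn_ge0.
Qed.

Let q0 x : (0 <= q x)%E.
Proof. by apply: integral_ge0 => y _; rewrite lee_fin exprn_ge0// supn_ge0. Qed.

(** The preceding analysis asks for integrable sections at every point, whereas Fubini's theorem
    provides them almost everywhere only. *)
Definition good : set S := [set x | (q x < +oo)%E].

Lemma measurable_good : measurable good.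
Proof.
rewrite (_ : good = q @^-1` [set x | (x < +oo)%E])//.
rewrite -[X in measurable X]setTI; apply: mq => //.
rewrite (_ : [set x | _] = ~` [set +oo%E]); first by apply: measurableC; exact: emeasurable_set1.
by apply/seteqP; split => x /=; rewrite ltey => /eqP.
Qed.

Lemma good1 : F good = 1%E.
Proof.
have E : (\int[F]_x q x = \int[F \x F]_z (supn (h z.1 z.2) ^+ 4)%:E)%E.
  rewrite (fubini_tonelli1 (m1 := F) (m2 := F) (fun z => (supn (h z.1 z.2) ^+ 4)%:E))//.
    exact/measurable_EFinP.
  by move=> z; rewrite lee_fin exprn_ge0// supn_ge0.
have iq : F.-integrable setT q.
  apply/integrableP; split => //.
  under eq_integral do rewrite gee0_abs//.
  by rewrite E (ExE intg_supn4) ltry.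
have [N [mN N0 NE]] := integrable_ae measurableT iq.
have GN : ~` good `<=` N.
  move=> x ng; apply: NE => /= H; apply: ng.
  by rewrite /good /= -ge0_fin_numE//; exact: H.
have G0 : F (~` good) = 0%E.
  apply/eqP; rewrite eq_le measure_ge0 andbT -N0 le_measure ?inE//.
  by apply: measurableC; exact: measurable_good.
rewrite -[good]setCK probability_setC; last by apply: measurableC; exact: measurable_good.
by rewrite G0 sube0.
Qed.

(* Equal to [dbl (h x y)] almost surely, but with integrable sections everywhere. *)
Definition hmod x y : (d + d).-tuple R :=
  if (x \in good) && (y \in good) then dbl (h x y) else tzero.

Lemma supn_hmod x y : supn (hmod x y) <= supn (h x y).
Proof.
rewrite /hmod; case: ifP => _; first exact: supn_dbl.
by apply: supn_le => [|j]; [exact: supn_ge0|rewrite tnth_tzero normr0 supn_ge0].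
Qed.

Lemma hmodC x y : hmod x y = hmod y x.
Proof. by rewrite /hmod andbC hC. Qed.

Lemma measurable_hmod : measurable_fun setT (fun z : S * S => hmod z.1 z.2).
Proof.
rewrite /hmod; apply: measurable_fun_ifT => //.
  apply: measurable_and; apply: (measurable_fun_bool true).
  - rewrite setTI (_ : _ @^-1` _ = good `*` setT); last first.
      by apply/seteqP; split => z /=; [move/set_mem; split|case=> g1 g2; exact/mem_set].
    by apply: measurableX => //; exact: measurable_good.
  - rewrite setTI (_ : _ @^-1` _ = setT `*` good); last first.
      by apply/seteqP; split => z /=; [move/set_mem; split|case=> g1 g2; exact/mem_set].
    by apply: measurableX => //; exact: measurable_good.
exact: (measurableT_comp measurable_dbl mh).
Qed.

Lemma hmod_sec4 x : intg F (fun y => supn (hmod x y) ^+ 4).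
Proof.
have mx : measurable_fun setT (fun y => supn (hmod x y)).
  exact: (measurableT_comp measurable_supn (measurable_hx measurable_hmod x)).
have [gx|ngx] := pselect (good x).
  have i4 : intg F (fun y => supn (h x y) ^+ 4).
    apply: intg_ge0P => //; last by move=> y; rewrite exprn_ge0// supn_ge0.
    by apply: measurable_funX; exact: (measurableT_comp measurable_supn (measurable_hx mh x)).
  apply: (intg_le (measurable_funX _ mx) _ i4) => y.
  rewrite ger0_norm ?exprn_ge0 ?supn_ge0//; apply: lerXn2r; rewrite ?nnegrE ?supn_ge0//.
  exact: supn_hmod.
apply: intg_ext (intg_cst F 0) => y; rewrite /hmod (_ : x \in good = false) /=; last first.
  by apply/negbTE/negP => /set_mem.
have -> : supn (tzero : (d + d).-tuple R) = 0.
  by apply/eqP; rewrite eq_le supn_ge0 andbT; apply: supn_le => // j; rewrite tnth_tzero normr0.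
by rewrite expr0n.
Qed.

Lemma hmod_4 : intg (F \x F)%E (fun z => supn (hmod z.1 z.2) ^+ 4).
Proof.
apply: (intg_le _ _ intg_supn4) => [|z].
  by apply: measurable_funX; exact: (measurableT_comp measurable_supn measurable_hmod).
rewrite ger0_norm ?exprn_ge0 ?supn_ge0//; apply: lerXn2r; rewrite ?nnegrE ?supn_ge0//.
exact: supn_hmod.
Qed.

Let good2 : (F \x F)%E (good `*` good) = 1%E.
Proof.
apply: etrans (product_measure1E F F measurable_good measurable_good) _.
by apply: etrans (congr2 (fun x y => x * y)%E good1 good1) _; exact: mule1.
Qed.

Let mgood2 : measurable (good `*` good).
Proof. by apply: measurableX; exact: measurable_good. Qed.

Let hsec' := hsec_of4 measurable_hmod hmod_sec4.
Let h2' := h2_of4 measurable_hmod hmod_4.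

Lemma hmod_mean0 i : Ex F (fun x => Ex F (fun y => tnth (hmod x y) i)) = 0.
Proof.
have i1 := intg_hj2 measurable_hmod h2' i.
rewrite -(Ex_prod i1 (fun x => intg_hj measurable_hmod hsec' x i)) /Ex.
rewrite (ae_Ex (g := fun z => tnth (dbl (h z.1 z.2)) i) mgood2 good2) => //.
- rewrite -/(Ex _ _); under [X in Ex _ X]eq_fun do rewrite tnth_dbl.
  by case: fintype.split => j; rewrite ?(ExN (intg_hj1 j)) h0 ?oppr0.
- exact: (intg_measurable i1).
- exact: (measurableT_comp (measurable_tnth i) (measurableT_comp measurable_dbl mh)).
- by move=> z /set_mem [/= g1 g2]; rewrite /hmod !mem_set.
Qed.

Lemma hmod_low i : b <= Ex F (fun x => tnth (hg F hmod x) i ^+ 2).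
Proof.
have i2 : intg F (fun x => tnth (hg F hmod x) i ^+ 2).
  apply: (intg_le _ _ (intg_hg2 measurable_hmod hsec' h2')) => [|x].
    by apply: measurable_funX; exact: (intg_measurable (intg_hg measurable_hmod hsec' h2' i)).
  by rewrite ger0_norm ?sqr_ge0// coord_sq_le.
rewrite -lee_fin -(ExE i2).
pose j := match fintype.split i with inl j => j | inr j => j end.
apply: le_trans (hb j) _.
have mE : measurable_fun setT (fun x => Ex F (fun y => tnth (h x y) j)).
  have := integrable_fubini_F (intg_hj1 j) => /integrableP[mI _].
  exact: (measurableT_comp (fine_measurable measurableT) mI).
rewrite (ae_Ex (f := fun x => Ex F (fun y => tnth (h x y) j) ^+ 2)
  (g := fun x => tnth (hg F hmod x) i ^+ 2) measurable_good good1) => //.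
- exact: measurable_funX.
- exact: intg_measurable i2.
move=> x gx; rewrite tnth_mktuple.
have E : Ex F (fun y => tnth (hmod x y) i) = Ex F (fun y => tnth (dbl (h x y)) i).
  congr fine; apply: (ae_Ex measurable_good good1).
  - exact: (measurableT_comp (measurable_tnth i) (measurable_hx measurable_hmod x)).
  - exact: (measurableT_comp (measurable_tnth i) (measurableT_comp measurable_dbl (measurable_hx mh x))).
  - by move=> y gy; rewrite /hmod gx gy.
rewrite E; under [X in _ = Ex _ X ^+ 2]eq_fun do rewrite tnth_dbl.
rewrite /j; case: (fintype.split i) => l //.
have il : intg F (fun y => tnth (h x y) l).
  have mx := measurable_hx mh x.
  apply: (intg_le (measurableT_comp (measurable_tnth l) mx) (g := fun y => 1 + (1 + supn (h x y) ^+ 4))) => [y|].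
    apply: le_trans (norm_le_sq1 _) _; rewrite lerD2l; apply: le_trans (coord_sq_le _ _) _.
    by apply: (powers_le_four _).1; exact: supn_ge0.
  apply: intgD; first exact: intg_cst.
  apply: intgD; first exact: intg_cst.
  apply: intg_ge0P => //; last 2 first.
  - by move=> y; rewrite exprn_ge0// supn_ge0.
  - exact: (set_mem gx).
  by apply: measurable_funX; exact: (measurableT_comp measurable_supn mx).
by rewrite (ExN il) sqrrN.
Qed.

Lemma hmod_pow i N (c : R) : (forall m, (\int[F \x F]_z (`|tnth (h z.1 z.2) m| ^+ N)%:E <= c%:E)%E) ->
  Ex (F \x F)%E (fun z => `|tnth (hmod z.1 z.2) i| ^+ N) <= c.
Proof.
move=> H; pose j := match fintype.split i with inl j => j | inr j => j end.
have mj m : measurable_fun setT (fun z : S * S => `|tnth (h z.1 z.2) m| ^+ N).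
  by apply: measurable_funX; exact: measurableT_comp.
have mi : measurable_fun setT (fun z : S * S => `|tnth (hmod z.1 z.2) i| ^+ N).
  apply: measurable_funX; apply: measurableT_comp => //.
  exact: (measurableT_comp (measurable_tnth i) measurable_hmod).
have le1 : (\int[F \x F]_z (`|tnth (hmod z.1 z.2) i| ^+ N)%:E =
    \int[F \x F]_z (`|tnth (h z.1 z.2) j| ^+ N)%:E)%E.
  apply: (ae_Ex mgood2 good2) => // z /set_mem [/= g1 g2]; rewrite /hmod !mem_set//=.
  by rewrite tnth_dbl /j; case: fintype.split => l; rewrite ?normrN.
rewrite /Ex le1 -lee_fin fineK//.
rewrite ge0_fin_numE; last by apply: integral_ge0 => z _; rewrite lee_fin exprn_ge0.
exact: le_lt_trans (H j) (ltry _).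
Qed.

Lemma hmod_tau M : tau F hmod M <= tau F h M.
Proof.
rewrite /tau; apply: Ex_le.
- exact: (intg_rho measurable_hmod h2').
- exact: (intg_rho mh intg_supn2).
move=> z; have le1 := supn_hmod z.1 z.2; rewrite /rho.
case: ltP => h1; last by case: ifP => // _; exact: sqr_ge0.
by rewrite (lt_le_trans h1 le1); apply: lerXn2r; rewrite ?nnegrE ?supn_ge0.
Qed.

End modified_kernel.

Lemma pr_ae {d} {T : measurableType d} {R : realType} (P : probability T R) (A B G : set T) :
  measurable G -> P G = 1%E -> measurable A -> measurable B ->
  (forall x, G x -> (A x <-> B x)) -> pr P A = pr P B.
Proof.
move=> mG G1 mA mB AB.
have E C : measurable C -> pr P C = fine (\int[P]_x ((\1_C : T -> R) x)%:E).
  by move=> mC; rewrite integral_indic// setIT.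
rewrite !E// (ae_Ex (f := \1_A) (g := \1_B) mG G1)//.
move=> x /set_mem Gx; rewrite !indicE; congr (_%:R).
by congr nat_of_bool; apply/idP/idP => /set_mem H; apply/mem_set/AB.
Qed.

Section statistics_link.
Context {R : realType} {n p d : nat}.
Variables (F : probability (p.-tuple R) R) (h : p.-tuple R -> p.-tuple R -> d.-tuple R).
Variables (th : 'I_d -> R) (t : n.-tuple (p.-tuple R)).
Hypotheses (th0 : forall m, th m = 0) (gt : forall i, good F h (tnth t i)).

Let hE i j : hmod F h (tnth t i) (tnth t j) = dbl (h (tnth t i) (tnth t j)).
Proof. by rewrite /hmod !mem_set. Qed.

Let hmE (a : 'I_n -> 'I_n -> R) l :
  \sum_(i < n) \sum_(j < n | i != j) a i j * tnth (hmod F h (tnth t i) (tnth t j)) l =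
  match fintype.split l with
  | inl m => \sum_(i < n) \sum_(j < n | i != j) a i j * tnth (h (tnth t i) (tnth t j)) m
  | inr m => - \sum_(i < n) \sum_(j < n | i != j) a i j * tnth (h (tnth t i) (tnth t j)) m
  end.
Proof.
under eq_bigr do under eq_bigr do rewrite hE tnth_dbl.
case: fintype.split => m //; rewrite -sumrN; apply: eq_bigr => i _.
by rewrite -sumrN; apply: eq_bigr => j _; rewrite mulrN.
Qed.

Lemma hT_hmod : hT (hmod F h) t = dbl (T_stat h th t).
Proof.
apply: eq_from_tnth => l; rewrite /hT tnth_mktuple tnth_dbl.
have := hmE (fun _ _ => 1) l; under eq_bigr do under eq_bigr do rewrite mul1r.
move=> ->; case: fintype.split => m; rewrite tnth_mktuple /U_stat th0 subr0.
  by under eq_bigr do under eq_bigr do rewrite mul1r.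
by under eq_bigr do under eq_bigr do rewrite mul1r; rewrite !mulrN mulNr.
Qed.

Lemma hTb_hmod xi : hTb (hmod F h) t xi = dbl (T_boot h t (shift1 xi)).
Proof.
apply: eq_from_tnth => l; rewrite /hTb tnth_mktuple tnth_dbl hmE.
have E m : U_boot h t (shift1 xi) m - U_stat h t m = (n%:R * (n%:R - 1))^-1 *
   \sum_(i < n) \sum_(j < n | i != j) ((1 + tnth xi i) * (1 + tnth xi j) - 1) *
    tnth (h (tnth t i) (tnth t j)) m.
  rewrite /U_boot /U_stat -mulrBr -sumrB; congr (_ * _); apply: eq_bigr => i _.
  by rewrite -sumrB; apply: eq_bigr => j _; rewrite !tnth_mktuple mulrBl mul1r.
by case: fintype.split => m; rewrite tnth_mktuple E// !mulrN mulNr.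
Qed.

End statistics_link.

Section kernel_rate.
Context {R : realType}.
Variables (b K A0 A : R).
Hypotheses (b0 : 0 < b) (K0 : 0 < K) (A00 : 264 <= A0) (A0b : 2 <= A0 * b)
  (A1 : 16 * A0 <= A) (A2 : 384 * (7 + K) <= A) (A3 : 32 * 96 * (7 + K) * A0 ^+ 2 <= A)
  (A4 : 780 * 864 * 16 * expR 2 <= A) (A5 : 10 ^+ 6 <= A).
Context {n p d : nat} {dO : measure_display} {Omega : measurableType dO}.
Variables (P : probability Omega R) (F : probability (p.-tuple R) R)
  (h : p.-tuple R -> p.-tuple R -> d.-tuple R)
  (X : 'I_n -> {RV P >-> p.-tuple R}) (w : 'I_n -> {RV P >-> R})
  (k : R.-pker (n.-tuple (p.-tuple R)) ~> (d.-tuple R)) (B gamma : R).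
Hypotheses (n4 : (4 <= n)%N) (d3 : (3 <= d)%N) (B1 : 1 <= B)
  (kc : kernel_condition h F) (model : bootstrap_model h F X w k)
  (th0 : forall m, theta h F m = 0) (mc : moment_condition h F b B)
  (g01 : 0 < gamma <= 1).

Lemma ln_nd_ge1 : 1 <= ln ((n * d)%:R : R).
Proof.
have e4 : expR (1 : R) <= 4.
  have h1 := expR_le_quad (lexx (2^-1 : R)).
  have h2 : expR (2^-1 : R) <= 2 by apply: le_trans h1 _; lra.
  have -> : expR (1 : R) = expR 2^-1 ^+ 2 by rewrite -expRM_natr mulVf.
  apply: (@le_trans _ _ (2 ^+ 2)); last by lra.
  by apply: lerXn2r h2; rewrite nnegrE ?expR_ge0.
have nd : (4 <= n * d)%N by rewrite -[4%N]muln1; apply: leq_mul => //; exact: leq_trans d3.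
rewrite -[1 in X in X <= _]expRK ler_ln ?posrE ?expR_gt0 ?ltr0n ?(leq_trans _ nd)//.
by apply: le_trans e4 _; rewrite ler_nat.
Qed.

Local Notation r := (Num.sqrt (ln ((n * d)%:R : R))).
Local Notation sn := (Num.sqrt (n%:R : R)).

Lemma sqrt_ln_nd : r ^+ 2 = ln (n * d)%:R.
Proof. by rewrite sqr_sqrtr//; apply: le_trans ln_nd_ge1. Qed.

Variables (v M1 M2 : R).
Hypotheses (v0 : 0 < v) (v1 : v <= 1) (M10 : 0 < M1) (M20 : 0 < M2)
  (gK : expR (- (K * r ^+ 2)) <= gamma)
  (c4 : A * (r ^+ 7 * B) <= sn * v ^+ 3)
  (c1 : 16 * tau F h M1 <= gamma * (v ^+ 2 / (A0 * r ^+ 2 ^+ 2)))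
  (c1' : A * M1 ^+ 2 * r ^+ 2 <= n%:R * (v ^+ 2 / (A0 * r ^+ 2 ^+ 2)))
  (c2 : 8 * tau F h M2 <= gamma * M2 ^+ 2)
  (c2' : A * (r ^+ 2 ^+ 3 * M2 ^+ 2) <= n%:R * v ^+ 3)
  (c3 : 384 * (r ^+ 3 / v) ^+ 2 * tau F h (sn / (2 * (r ^+ 3 / v))) <= v).

(** The modified kernel satisfies the hypotheses of [core_rate] in dimension [d + d]. On samples
    with all entries in [good], which have full measure, its two statistics are the doubled original
    ones, and orthants pull back to boxes. *)
Theorem kernel_rate (C : R) : core_const (Num.sqrt (b / 2)) * v <= C ->
  ((1 - gamma)%:E <=
  P [set o | rhoB P (fun o' => T_stat h (theta h F) (joint X o')) (k (joint X o)) <= C%:E])%E.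
Proof.
move=> vC.
have [mh hC _] := kc.
have N0 : (0 < n)%N by apply: leq_trans n4.
have d0 : (0 < d)%N by apply: leq_trans d3.
have E3 m : (\int[F \x F]_z (`|tnth (h z.1 z.2) m| ^+ 3)%:E <= B%:E)%E.
  by have [_ /(_ 1%N isT)] := mc m; rewrite unlock expr1.
have E4 m : (\int[F \x F]_z (`|tnth (h z.1 z.2) m| ^+ 4)%:E <= (B ^+ 2)%:E)%E.
  by have [_ /(_ 2%N isT)] := mc m; rewrite unlock.
have e0 m : Ex (F \x F)%E (fun z => tnth (h z.1 z.2) m) = 0.
  by have := th0 m; rewrite /theta unlock.
have eb m : (b%:E <= \int[F]_x ((Ex F (fun y => tnth (h x y) m)) ^+ 2)%:E)%E.
  have [+ _] := mc m; rewrite unlock => /le_trans; apply.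
  by rewrite le_eqVlt; apply/orP; left; apply/eqP; apply: eq_integral => x _;
    rewrite /g th0 subr0 unlock.
pose h' := hmod F h.
have mh' : measurable_fun setT (fun z => h' z.1 z.2) := measurable_hmod F mh.
have hC' : forall x y, h' x y = h' y x := hmodC F hC.
have hs4 : forall x, intg F (fun y => supn (h' x y) ^+ 4) := hmod_sec4 F mh.
have h44 : intg (F \x F)%E (fun z => supn (h' z.1 z.2) ^+ 4) := hmod_4 mh E4.
have m0 := hmod_mean0 mh e0 E4.
have m2 := hmod_low mh eb E4.
have m3 i := hmod_pow mh E4 i E3.
have m4 i : Ex (F \x F)%E (fun z => tnth (h' z.1 z.2) i ^+ 4) <= B ^+ 2.
  have := hmod_pow mh E4 i E4; apply: le_trans.
  rewrite le_eqVlt; apply/orP; left; apply/eqP; apply: Ex_ext => z.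
  by rewrite -normrX ger0_norm// exprn_even_ge0.
have ht M := hmod_tau mh E4 M.
have r1 : 1 <= r.
  by rewrite -[X in X <= _]sqrtr1; apply: ler_wsqrtr; exact: ln_nd_ge1.
have r0 : 0 < r by apply: lt_le_trans r1.
have lD : ln ((d + d)%:R : R) <= 2 * r ^+ 2.
  apply: (@le_trans _ _ (r ^+ 2)); last by have := sqr_ge0 r; lra.
  rewrite sqrt_ln_nd ler_ln ?posrE ?ltr0n ?addn_gt0 ?muln_gt0 ?d0 ?N0//.
  by rewrite ler_nat addnn -mul2n leq_mul2r (leq_trans _ n4) ?orbT.
have ln' : ln (n%:R : R) <= r ^+ 2.
  rewrite sqrt_ln_nd ler_ln ?posrE ?ltr0n ?muln_gt0 ?d0 ?N0//.
  by rewrite ler_nat leq_pmulr.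
have D0 : (0 < d + d)%N by rewrite addn_gt0 d0.
have s3 : 0 <= 384 * (r ^+ 3 / v) ^+ 2 :> R.
  by apply: mulr_ge0; [exact: ler0n|exact: sqr_ge0].
have [G [mG pG gG]] := core_rate b0 K0 A00 A0b A1 A2 A3 A4 A5 n4 r1 v0 v1 B1 c4 mh' hC' hs4 h44
  m0 m2 m3 m4 D0 lD ln' g01 gK M10 M20
  (le_trans (ler_wpM2l (ler0n _ _) (ht M1)) c1) c1'
  (le_trans (ler_wpM2l (ler0n _ _) (ht M2)) c2) c2'
  (le_trans (ler_wpM2l s3 (ht _)) c3).
pose Gn := trect (n := n) (fun _ => good F h).
have mgood := measurable_good F mh.
have mGn : measurable Gn by apply: measurable_trect => i; exact: mgood.
have Gn1 : prodn F n Gn = 1%E.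
  rewrite prodn_trect; last by move=> i; exact: mgood.
  by rewrite big1// => i _; exact: (good1 mh E4).
have C0 : 0 <= C.
  apply: le_trans vC.
  have s0 : 0 <= 7 / Num.sqrt (b / 2) by rewrite divr_ge0// sqrtr_ge0.
  rewrite mulr_ge0 ?(ltW v0)// /core_const addr_ge0// mulr_ge0 ?divr_ge0//.
apply: (model_rho_le mh model (G := G `&` Gn)) => //; first exact: measurableI.
  apply: le_trans pG _; rewrite le_eqVlt; apply/orP; left; apply/eqP.
  by apply: (pr_ae mGn) => //; [exact: measurableI|move=> t Gt; split=> [|[]]].
move=> t [Gt gt] a c.
have -> : pr (prodn F n) ((fun t => T_stat h (theta h F) t) @^-1` box a c) =
    pr (prodn F n) (hT h' (n := n) @^-1` orth (cdbl a c)).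
  apply: (pr_ae mGn Gn1).
  - rewrite -[X in measurable X]setTI; apply: measurable_T_stat => //; exact: measurable_box.
  - rewrite -[X in measurable X]setTI.
    apply: (measurable_hT mh' hC' (hsec_of4 mh' hs4) (h2_of4 mh' h44)) => //.
      exact: leq_trans n4.
    exact: measurable_orth.
  - by move=> s gs /=; rewrite (hT_hmod th0 gs); apply: iff_sym; exact: orth_dbl.
have -> : (fun xi => T_boot h t (shift1 xi)) @^-1` box a c = hTb h' t @^-1` orth (cdbl a c).
  by apply/seteqP; split => xi /=; rewrite (hTb_hmod gt) => H; apply/orth_dbl.
exact: le_trans (gG _ Gt _) vC.
Qed.

End kernel_rate.

(** * Tail bounds and rates *)

Lemma supn_attained {R : realType} {D : nat} (y : D.-tuple R) : 0 < supn y ->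
  exists j, `|tnth y j| = supn y.
Proof.
move=> y0; apply: contrapT => H.
have Hj j : `|tnth y j| < supn y.
  by rewrite lt_neqAle le_supn andbT; apply/eqP => E; apply: H; exists j.
suff : supn y < supn y by rewrite ltxx.
rewrite {1}/supn; elim/big_ind: _ => // x z x1 z1; by rewrite gt_max x1.
Qed.

Section tail_bounds.
Context {R : realType} {dS : measure_display} {S : measurableType dS} {d : nat}.
Variables (F : probability S R) (h : S -> S -> d.-tuple R) (B : R).
Hypothesis mh : measurable_fun setT (fun z : S * S => h z.1 z.2).
Hypothesis h2 : intg (F \x F)%E (fun z => supn (h z.1 z.2) ^+ 2).
Hypothesis B0 : 0 < B.

Let mhj m : measurable_fun setT (fun z : S * S => tnth (h z.1 z.2) m).
Proof. exact: (measurableT_comp (measurable_tnth m) mh). Qed.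

(** An infimum need not be an admissible constant itself, but some admissible constant lies below
    [2 * B]. *)
Lemma psi1_exp m : (psi1_norm (F \x F)%E (fun z => tnth (h z.1 z.2) m) <= B%:E)%E ->
  (\int[F \x F]_z (expR (`|tnth (h z.1 z.2) m| / (2 * B)))%:E <= 2%:E)%E.
Proof.
move=> H; have : (psi1_norm (F \x F)%E (fun z => tnth (h z.1 z.2) m) < (2 * B)%:E)%E.
  by apply: le_lt_trans H _; rewrite lte_fin; move: B0; lra.
move=> /ereal_inf_lt [_ [C [C0 HC] <-]]; rewrite lte_fin => CB.
rewrite unlock in HC.
have me c : measurable_fun setT (fun z : S * S => expR (`|tnth (h z.1 z.2) m| / c)).
  apply: measurableT_comp => //; apply: measurable_funM => //.
  exact: measurableT_comp.
apply: (@le_trans _ _ (\int[F \x F]_z (expR (`|tnth (h z.1 z.2) m| / C))%:E)%E).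
  apply: ge0_le_integral; [exact: measurableT|by move=> z _; rewrite lee_fin expR_ge0|
    by apply/measurable_EFinP; exact: me|by apply/measurable_EFinP; exact: me|].
  move=> z _; rewrite lee_fin ler_expR; apply: ler_wpM2l => //.
  by rewrite lef_pV2 ?posrE ?mulr_gt0// ltW.
have -> : (\int[F \x F]_z (expR (`|tnth (h z.1 z.2) m| / C))%:E =
   \int[F \x F]_z ((expR (`|tnth (h z.1 z.2) m| / C) - 1)%:E + 1%:E))%E.
  by apply: eq_integral => z _; rewrite -EFinD subrK.
rewrite ge0_integralD//; last 2 first.
- by move=> z _; rewrite lee_fin subr_ge0 -expR0 ler_expR divr_ge0// ltW.
- by apply/measurable_EFinP; apply: measurable_funB.
have e1 : (\int[F \x F]_z (cst (1 : R)%R z)%:E = 1)%E.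
  by rewrite (ExE (intg_cst _ 1)) Ex_cst.
rewrite [X in (_ + X)%E]e1 [2%:E](_ : _ = 1 + 1)%E; last by rewrite -EFinD.
by rewrite leeD2r.
Qed.

(** With $a=s/(4B)$ the available exponential is $e^{2a}$: one factor $e^a$ absorbs $s^2$, the other
    gives the decay in [M]. The maximum is replaced by a sum over coordinates, hence the factor
    [d]. *)
Lemma tau_psi1 M : 0 <= M ->
  (forall m, (\int[F \x F]_z (expR (`|tnth (h z.1 z.2) m| / (2 * B)))%:E <= 2%:E)%E) ->
  tau F h M <= 128 * B ^+ 2 * d%:R * expR (- (M / (4 * B))).
Proof.
move=> M0 H; pose c := 64 * B ^+ 2 * expR (- (M / (4 * B))).
have c0 : 0 <= c by rewrite mulr_ge0 ?expR_ge0// mulr_ge0// sqr_ge0.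
pose u m (z : S * S) := expR (`|tnth (h z.1 z.2) m| / (2 * B)).
have iu m : intg (F \x F)%E (u m).
  apply: intg_ge0P; last exact: le_lt_trans (H m) (ltry _).
    by apply: measurableT_comp => //; apply: measurable_funM => //; exact: measurableT_comp.
  by move=> z; exact: expR_ge0.
have le1 z : rho h M z <= \sum_m c * u m z.
  rewrite /rho; case: ltP => hM; last first.
    by apply: sumr_ge0 => m _; rewrite mulr_ge0 ?expR_ge0.
  have [j ej] := supn_attained (le_lt_trans M0 hM).
  rewrite (bigD1 j)//=; apply: ler_wpDr.
    by apply: sumr_ge0 => m _; rewrite mulr_ge0 ?expR_ge0.
  rewrite /u /c ej; set s := supn _ in hM *.
  have s0 : 0 < s by apply: le_lt_trans hM.
  pose a := s / (4 * B); have a0 : 0 <= a by rewrite divr_ge0 ?mulr_ge0 ?ltW.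
  have B40 : 0 < 4 * B by rewrite mulr_gt0.
  have q1 : a ^+ 2 <= 4 * expR a.
    have e2 : 1 + a / 2 <= expR (a / 2) by exact: expR_ge1Dx.
    have E : expR a = expR (a / 2) ^+ 2 by rewrite -expRM_natr divfK.
    have : (1 + a / 2) ^+ 2 <= expR a.
      rewrite E; apply: (lerXn2r _ _ _ e2); rewrite nnegrE ?expR_ge0//.
      by rewrite addr_ge0// divr_ge0.
    have -> : (1 + a / 2) ^+ 2 = 1 + a + a ^+ 2 / 4 by field.
    by move: a0; lra.
  have q2 : 1 <= expR (a - M / (4 * B)).
    by rewrite -[X in X <= _]expR0 ler_expR subr_ge0 /a ler_pM2r ?invr_gt0// ltW.
  have -> : s ^+ 2 = 16 * B ^+ 2 * a ^+ 2 by rewrite /a; field; rewrite gt_eqF.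
  have -> : 64 * B ^+ 2 * expR (- (M / (4 * B))) * expR (s / (2 * B)) =
     16 * B ^+ 2 * (4 * expR a * expR (a - M / (4 * B))).
    have -> : s / (2 * B) = a + a by rewrite /a; field; rewrite gt_eqF.
    by rewrite !expRD; ring.
  apply: ler_wpM2l; first by rewrite mulr_ge0// sqr_ge0.
  apply: le_trans q1 _; rewrite ler_peMr// mulr_ge0// expR_ge0.
apply: (@le_trans _ _ (Ex (F \x F)%E (fun z => \sum_m c * u m z))).
  by apply: Ex_le => //; [exact: intg_rho|apply: intg_sum => m _; exact: intgZ].
rewrite Ex_sum; last by move=> m; exact: intgZ.
apply: (@le_trans _ _ (\sum_(m < d) c * 2)).
  apply: ler_sum => m _; rewrite (ExZ _ (iu m)); apply: ler_wpM2l => //.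
  by rewrite -lee_fin -(ExE (iu m)); exact: H.
by rewrite sumr_const card_ord -[_ *+ _]mulr_natr /c le_eqVlt; apply/orP; left; apply/eqP; ring.
Qed.

(** Parametrized by the squared level [x] relative to [B]: beyond it $w=w^{q/2}w^{1-q/2}\le
    w^{q/2}x^{1-q/2}$. *)
Lemma tau_pow (q x : R) : 4 <= q -> 0 < x ->
  (\int[F \x F]_z (\big[Num.max/0]_(m < d) ((`|tnth (h z.1 z.2) m| / B) `^ q))%:E <= 1)%E ->
  tau F h (B * Num.sqrt x) <= B ^+ 2 * (x / x `^ (q / 2)).
Proof.
move=> q4 x0 H.
have q0 : 0 < q by apply: lt_le_trans q4.
pose u (z : S * S) := (supn (h z.1 z.2) / B) `^ q.
have uE z : \big[Num.max/0]_(m < d) ((`|tnth (h z.1 z.2) m| / B) `^ q) = u z.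
  apply/eqP; rewrite eq_le; apply/andP; split.
    elim/big_ind: _ => [|y1 y2 h1 h2'|m _]; first exact: powR_ge0.
      by rewrite ge_max h1.
    apply: ge0_ler_powR; rewrite ?nnegrE ?divr_ge0 ?supn_ge0 ?(ltW q0) ?(ltW B0)//.
    by rewrite ler_pM2r ?invr_gt0// le_supn.
  rewrite /u; have [s0|s0] := ltP 0 (supn (h z.1 z.2)).
    by have [j <-] := supn_attained s0; rewrite (bigD1 j)//= le_max lexx.
  have -> : supn (h z.1 z.2) = 0 by apply/eqP; rewrite eq_le s0 supn_ge0.
  rewrite mul0r powR0 ?gt_eqF//.
  by elim/big_ind: _ => [//|y1 y2 h1 h2'|m _]; [rewrite le_max h1|exact: powR_ge0].
move: H; under eq_integral do rewrite uE; move=> H.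
have mu : measurable_fun setT u.
  apply: (measurableT_comp (measurable_powR q)); apply: measurable_funM => //.
  exact: (measurableT_comp measurable_supn mh).
have iu : intg (F \x F)%E u.
  by apply: intg_ge0P => //; [move=> z; exact: powR_ge0|exact: le_lt_trans H (ltry _)].
pose c := B ^+ 2 * (x / x `^ (q / 2)).
have c0 : 0 <= c by rewrite mulr_ge0 ?sqr_ge0// divr_ge0 ?powR_ge0// ltW.
have le1 z : rho h (B * Num.sqrt x) z <= c * u z.
  rewrite /rho; case: ltP => hM; last by rewrite mulr_ge0// powR_ge0.
  rewrite /u; set s := supn _ in hM *; pose w := (s / B) ^+ 2.
  have xs : Num.sqrt x < s / B by rewrite ltr_pdivlMr// mulrC.
  have sB0 : 0 < s / B by apply: le_lt_trans xs; exact: sqrtr_ge0.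
  have xw : x < w.
    by rewrite -(sqr_sqrtr (ltW x0)) /w; apply: ltrXn2r; rewrite ?nnegrE ?sqrtr_ge0// ltW.
  have w0 : 0 < w by apply: lt_trans xw.
  have -> : (s / B) `^ q = w `^ (q / 2).
    by rewrite /w -powR_mulrn ?(ltW sB0)// -powRrM; congr (_ `^ _); field.
  have -> : s ^+ 2 = B ^+ 2 * w by rewrite /w; field; rewrite gt_eqF.
  rewrite /c -mulrA; apply: ler_wpM2l; first exact: sqr_ge0.
  rewrite mulrAC ler_pdivlMr ?powR_gt0//.
  have E y : 0 < y -> y `^ (q / 2) = y * y `^ (q / 2 - 1).
    move=> y0; rewrite [in LHS](_ : q / 2 = 1 + (q / 2 - 1)); last by ring.
    by rewrite powRD ?(gt_eqF y0) ?implybT// powRr1 ?(ltW y0).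
  rewrite (E x)// (E w)// mulrCA; apply: ler_wpM2l; first exact: ltW.
  apply: ler_wpM2l; first exact: ltW.
  apply: ge0_ler_powR; rewrite ?nnegrE ?(ltW x0) ?(ltW w0) ?(ltW xw)//.
  by move: q4; lra.
apply: (@le_trans _ _ (Ex (F \x F)%E (fun z => c * u z))).
  by apply: Ex_le => //; [exact: intg_rho|exact: intgZ].
rewrite (ExZ _ iu) -[X in _ <= X]mulr1; apply: ler_wpM2l => //.
by rewrite -lee_fin -(ExE iu).
Qed.

End tail_bounds.

(** [A0] is a numerical constant plus $2/b$, and [A] the sum of all the nonnegative lower bounds
    asked of it. *)
Lemma rate_const_exists {R : realType} (b K : R) : 0 < b -> 0 < K ->
  exists A0 A, [/\ [/\ 264 <= A0, 2 <= A0 * b, 16 * A0 <= A & 384 * (7 + K) <= A],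
    32 * 96 * (7 + K) * A0 ^+ 2 <= A, 780 * 864 * 16 * expR 2 <= A & 10 ^+ 6 <= A].
Proof.
move=> b0 K0; pose A0 := 264 + 2 / b.
have ib : 0 < 2 / b by rewrite divr_gt0.
have p1 : 0 <= 16 * A0 by rewrite mulr_ge0// addr_ge0// ltW.
have p2 : 0 <= 384 * (7 + K) by rewrite mulr_ge0 ?ler0n// addr_ge0// ltW.
have p3 : 0 <= 32 * 96 * (7 + K) * A0 ^+ 2.
  by rewrite mulr_ge0 ?sqr_ge0// mulr_ge0 ?mulr_ge0 ?ler0n// addr_ge0// ltW.
have p4 : 0 <= 780 * 864 * 16 * expR (2 : R).
  by rewrite !mulr_ge0 ?expR_ge0 ?ler0n.
have p5 : 0 <= 10 ^+ 6 :> R by rewrite exprn_ge0.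
exists A0, (16 * A0 + 384 * (7 + K) + 32 * 96 * (7 + K) * A0 ^+ 2 +
  780 * 864 * 16 * expR 2 + 10 ^+ 6).
move: p1 p2 p3 p4 p5; set x1 := 16 * A0; set x2 := 384 * _; set x3 := _ * A0 ^+ 2.
set x4 := _ * expR 2; set x5 := 10 ^+ 6; clearbody x1 x2 x3 x4 x5 => *.
split; [split| | |]; try lra.
- by rewrite /A0; lra.
- by rewrite /A0 mulrDl divfK ?gt_eqF//; move: b0; lra.
Qed.

(** * Verification of the rate conditions under either tail assumption *)

Section rate_conditions.
Context {R : realType}.
Variables (K A0 A : R).
Hypotheses (K0 : 0 < K) (A00 : 264 <= A0) (A5 : 10 ^+ 6 <= A).
Variables (n : nat) (r B gamma : R).
Hypotheses (n4 : (4 <= n)%N) (r1 : 1 <= r) (B1 : 1 <= B) (ln' : ln (n%:R : R) <= r ^+ 2)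
  (gK : expR (- (K * r ^+ 2)) <= gamma) (g1 : gamma <= 1).

Local Notation sn := (Num.sqrt (n%:R : R)).
Local Notation L := (r ^+ 2).

Let A01 : 1 <= A0. Proof. by apply: le_trans A00; rewrite ler1n. Qed.
Let A1 : 1 <= A. Proof. by apply: le_trans A5; rewrite exprn_ege1// ler1n. Qed.
Let A0' : 0 < A0. Proof. exact: lt_le_trans A01. Qed.
Let A' : 0 < A. Proof. exact: lt_le_trans A1. Qed.
Let r0 : 0 < r. Proof. exact: lt_le_trans r1. Qed.
Let B0 : 0 < B. Proof. exact: lt_le_trans B1. Qed.
Let g0 : 0 < gamma. Proof. exact: lt_le_trans (expR_gt0 _) gK. Qed.
Let N0 : 0 < n%:R :> R. Proof. by rewrite ltr0n (leq_trans _ n4). Qed.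
Let N1 : 1 <= n%:R :> R. Proof. by rewrite ler1n (leq_trans _ n4). Qed.
Let sn0 : 0 < sn. Proof. by rewrite sqrtr_gt0. Qed.
Let snE : sn ^+ 2 = n%:R. Proof. by rewrite sqr_sqrtr// ltW. Qed.
Let L1 : 1 <= L. Proof. by rewrite exprn_ege1. Qed.
Let L0 : 0 < L. Proof. exact: lt_le_trans L1. Qed.
Let NE : n%:R <= expR L. Proof. by rewrite -ler_ln ?posrE ?expR_gt0// expRK. Qed.

(** The truncation level is [psi1_a * B * L], which makes the tail $e^{-(2+K+10^4A_0)L}$: enough to
    pay for the dimension, for [gamma], for $1/n$ and for the numerical constants. *)
Definition psi1_a := 4 * (2 + K + 10 ^+ 4 * A0).
Definition psi1_T := A * A0 * psi1_a ^+ 2.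

Let a1 : 1 <= psi1_a.
Proof.
have : 0 <= 10 ^+ 4 * A0 by rewrite mulr_ge0 ?exprn_ge0// ltW.
by rewrite /psi1_a; set z := _ * A0; clearbody z; move: K0; lra.
Qed.
Let a0 : 0 < psi1_a. Proof. exact: lt_le_trans a1. Qed.

Let TA : A <= psi1_T.
Proof.
have h : 1 <= A0 * psi1_a ^+ 2.
  by rewrite -[X in X <= _]mulr1; apply: ler_pM => //; exact: exprn_ege1.
by rewrite /psi1_T -mulrA ler_pMr.
Qed.
Let T1 : 1 <= psi1_T. Proof. exact: le_trans TA. Qed.
Let T0 : 0 < psi1_T. Proof. exact: lt_le_trans T1. Qed.

Section exponential.
Variables (y v : R) (dd : R) (ta : R -> R).
Hypotheses (y0 : 0 < y) (y6 : y ^+ 6 = B ^+ 2 * L ^+ 7 / n%:R)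
  (vE : v = psi1_T * y) (v1 : v <= 1) (dd0 : 0 <= dd) (ddL : dd <= expR L)
  (taE : forall M, 0 <= M -> ta M <= 128 * B ^+ 2 * dd * expR (- (M / (4 * B)))).

Let v0 : 0 < v. Proof. by rewrite vE mulr_gt0. Qed.
Let yv : y <= v. Proof. by rewrite vE ler_peMl// ltW. Qed.
Let y1 : y <= 1. Proof. exact: le_trans v1. Qed.
(** The reason for the form of $\varpi_{1,n}$: up to the constant [A], it solves the contraction
    condition of the swaps with equality. *)
Lemma exp_y3 : sn * y ^+ 3 = r ^+ 7 * B.
Proof.
have E : (sn * y ^+ 3) ^+ 2 = (r ^+ 7 * B) ^+ 2.
  have -> : (sn * y ^+ 3) ^+ 2 = sn ^+ 2 * y ^+ 6 by ring.
  by rewrite snE y6; field; rewrite gt_eqF.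
apply/eqP; rewrite -(eqrXn2 (_ : 0 < 2)%N) ?E// mulr_ge0 ?exprn_ge0 ?ltW//.
Qed.
Let ny6 : n%:R * y ^+ 6 = B ^+ 2 * L ^+ 7.
Proof. by rewrite y6 mulrC divfK// gt_eqF. Qed.
Let y6v m : (m <= 6)%N -> y ^+ 6 <= v ^+ m.
Proof.
move=> m6; apply: (@le_trans _ _ (y ^+ m)); first by apply: ler_wiXn2l => //; exact: ltW.
by apply: lerXn2r; rewrite ?nnegrE ?(ltW y0) ?(ltW v0).
Qed.

Lemma exp_c4 : A * (r ^+ 7 * B) <= sn * v ^+ 3.
Proof.
rewrite vE [(psi1_T * y) ^+ _]exprMn [X in _ <= X]mulrCA exp_y3; apply: ler_wpM2r; first by rewrite mulr_ge0 ?exprn_ge0// ltW.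
by apply: le_trans TA _; apply: ler_eXnr.
Qed.

Let key (kap : R) : 0 < kap -> kap <= 10 ^+ 4 * A0 ->
  kap * (dd * expR (- (psi1_a * B * L / (4 * B)))) <= expR (- (K * L)) * expR (- L).
Proof.
move=> k0 kA; have -> : psi1_a * B * L / (4 * B) = (2 + K + 10 ^+ 4 * A0) * L.
  by rewrite /psi1_a; field; rewrite gt_eqF.
apply: (@le_trans _ _ (expR (10 ^+ 4 * A0 * L) * (expR L * expR (- ((2 + K + 10 ^+ 4 * A0) * L))))).
  apply: ler_pM; rewrite ?(ltW k0) ?mulr_ge0 ?expR_ge0//; last first.
    by apply: ler_wpM2r ddL; exact: expR_ge0.
  apply: le_trans kA _; apply: (@le_trans _ _ (10 ^+ 4 * A0 * L)).
    by apply: ler_peMr L1; rewrite mulr_ge0 ?exprn_ge0// ltW.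
  by apply: le_trans (expR_ge1Dx _); rewrite lerDr.
rewrite -!expRD ler_expR; set z := 10 ^+ 4 * A0; clearbody z.
by rewrite le_eqVlt; apply/orP; left; apply/eqP; ring.
Qed.

Let M := psi1_a * B * L.
Let M0 : 0 < M. Proof. by rewrite /M; apply: mulr_gt0 => //; exact: mulr_gt0. Qed.

Let eLy : B ^+ 2 * L ^+ 2 * expR (- L) <= y ^+ 6.
Proof.
rewrite y6 expRN; apply: ler_pM; rewrite ?invr_ge0 ?expR_ge0 ?mulr_ge0 ?exprn_ge0 ?(ltW r0) ?(ltW B0)//.
  by rewrite ler_wpM2l ?sqr_ge0//; exact: ler_weXn2l.
by rewrite lef_pV2 ?posrE ?expR_gt0.
Qed.

Lemma exp_c1 : 16 * ta M <= gamma * (v ^+ 2 / (A0 * L ^+ 2)).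
Proof.
have k := key (kap := 16 * 128 * A0) _ _.
apply: (@le_trans _ _ (16 * (128 * B ^+ 2 * dd * expR (- (M / (4 * B)))))).
  by apply: ler_wpM2l; [exact: ler0n|apply: taE; exact: ltW].
rewrite [X in _ <= X]mulrA ler_pdivlMr; last by rewrite mulr_gt0// exprn_gt0.
have -> : 16 * (128 * B ^+ 2 * dd * expR (- (M / (4 * B)))) * (A0 * L ^+ 2) =
  B ^+ 2 * L ^+ 2 * (16 * 128 * A0 * (dd * expR (- (M / (4 * B))))) by ring.
apply: (@le_trans _ _ (B ^+ 2 * L ^+ 2 * (expR (- (K * L)) * expR (- L)))).
  apply: ler_wpM2l; first by rewrite mulr_ge0 ?exprn_ge0// ltW.
  apply: k; first by apply: mulr_gt0 A0'; apply: mulr_gt0; rewrite ltr0n.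
  apply: ler_wpM2r; first exact: ltW.
  by rewrite -!natrX -!natrM ler_nat.
rewrite mulrCA; apply: ler_pM; rewrite ?expR_ge0 ?mulr_ge0 ?exprn_ge0 ?expR_ge0 ?(ltW r0) ?(ltW B0)//.
by apply: le_trans eLy _; exact: y6v.
Qed.

Lemma exp_c1' : A * M ^+ 2 * L <= n%:R * (v ^+ 2 / (A0 * L ^+ 2)).
Proof.
rewrite [X in _ <= X]mulrA ler_pdivlMr; last by rewrite mulr_gt0// exprn_gt0.
apply: (@le_trans _ _ (psi1_T ^+ 2 * (n%:R * y ^+ 6))); last first.
  rewrite vE [(psi1_T * y) ^+ _]exprMn [X in _ <= X]mulrCA; apply: ler_wpM2l; first exact: sqr_ge0.
  by rewrite ler_pM2l//; apply: ler_wiXn2l => //; exact: ltW.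
rewrite ny6; have -> : A * M ^+ 2 * L * (A0 * L ^+ 2) = (A * A0 * psi1_a ^+ 2) * (B ^+ 2 * L ^+ 5).
  by rewrite /M; ring.
apply: ler_pM.
- by apply: mulr_ge0 (sqr_ge0 _); apply: mulr_ge0; exact: ltW.
- by apply: (mulr_ge0 (sqr_ge0 _)); exact: exprn_ge0 (ltW L0).
- by apply: ler_eXnr.
by rewrite ler_wpM2l ?sqr_ge0//; exact: ler_weXn2l.
Qed.

Lemma exp_c2 : 8 * ta M <= gamma * M ^+ 2.
Proof.
apply: (@le_trans _ _ (8 * (128 * B ^+ 2 * dd * expR (- (M / (4 * B)))))).
  by apply: ler_wpM2l; [exact: ler0n|apply: taE; exact: ltW].
have k := key (kap := 8 * 128) _ _.
have -> : 8 * (128 * B ^+ 2 * dd * expR (- (M / (4 * B)))) =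
  8 * 128 * (dd * expR (- (M / (4 * B)))) * B ^+ 2 by ring.
apply: ler_pM.
- by rewrite mulr_ge0 ?mulr_ge0 ?expR_ge0 ?ler0n.
- exact: sqr_ge0.
- apply: le_trans gK; apply: le_trans (k _ _) _; first by rewrite -natrM ltr0n.
    apply: le_trans (_ : 10 ^+ 4 <= _); last by rewrite ler_peMr// exprn_ge0.
    by rewrite -natrX -natrM ler_nat.
  by rewrite ler_piMr ?expR_ge0// -[X in _ <= X]expR0 ler_expR oppr_le0 ltW.
- rewrite /M; apply: lerXn2r; [exact: ltW|exact: ltW|].
  by rewrite mulrAC -[X in X <= _]mul1r ler_pM2r// -[1]mulr1; apply: ler_pM.
Qed.

Lemma exp_c2' : A * (L ^+ 3 * M ^+ 2) <= n%:R * v ^+ 3.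
Proof.
apply: (@le_trans _ _ (psi1_T ^+ 3 * (n%:R * y ^+ 6))); last first.
  rewrite vE [(psi1_T * y) ^+ _]exprMn [X in _ <= X]mulrCA; apply: ler_wpM2l; first by rewrite exprn_ge0// ltW.
  by rewrite ler_pM2l//; apply: ler_wiXn2l => //; exact: ltW.
rewrite ny6; have -> : A * (L ^+ 3 * M ^+ 2) = (A * psi1_a ^+ 2) * (B ^+ 2 * L ^+ 5).
  by rewrite /M; ring.
apply: ler_pM.
- by apply: mulr_ge0 (sqr_ge0 _); exact: ltW.
- by apply: (mulr_ge0 (sqr_ge0 _)); exact: exprn_ge0 (ltW L0).
- apply: (@le_trans _ _ psi1_T); last exact: ler_eXnr.
  by rewrite /psi1_T; apply: ler_wpM2r; [exact: sqr_ge0|rewrite ler_peMr// ltW].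
by rewrite ler_wpM2l ?sqr_ge0//; exact: ler_weXn2l.
Qed.

Lemma exp_c3 : 384 * (r ^+ 3 / v) ^+ 2 * ta (sn / (2 * (r ^+ 3 / v))) <= v.
Proof.
set M3 := sn / _.
have M3E : M3 = sn * v / (2 * r ^+ 3) by rewrite /M3; field; rewrite !gt_eqF.
have M30 : 0 <= M3 by rewrite M3E divr_ge0 ?mulr_ge0 ?exprn_ge0// ltW.
have c0 : 0 <= 384 * (r ^+ 3 / v) ^+ 2 :> R by apply: mulr_ge0 (sqr_ge0 _); exact: ler0n.
apply: (@le_trans _ _ (384 * (r ^+ 3 / v) ^+ 2 * (128 * B ^+ 2 * dd * expR (- (M3 / (4 * B)))))).
  by apply: ler_wpM2l => //; exact: taE.
have -> : 384 * (r ^+ 3 / v) ^+ 2 * (128 * B ^+ 2 * dd * expR (- (M3 / (4 * B)))) =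
  B ^+ 2 * L ^+ 3 * (384 * 128 * (dd * expR (- (M3 / (4 * B))))) / v ^+ 2.
  by field; rewrite gt_eqF.
rewrite ler_pdivrMr ?exprn_gt0// -exprS.
apply: le_trans (y6v (isT : 3 <= 6)%N).
rewrite y6 -[X in _ <= X]mulrA; apply: (@le_trans _ _ (B ^+ 2 * L ^+ 3 * expR (- L))); last first.
  rewrite -[X in X <= _]mulrA; apply: ler_wpM2l; first exact: sqr_ge0.
  apply: ler_pM; [by rewrite exprn_ge0// ltW|exact: expR_ge0|exact: ler_weXn2l|].
  by rewrite expRN lef_pV2 ?posrE ?expR_gt0.
apply: ler_wpM2l; first by rewrite mulr_ge0 ?exprn_ge0// ltW.
(* The truncation level here is imposed by the smoothing and not chosen; [h1] shows that it is a
   large multiple of [B * L]. *)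
have MB : psi1_T * L / 8 <= M3 / (4 * B).
  have h1 : psi1_T ^+ 3 * (r ^+ 7 * B) <= sn * v.
    rewrite -exp_y3 mulrCA -exprMn -vE ler_pM2l//.
    by apply: ler_iXnr => //; rewrite ltW// v0.
  have -> : M3 / (4 * B) = sn * v / (8 * r ^+ 3 * B) by rewrite M3E; field; rewrite !gt_eqF.
  rewrite ler_pdivlMr; last by rewrite !mulr_gt0// exprn_gt0.
  apply: le_trans h1; have -> : psi1_T * L / 8 * (8 * r ^+ 3 * B) = psi1_T * (r ^+ 5 * B) by field.
  apply: ler_pM; [exact: ltW|by rewrite mulr_ge0 ?exprn_ge0// ltW|exact: ler_eXnr|].
  by apply: ler_wpM2r; [exact: ltW|exact: ler_weXn2l].
have T6 : 8 * (2 + 384 * 128) <= psi1_T.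
  apply: le_trans TA; apply: le_trans A5.
  by lra.
have kk : 384 * 128 <= psi1_T / 8 - 2.
  by move: T6; set k := 384 * 128; clearbody k; lra.
have k0 : 0 <= 384 * 128 :> R by apply: mulr_ge0; exact: ler0n.
set k := 384 * 128 in kk k0 *.
apply: (@le_trans _ _ (expR (k * L) * (expR L * expR (- (psi1_T * L / 8))))).
  apply: ler_pM => //; first by rewrite mulr_ge0 ?expR_ge0.
    apply: le_trans (_ : k * L <= _); first by rewrite ler_peMr.
    by apply: le_trans (expR_ge1Dx _); rewrite lerDr.
  by apply: ler_pM; rewrite ?expR_ge0// ler_expR lerN2.
rewrite -!expRD ler_expR.
have : k * L <= (psi1_T / 8 - 2) * L by apply: ler_wpM2r kk; exact: ltW.
have -> : psi1_T * L / 8 = psi1_T / 8 * L by ring.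
by rewrite mulrBl; set x := k * L; set z := _ / 8 * _; clearbody x z; lra.
Qed.

End exponential.

Definition pow_T := 8 * A * A0.

Section polynomial.
Variables (s y z v G e Nq : R) (ta : R -> R).
Hypotheses (s1 : 1 <= s) (y0 : 0 < y) (y3 : sn * y ^+ 3 = r ^+ 7 * B) (z0 : 0 < z)
  (z3 : z ^+ 3 = B ^+ 2 * L ^+ 3 / (G * Nq)) (G0 : 0 < G) (G1 : G <= 1) (Nq0 : 0 < Nq)
  (e1 : 1 <= e) (eN : Nq * e = n%:R) (Gs : G `^ s = gamma) (es : e `^ s = n%:R)
  (vE : v = pow_T * (y + z)) (v1 : v <= 1)
  (taE : forall x, 0 < x -> ta (B * Num.sqrt x) <= B ^+ 2 * (x / x `^ s)).

Let TA8 : 8 * A <= pow_T.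
Proof. by rewrite /pow_T ler_pMr// mulr_gt0. Qed.
Let T384 : 384 <= pow_T.
Proof. by apply: le_trans TA8; move: A5; lra. Qed.
Let TAA : A * A0 <= pow_T.
Proof. by rewrite /pow_T -mulrA ler_pMl ?mulr_gt0// ler1n. Qed.
Let T1p : 1 <= pow_T. Proof. by apply: le_trans T384; rewrite ler1n. Qed.
Let T0p : 0 < pow_T. Proof. exact: lt_le_trans T1p. Qed.
Let vy : pow_T * y <= v. Proof. by rewrite vE ler_pM2l// lerDl ltW. Qed.
Let vz : pow_T * z <= v. Proof. by rewrite vE ler_pM2l// lerDr ltW. Qed.
Let v0 : 0 < v. Proof. by apply: lt_le_trans vy; exact: mulr_gt0. Qed.
Let zz1 : z <= 1.
Proof. by apply: le_trans v1; apply: le_trans vz; rewrite ler_pMl. Qed.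
Let L3B : 0 < L ^+ 3 * B ^+ 2. Proof. by rewrite mulr_gt0 ?exprn_gt0. Qed.
Let nz : n%:R * z ^+ 3 * G = L ^+ 3 * B ^+ 2 * e.
Proof. by rewrite z3 -eN; field; rewrite !gt_eqF. Qed.

(** Raising [c * e <= X * G] to the power $s=q/2$ turns $e=n^{2/q}$ and $G=\gamma^{2/q}$ into [n]
    and [gamma]; the exponents of the second rate come from here. *)
Let pw c X : 1 <= c -> 0 < X -> c * e <= X * G -> c * n%:R <= X `^ s * gamma.
Proof.
move=> c1 X0 H; have c0 : 0 < c by exact: lt_le_trans c1.
have e0 : 0 < e by exact: lt_le_trans e1.
have : (c * e) `^ s <= (X * G) `^ s.
  by apply: ge0_ler_powR => //; rewrite ?nnegrE ?mulr_ge0 ?ltW// (lt_le_trans _ s1).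
rewrite !powRM ?(ltW c0) ?(ltW X0) ?(ltW G0) ?(ltW e0)// Gs es; apply: le_trans.
rewrite ler_pM2r//; apply: le_trans (ler_powR c1 s1).
by rewrite powRr1// ltW.
Qed.

Let vzm m : pow_T ^+ m * z ^+ m <= v ^+ m.
Proof.
rewrite -exprMn; apply: lerXn2r; rewrite ?nnegrE ?(ltW v0)//.
by rewrite mulr_ge0 ?(ltW z0)// ltW.
Qed.

(** Squared truncation levels relative to [B]: [x1] and [x2] are the largest that [pow_c1'] and
    [pow_c2'] allow, so these hold with equality, while [x3] is imposed by the smoothing in
    [pow_c3]. *)
Let x1 := n%:R * v ^+ 2 / (A * A0 * (L ^+ 3 * B ^+ 2)).
Let x2 := n%:R * v ^+ 3 / (A * (L ^+ 3 * B ^+ 2)).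
Let x3 := n%:R * v ^+ 2 / (4 * (L ^+ 3 * B ^+ 2)).

Let x10 : 0 < x1. Proof. by rewrite /x1 divr_gt0 ?mulr_gt0 ?exprn_gt0. Qed.
Let x20 : 0 < x2. Proof. by rewrite /x2 divr_gt0 ?mulr_gt0 ?exprn_gt0. Qed.
Let x30 : 0 < x3. Proof. by rewrite /x3 divr_gt0 ?mulr_gt0 ?exprn_gt0. Qed.

Let vz3 c m : (2 <= m <= 3)%N -> 0 <= c -> c <= pow_T ->
  c * (L ^+ 3 * B ^+ 2 * e) <= n%:R * v ^+ m * G.
Proof.
move=> /andP[m2 m3] c0 cT; rewrite -nz.
have -> : c * (n%:R * z ^+ 3 * G) = n%:R * (c * z ^+ 3) * G by ring.
rewrite ler_pM2r// ler_pM2l//; apply: le_trans (vzm m).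
apply: ler_pM => //; [by rewrite exprn_ge0// ltW| |].
  by apply: le_trans cT _; apply: ler_eXnr => //; exact: leq_trans m2.
by apply: ler_wiXn2l => //; exact: ltW.
Qed.

Let pw1 : n%:R <= x1 `^ s * gamma.
Proof.
rewrite -[X in X <= _]mul1r; apply: pw => //; rewrite mul1r /x1 mulrAC ler_pdivlMr ?mulr_gt0//.
have := vz3 (m := 2) isT (ltW (mulr_gt0 A' A0')) TAA; apply: le_trans.
by rewrite le_eqVlt; apply/orP; left; apply/eqP; ring.
Qed.

Let pw2 : 8 * n%:R <= x2 `^ s * gamma.
Proof.
apply: pw => //; first by rewrite ler1n.
rewrite /x2 mulrAC ler_pdivlMr ?mulr_gt0//.
have := vz3 (m := 3) isT _ TA8; have A80 : 0 <= 8 * A by rewrite mulr_ge0// ltW.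
move=> /(_ A80); apply: le_trans.
by rewrite le_eqVlt; apply/orP; left; apply/eqP; ring.
Qed.

Let pw3 : 96 * n%:R <= (v * x3) `^ s * gamma.
Proof.
apply: pw; [by rewrite ler1n|exact: mulr_gt0|].
have -> : v * x3 * G = n%:R * v ^+ 3 * G / (4 * (L ^+ 3 * B ^+ 2)).
  by rewrite /x3; field; rewrite !gt_eqF.
rewrite ler_pdivlMr ?mulr_gt0//.
have := vz3 (m := 3) isT (ler0n _ 384) T384; apply: le_trans.
by rewrite le_eqVlt; apply/orP; left; apply/eqP; ring.
Qed.

Let sqrt2 x : 0 < x -> (B * Num.sqrt x) ^+ 2 = B ^+ 2 * x.
Proof. by move=> x0; rewrite exprMn sqr_sqrtr// ltW. Qed.

Lemma pow_c4 : A * (r ^+ 7 * B) <= sn * v ^+ 3.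
Proof.
apply: (@le_trans _ _ (sn * (pow_T * y) ^+ 3)).
  rewrite [(pow_T * y) ^+ _]exprMn [X in _ <= X]mulrCA y3; apply: ler_wpM2r.
    by rewrite mulr_ge0 ?exprn_ge0// ltW.
  apply: (@le_trans _ _ pow_T); last exact: ler_eXnr.
  by apply: le_trans TA8; rewrite ler_pMl// ler1n.
by rewrite ler_pM2l//; apply: lerXn2r; rewrite ?nnegrE ?(ltW v0)// mulr_ge0// ltW.
Qed.

Definition pow_M1 := B * Num.sqrt x1.
Definition pow_M2 := B * Num.sqrt x2.

Lemma pow_M10 : 0 < pow_M1. Proof. by rewrite /pow_M1 mulr_gt0// sqrtr_gt0. Qed.
Lemma pow_M20 : 0 < pow_M2. Proof. by rewrite /pow_M2 mulr_gt0// sqrtr_gt0. Qed.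

Lemma pow_c1 : 16 * ta pow_M1 <= gamma * (v ^+ 2 / (A0 * L ^+ 2)).
Proof.
apply: le_trans (ler_wpM2l (ler0n _ 16) (taE x10)) _.
have p0 : 0 < x1 `^ s by exact: powR_gt0.
have -> : v ^+ 2 / (A0 * L ^+ 2) = x1 * B ^+ 2 * (A * L / n%:R).
  by rewrite /x1; field; rewrite !gt_eqF.
have -> : 16 * (B ^+ 2 * (x1 / x1 `^ s)) = x1 * B ^+ 2 * (16 / x1 `^ s) by ring.
rewrite [X in _ <= X]mulrCA; apply: ler_wpM2l; first by rewrite mulr_ge0 ?sqr_ge0// ltW.
rewrite ler_pdivrMr// (_ : gamma * (A * L / n%:R) * x1 `^ s = (A * L) * (x1 `^ s * gamma) / n%:R); last by ring.
rewrite ler_pdivlMr//.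
apply: (@le_trans _ _ (16 * (x1 `^ s * gamma))); first by rewrite ler_wpM2l// ler0n.
apply: ler_wpM2r; first by rewrite mulr_ge0// ltW.
apply: (@le_trans _ _ A); first by move: A5; lra.
by rewrite ler_pMr.
Qed.

Lemma pow_c1' : A * pow_M1 ^+ 2 * L <= n%:R * (v ^+ 2 / (A0 * L ^+ 2)).
Proof.
rewrite /pow_M1 sqrt2// le_eqVlt /x1; apply/orP; left; apply/eqP.
by field; rewrite !gt_eqF.
Qed.

Lemma pow_c2 : 8 * ta pow_M2 <= gamma * pow_M2 ^+ 2.
Proof.
apply: le_trans (ler_wpM2l (ler0n _ 8) (taE x20)) _.
have p0 : 0 < x2 `^ s by exact: powR_gt0.
rewrite /pow_M2 sqrt2//.
have -> : 8 * (B ^+ 2 * (x2 / x2 `^ s)) = (8 / x2 `^ s) * (B ^+ 2 * x2) by ring.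
apply: ler_wpM2r; first by rewrite mulr_ge0 ?sqr_ge0// ltW.
rewrite ler_pdivrMr// mulrC; apply: le_trans pw2.
by rewrite ler_pMr// ltr0n.
Qed.

Lemma pow_c2' : A * (L ^+ 3 * pow_M2 ^+ 2) <= n%:R * v ^+ 3.
Proof.
rewrite /pow_M2 sqrt2// le_eqVlt /x2; apply/orP; left; apply/eqP.
by field; rewrite !gt_eqF.
Qed.

Lemma pow_c3 : 384 * (r ^+ 3 / v) ^+ 2 * ta (sn / (2 * (r ^+ 3 / v))) <= v.
Proof.
have ME : sn / (2 * (r ^+ 3 / v)) = B * Num.sqrt x3.
  have -> : x3 = (sn * v / (2 * r ^+ 3 * B)) ^+ 2.
    transitivity (sn ^+ 2 * v ^+ 2 / (4 * (L ^+ 3 * B ^+ 2))); first by rewrite snE.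
    by field; rewrite !gt_eqF.
  rewrite sqrtr_sqr ger0_norm; last by rewrite divr_ge0 ?mulr_ge0 ?exprn_ge0// ltW.
  by field; rewrite !gt_eqF.
rewrite ME; have c0 : 0 <= 384 * (r ^+ 3 / v) ^+ 2 :> R by apply: mulr_ge0 (sqr_ge0 _); exact: ler0n.
apply: le_trans (ler_wpM2l c0 (taE x30)) _.
have p0 : 0 < x3 `^ s by exact: powR_gt0.
have -> : 384 * (r ^+ 3 / v) ^+ 2 * (B ^+ 2 * (x3 / x3 `^ s)) = 96 * n%:R / x3 `^ s.
  rewrite {1}/x3; field; rewrite !gt_eqF//.
rewrite ler_pdivrMr//; apply: le_trans pw3 _.
rewrite powRM ?(ltW v0) ?(ltW x30)//.
apply: (@le_trans _ _ (v `^ s * x3 `^ s)).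
  by rewrite ler_piMr// mulr_ge0 ?powR_ge0.
rewrite ler_pM2r//.
have h : v `^ s <= v `^ 1 by apply: ger_powR => //; rewrite v0.
by apply: le_trans h _; rewrite powRr1// ltW.
Qed.

End polynomial.

End rate_conditions.

(** * Conclusion *)

Lemma powR_root {R : realType} (a : R) (k : nat) : (0 < k)%N -> 0 <= a ->
  (a `^ k%:R^-1) ^+ k = a.
Proof.
move=> k0 a0; rewrite -powR_mulrn ?powR_ge0// -powRrM mulVf ?powRr1//.
by rewrite pnatr_eq0 -lt0n.
Qed.

Lemma core_const_ge0 {R : realType} (s0 : R) : 0 <= s0 -> 0 <= core_const s0.
Proof.
move=> h; have k : 0 <= 7 / s0 by rewrite divr_ge0.
rewrite /core_const; set c := 7 / s0 in k *; have e := expR_ge0 (3 / 2 : R).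
apply: addr_ge0 => //; apply: mulr_ge0; first exact: divr_ge0.
apply: mulr_ge0 => //; apply: addr_ge0 => //; apply: mulr_ge0 => //; exact: addr_ge0.
Qed.

Lemma psi1_a_gt0 {R : realType} (K A0 : R) : 0 < K -> 0 < A0 -> 0 < psi1_a K A0.
Proof.
move=> K0 A00; rewrite /psi1_a; apply: mulr_gt0 => //; apply: addr_gt0; first exact: addr_gt0.
by apply: mulr_gt0 => //; exact: exprn_gt0.
Qed.

Lemma psi1_T_gt0 {R : realType} (K A0 A : R) : 0 < K -> 0 < A0 -> 0 < A -> 0 < psi1_T K A0 A.
Proof.
move=> K0 A00 A1; rewrite /psi1_T; apply: mulr_gt0; first exact: mulr_gt0.
by apply: exprn_gt0; exact: psi1_a_gt0.
Qed.

Section rates_of_convergence.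
Context {R : realType}.
Variables (b K A0 A : R).
Hypotheses (b0 : 0 < b) (K0 : 0 < K) (A00 : 264 <= A0) (A0b : 2 <= A0 * b)
  (A1 : 16 * A0 <= A) (A2 : 384 * (7 + K) <= A) (A3 : 32 * 96 * (7 + K) * A0 ^+ 2 <= A)
  (A4 : 780 * 864 * 16 * expR 2 <= A) (A5 : 10 ^+ 6 <= A).
Context {n p d : nat} {dO : measure_display} {Omega : measurableType dO}.
Variables (P : probability Omega R) (F : probability (p.-tuple R) R)
  (h : p.-tuple R -> p.-tuple R -> d.-tuple R)
  (X : 'I_n -> {RV P >-> p.-tuple R}) (w : 'I_n -> {RV P >-> R})
  (k : R.-pker (n.-tuple (p.-tuple R)) ~> (d.-tuple R)) (B gamma : R).
Hypotheses (n4 : (4 <= n)%N) (d3 : (3 <= d)%N) (B1 : 1 <= B)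
  (kc : kernel_condition h F) (model : bootstrap_model h F X w k)
  (th0 : forall m, theta h F m = 0) (mc : moment_condition h F b B)
  (g01 : 0 < gamma < expR (-1)) (gln : ln (gamma^-1) <= K * ln (d * n)%:R).

Local Notation r := (Num.sqrt (ln ((n * d)%:R : R))).
Local Notation event C := ((1 - gamma)%:E <=
  P [set o | rhoB P (fun o' => T_stat h (theta h F) (joint X o')) (k (joint X o)) <= C%:E])%E.

Let g0 : 0 < gamma. Proof. by case/andP: g01. Qed.
Let g1 : gamma <= 1.
Proof.
case/andP: g01 => _ /ltW g2; apply: le_trans g2 _.
by rewrite -[X in _ <= X]expR0 ler_expR oppr_le0.
Qed.
Let g01' : 0 < gamma <= 1. Proof. by rewrite g0 g1. Qed.
Let rE : r ^+ 2 = ln (n * d)%:R. Proof. exact: sqrt_ln_nd. Qed.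
Let r1 : 1 <= r.
Proof. by rewrite -[X in X <= _]sqrtr1; apply: ler_wsqrtr; exact: ln_nd_ge1. Qed.
Let gK : expR (- (K * r ^+ 2)) <= gamma.
Proof.
have -> : gamma = expR (- ln gamma^-1) by rewrite lnV ?posrE// opprK lnK.
by rewrite ler_expR lerN2 rE mulnC.
Qed.
Let n0 : (0 < n)%N. Proof. exact: leq_trans n4. Qed.
Let d0 : (0 < d)%N. Proof. exact: leq_trans d3. Qed.
Let N0 : 0 < n%:R :> R. Proof. by rewrite ltr0n. Qed.
Let ln' : ln (n%:R : R) <= r ^+ 2.
Proof.
rewrite rE ler_ln ?posrE ?ltr0n ?muln_gt0 ?d0 ?n0//.
by rewrite ler_nat leq_pmulr.
Qed.
Let B0 : 0 < B. Proof. exact: lt_le_trans B1. Qed.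
Let mh := let: And3 mh _ _ := kc in mh.

Let h2 : intg (F \x F)%E (fun z => supn (h z.1 z.2) ^+ 2).
Proof.
apply: (intg_supn2 (B := B) mh) => m.
by have [_ /(_ 2%N isT)] := mc m; rewrite unlock.
Qed.

(** Two probabilities differ by at most 1; this disposes of the case where the rate exceeds 1. *)
Lemma rate_trivial C : 1 <= C -> event C.
Proof.
move=> C1; apply: (model_rho_le mh model (G := setT)) => //; first exact: le_trans C1.
  by rewrite /pr probability_setT /= gerBl ltW.
move=> t _ a c; apply: le_trans C1; rewrite ler_norml.
have p01 (d' : measure_display) (T : measurableType d') (Q : probability T R) (E : set T) :
    measurable E -> 0 <= pr Q E <= 1 by move=> mE; rewrite pr_ge0 pr_le1.
have /andP[x0 x1] : 0 <= pr (prodn F n) ((fun t => T_stat h (theta h F) t) @^-1` box a c) <= 1.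
  apply: p01; rewrite -[X in measurable X]setTI; apply: measurable_T_stat => //; exact: measurable_box.
have /andP[y0 y1] : 0 <= pr (prodn N01 n) ((fun xi => T_boot h t (shift1 xi)) @^-1` box a c) <= 1.
  apply: p01; rewrite -[X in measurable X]setTI.
  have : measurable_fun setT (fun xi : n.-tuple R => T_boot h t (shift1 xi)).
    apply: (measurableT_comp (measurable_T_boot mh) (g := fun xi : n.-tuple R => (t, shift1 xi))).
    by apply: measurable_fun_pair => //; exact: measurable_shift1.
  by apply => //; exact: measurable_box.
by move: x0 x1 y0 y1; set x := pr _ _; set y := pr _ _; clearbody x y => *; apply/andP; split; lra.
Qed.

Let cc := core_const (Num.sqrt (b / 2)).
Let cc0 : 0 <= cc. Proof. by apply: core_const_ge0; exact: sqrtr_ge0. Qed.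

Let y := varpi1 n d B.
Let L0 : 0 < r ^+ 2. Proof. by rewrite exprn_gt0// (lt_le_trans _ r1). Qed.

Let l0 : 0 < ln ((n * d)%:R : R). Proof. by rewrite -rE. Qed.

Let y0 : 0 < y.
Proof. by rewrite /y /varpi1; apply/powR_gt0/divr_gt0 => //; rewrite mulr_gt0 ?exprn_gt0. Qed.

Let y6 : y ^+ 6 = B ^+ 2 * r ^+ 2 ^+ 7 / n%:R.
Proof.
rewrite rE /y /varpi1 powR_root//.
by rewrite divr_ge0 ?(ltW N0)// mulr_ge0 ?exprn_ge0 ?(ltW B0) ?(ltW l0).
Qed.

Theorem psi1_rate : psi1_condition h F B -> event ((cc + 1) * psi1_T K A0 A * y).
Proof.
move=> ps; have T0 : 0 < psi1_T K A0 A.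
  have A0p : 0 < A0 by apply: lt_le_trans A00; rewrite ltr0n.
  have Ap : 0 < A by move: A1 A00; lra.
  exact: psi1_T_gt0.
(* If the rate exceeds 1, so does the claimed bound, thanks to the [+ 1] in its constant. *)
have [v1|v1] := leP (psi1_T K A0 A * y) 1; last first.
  apply: rate_trivial; rewrite -mulrA; apply: le_trans (ltW v1) _.
  by rewrite ler_peMl ?lerDr// ltW// (lt_trans _ v1).
have dd0 : 0 <= d%:R :> R by [].
have ddL : d%:R <= expR (r ^+ 2).
  rewrite rE lnK ?posrE ?ltr0n ?muln_gt0 ?n0 ?d0//.
  by rewrite ler_nat leq_pmull.
have taE M : 0 <= M -> tau F h M <= 128 * B ^+ 2 * d%:R * expR (- (M / (4 * B))).
  by move=> M0; apply: tau_psi1 => // m; apply: psi1_exp => //; exact: ps.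
have M0 : 0 < psi1_a K A0 * B * r ^+ 2.
  apply: mulr_gt0 => //; apply: mulr_gt0 => //; apply: psi1_a_gt0 => //.
  by apply: lt_le_trans A00; rewrite ltr0n.
apply: (kernel_rate b0 K0 A00 A0b A1 A2 A3 A4 A5 n4 d3 B1 kc model th0 mc g01'
  (mulr_gt0 T0 y0) v1 M0 M0 gK).
- exact: (exp_c4 K0 A00 A5 n4 r1 B1 y0 y6 erefl).
- exact: (exp_c1 K0 A00 A5 n4 r1 B1 ln' gK y0 y6 erefl v1 dd0 ddL taE).
- exact: (exp_c1' K0 A00 A5 n4 r1 y0 y6 erefl v1).
- exact: (exp_c2 K0 A00 r1 B1 gK dd0 ddL taE).
- exact: (exp_c2' K0 A00 A5 n4 r1 y0 y6 erefl v1).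
- exact: (exp_c3 K0 A00 A5 n4 r1 B1 ln' y0 y6 erefl v1 dd0 ddL taE).
rewrite -/cc -mulrA; apply: ler_wpM2r; first by apply: mulr_ge0; exact: ltW.
by rewrite lerDl.
Qed.

Theorem envelope_rate (q : R) : 4 <= q -> envelope_condition h F q B ->
  event ((cc + 1) * pow_T A0 A * (y + varpi2B n d B q gamma)).
Proof.
move=> q4; rewrite /envelope_condition unlock => en.
have A0p : 0 < A0 by apply: lt_le_trans A00; rewrite ltr0n.
have Ap : 0 < A by move: A1 A00; lra.
have T0 : 0 < pow_T A0 A by rewrite /pow_T !mulr_gt0.
have q0 : 0 < q by apply: lt_le_trans q4; rewrite ltr0n.
pose z := varpi2B n d B q gamma.
(* The factors of the second rate, with [Nq * e = n]; the power [q / 2] takes [G] to [gamma] and [e]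
   to [n]. *)
pose G := gamma `^ (2 / q); pose Nq := n%:R `^ (1 - 2 / q) : R; pose e := n%:R `^ (2 / q) : R.
have G0 : 0 < G by exact: powR_gt0.
have Nq0 : 0 < Nq by exact: powR_gt0.
have z0 : 0 < z.
  rewrite /z /varpi2B; apply/powR_gt0/divr_gt0; last exact: mulr_gt0.
  by rewrite mulr_gt0 ?exprn_gt0.
have z3 : z ^+ 3 = B ^+ 2 * r ^+ 2 ^+ 3 / (G * Nq).
  rewrite rE /z /varpi2B powR_root//.
  by rewrite divr_ge0 ?mulr_ge0 ?exprn_ge0 ?powR_ge0 ?(ltW B0) ?(ltW l0).
have [v1|v1] := leP (pow_T A0 A * (y + z)) 1; last first.
  apply: rate_trivial; rewrite -mulrA; apply: le_trans (ltW v1) _.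
  by rewrite ler_peMl ?lerDr// ltW// (lt_trans _ v1).
have s1 : 1 <= q / 2 by move: q4; lra.
have qi : 0 <= 2 / q by rewrite divr_ge0// ltW.
have qq : 2 / q * (q / 2) = 1 by field; rewrite gt_eqF.
have G1 : G <= 1.
  apply: (@le_trans _ _ (1 `^ (2 / q))); last by rewrite powR1.
  by apply: ge0_ler_powR => //; rewrite ?nnegrE ?(ltW g0).
have e1 : 1 <= e.
  apply: (@le_trans _ _ (n%:R `^ 0)); first by rewrite powRr0.
  by apply: ler_powR => //; rewrite ler1n.
have eN : Nq * e = n%:R.
  rewrite /Nq /e -powRD; last by rewrite (gt_eqF N0) ?implybT.
  by rewrite subrK powRr1 ?(ltW N0).
have Gs : G `^ (q / 2) = gamma by rewrite /G -powRrM qq powRr1 ?(ltW N0) ?(ltW g0).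
have es : e `^ (q / 2) = n%:R by rewrite /e -powRrM qq powRr1 ?(ltW N0) ?(ltW g0).
have taE x : 0 < x -> tau F h (B * Num.sqrt x) <= B ^+ 2 * (x / x `^ (q / 2)).
  by move=> x0; exact: tau_pow.
have y3 := exp_y3 n4 r1 B1 y0 y6.
apply: (kernel_rate b0 K0 A00 A0b A1 A2 A3 A4 A5 n4 d3 B1 kc model th0 mc g01'
  (mulr_gt0 T0 (addr_gt0 y0 z0)) v1 (pow_M10 A00 A5 n4 r1 B1 y0 z0 erefl)
  (pow_M20 A00 A5 n4 r1 B1 y0 z0 erefl) gK).
- exact: (pow_c4 A00 A5 n4 r1 B1 y0 y3 z0 erefl).
- exact: (pow_c1 A00 A5 n4 r1 B1 gK s1 y0 z0 z3 G0 Nq0 e1 eN Gs es erefl v1 taE).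
- exact: (pow_c1' A00 A5 n4 r1 B1 y0 z0 erefl).
- exact: (pow_c2 A00 A5 n4 r1 B1 s1 y0 z0 z3 G0 Nq0 e1 eN Gs es erefl v1 taE).
- exact: (pow_c2' A00 A5 n4 r1 B1 y0 z0 erefl).
- exact: (pow_c3 A00 A5 n4 r1 B1 g1 s1 y0 z0 z3 G0 Nq0 e1 eN Gs es erefl v1 taE).
rewrite -/cc -mulrA; apply: ler_wpM2r.
  by apply: mulr_ge0; [exact: ltW|apply: addr_ge0; exact: ltW].
by rewrite lerDl.
Qed.

End rates_of_convergence.

Theorem theorem3p3 (R : realType) (b_low b_bar K : R) :
  0 < b_low -> 0 < b_bar -> 0 < K ->
  (exists C : R, 0 < C /\
    forall (n p d : nat) (dO : measure_display) (Omega : measurableType dO)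
      (P : probability Omega R) (F : probability (p.-tuple R) R)
      (h : p.-tuple R -> p.-tuple R -> d.-tuple R)
      (X : 'I_n -> {RV P >-> p.-tuple R}) (w : 'I_n -> {RV P >-> R})
      (k : R.-pker (n.-tuple (p.-tuple R)) ~> (d.-tuple R))
      (B gamma : R),
    (4 <= n)%N -> (3 <= d)%N -> 1 <= B ->
    kernel_condition h F -> bootstrap_model h F X w k ->
    (forall m, theta h F m = 0) ->
    moment_condition h F b_low B ->
    0 < gamma < expR (-1) ->
    ln (gamma^-1) <= K * ln (d * n)%:R ->
    ln d%:R <= b_bar * n%:R ->
    psi1_condition h F B ->
    ((1 - gamma)%:E <=
       P [set o | rhoB P (fun o' => T_stat h (theta h F) (joint X o'))
                    (k (joint X o))
                  <= (C * varpi1 n d B)%:E])%E) /\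
  (forall q : R, 4 <= q ->
    exists C : R, 0 < C /\
    forall (n p d : nat) (dO : measure_display) (Omega : measurableType dO)
      (P : probability Omega R) (F : probability (p.-tuple R) R)
      (h : p.-tuple R -> p.-tuple R -> d.-tuple R)
      (X : 'I_n -> {RV P >-> p.-tuple R}) (w : 'I_n -> {RV P >-> R})
      (k : R.-pker (n.-tuple (p.-tuple R)) ~> (d.-tuple R))
      (B gamma : R),
    (4 <= n)%N -> (3 <= d)%N -> 1 <= B ->
    kernel_condition h F -> bootstrap_model h F X w k ->
    (forall m, theta h F m = 0) ->
    moment_condition h F b_low B ->
    0 < gamma < expR (-1) ->
    ln (gamma^-1) <= K * ln (d * n)%:R ->
    ln d%:R <= b_bar * n%:R ->
    envelope_condition h F q B ->
    ((1 - gamma)%:E <=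
       P [set o | rhoB P (fun o' => T_stat h (theta h F) (joint X o'))
                    (k (joint X o))
                  <= (C * (varpi1 n d B + varpi2B n d B q gamma))%:E])%E).
Proof.
move=> b0 _ K0; have [A0 [A [[A00 A0b A1 A2] A3 A4 A5]]] := rate_const_exists b0 K0.
have A0p : 0 < A0 by apply: lt_le_trans A00; rewrite ltr0n.
have Ap : 0 < A by move: A1 A00; lra.
have c0 : 0 < core_const (Num.sqrt (b_low / 2)) + 1.
  by apply: ltr_wpDl => //; apply: core_const_ge0; exact: sqrtr_ge0.
split; last move=> q q4.
  exists ((core_const (Num.sqrt (b_low / 2)) + 1) * psi1_T K A0 A); split.
    by apply: mulr_gt0 => //; exact: psi1_T_gt0.
  move=> n p d dO Omega P F h X w k B gamma n4 d3 B1 kc model th0 mc g01 gln _.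
  exact: (psi1_rate b0 K0 A00 A0b A1 A2 A3 A4 A5 n4 d3 B1 kc model th0 mc g01 gln).
exists ((core_const (Num.sqrt (b_low / 2)) + 1) * pow_T A0 A); split.
  by rewrite mulr_gt0// /pow_T !mulr_gt0.
move=> n p d dO Omega P F h X w k B gamma n4 d3 B1 kc model th0 mc g01 gln _.
exact: (envelope_rate b0 K0 A00 A0b A1 A2 A3 A4 A5 n4 d3 B1 kc model th0 mc g01 gln).
Qed.
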